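(* Let $\Theta_0\subset\Theta$ be a neighborhood of $\theta_0$. With $\varepsilon_\theta=Y-\theta'Z$ and $\varepsilon_0=Y-\theta_0'Z$, put $$\Psi(\theta,\eta,\rho)=P[\rho(\varepsilon_\theta,\theta)\{Z-\eta(\varepsilon_\theta,\theta)\}\Delta],$$ $$\Psi_n(\theta,\eta,\rho)=\frac1n\sum_{i=1}^n\Omega_i\,\rho(Y_i-\theta'Z_i,\theta)\{Z_i-\eta(Y_i-\theta'Z_i,\theta)\}\Delta_i ,$$ $$\eta_0(t,\theta)=\frac{E\{1(Y-\theta'Z\ge t)Z\}}{E\{1(Y-\theta'Z\ge t)\}},\qquad \rho_0(t,\theta)=\Pr(Y-\theta'Z\ge t),$$ $$\hat\eta_n(t,\theta)=\frac{\sum_{j=1}^nW_j1(Y_j-\theta'Z_j\ge t)Z_j}{\sum_{j=1}^nW_j1(Y_j-\theta'Z_j\ge t)},\qquad \hat\rho_n(t,\theta)=\frac{\sum_{j=1}^nW_j1(Y_j-\theta'Z_j\ge t)}{\sum_{j=1}^nW_j}.$$ Let $\hat\theta_n$ be an approximate root satisfying $\Psi_n(\hat\theta_n,\hat\eta_n(\cdot,\hat\theta_n),\hat\rho_n(\cdot,\hat\theta_n))=o_{p^*}(n^{-1/2})$. Let $\mathcal{Y}$ and $\mathcal{Z}$ denote the sample spaces of $Y$ and $Z$. Suppose that $\rho_0(\varepsilon_\theta,\theta)$ and $\eta_0(\varepsilon_\theta,\theta)$ are differentiable in $\theta$ with derivatives $\dot\rho_{0\theta}$ and $\dot\eta_{0\theta}$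 that are uniformly bounded and continuous in $\Theta_0\times\mathcal{Y}\times\mathcal{Z}$. (This implies that $\Psi(\theta,\eta_0(\cdot,\theta),\rho_0(\cdot,\theta))$ is differentiable in $\theta$ with bounded continuous derivative $\dot\Psi_\theta(\theta,\eta_0(\cdot,\theta),\rho_0(\cdot,\theta))$ in $\Theta_0$.) Then: (i) The asymptotic linearity $$n^{1/2}\Psi_n(\hat\theta_n,\hat\eta_n(\cdot,\hat\theta_n),\hat\rho_n(\cdot,\hat\theta_n))=n^{1/2}\Psi_n(\theta_0,\hat\eta_n(\cdot,\theta_0),\hat\rho_n(\cdot,\theta_0))+\dot\Psi_\theta(\theta_0,\eta_0(\cdot,\theta_0),\rho_0(\cdot,\theta_0))\,n^{1/2}(\hat\theta_n-\theta_0)+o_{p^*}(1)$$ holds. (ii) If $\dot\Psi_\theta(\theta_0,\eta_0(\cdot,\theta_0),\rho_0(\cdot,\theta_0))$ is nonsingular, then $n^{1/2}(\hat\theta_n-\theta_0)$ is asymptotically normal with the asymptotic representation $$n^{1/2}(\hat\theta_n-\theta_0)=\{-\dot\Psi_\theta(\theta_0,\eta_0(\cdot,\theta_0),\rho_0(\cdot,\theta_0))\}^{-1}\,\mathbb{G}_n\Big[\Omega\rho_0(\varepsilon_0,\theta_0)\{Z-\eta_0(\varepsilon_0,\theta_0)\}\Delta-\int W\rho_0(t,\theta_0)\{Z-\eta_0(t,\theta_0)\}1(\varepsilon_0\ge t)\,d\Lambda_0(t)\Big]+o_{p^*}(1),$$ where $\Lambda_0$ is the cumulative hazard function of $T-\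theta_0'Z$.
   Context: Model. $T_i=\theta_0'Z_i+e_i$, $i=1,\dots,n$, where $T_i$ is a failure time transformed by a known monotone function, $Z_i$ is a $d$-dimensional covariate vector, $\theta_0\in\Theta\subset\mathbb{R}^d$ is the unknown true parameter value, and the $e_i$ are i.i.d. with unknown distribution $F$, with $e_i$ independent of $(Z_i,C_i)$; $C_i$ is the correspondingly transformed censoring time. Put $Y_i=\min(T_i,C_i)$, $\Delta_i=1(T_i\le C_i)$, $X_i=(Y_i,\Delta_i,Z_i)$. A prime on a vector denotes transpose. Write $Z_i=(Z_{1i}',Z_{2i}')'$; $Z_{2i},Y_i,\Delta_i$ are always observed, $R_i\in\{0,1\}$ indicates that $Z_{1i}$ is observed, and $Z_{1i}$ is missing at random: $\pi_i=\Pr(R_i=1\mid Z_i,Y_i,\Delta_i)=\Pr(R_i=1\mid Z_{2i},Y_i,\Delta_i)$. Weights. $\Omega_i$ and $W_i$ are subject-specific weights (possibly different, possibly depending on $\Delta_i$); they are bounded and satisfy $E(\Omega_i\mid X_i)=E(W_i\mid X_i)=1$ for all $i$. The observed data and weights are i.i.d. over $i$; symbols without the index $i$ denote a generic observation. Notation. $P$ is expectation under the law of one observation, $\mathbb{P}_nf$ is the average of $f$ over the $n$ observations, and $\mathbb{G}_nf=n^{1/2}(\mathbb{P}_n-P)f$. $o_{p^*}$ is the stochastic order symbol in outer probability. Standing regularity conditions. (1) $Z$ is bounded. (2) The error density $f$ of $F$ and its derivative $f'$ exist and are bounded, and $\int (f'/f)^2 f\,dt<\infty$. (3) The conditional density of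 the censoring time $C$ given $Z$ is uniformly bounded. (A) There are constants $\tau<\infty$ and $\xi$ such that $\Pr(Y-\theta'Z\ge\tau)\ge\xi>0$ for all $Z$ and $\theta\in\Theta$. (B) $\Pr(R=1\mid Z_2,Y,\Delta)\ge\zeta>0$ for all $Z_2,Y,\Delta$, for some constant $\zeta$.
   Formalization: Part (i) is proved under an added premise: F(τ)>0, or n^{1/2}(θ̂_n−θ_0)=O_{p*}(1), or the derivative of Ψ at θ_0 is nonsingular; without it (i) can fail when some covariate groups are never at risk at failure times. Θ_0 is taken open. *)

(* Defs.v *)
From HB Require Import structures.
From mathcomp Require Import all_boot all_order all_algebra.
From mathcomp Require Import all_classical all_reals all_analysis.
From mathcomp Require Import measurable_realfun.

Set Implicit Arguments.
Unset Strict Implicit.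
Unset Printing Implicit Defensive.

Import Order.TTheory GRing.Theory Num.Theory.
Import numFieldNormedType.Exports.

Local Open Scope classical_set_scope.
Local Open Scope ring_scope.

(* Vectors are row vectors, so "A x" becomes [x *m A], with A = 'J g p the
   jacobian in the library's convention, transposed from the usual one. *)

Notation borel S := (g_sigma_algebraType (@open S)).

Section random_elements.
Context {disp : measure_display} {T : measurableType disp} {R : realType}.
Variable P : probability T R.

Definition independent_pair (ds1 ds2 : measure_display)
    (S1 : measurableType ds1) (S2 : measurableType ds2)
    (X1 : T -> S1) (X2 : T -> S2) :=
  forall (B1 : set S1) (B2 : set S2), measurable B1 -> measurable B2 ->
    P (X1 @^-1` B1 `&` X2 @^-1` B2) = (P (X1 @^-1` B1) * P (X2 @^-1` B2))%E.

Definition independent_seq (ds : measure_display) (S : measurableType ds)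
    (X : nat -> T -> S) :=
  forall (s : seq nat) (B : nat -> set S),
    uniq s -> (forall i, measurable (B i)) ->
    fine (P (\bigcap_(i in [set` s]) X i @^-1` B i)) =
    \prod_(i <- s) fine (P (X i @^-1` B i)).

Definition iid (ds : measure_display) (S : measurableType ds)
    (X : nat -> T -> S) :=
  [/\ forall i, measurable_fun setT (X i),
      independent_seq X &
      forall i (B : set S), measurable B ->
        P (X i @^-1` B) = P (X 0%N @^-1` B)].

(* E(U | X) = g(X), with g a measurable version of x |-> E(U | X = x) *)
Definition is_cond_exp (ds : measure_display) (S : measurableType ds)
    (U : T -> R) (X : T -> S) (g : S -> R) :=
  [/\ measurable_fun setT g,
      P.-integrable setT (EFin \o U),
      P.-integrable setT (EFin \o (g \o X)) &
      forall B : set S, measurable B ->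
        (\int[P]_(w in X @^-1` B) (U w)%:E =
         \int[P]_(w in X @^-1` B) (g (X w))%:E)%E].

(* h z is a density of the conditional distribution of C given Z = z *)
Definition is_cond_density (ds : measure_display) (S : measurableType ds)
    (C : T -> R) (Z : T -> S) (h : S -> R -> R) :=
  [/\ measurable_fun setT (fun zc : S * R => h zc.1 zc.2),
      forall z c, 0 <= h z c,
      forall z, (\int[lebesgue_measure]_c (h z c)%:E = 1)%E &
      forall B : set R, measurable B ->
        is_cond_exp (fun w => \1_B (C w)) Z
          (fun z => \int[lebesgue_measure]_(c in B) h z c)].

(* [mu_ext P] is outer probability: the maps X n need not be measurable *)

Definition op_star (V : normedModType R) (X : nat -> T -> V) (r : nat -> R) :=
  forall eps : R, 0 < eps ->
    (fun n => mu_ext P [set w | eps * r n < `|X n w|]) @ \oo --> 0%E.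

Definition Op_star (V : normedModType R) (X : nat -> T -> V) (r : nat -> R) :=
  forall eps : R, 0 < eps -> exists K : R,
    \forall n \near \oo,
      (mu_ext P [set w | (K * r n < `|X n w|)%R] <= eps%:E)%E.

Definition outer_expectation (h : T -> R) : \bar R :=
  ereal_inf [set (\int[P]_w U w)%E | U in
    [set U : T -> \bar R |
      P.-integrable setT U /\ forall w, ((h w)%:E <= U w)%E]].

(* Hoffmann-Joergensen weak convergence *)
Definition weak_cvg_star (S : ptopologicalType) (X : nat -> T -> S)
    (nu : probability (borel S) R) :=
  forall h : S -> R, continuous h -> (exists K, forall x, `|h x| <= K) ->
    (fun n => outer_expectation (h \o X n)) @ \oo --> (\int[nu]_x (h x)%:E)%E.

Definition mean (d : nat) (f : T -> 'rV[R]_d) : 'rV[R]_d :=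
  \row_k \int[P]_w f w 0 k.

Definition covariance_mx (d : nat) (f : T -> 'rV[R]_d) : 'M[R]_d :=
  \matrix_(k, l)
    \int[P]_w ((f w 0 k - mean f 0 k) * (f w 0 l - mean f 0 l)).

End random_elements.

Definition dotv {R : realType} {d : nat} (u v : 'rV[R]_d) : R := (u *m v^T) 0 0.

(* nu = N(0, Sigma), Sigma possibly singular: every linear form a'x is
   N(0, a' Sigma a). The third argument of [normal_prob] is the standard
   deviation, and it is not the point mass when that is 0. *)
Definition centered_gaussian {R : realType} {d : nat} (Sigma : 'M[R]_d)
    (nu : probability (borel 'rV[R]_d) R) :=
  forall (a : 'rV[R]_d) (B : set R), measurable B ->
    let v := dotv (a *m Sigma) a in
    0 <= v /\
    nu (dotv a @^-1` B) =
      if v == 0 then \d_(0 : R) B else normal_prob 0 (Num.sqrt v) B.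

(* As a measure: dLambda(t) = dF(t) / F[t, +oo[ *)

Section hazard.
Context {R : realType} (F : probability R R).

Definition inv_survival (t : R) : R := (fine (F `[t, +oo[%classic))^-1.

Definition cum_hazard (A : set R) : \bar R :=
  (\int[F]_(t in A) (inv_survival t)%:E)%E.

Lemma inv_survival_ge0 t : 0 <= inv_survival t.
Proof. by rewrite invr_ge0 fine_ge0. Qed.

Lemma measurable_inv_survival : measurable_fun setT inv_survival.
Proof.
have S_ni (s t : R) : s <= t ->
    fine (F `[t, +oo[%classic) <= fine (F `[s, +oo[%classic).
  move=> st; rewrite fine_le ?fin_num_measure// le_measure ?inE// => x /=.
  by rewrite !in_itv/= !andbT; exact: le_trans.
apply: (measurability (@RGenCInfty.G R)) => [|/= _ [_] [r] -> <-].
  exact: RGenCInfty.measurableE.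
apply: measurableI => //; apply: is_interval_measurable => s t/=.
rewrite !in_itv/= !andbT => rs rt u /andP[/S_ni us /S_ni tu].
rewrite in_itv/= andbT.
have [t0|t_gt0] := eqVneq (fine (F `[t, +oo[%classic)) 0.
  by apply: (le_trans rt); rewrite /inv_survival t0 invr0 inv_survival_ge0.
apply: (le_trans rs); rewrite lef_pV2// posrE.
  apply: lt_le_trans (le_trans tu us).
  by rewrite lt0r t_gt0 fine_ge0.
by apply: lt_le_trans tu; rewrite lt0r t_gt0 fine_ge0.
Qed.

Let cum_hazard0 : cum_hazard set0 = 0%E.
Proof. exact: integral_set0. Qed.

Let cum_hazard_ge0 A : (0 <= cum_hazard A)%E.
Proof. by apply: integral_ge0 => t _; rewrite lee_fin inv_survival_ge0. Qed.

Let cum_hazard_sigma_additive : semi_sigma_additive cum_hazard.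
Proof.
apply: semi_sigma_additive_nng_induced => [|t].
  by apply/measurable_EFinP; exact: measurable_inv_survival.
by rewrite lee_fin inv_survival_ge0.
Qed.

HB.instance Definition _ := isMeasure.Build _ _ _
  cum_hazard cum_hazard0 cum_hazard_ge0 cum_hazard_sigma_additive.

End hazard.

Section estimating_function.
Context {disp : measure_display} {T : measurableType disp} {R : realType}.
Context {d : nat} (P : probability T R).
Variables (Y : nat -> T -> R) (Delta : nat -> T -> bool) (Z : nat -> T -> 'rV[R]_d).
Variables (Om W : nat -> T -> R).

Definition resid (theta : 'rV[R]_d) (y : R) (z : 'rV[R]_d) : R :=
  y - dotv theta z.

(* observation 0 plays the role of the generic observation *)
Let eps (theta : 'rV[R]_d) (w : T) : R := resid theta (Y 0%N w) (Z 0%N w).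

Definition at_risk (t : R) (theta : 'rV[R]_d) (i : nat) (w : T) : R :=
  (t <= resid theta (Y i w) (Z i w))%R%:R.

Definition Psi (theta : 'rV[R]_d) (eta : R -> 'rV[R]_d -> 'rV[R]_d)
    (rho : R -> 'rV[R]_d -> R) : 'rV[R]_d :=
  mean P (fun w => (rho (eps theta w) theta * (Delta 0%N w)%:R) *:
                   (Z 0%N w - eta (eps theta w) theta)).

Definition rho0 (t : R) (theta : 'rV[R]_d) : R :=
  fine (P [set w | t <= eps theta w]).

Definition eta0 (t : R) (theta : 'rV[R]_d) : 'rV[R]_d :=
  (\int[P]_w at_risk t theta 0 w)^-1 *:
  mean P (fun w => at_risk t theta 0 w *: Z 0%N w).

Definition Psi_n (n : nat) (w : T) (theta : 'rV[R]_d)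
    (eta : R -> 'rV[R]_d -> 'rV[R]_d) (rho : R -> 'rV[R]_d -> R) : 'rV[R]_d :=
  n%:R^-1 *: \sum_(i < n)
    (Om i w * rho (resid theta (Y i w) (Z i w)) theta * (Delta i w)%:R) *:
    (Z i w - eta (resid theta (Y i w) (Z i w)) theta).

Definition eta_hat (n : nat) (w : T) (t : R) (theta : 'rV[R]_d) : 'rV[R]_d :=
  (\sum_(j < n) W j w * at_risk t theta j w)^-1 *:
  \sum_(j < n) (W j w * at_risk t theta j w) *: Z j w.

Definition rho_hat (n : nat) (w : T) (t : R) (theta : 'rV[R]_d) : R :=
  (\sum_(j < n) W j w * at_risk t theta j w) / \sum_(j < n) W j w.

(* Psi_n(theta, eta_hat_n(., theta), rho_hat_n(., theta)) *)
Definition score (n : nat) (theta : 'rV[R]_d) (w : T) : 'rV[R]_d :=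
  Psi_n n w theta (eta_hat n w) (rho_hat n w).

(* theta |-> Psi(theta, eta_0(., theta), rho_0(., theta)) *)
Definition Psi0 (theta : 'rV[R]_d) : 'rV[R]_d := Psi theta eta0 rho0.

(* The integrand of the asymptotic representation, at observation i; [F] is the
   law of T - theta_0' Z *)
Definition influence (F : probability R R) (theta : 'rV[R]_d) (i : nat)
    (w : T) : 'rV[R]_d :=
  let e := resid theta (Y i w) (Z i w) in
  (Om i w * rho0 e theta * (Delta i w)%:R) *: (Z i w - eta0 e theta) -
  \row_k \int[cum_hazard F]_t
    (W i w * rho0 t theta * (Z i w 0 k - eta0 t theta 0 k) * (t <= e)%R%:R).

End estimating_function.

Definition Gn {disp : measure_display} {T : measurableType disp} {R : realType}
    {d : nat} (P : probability T R) (f : nat -> T -> 'rV[R]_d) (n : nat)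
    (w : T) : 'rV[R]_d :=
  Num.sqrt n%:R *: (n%:R^-1 *: (\sum_(i < n) f i w) - mean P (f 0%N)).

(* theta |-> g theta y z is differentiable with derivative uniformly bounded and
   continuous in (theta, y, z) on A x B x C. Boundedness and continuity of the
   derivative, a linear map on R^d, are required of its value in each direction h. *)
Definition bounded_cont_diff {R : realType} {d : nat} (V : normedModType R)
    (g : 'rV[R]_d -> R -> 'rV[R]_d -> V)
    (A : set 'rV[R]_d) (B : set R) (C : set 'rV[R]_d) :=
  (forall theta y z, A theta -> B y -> C z ->
     differentiable (fun u : 'rV[R]_d => g u y z) theta) /\
  forall h : 'rV[R]_d,
    (exists K : R, forall theta y z, A theta -> B y -> C z ->
       `|'d (fun u : 'rV[R]_d => g u y z) theta h| <= K) /\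
    {within A `*` B `*` C,
       continuous (fun x : 'rV[R]_d * R * 'rV[R]_d =>
         'd (fun u : 'rV[R]_d => g u x.1.2 x.2) (x.1.1) h)}.

(* Main.v *)
From HB Require Import structures.
Require Import Defs.
From mathcomp Require Import all_boot all_order all_algebra.
From mathcomp Require Import all_classical all_reals all_analysis.
From mathcomp Require Import measurable_realfun.
From mathcomp Require Import ring lra.
From mathcomp Require Import zify.

Set Implicit Arguments.
Unset Strict Implicit.
Unset Printing Implicit Defensive.

Import Order.TTheory GRing.Theory Num.Theory.
Import numFieldNormedType.Exports.

Local Open Scope classical_set_scope.
Local Open Scope ring_scope.

(** Multiplied by the mean weight, the score is, up to terms that cancel, a rank
    statistic: a U-statistic of order 2 whose kernel compares the residuals of two
    observations and multiplies by the difference of their covariates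
    ([score_rank_stat]). Everything is read off this U-process.

    Uniformity in theta. At radius r about theta0 a net of mesh n^-1/2 has about
    (1 + r sqrt n)^d points, and Chebyshev's inequality at each of them suffices,
    because the increments of the kernel live on near ties of residuals and near
    ties are rare: the residual puts mass O(h) on an interval of length h
    ([residual_anticoncentration], [rank_stat_equicontinuity]). So the score is
    uniformly linear on balls that shrink slightly more slowly than n^-1/2.
    Far from theta0 the unweighted statistic is used: it is the gradient of a
    convex function of theta (Gehan's dispersion), hence monotone along lines
    ([plain_rank_stat_monotone]), and the weights change it by O(L / sqrt n)
    uniformly in theta, since residual half-lines are half-spaces of the
    observation and their patterns are polynomially many ([residual_deviation]).
    Monotonicity carries the sign of the directional score from a small sphere
    outwards, which localizes every approximate root ([estimator_localized]) and
    then yields its rate ([estimator_rate]), provided that the derivative J of the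
    mean score is positive definite in the directions that matter.

    Degenerate directions. The form v'Jv is nonnegative and vanishes only where
    v J = 0 ([curvature_eq0]), so nonsingularity gives definiteness. If J is
    singular but errors below tau are possible, a vector v with v J = 0 has v'Z
    almost surely constant: otherwise error pairs that are close together, with
    values v'Z apart, would give a positive second-order contribution
    ([curvature_gt0]). Moving theta along such v shifts all residuals equally and
    leaves the score unchanged ([score_shift]), so the root may be projected onto
    a complement of the kernel of J ([projected_linearity]).

    Limit law. At theta0 the U-statistic is replaced by its Hajek projection
    ([hajek_projection]); the compensator identity of the martingale
    1(e <= t) - Lambda turns the projection into the stated influence function
    ([compensator], [influence_hajek]). The central limit theorem is proved for
    expectations of cosines of linear forms, and passes to bounded continuous
    functions through trigonometric approximation on compact sets. *)

(** * Bounded random variables and expectation *)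

Lemma le_of_eq (R : numDomainType) (x y : R) : x = y -> x <= y.
Proof. by move->. Qed.

Section bounded_measurable.
Context {d : measure_display} {T : measurableType d} {R : realType}.
Implicit Types f g : T -> R.

Definition bmfun f := measurable_fun setT f /\ exists K, forall w, `|f w| <= K.

Lemma bmfun_measurable f : bmfun f -> measurable_fun setT f.
Proof. by case. Qed.

Lemma bmfun_bound f : bmfun f -> exists2 K, 0 <= K & forall w, `|f w| <= K.
Proof.
move=> [_ [K fK]]; exists `|K| => // w.
exact: le_trans (fK w) (ler_norm _).
Qed.

Lemma bmfun_cst c : bmfun (cst c).
Proof. by split; [exact: measurable_cst|exists `|c|]. Qed.

Lemma bmfunD f g : bmfun f -> bmfun g -> bmfun (fun w => f w + g w).
Proof.
move=> [mf [K fK]] [mg [L gL]]; split; first exact: measurable_funD.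
by exists (K + L) => w; rewrite (le_trans (ler_normD _ _))// lerD.
Qed.

Lemma bmfunN f : bmfun f -> bmfun (fun w => - f w).
Proof.
move=> [mf [K fK]]; split; first exact: measurable_funN.
by exists K => w; rewrite normrN.
Qed.

Lemma bmfunB f g : bmfun f -> bmfun g -> bmfun (fun w => f w - g w).
Proof. by move=> bf bg; apply: bmfunD => //; exact: bmfunN. Qed.

Lemma bmfunM f g : bmfun f -> bmfun g -> bmfun (fun w => f w * g w).
Proof.
move=> [mf [K fK]] [mg [L gL]]; split; first exact: measurable_funM.
by exists (K * L) => w; rewrite normrM ler_pM.
Qed.

Lemma bmfunZ c f : bmfun f -> bmfun (fun w => c * f w).
Proof. by move=> bf; apply: bmfunM => //; exact: bmfun_cst. Qed.

Lemma bmfunX f n : bmfun f -> bmfun (fun w => f w ^+ n).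
Proof.
move=> bf; elim: n => [|n IH].
  by rewrite (_ : (fun=> _) = cst 1)//; exact: bmfun_cst.
by under eq_fun do rewrite exprS; exact: bmfunM.
Qed.

Lemma bmfun_norm f : bmfun f -> bmfun (fun w => `|f w|).
Proof.
move=> [mf [K fK]]; split; first exact: measurableT_comp.
by exists K => w; rewrite normr_id.
Qed.

Lemma bmfun_sum (I : Type) (s : seq I) (Q : pred I) (F : I -> T -> R) :
  (forall i, bmfun (F i)) -> bmfun (fun w => \sum_(i <- s | Q i) F i w).
Proof.
move=> bF; elim: s => [|i s IH].
  by under eq_fun do rewrite big_nil; exact: bmfun_cst.
under eq_fun do rewrite big_cons; case: (Q i) => //.
exact: bmfunD.
Qed.

Lemma bmfun_prod (I : Type) (s : seq I) (Q : pred I) (F : I -> T -> R) :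
  (forall i, bmfun (F i)) -> bmfun (fun w => \prod_(i <- s | Q i) F i w).
Proof.
move=> bF; elim: s => [|i s IH].
  by under eq_fun do rewrite big_nil; exact: bmfun_cst.
under eq_fun do rewrite big_cons; case: (Q i) => //.
exact: bmfunM.
Qed.

Lemma bmfun_bool (b : T -> bool) : measurable_fun setT b ->
  bmfun (fun w => (b w)%:R).
Proof.
move=> mb; split.
  rewrite (_ : (fun=> _) = (fun w => if b w then 1 else 0)); last first.
    by apply/funext => w; case: (b w).
  by apply: measurable_fun_ifT => //; exact: measurable_cst.
by exists 1 => w; case: (b w); rewrite ?normr1 ?normr0.
Qed.

Lemma bmfun_indic (A : set T) : measurable A -> bmfun (\1_A).
Proof.
move=> mA; split; first exact: measurable_indic.
by exists 1 => w; rewrite /indic/=; case: (_ \in _); rewrite ?normr1 ?normr0.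
Qed.

Lemma bmfun_eq f g : f =1 g -> bmfun f -> bmfun g.
Proof. by move=> /funext ->. Qed.

End bounded_measurable.

Lemma bmfun_comp d1 d2 (S1 : measurableType d1) (S2 : measurableType d2)
    (R : realType) (h : S2 -> R) (u : S1 -> S2) :
  measurable_fun setT u -> bmfun h -> bmfun (fun w => h (u w)).
Proof.
move=> mu [mh [K hK]]; split; first exact: measurableT_comp.
by exists K => w; exact: hK.
Qed.

Lemma measurable_set_bool d (T : measurableType d) (b : T -> bool) :
  measurable_fun setT b -> measurable [set w | b w].
Proof.
move=> mb; rewrite (_ : [set w | b w] = setT `&` b @^-1` [set true]).
  exact: mb.
by apply/seteqP; split => w //= [].
Qed.

Section expectation_bounded.
Context {d : measure_display} {T : measurableType d} {R : realType}.
Variable P : probability T R.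
Implicit Types f g : T -> R.

Lemma bmfun_integrable f : bmfun f -> P.-integrable setT (EFin \o f).
Proof.
move=> [mf [K fK]]; apply: measurable_bounded_integrable => //.
  exact: fin_num_fun_lty.
exists K; split; first exact: num_real.
by move=> x Kx w _; exact: le_trans (fK w) (ltW Kx).
Qed.
Hint Resolve bmfun_integrable : core.

Lemma integral_bmfun f : bmfun f -> (\int[P]_w (f w)%:E)%E = (\int[P]_w f w)%:E.
Proof.
move=> bf; rewrite /Rintegral fineK//.
exact: (integrable_fin_num _ (bmfun_integrable bf)).
Qed.

Lemma exD f g : bmfun f -> bmfun g ->
  \int[P]_w (f w + g w) = \int[P]_w f w + \int[P]_w g w.
Proof. by move=> bf bg; rewrite RintegralD//; exact: bmfun_integrable. Qed.

Lemma exB f g : bmfun f -> bmfun g ->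
  \int[P]_w (f w - g w) = \int[P]_w f w - \int[P]_w g w.
Proof. by move=> bf bg; rewrite RintegralB//; exact: bmfun_integrable. Qed.

Lemma exZ c f : bmfun f -> \int[P]_w (c * f w) = c * \int[P]_w f w.
Proof. by move=> bf; rewrite RintegralZl//; exact: bmfun_integrable. Qed.

Lemma exZr c f : bmfun f -> \int[P]_w (f w * c) = \int[P]_w f w * c.
Proof. by move=> bf; rewrite RintegralZr//; exact: bmfun_integrable. Qed.

Lemma exN f : bmfun f -> \int[P]_w (- f w) = - \int[P]_w f w.
Proof.
by move=> bf; rewrite -mulN1r -exZ//; apply: eq_Rintegral => w _; rewrite mulN1r.
Qed.

Lemma ex_cst c : \int[P]_w c = c.
Proof. transitivity (c * fine (P setT)); first exact: Rintegral_cst.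
by have -> : P setT = 1%E := probability_setT P; rewrite mulr1. Qed.

Lemma ex_eq f g : f =1 g -> \int[P]_w f w = \int[P]_w g w.
Proof. by move=> fg; apply: eq_Rintegral => w _. Qed.

Lemma ex_sum (I : Type) (s : seq I) (Q : pred I) (F : I -> T -> R) :
  (forall i, bmfun (F i)) ->
  \int[P]_w (\sum_(i <- s | Q i) F i w) = \sum_(i <- s | Q i) \int[P]_w F i w.
Proof.
move=> bF; elim: s => [|i s IH].
  by rewrite big_nil -[RHS]ex_cst; apply: ex_eq => w; rewrite big_nil.
rewrite big_cons -IH; case: ifPn => Qi.
  rewrite -exD//; last exact: bmfun_sum.
  by apply: ex_eq => w; rewrite big_cons Qi.
by apply: ex_eq => w; rewrite big_cons (negbTE Qi).
Qed.

Lemma le_ex f g : bmfun f -> bmfun g -> (forall w, f w <= g w) ->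
  \int[P]_w f w <= \int[P]_w g w.
Proof. by move=> bf bg fg; apply: le_Rintegral => //; exact: bmfun_integrable. Qed.

Lemma ex_ge0 f : (forall w, 0 <= f w) -> 0 <= \int[P]_w f w.
Proof. by move=> f0; apply: Rintegral_ge0. Qed.

Lemma norm_ex_le f g : bmfun f -> bmfun g -> (forall w, `|f w| <= g w) ->
  `|\int[P]_w f w| <= \int[P]_w g w.
Proof.
move=> bf bg fg; apply: (le_trans (le_normr_Rintegral _ (bmfun_integrable bf))) => //.
by apply: le_ex => //; exact: bmfun_norm.
Qed.

Lemma norm_ex_bound f K : bmfun f -> (forall w, `|f w| <= K) ->
  `|\int[P]_w f w| <= K.
Proof.
move=> bf fK; rewrite -[leRHS]ex_cst; apply: norm_ex_le => //.
exact: bmfun_cst.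
Qed.

Definition pr (A : set T) : R := fine (P A).

Lemma prE A : measurable A -> P A = (pr A)%:E.
Proof. by move=> mA; rewrite /pr fineK// fin_num_measure. Qed.

Lemma pr_ge0 A : 0 <= pr A.
Proof. by rewrite fine_ge0. Qed.

Lemma le_pr A B : measurable A -> measurable B -> A `<=` B -> pr A <= pr B.
Proof. by move=> mA mB AB; rewrite -lee_fin -!prE// le_measure// inE. Qed.

Lemma pr_setT : pr setT = 1.
Proof. by rewrite /pr probability_setT. Qed.

Lemma pr_setU A B : measurable A -> measurable B -> pr (A `|` B) <= pr A + pr B.
Proof.
move=> mA mB; rewrite -lee_fin EFinD -!prE//; last exact: measurableU.
exact: measureU2.
Qed.

Lemma ex_indic A : measurable A -> \int[P]_w \1_A w = pr A.
Proof. by move=> mA; rewrite /Rintegral integral_indic// setIT. Qed.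

Lemma ex_bool (b : T -> bool) : measurable_fun setT b ->
  \int[P]_w (b w)%:R = pr [set w | b w].
Proof.
move=> mb; rewrite -ex_indic; last exact: measurable_set_bool.
apply: ex_eq => w; rewrite /indic; congr (nat_of_bool _)%:R.
by apply/idP/idP => [?|/set_mem//]; exact/mem_set.
Qed.

Lemma markov_bmfun f x : bmfun f -> (forall w, 0 <= f w) -> 0 < x ->
  pr [set w | x <= f w] <= (\int[P]_w f w) / x.
Proof.
move=> bf f0 x0; have mf := bmfun_measurable bf.
have mb : measurable_fun setT (fun w => x <= f w).
  by apply: measurable_fun_ler => //; exact: measurable_cst.
rewrite ler_pdivlMr// -ex_bool// -exZr; last exact: bmfun_bool.
apply: le_ex => //.
  by apply: bmfunM; [exact: bmfun_bool|exact: bmfun_cst].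
by move=> w; case: (leP x (f w)); rewrite ?mul1r ?mul0r.
Qed.

Lemma chebyshev_bmfun f x : bmfun f -> 0 < x ->
  pr [set w | x <= `|f w|] <= (\int[P]_w (f w ^+ 2)) / x ^+ 2.
Proof.
move=> bf x0.
have -> : [set w | x <= `|f w|] = [set w | x ^+ 2 <= f w ^+ 2].
  apply/seteqP; split => w /=; rewrite -[f w ^+ 2]real_normK ?num_real//.
    by move=> ?; rewrite ler_pXn2r// nnegrE ?ltW.
  by rewrite ler_pXn2r// nnegrE ?ltW.
apply: markov_bmfun; last by rewrite exprn_gt0.
  exact: bmfunX.
by move=> w; exact: sqr_ge0.
Qed.

Lemma ex_cauchy_schwarz_half f g : bmfun f -> bmfun g ->
  `|\int[P]_w (f w * g w)| <= (\int[P]_w (f w ^+ 2) + \int[P]_w (g w ^+ 2)) / 2.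
Proof.
move=> bf bg; rewrite -exD; [|exact: bmfunX|exact: bmfunX].
rewrite -exZr; last by apply: bmfunD; exact: bmfunX.
apply: norm_ex_le; first exact: bmfunM.
  by apply: bmfunM; [apply: bmfunD; exact: bmfunX|exact: bmfun_cst].
move=> w; rewrite normrM -[f w ^+ 2]real_normK ?num_real//.
rewrite -[g w ^+ 2]real_normK ?num_real//.
have := sqr_ge0 (`|f w| - `|g w|); lra.
Qed.

End expectation_bounded.

Section laws.
Context {d d' : measure_display} {T : measurableType d} {T' : measurableType d'}.
Context {R : realType} (P : probability T R) (Q : probability T' R).

Lemma law_eq_ex ds (S : measurableType ds) (U : T -> S) (V : T' -> S) (f : S -> R) :
  measurable_fun setT U -> measurable_fun setT V ->
  (forall A, measurable A -> P (U @^-1` A) = Q (V @^-1` A)) ->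
  bmfun f -> \int[P]_w f (U w) = \int[Q]_w f (V w).
Proof.
move=> mU mV UV bf; have mf := bmfun_measurable bf.
pose U' : {mfun T >-> S} := HB.pack U (isMeasurableFun.Build _ _ _ _ _ mU).
pose V' : {mfun T' >-> S} := HB.pack V (isMeasurableFun.Build _ _ _ _ _ mV).
have mfE : measurable_fun setT (EFin \o f) by exact/measurable_EFinP.
rewrite /Rintegral; congr fine.
have iU := bmfun_integrable P (bmfun_comp mU bf).
have iV := bmfun_integrable Q (bmfun_comp mV bf).
have := @integral_distribution _ _ _ _ _ P U' _ mfE iU.
have := @integral_distribution _ _ _ _ _ Q V' _ mfE iV.
rewrite /= => <- <-; apply: eq_measure_integral => A mA _; exact: UV.
Qed.

End laws.

Section independence.
Context {d : measure_display} {T : measurableType d} {R : realType}.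
Variable P : probability T R.
Context {d1 d2 : measure_display} {S1 : measurableType d1} {S2 : measurableType d2}.
Variables (U : T -> S1) (V : T -> S2).
Hypotheses (mU : measurable_fun setT U) (mV : measurable_fun setT V).
Hypothesis UV : independent_pair P U V.

Let U' : {mfun T >-> S1} := HB.pack U (isMeasurableFun.Build _ _ _ _ _ mU).
Let V' : {mfun T >-> S2} := HB.pack V (isMeasurableFun.Build _ _ _ _ _ mV).
Let mW : measurable_fun setT (fun w => (U w, V w)).
Proof. exact: measurable_fun_pair. Qed.
Let W' : {mfun T >-> (S1 * S2)%type} :=
  HB.pack (fun w => (U w, V w)) (isMeasurableFun.Build _ _ _ _ _ mW).

Let m := (distribution P U' \x distribution P V')%E.

Let ex_distr (f : S1 * S2 -> R) x : bmfun f ->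
  (\int[distribution P V']_y (f (x, y))%:E)%E = (\int[P]_w (f (x, V w)))%:E.
Proof.
move=> bf; have bfx : bmfun (fun y => f (x, y)).
  by apply: bmfun_comp bf; exact: pair1_measurable.
have := @integral_distribution _ _ _ _ _ P V' (fun y => (f (x, y))%:E) _
  (bmfun_integrable P (bmfun_comp mV bfx)).
rewrite /= => ->; last first.
  by apply/measurable_EFinP; exact: bmfun_measurable.
by rewrite integral_bmfun//; exact: (bmfun_comp mV bfx).
Qed.

Lemma bmfun_section (f : S1 * S2 -> R) : bmfun f ->
  bmfun (fun x => \int[P]_w f (x, V w)).
Proof.
move=> bf; have imf := @bmfun_integrable _ _ _ m _ bf.
have [K K0 fK] := bmfun_bound bf.
split; last first.
  exists K => x; apply: norm_ex_bound => //.
  exact: (@bmfun_comp _ _ _ _ R (fun y => f (x, y)) V mV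
    (bmfun_comp (pair1_measurable x) bf)).
have := measurable_fubini_F imf.
rewrite /fubini_F; under eq_fun do rewrite (ex_distr _ bf).
by move/measurable_EFinP.
Qed.

Lemma indep_Fubini (f : S1 * S2 -> R) : bmfun f ->
  \int[P]_w f (U w, V w) = \int[P]_w \int[P]_w' f (U w, V w').
Proof.
move=> bf; have mf := bmfun_measurable bf.
have mfE : measurable_fun setT (EFin \o f) by exact/measurable_EFinP.
have imf := @bmfun_integrable _ _ _ m _ bf.
transitivity (fine (\int[m]_z (f z)%:E)).
  rewrite {1}/Rintegral; congr fine.
  have := @integral_distribution _ _ _ _ _ P W' _ mfE
    (bmfun_integrable P (bmfun_comp mW bf)).
  rewrite /= => <-; apply: eq_measure_integral => A mA _.
  by rewrite /m; symmetry; apply: product_measure_unique.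
rewrite -(integral12_prod_meas1 imf)/=.
rewrite [in RHS]/Rintegral; congr fine.
have bF := bmfun_section bf.
transitivity (\int[distribution P U']_x (\int[P]_w f (x, V w))%:E)%E.
  by apply: eq_integral => x _; exact: ex_distr.
have := @integral_distribution _ _ _ _ _ P U'
  (fun x => (\int[P]_w f (x, V w))%:E) _ (bmfun_integrable P (bmfun_comp mU bF)).
by rewrite /= => ->//; apply/measurable_EFinP; exact: bmfun_measurable.
Qed.

Lemma indep_exM (f : S1 -> R) (g : S2 -> R) : bmfun f -> bmfun g ->
  \int[P]_w (f (U w) * g (V w)) = (\int[P]_w f (U w)) * \int[P]_w g (V w).
Proof.
move=> bf bg.
have := @indep_Fubini (fun x => f x.1 * g x.2).
rewrite /= => ->; last first.
  by apply: bmfunM; [apply: (@bmfun_comp _ _ _ _ _ f fst)|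
    apply: (@bmfun_comp _ _ _ _ _ g snd)].
rewrite -exZr; last exact: bmfun_comp bf.
by apply: ex_eq => w; rewrite exZ//; exact: bmfun_comp bg.
Qed.

End independence.

(** * Independence and i.i.d. sequences *)

Section measure_ext.
Context {d : measure_display} {T : measurableType d} {R : realType}.
Variable P : probability T R.
Context {d1 d2 : measure_display} {S1 : measurableType d1} {S2 : measurableType d2}.
Variables (U : T -> S1) (V : T -> S2).
Hypotheses (mU : measurable_fun setT U) (mV : measurable_fun setT V).

(** Rectangles generate the product sigma-algebra. E1, E2 and c are left free so
    that one statement serves every factorization below. *)
Lemma prod_measure_ext (E1 E2 : set T) (c : {nonneg R}) :
  measurable E1 -> measurable E2 ->
  (forall A B, measurable A -> measurable B ->
    (P (U @^-1` A `&` V @^-1` B `&` E1) =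
     c%:num%:E * P (U @^-1` A `&` V @^-1` B `&` E2))%E) ->
  forall A : set (S1 * S2), measurable A ->
    (P ((fun w => (U w, V w)) @^-1` A `&` E1) =
     c%:num%:E * P ((fun w => (U w, V w)) @^-1` A `&` E2))%E.
Proof.
move=> mE1 mE2 rect A mA.
have mW : measurable_fun setT (fun w => (U w, V w)) by exact: measurable_fun_pair.
pose W' : {mfun T >-> (S1 * S2)%type} :=
  HB.pack (fun w => (U w, V w)) (isMeasurableFun.Build _ _ _ _ _ mW).
pose m1 := pushforward (mrestr P mE1) W'.
pose m2 := pushforward (mscale c (mrestr P mE2)) W'.
pose G := [set A `*` B | A in [set A : set S1 | measurable A] &
                         B in [set B : set S2 | measurable B]].
have GT : G setT.
  by exists setT; [exact: measurableT|exists setT; [exact: measurableT|rewrite setXTT]].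
suff : m1 A = m2 A by [].
apply: (@measure_unique _ _ _ G (fun=> setT)) => //.
- by rewrite measurable_prod_measurableType.
- move=> _ _ [A1 mA1 [B1 mB1 <-]] [A2 mA2 [B2 mB2 <-]].
  exists (A1 `&` A2); first exact: measurableI.
  by exists (B1 `&` B2); [exact: measurableI|rewrite setXI].
- by rewrite bigcup_const.
- by move=> _ [A1 mA1 [B1 mB1 <-]]; exact: rect.
- move=> _; rewrite /m1/= /pushforward/mrestr/=.
  by rewrite preimage_setT setTI prE// ltry.
Qed.

End measure_ext.

Section iid_sequence.
Context {d : measure_display} {T : measurableType d} {R : realType}.
Variable P : probability T R.
Context {ds : measure_display} {S : measurableType ds}.
Variable X : nat -> T -> S.
Hypothesis iidX : iid P X.

Lemma iid_measurable i : measurable_fun setT (X i).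
Proof. by case: iidX. Qed.
Hint Resolve iid_measurable : core.

Lemma iid_measurable_preimage i (A : set S) : measurable A -> measurable (X i @^-1` A).
Proof. by move=> mA; rewrite -[X in measurable X]setTI; exact: iid_measurable. Qed.

Definition cyl {I : finType} (t : I -> nat) (A : I -> set S) : set T :=
  [set w | forall k, A k (X (t k) w)].

Lemma measurable_cyl (I : finType) (t : I -> nat) (A : I -> set S) :
  (forall k, measurable (A k)) -> measurable (cyl t A).
Proof.
move=> mA; rewrite (_ : cyl t A = \bigcap_(k in setT) X (t k) @^-1` A k).
  by apply: fin_bigcap_measurable => // k _; exact: iid_measurable_preimage.
by apply/seteqP; split => w /= h k; [move=> _; exact: h|exact: h].
Qed.

Let at_ {I : finType} (t : I -> nat) (A : I -> set S) (i : nat) : set S :=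
  \bigcap_(k in [set k | t k = i]) A k.

Let mat_ (I : finType) (t : I -> nat) (A : I -> set S) i :
  (forall k, measurable (A k)) -> measurable (at_ t A i).
Proof. by move=> mA; apply: fin_bigcap_measurable. Qed.

Let cylE (I : finType) (t : I -> nat) (A : I -> set S) :
  cyl t A = \bigcap_(i in [set` undup (codom t)]) X i @^-1` at_ t A i.
Proof.
apply/seteqP; split => w /=.
  by move=> h i _ k /= <-.
by move=> h k; apply: (h (t k)) => //=; rewrite mem_undup codom_f.
Qed.

(** Independence of a sequence is stated for one set per index; a family of
    indices with repetitions is reduced to it by intersecting the sets at each
    index. *)
Lemma pr_cyl_indep (I J : finType) (t : I -> nat) (u : J -> nat)
    (A : I -> set S) (B : J -> set S) :
  (forall a b, t a != u b) ->
  (forall k, measurable (A k)) -> (forall k, measurable (B k)) ->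
  P (cyl t A `&` cyl u B) = (P (cyl t A) * P (cyl u B))%E.
Proof.
move=> tu mA mB; have [_ indX _] := iidX.
have mcA := measurable_cyl t mA; have mcB := measurable_cyl u mB.
rewrite !prE//; last exact: measurableI.
rewrite -EFinM; congr EFin; rewrite /pr.
have -> : cyl t A `&` cyl u B =
  \bigcap_(i in [set` undup (codom t) ++ undup (codom u)])
     X i @^-1` (if i \in codom t then at_ t A i else at_ u B i).
  rewrite !cylE; apply/seteqP; split => w /=.
    move=> [h1 h2] i /=; rewrite mem_cat !mem_undup.
    case: ifPn => [it _|_ /= iu]; first by apply: h1; rewrite /= mem_undup.
    by apply: h2; rewrite /= mem_undup.
  move=> h; split=> i /= ii.
    have := h i; rewrite /= mem_cat ii => /(_ isT).
    by rewrite -mem_undup ii.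
  have := h i; rewrite /= mem_cat ii orbT => /(_ isT).
  case: ifPn => // /codomP[a ia]; move: ii; rewrite mem_undup => /codomP[b ib].
  by have := tu a b; rewrite -ia -ib eqxx.
rewrite indX; last 2 first.
- rewrite cat_uniq !undup_uniq andbT/=; apply/hasPn => i.
  rewrite mem_undup => /codomP[b ->]; rewrite mem_undup.
  by apply/negP => /codomP[a] ab; have := tu a b; rewrite ab eqxx.
- by move=> i; case: ifP => _; exact: mat_.
rewrite big_cat/= !cylE !indX ?undup_uniq//; last 2 first.
- by move=> i; exact: mat_.
- by move=> i; exact: mat_.
congr (_ * _); apply: eq_big_seq => i.
  by rewrite mem_undup => ->.
rewrite mem_undup => /codomP[b ->]; case: ifPn => // /codomP[a ab].
by have := tu a b; rewrite ab eqxx.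
Qed.

Lemma iid_eq_dist i j (A : set S) : measurable A -> P (X i @^-1` A) = P (X j @^-1` A).
Proof. by case: iidX => _ _ h mA; rewrite h// [RHS]h. Qed.

Let nn (A : set T) : {nonneg R} := NngNum (pr_ge0 P A).

Let two (i j : nat) (k : bool) := if k then i else j.
Let cyl2 i j A B : X i @^-1` A `&` X j @^-1` B =
  cyl (two i j) (fun k : bool => if k then A else B).
Proof.
apply/seteqP; split => w /=; first by move=> [? ?] [].
by move=> h; split; [exact: (h true)|exact: (h false)].
Qed.

Let cyl1 i A : X i @^-1` A = cyl (fun _ : unit => i) (fun _ => A).
Proof.
apply/seteqP; split => w /=; first by move=> ? [].
by move=> h; exact: (h tt).
Qed.

Lemma iid_indep_pair i j : i != j -> independent_pair P (X i) (X j).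
Proof. by move=> ij A B mA mB; rewrite !cyl1 pr_cyl_indep. Qed.

Lemma measurable_iid_pair i j : measurable_fun setT (fun w => (X i w, X j w)).
Proof. exact: measurable_fun_pair. Qed.

Lemma iid_indep_pair_pair i j k l : i != k -> i != l -> j != k -> j != l ->
  independent_pair P (fun w => (X i w, X j w)) (fun w => (X k w, X l w)).
Proof.
move=> ik il jk jl.
have H A1 A2 B1 B2 : measurable A1 -> measurable A2 -> measurable B1 -> measurable B2 ->
    (P (X i @^-1` A1 `&` X j @^-1` A2 `&` (X k @^-1` B1 `&` X l @^-1` B2)) =
     P (X i @^-1` A1 `&` X j @^-1` A2) * P (X k @^-1` B1 `&` X l @^-1` B2))%E.
  move=> mA1 mA2 mB1 mB2; rewrite !cyl2 pr_cyl_indep//.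
  - by move=> [] []; rewrite /two.
  - by case.
  - by case.
have m2 a b (A B : set S) : measurable A -> measurable B ->
    measurable (X a @^-1` A `&` X b @^-1` B).
  by move=> mA mB; apply: measurableI; exact: iid_measurable_preimage.
have H2 (A : set (S * S)) B1 B2 : measurable A -> measurable B1 -> measurable B2 ->
    (P ((fun w => (X i w, X j w)) @^-1` A `&` (X k @^-1` B1 `&` X l @^-1` B2)) =
     P ((fun w => (X i w, X j w)) @^-1` A) * P (X k @^-1` B1 `&` X l @^-1` B2))%E.
  move=> mA mB1 mB2.
  have := @prod_measure_ext _ _ _ P _ _ _ _ (X i) (X j) (iid_measurable i)
    (iid_measurable j) (X k @^-1` B1 `&` X l @^-1` B2) setT
    (nn (X k @^-1` B1 `&` X l @^-1` B2)) (m2 _ _ _ _ mB1 mB2) measurableT.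
  rewrite -prE; last exact: m2.
  move=> -> //; first by rewrite setIT muleC.
  by move=> A1 A2 mA1 mA2; rewrite H// setIT muleC.
move=> A B mA mB.
have mpA : measurable ((fun w => (X i w, X j w)) @^-1` A).
  by rewrite -[X in measurable X]setTI; exact: measurable_iid_pair.
have := @prod_measure_ext _ _ _ P _ _ _ _ (X k) (X l) (iid_measurable k)
  (iid_measurable l) ((fun w => (X i w, X j w)) @^-1` A) setT
  (nn ((fun w => (X i w, X j w)) @^-1` A)) mpA measurableT.
rewrite -prE// setIC => -> //; first by rewrite setIT.
by move=> B1 B2 mB1 mB2; rewrite setIC H2// setIT.
Qed.

Lemma iid_indep_triple i j k l : i != l -> j != l -> k != l ->
  independent_pair P (fun w => ((X i w, X j w), X k w)) (X l).
Proof.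
move=> il jl kl.
pose t3 (a : option bool) := if a is Some b then two i j b else k.
have H A1 A2 A3 B : measurable A1 -> measurable A2 -> measurable A3 -> measurable B ->
    (P (X i @^-1` A1 `&` X j @^-1` A2 `&` X k @^-1` A3 `&` X l @^-1` B) =
     P (X i @^-1` A1 `&` X j @^-1` A2 `&` X k @^-1` A3) * P (X l @^-1` B))%E.
  move=> mA1 mA2 mA3 mB.
  have -> : X i @^-1` A1 `&` X j @^-1` A2 `&` X k @^-1` A3 =
    cyl t3 (fun a => if a is Some b then if b then A1 else A2 else A3).
    apply/seteqP; split => w /=; first by move=> [[? ?] ?] [[]|].
    by move=> h; split; [split; [exact: (h (Some true))|exact: (h (Some false))]|
      exact: (h None)].
  rewrite cyl1 pr_cyl_indep//.
  - by move=> [[]|].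
  - by move=> [[]|].
have mp a (A : set S) : measurable A -> measurable (X a @^-1` A).
  exact: iid_measurable_preimage.
have H2 (A : set (S * S)) A3 B : measurable A -> measurable A3 -> measurable B ->
    (P ((fun w => (X i w, X j w)) @^-1` A `&` (X k @^-1` A3 `&` X l @^-1` B)) =
     P (X l @^-1` B) * P ((fun w => (X i w, X j w)) @^-1` A `&` X k @^-1` A3))%E.
  move=> mA mA3 mB.
  have := @prod_measure_ext _ _ _ P _ _ _ _ (X i) (X j) (iid_measurable i)
    (iid_measurable j) (X k @^-1` A3 `&` X l @^-1` B) (X k @^-1` A3)
    (nn (X l @^-1` B)) (measurableI _ _ (mp _ _ mA3) (mp _ _ mB)) (mp _ _ mA3).
  rewrite -prE; last exact: mp.
  move=> -> // A1 A2 mA1 mA2.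
  by rewrite setIA H// muleC.
move=> A B mA mB.
have := @prod_measure_ext _ _ _ P _ _ _ _ (fun w => (X i w, X j w)) (X k)
  (measurable_iid_pair i j) (iid_measurable k) (X l @^-1` B) setT
  (nn (X l @^-1` B)) (mp _ _ mB) measurableT.
rewrite -prE; last exact: mp.
move=> -> //; first by rewrite setIT muleC.
by move=> A1 A2 mA1 mA2; rewrite -setIA H2// setIT.
Qed.

(** A partial sum, or any state updated by the first k terms, is independent of
    the next term. *)
Lemma iid_indep_fold {d' : measure_display} {S' : measurableType d'}
    (G : nat -> S' * S -> S') (Phi : nat -> T -> S') (c : S') :
  (forall k, measurable_fun setT (G k)) ->
  (forall w, Phi 0%N w = c) -> (forall k w, Phi k.+1 w = G k (Phi k w, X k w)) ->
  forall k, measurable_fun setT (Phi k) /\ independent_pair P (Phi k) (X k).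
Proof.
move=> mG Phi0 PhiS.
suff main k : measurable_fun setT (Phi k) /\
    forall (J : finType) (u : J -> nat) (B : J -> set S) (A : set S'),
      (forall j, (k <= u j)%N) -> (forall j, measurable (B j)) -> measurable A ->
      P (Phi k @^-1` A `&` cyl u B) = (P (Phi k @^-1` A) * P (cyl u B))%E.
  move=> k; have [mPhi h] := main k; split=> // A B mA mB.
  by rewrite cyl1 h.
elim: k => [|k [mPhi IH]].
  split; first by rewrite (_ : Phi 0%N = cst c); [exact: measurable_cst|apply/funext].
  move=> J u B A _ mB mA; rewrite (_ : Phi 0%N = cst c); last exact/funext.
  rewrite preimage_cst; case: ifPn => _.
    by rewrite setTI probability_setT mul1e.
  by rewrite set0I measure0 mul0e.
have E : Phi k.+1 = G k \o (fun w => (Phi k w, X k w)) by apply/funext.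
have mpair : measurable_fun setT (fun w => (Phi k w, X k w)).
  exact: measurable_fun_pair.
split; first by rewrite E; exact: measurableT_comp.
move=> J u B A ku mB mA.
have mc := measurable_cyl u mB.
have mGA : measurable (G k @^-1` A) by rewrite -[X in measurable X]setTI; exact: mG.
have mP (A1 : set S') : measurable A1 -> measurable (Phi k @^-1` A1).
  by move=> mA1; rewrite -[X in measurable X]setTI; exact: mPhi.
have := @prod_measure_ext _ _ _ P _ _ _ _ (Phi k) (X k) mPhi (iid_measurable k)
  (cyl u B) setT (nn (cyl u B)) mc measurableT.
rewrite -prE// => /(_ _ (G k @^-1` A) mGA).
rewrite setIT muleC E => <- // A1 A2 mA1 mA2; rewrite setIT.
pose v (j : option J) := if j is Some j then u j else k.
pose Bv (j : option J) := if j is Some j then B j else A2.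
have cv : X k @^-1` A2 `&` cyl u B = cyl v Bv.
  apply/seteqP; split => w /=; first by move=> [? ?] [j|]//=.
  by move=> h; split; [exact: (h None)|move=> j; exact: (h (Some j))].
rewrite -setIA cv IH//; last 2 first.
- by move=> [j|]//=; exact: ltnW.
- by move=> [j|]/=.
rewrite -cv cyl1 (pr_cyl_indep (t := fun _ : unit => k))//; last first.
  by move=> _ b; rewrite neq_ltn ku.
by rewrite IH// muleA muleC.
Qed.

Lemma iid_ex_prod (n : nat) (f : nat -> S -> R) : (forall i, bmfun (f i)) ->
  \int[P]_w (\prod_(i < n) f i (X i w)) = \prod_(i < n) \int[P]_w f i (X i w).
Proof.
move=> bf.
pose Phi k w := \prod_(i < k) f i (X i w).
pose G k (z : R * S) := z.1 * f k z.2.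
have mG k : measurable_fun setT (G k).
  apply: measurable_funM => //.
  by apply: measurableT_comp; [exact: bmfun_measurable|exact: measurable_snd].
have H k : measurable_fun setT (Phi k) /\ independent_pair P (Phi k) (X k).
  apply: (@iid_indep_fold _ _ G Phi 1 mG) => [w|i w]; first by rewrite /Phi big_ord0.
  by rewrite /Phi big_ord_recr.
elim: n => [|n IH]; first by rewrite big_ord0 -[RHS](ex_cst P); apply: ex_eq => w; rewrite big_ord0.
rewrite big_ord_recr/= -IH.
have [mPhi ind] := H n.
have bPhi : bmfun (Phi n).
  by apply: bmfun_prod => i; exact: bmfun_comp (bf i).
have [K K0 PK] := bmfun_bound bPhi.
pose trunc (x : R) := Num.max (- K) (Num.min x K).
have trE w : trunc (Phi n w) = Phi n w.
  have := PK w; rewrite ler_norml => /andP[h1 h2].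
  by rewrite /trunc (min_idPl h2) (max_idPr h1).
have btr : bmfun trunc.
  split.
    apply: measurable_maxr; first exact: measurable_cst.
    by apply: measurable_minr => //; exact: measurable_cst.
  exists K => x; rewrite ler_norml /trunc le_max lexx/= ge_max.
  rewrite ge_min lexx orbT andbT; lra.
have := indep_exM mPhi (iid_measurable n) ind btr (bf n).
under ex_eq do rewrite trE.
under [X in _ = X * _ -> _]ex_eq do rewrite trE.
move=> <-; apply: ex_eq => w; rewrite /Phi big_ord_recr//.
Qed.

Lemma iid_ex i (f : S -> R) : bmfun f ->
  \int[P]_w f (X i w) = \int[P]_w f (X 0%N w).
Proof. by move=> bf; apply: law_eq_ex => // A mA; exact: iid_eq_dist. Qed.

Definition ex2 (f : S * S -> R) : R := \int[P]_w \int[P]_w' f (X 0%N w, X 0%N w').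

Lemma iid_ex2 i j (f : S * S -> R) : i != j -> bmfun f ->
  \int[P]_w f (X i w, X j w) = ex2 f.
Proof.
move=> ij bf.
rewrite (indep_Fubini (iid_measurable i) (iid_measurable j) (iid_indep_pair ij) bf).
rewrite /ex2 (iid_ex i (f := fun x => \int[P]_w f (x, X j w))); last first.
  exact: (bmfun_section P (iid_measurable i) (iid_measurable j) bf).
apply: ex_eq => w; apply: (iid_ex j (f := fun y => f (X 0%N w, y))).
by apply: bmfun_comp bf; exact: pair1_measurable.
Qed.

End iid_sequence.

(** * Second moments of U-statistics *)

Section ustatistics.
Context {d : measure_display} {T : measurableType d} {R : realType}.
Variable P : probability T R.
Context {ds : measure_display} {S : measurableType ds}.
Variable X : nat -> T -> S.
Hypothesis iidX : iid P X.
Let mX := iid_measurable iidX.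

Definition offdiag_sum (k : S * S -> R) (n : nat) (w : T) : R :=
  \sum_(p : 'I_n * 'I_n | p.1 != p.2) k (X p.1 w, X p.2 w).

Let bmk (k : S * S -> R) i j : bmfun k -> bmfun (fun w => k (X i w, X j w)).
Proof. by move=> bk; apply: bmfun_comp bk; exact: measurable_iid_pair iidX _ _. Qed.

Lemma bmfun_offdiag_sum k n : bmfun k -> bmfun (offdiag_sum k n).
Proof. by move=> bk; apply: bmfun_sum => p; exact: bmk. Qed.

Let sqr_offdiag k n w : offdiag_sum k n w ^+ 2 =
  \sum_(p : 'I_n * 'I_n | p.1 != p.2) \sum_(q : 'I_n * 'I_n | q.1 != q.2)
    (k (X p.1 w, X p.2 w) * k (X q.1 w, X q.2 w)).
Proof. by rewrite expr2 /offdiag_sum big_distrlr. Qed.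

Let ex_sqr_offdiag k n : bmfun k -> \int[P]_w (offdiag_sum k n w ^+ 2) =
  \sum_(p : 'I_n * 'I_n | p.1 != p.2) \sum_(q : 'I_n * 'I_n | q.1 != q.2)
    \int[P]_w (k (X p.1 w, X p.2 w) * k (X q.1 w, X q.2 w)).
Proof.
move=> bk; under ex_eq do rewrite sqr_offdiag.
rewrite ex_sum; last first.
  by move=> p; apply: bmfun_sum => q; apply: bmfunM; exact: bmk.
apply: eq_bigr => p _; rewrite ex_sum// => q.
by apply: bmfunM; exact: bmk.
Qed.

Let sum_pair_fst n (a : 'I_n) : \sum_(q : 'I_n * 'I_n) (q.1 == a)%:R = n%:R :> R.
Proof.
rewrite -(pair_bigA _ (fun i j : 'I_n => (i == a)%:R))/=.
under eq_bigr do rewrite sumr_const card_ord.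
rewrite (bigD1 a)//= eqxx big1 ?addr0// => i /negbTE ->.
by rewrite mul0rn.
Qed.

Let sum_pair_snd n (a : 'I_n) : \sum_(q : 'I_n * 'I_n) (q.2 == a)%:R = n%:R :> R.
Proof.
rewrite -(pair_bigA _ (fun i j : 'I_n => (j == a)%:R))/=.
have E (i : 'I_n) : \sum_(j < n) (j == a)%:R = 1 :> R.
  by rewrite (bigD1 a)//= eqxx big1 ?addr0// => j /negbTE ->.
transitivity (\sum_(i < n) (1 : R)); first by apply: eq_bigr => i _; exact: E.
by rewrite sumr_const card_ord.
Qed.

Lemma ex2_ge0 k : (forall z, 0 <= k z) -> 0 <= ex2 P X k.
Proof. by move=> k0; apply: ex_ge0 => w; apply: ex_ge0. Qed.

Let ov n (p q : 'I_n * 'I_n) : R := (q.1 == p.1)%:R + (q.1 == p.2)%:R +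
  (q.2 == p.1)%:R + (q.2 == p.2)%:R.

Let sum_ov n (p : 'I_n * 'I_n) : \sum_q ov p q = 4 * n%:R.
Proof.
rewrite /ov !big_split/= !sum_pair_fst !sum_pair_snd.
ring.
Qed.

Let ov_ge0 n (p q : 'I_n * 'I_n) : 0 <= ov p q.
Proof. by rewrite /ov !addr_ge0. Qed.

Let or4_ge1 (b1 b2 b3 b4 : bool) : [|| b1, b2, b3 | b4] ->
  (1 : R) <= b1%:R + b2%:R + b3%:R + b4%:R.
Proof. by case: b1 b2 b3 b4 => [] [] [] []//= _; rewrite -!natrD ler1n. Qed.

Let or2_ge1 (b1 b2 : bool) : b1 || b2 -> (1 : R) <= b1%:R + b2%:R.
Proof. by case: b1 b2 => [] []//= _; rewrite -!natrD ler1n. Qed.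

(** Only pairs of pairs that share an index can have covariance other than the
    product of means, and there are O(n^3) of them. *)
Lemma ex_sqr_offdiag_sum k n : bmfun k ->
  \int[P]_w ((offdiag_sum k n w - (n * n.-1)%:R * ex2 P X k) ^+ 2) <=
  4 * n%:R ^+ 3 * ex2 P X (fun z => k z ^+ 2).
Proof.
move=> bk; set m := ex2 P X k; pose c z := k z - m.
have bc : bmfun c by apply: bmfunB => //; exact: bmfun_cst.
have bk2 : bmfun (fun z => k z ^+ 2) by exact: bmfunX.
have bc2 : bmfun (fun z => c z ^+ 2) by exact: bmfunX.
set v := ex2 P X (fun z => k z ^+ 2).
have v0 : 0 <= v by apply: ex2_ge0 => z; exact: sqr_ge0.
have Ec : ex2 P X c = 0.
  rewrite -(iid_ex2 iidX (i := 0) (j := 1))//.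
  rewrite exB; [|exact: bmk|exact: bmfun_cst].
  by rewrite ex_cst (iid_ex2 iidX (i := 0) (j := 1)) ?subrr.
have Ec2 : ex2 P X (fun z => c z ^+ 2) <= v.
  rewrite -(iid_ex2 iidX (i := 0) (j := 1))//.
  have -> : \int[P]_w (c (X 0%N w, X 1%N w) ^+ 2) = v - m ^+ 2.
    transitivity (\int[P]_w (k (X 0%N w, X 1%N w) ^+ 2 -
                   (2 * m * k (X 0%N w, X 1%N w) - m ^+ 2))).
      by apply: ex_eq => w; rewrite /c; ring.
    have b1 := bmk 0 1 bk; have b2 := bmk 0 1 bk2.
    rewrite exB//; last first.
      by apply: bmfunB; [exact: bmfunZ|exact: bmfun_cst].
    rewrite exB; [|exact: bmfunZ|exact: bmfun_cst].
    rewrite exZ// ex_cst (iid_ex2 iidX (f := fun z => k z ^+ 2))// (iid_ex2 iidX)//.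
    by rewrite -/m -/v; ring.
  by rewrite gerBl sqr_ge0.
have card_off : \sum_(p : 'I_n * 'I_n | p.1 != p.2) (1 : R) = (n * n.-1)%:R.
  rewrite -(pair_big_dep xpredT (fun i j : 'I_n => i != j) (fun _ _ => 1))/=.
  have E (i : 'I_n) : \sum_(j < n | i != j) (1 : R) = n.-1%:R.
    rewrite sumr_const (eq_card (B := predC1 i)); last by move=> j; rewrite !inE eq_sym.
    by rewrite cardC1 card_ord.
  by under eq_bigr do rewrite E; rewrite sumr_const card_ord natrM mulr_natl.
have -> : \int[P]_w ((offdiag_sum k n w - (n * n.-1)%:R * m) ^+ 2) =
          \int[P]_w (offdiag_sum c n w ^+ 2).
  apply: ex_eq => w; congr (_ ^+ 2).
  rewrite /offdiag_sum sumrB; congr (_ - _); rewrite -card_off mulr_suml.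
  by apply: eq_bigr => p _; rewrite mul1r.
rewrite ex_sqr_offdiag//.
apply: (@le_trans _ _ (\sum_(p : 'I_n * 'I_n) \sum_(q : 'I_n * 'I_n) ov p q * v)).
  rewrite big_mkcond/=; apply: ler_sum => p _; case: ifPn => [pn|_]; last first.
    by apply: sumr_ge0 => q _; rewrite mulr_ge0.
  rewrite big_mkcond/=; apply: ler_sum => q _; case: ifPn => [qn|_]; last first.
    by rewrite mulr_ge0.
  have [ovl|] := boolP [|| q.1 == p.1, q.1 == p.2, q.2 == p.1 | q.2 == p.2].
    apply: (@le_trans _ _ v).
      apply: le_trans (ler_norm _) _.
      apply: (le_trans (ex_cauchy_schwarz_half P (bmk p.1 p.2 bc) (bmk q.1 q.2 bc))).
      rewrite !(iid_ex2 iidX (f := fun z => c z ^+ 2))//.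
      by rewrite ler_pdivrMr// mulr_natr mulr2n lerD.
    by rewrite -[leLHS]mul1r ler_wpM2r// /ov or4_ge1.
  rewrite !negb_or => /and4P[n1 n2 n3 n4].
  have -> : \int[P]_w (c (X p.1 w, X p.2 w) * c (X q.1 w, X q.2 w)) = 0.
    rewrite (indep_exM (U := fun w => (X p.1 w, X p.2 w))
      (V := fun w => (X q.1 w, X q.2 w)))//.
    - by rewrite (iid_ex2 iidX)// Ec mul0r.
    - exact: measurable_iid_pair iidX _ _.
    - exact: measurable_iid_pair iidX _ _.
    - by apply: (iid_indep_pair_pair iidX); rewrite eq_sym.
  by rewrite mulr_ge0.
under eq_bigr do rewrite -mulr_suml sum_ov.
rewrite sumr_const card_prod card_ord -[leLHS]mulr_natr natrM.
by apply: le_of_eq; ring.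
Qed.

(** If both conditional means vanish, only identical or reversed pairs
    contribute, so the order drops from n^3 to n^2. *)
Lemma ex_sqr_degenerate_sum g n K : bmfun g -> (forall z, `|g z| <= K) ->
  (forall x, \int[P]_w g (x, X 0%N w) = 0) ->
  (forall y, \int[P]_w g (X 0%N w, y) = 0) ->
  \int[P]_w (offdiag_sum g n w ^+ 2) <= 2 * n%:R ^+ 2 * K ^+ 2.
Proof.
move=> bg gK g1 g2; rewrite ex_sqr_offdiag//.
have K0 : 0 <= K ^+ 2 by exact: sqr_ge0.
pose same (p q : 'I_n * 'I_n) : R := (q == p)%:R + (q == (p.2, p.1))%:R.
have same0 p q : 0 <= same p q by rewrite addr_ge0.
apply: (@le_trans _ _ (\sum_(p : 'I_n * 'I_n) \sum_(q : 'I_n * 'I_n) same p q * K ^+ 2)).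
  rewrite big_mkcond/=; apply: ler_sum => p _; case: ifPn => [pn|_]; last first.
    by apply: sumr_ge0 => q _; rewrite mulr_ge0.
  rewrite big_mkcond/=; apply: ler_sum => q _; case: ifPn => [qn|_]; last first.
    by rewrite mulr_ge0.
  have [sm|] := boolP ((q == p) || (q == (p.2, p.1))).
    apply: (@le_trans _ _ (K ^+ 2)); last first.
      by rewrite -[leLHS]mul1r ler_wpM2r// /same or2_ge1.
    apply: le_trans (ler_norm _) _; apply: norm_ex_bound.
      by apply: bmfunM; exact: bmk.
    by move=> w; rewrite normrM expr2 ler_pM.
  rewrite negb_or => /andP[nqp nqs].
  suff -> : \int[P]_w (g (X p.1 w, X p.2 w) * g (X q.1 w, X q.2 w)) = 0.
    by rewrite mulr_ge0.
  have [/andP[q11 q12]|q1in] := boolP ((q.1 != p.1) && (q.1 != p.2)).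
    have ind : independent_pair P
        (fun w => ((X p.1 w, X p.2 w), X q.2 w)) (X q.1).
      by apply: (iid_indep_triple iidX); rewrite eq_sym// eq_sym.
    have mt : measurable_fun setT (fun w => ((X p.1 w, X p.2 w), X q.2 w)).
      by apply: measurable_fun_pair => //; exact: measurable_iid_pair iidX _ _.
    have := indep_Fubini mt (mX q.1) ind
      (f := fun z => g z.1.1 * g (z.2, z.1.2)).
    rewrite /= => ->; last first.
      apply: bmfunM.
        by apply: (@bmfun_comp _ _ _ _ _ g (fun z => z.1.1)) => //; exact: measurableT_comp.
      apply: (@bmfun_comp _ _ _ _ _ g (fun z => (z.2, z.1.2))) => //.
      by apply: measurable_fun_pair => //; exact: measurableT_comp.
    rewrite -[RHS](ex_cst P); apply: ex_eq => w.
    have bgx : bmfun (fun x => g (x, X q.2 w)).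
      by apply: bmfun_comp bg; exact: pair2_measurable.
    rewrite exZ; last exact: bmfun_comp bgx.
    by rewrite (iid_ex iidX q.1 bgx) g2 mulr0.
  have [/andP[q21 q22]|q2in] := boolP ((q.2 != p.1) && (q.2 != p.2)).
    have ind : independent_pair P
        (fun w => ((X p.1 w, X p.2 w), X q.1 w)) (X q.2).
      by apply: (iid_indep_triple iidX); rewrite // eq_sym.
    have mt : measurable_fun setT (fun w => ((X p.1 w, X p.2 w), X q.1 w)).
      by apply: measurable_fun_pair => //; exact: measurable_iid_pair iidX _ _.
    have := indep_Fubini mt (mX q.2) ind
      (f := fun z => g z.1.1 * g (z.1.2, z.2)).
    rewrite /= => ->; last first.
      apply: bmfunM.
        by apply: (@bmfun_comp _ _ _ _ _ g (fun z => z.1.1)) => //; exact: measurableT_comp.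
      apply: (@bmfun_comp _ _ _ _ _ g (fun z => (z.1.2, z.2))) => //.
      by apply: measurable_fun_pair => //; exact: measurableT_comp.
    rewrite -[RHS](ex_cst P); apply: ex_eq => w.
    have bgx : bmfun (fun x => g (X q.1 w, x)).
      by apply: bmfun_comp bg; exact: pair1_measurable.
    rewrite exZ; last exact: bmfun_comp bgx.
    by rewrite (iid_ex iidX q.2 bgx) g1 mulr0.
  exfalso; move: pn qn nqp nqs q1in q2in; case: p => a b; case: q => a' b' /=.
  rewrite !negb_and !negbK.
  move=> ab a'b' n1 n2 /orP[] /eqP e1 /orP[] /eqP e2; subst.
  - by rewrite eqxx in a'b'.
  - by rewrite /= !eqxx in n1.
  - by rewrite /= !eqxx in n2.
  - by rewrite eqxx in a'b'.
have E (p : 'I_n * 'I_n) : \sum_(q : 'I_n * 'I_n) same p q = 2.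
  rewrite /same big_split/=.
  have F (a : 'I_n * 'I_n) : \sum_(q : 'I_n * 'I_n) (q == a)%:R = 1 :> R.
    by rewrite (bigD1 a)//= eqxx big1 ?addr0// => j /negbTE ->.
  by rewrite !F.
under eq_bigr do rewrite -mulr_suml E.
rewrite sumr_const card_prod card_ord -[leLHS]mulr_natr natrM.
by apply: le_of_eq; ring.
Qed.

End ustatistics.

(** * Shattering and half-spaces *)

Section sauer_shelah.
Variable I : finType.
Implicit Types (F : {set {set I}}) (A B : {set I}).

Definition shatters F : pred {set I} := fun A =>
  [forall B : {set I}, (B \subset A) ==> [exists H in F, H :&: A == B]].

Lemma shattersP F A :
  reflect (forall B, B \subset A -> exists2 H, H \in F & H :&: A = B) (shatters F A).
Proof.
apply: (iffP forallP) => h B.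
  move=> BA; have /implyP/(_ BA)/existsP[H /andP[HF /eqP HA]] := h B.
  by exists H.
apply/implyP => BA; have [H HF HA] := h B BA.
by apply/existsP; exists H; rewrite HF HA eqxx.
Qed.

(** Split F by membership of a point x: a set that both halves shatter is
    shattered by F with x adjoined as well as without. *)
Lemma pajor F : (#|F| <= #|shatters F|)%N.
Proof.
have [n] := ubnP #|F|; elim: n F => // n IH F; rewrite ltnS => Fn.
have [F1|F1] := leqP #|F| 1.
  have [F0|F0] := posnP #|F|; first by rewrite F0.
  apply: (leq_trans F1); apply/card_gt0P.
  have /card_gt0P[H HF] := F0.
  exists finset.set0; apply/shattersP => B; rewrite finset.subset0 => /eqP ->.
  by exists H => //; rewrite finset.setI0.
have [H1 [H2 [H1F H2F H12]]] : exists H1 H2, [/\ H1 \in F, H2 \in F & H1 != H2].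
  have /card_gt0P[H1 H1F] : (0 < #|F|)%N by rewrite (ltn_trans _ F1).
  have : (0 < #|F :\ H1|)%N by move: F1; rewrite (cardsD1 H1) H1F.
  move=> /card_gt0P[H2]; rewrite !inE => /andP[H21 H2F].
  by exists H1, H2; rewrite eq_sym.
have [x [G1 [G2 [G1F G2F xG1 xG2]]]] : exists x G1 G2,
    [/\ G1 \in F, G2 \in F, x \in G1 & x \notin G2].
  have : ~~ [forall x, (x \in H1) == (x \in H2)].
    apply: contraNN H12 => /forallP h; apply/eqP/finset.setP => x.
    exact/eqP/h.
  rewrite negb_forall => /existsP[x]; have [x1|x1] := boolP (x \in H1).
    by have [//|x2 _] := boolP (x \in H2); exists x, H1, H2.
  by have [x2 _|//] := boolP (x \in H2); exists x, H2, H1.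
pose Fx := [set H : {set I} | x \in H]%SET.
have Fx1 : (#|F :&: Fx| < n)%N.
  apply: leq_trans Fn; rewrite -(cardsID Fx F) -[ltnLHS]addn0 ltn_add2l.
  by apply/card_gt0P; exists G2; rewrite !inE G2F xG2.
have Fx0 : (#|F :\: Fx| < n)%N.
  apply: leq_trans Fn; rewrite -(cardsID Fx F) -[ltnLHS]add0n ltn_add2r.
  by apply/card_gt0P; exists G1; rewrite !inE G1F xG1.
rewrite -(cardsID Fx F).
apply: (leq_trans (leq_add (IH _ Fx1) (IH _ Fx0))).
set S1 := shatters _; set S0 := shatters _.
have S1x A : S1 A -> x \notin A.
  move=> /shattersP/(_ finset.set0 (finset.sub0set _))[H].
  rewrite !inE => /andP[_ xH] /finset.setP/(_ x).
  by rewrite !inE xH/= => ->.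
have S0x A : S0 A -> x \notin A.
  move=> /shattersP/(_ A (subxx _))[H].
  rewrite !inE => /andP[xH _] /finset.setP/(_ x).
  by rewrite !inE (negbTE xH)/= => <-.
rewrite -cardUI -(cardID [pred A : {set I} | x \notin A] (shatters F)).
apply: leq_add.
  apply: subset_leq_card; apply/fintype.subsetP => A; rewrite !inE => /orP[] SA.
    rewrite -[_ \in _]/(shatters F A) (S1x _ SA) andbT.
    apply/shattersP => B /(shattersP _ _ SA)[H].
    by rewrite !inE => /andP[HF _] HA; exists H.
  rewrite -[_ \in _]/(shatters F A) (S0x _ SA) andbT.
  apply/shattersP => B /(shattersP _ _ SA)[H].
  by rewrite !inE => /andP[_ HF] HA; exists H.
have inj : {in [predI S1 & S0] &, injective (fun A => x |: A)}.
  move=> A B; rewrite -!topredE/= => /andP[/S1x xA _] /andP[/S1x xB _] AB.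
  by rewrite -(setU1K xA) -(setU1K xB) AB.
rewrite -(card_in_image inj); apply: subset_leq_card; apply/fintype.subsetP => C /fintype.imageP[A].
rewrite -[_ \in [predI _ & _]]/(S1 A && S0 A) => /andP[SA1 SA0] ->.
apply/andP; split=> /=; first by rewrite !inE eqxx.
rewrite -[_ \in _]/(shatters F (x |: A)).
have xA := S1x _ SA1.
apply/shattersP => B BA.
have [xB|xB] := boolP (x \in B).
  have BxA : B :\ x \subset A by rewrite finset.subDset.
  have [H] := shattersP _ _ SA1 _ BxA; rewrite !inE => /andP[HF xH] HA.
  exists H => //; apply/finset.setP => y; rewrite !inE.
  have [->|yx] /= := eqVneq y x; first by rewrite xH xB.
  by move/finset.setP: HA => /(_ y); rewrite !inE yx.
have BxA : B \subset A.
  by apply/fintype.subsetP => y yB; have := fintype.subsetP BA _ yB; rewrite !inE => /orP[/eqP yx|//];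
    rewrite -yx yB in xB.
have [H] := shattersP _ _ SA0 _ BxA; rewrite !inE => /andP[xH HF] HA.
exists H => //; apply/finset.setP => y; rewrite !inE.
have [->|yx] /= := eqVneq y x; first by rewrite (negbTE xH) (negbTE xB).
by move/finset.setP: HA => /(_ y); rewrite !inE.
Qed.

Lemma card_small_sets m : (#|[pred A : {set I} | #|A| <= m]| <= #|I|.+1 ^ m)%N.
Proof.
pose g (u : {ffun 'I_m -> option I}) : {set I} := [set x | Some x \in codom u]%SET.
have -> : (#|I|.+1 ^ m = #|{ffun 'I_m -> option I}|)%N.
  by rewrite card_ffun card_option card_ord.
apply: leq_trans (leq_image_card g _).
apply: subset_leq_card; apply/fintype.subsetP => A; rewrite inE => Am.
apply/fintype.imageP; pose u : {ffun 'I_m -> option I} := [ffun i : 'I_m => nth None [seq Some x | x <- enum A] i].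
exists u => //; apply/finset.setP => x; rewrite inE.
apply/idP/codomP => [xA|[i]].
  have ix : (index x (enum A) < m)%N.
    by apply: leq_trans Am; rewrite cardE index_mem mem_enum.
  exists (Ordinal ix); rewrite ffunE/= (nth_map x) ?index_mem ?mem_enum//.
  by rewrite nth_index// mem_enum.
rewrite ffunE; have [iA|iA] := ltnP i (size (enum A)).
  by rewrite (nth_map x)// => -[->]; rewrite -mem_enum mem_nth.
by rewrite nth_default// size_map.
Qed.

Lemma sauer_shelah F m : (forall A, shatters F A -> #|A| <= m)%N ->
  (#|F| <= #|I|.+1 ^ m)%N.
Proof.
move=> h; apply: (leq_trans (pajor F)); apply: leq_trans (card_small_sets m).
by apply: subset_leq_card; apply/fintype.subsetP => A; rewrite inE; exact: h.
Qed.

End sauer_shelah.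

Section dotv_theory.
Context {R : realType} (m : nat).
Implicit Types a b : 'rV[R]_m.

Lemma dotvE a b : dotv a b = \sum_k a 0 k * b 0 k.
Proof. by rewrite /dotv mxE; apply: eq_bigr => k _; rewrite mxE. Qed.

Lemma dotvC a b : dotv a b = dotv b a.
Proof. by rewrite !dotvE; apply: eq_bigr => k _; rewrite mulrC. Qed.

Lemma dotvDl a a' b : dotv (a + a') b = dotv a b + dotv a' b.
Proof. by rewrite /dotv mulmxDl mxE. Qed.

Lemma dotvNl a b : dotv (- a) b = - dotv a b.
Proof. by rewrite /dotv mulNmx mxE. Qed.

Lemma dotvBl a a' b : dotv (a - a') b = dotv a b - dotv a' b.
Proof. by rewrite dotvDl dotvNl. Qed.

Lemma dotvZl c a b : dotv (c *: a) b = c * dotv a b.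
Proof. by rewrite /dotv -scalemxAl mxE. Qed.

Lemma dotvDr a b b' : dotv a (b + b') = dotv a b + dotv a b'.
Proof. by rewrite dotvC dotvDl !(dotvC a). Qed.

Lemma dotvNr a b : dotv a (- b) = - dotv a b.
Proof. by rewrite dotvC dotvNl (dotvC a). Qed.

Lemma dotvBr a b b' : dotv a (b - b') = dotv a b - dotv a b'.
Proof. by rewrite dotvDr dotvNr. Qed.

Lemma dotvZr c a b : dotv a (c *: b) = c * dotv a b.
Proof. by rewrite dotvC dotvZl (dotvC a). Qed.

Lemma dotv0l b : dotv 0 b = 0.
Proof. by rewrite /dotv mul0mx mxE. Qed.

Lemma norm_coord_le a k : `|a 0 k| <= `|a|.
Proof.
rewrite [leRHS]/Num.norm/= mx_normrE.
exact: (le_bigmax _ (fun i : 'I_1 * 'I_m => `|a i.1 i.2|) (0, k)).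
Qed.

Lemma norm_row_le a (K : R) : 0 <= K -> (forall k, `|a 0 k| <= K) -> `|a| <= K.
Proof.
move=> K0 aK; rewrite [leLHS]/Num.norm/= mx_normrE.
by apply: bigmax_le => // -[i k] _; rewrite ord1.
Qed.

Lemma norm_dotv_le a b : `|dotv a b| <= m%:R * `|a| * `|b|.
Proof.
rewrite dotvE; apply: (le_trans (ler_norm_sum _ _ _)).
apply: (@le_trans _ _ (\sum_(k < m) `|a| * `|b|)); last first.
  by rewrite sumr_const card_ord -mulrA mulr_natl.
by apply: ler_sum => k _; rewrite normrM ler_pM// norm_coord_le.
Qed.

End dotv_theory.

Section halfspace_patterns.
Context {R : realType} (n M : nat) (x : 'I_n -> 'rV[R]_M).

(** More than M vectors of R^M are linearly dependent, and a sign pattern chosen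
    according to the signs of a dependency cannot be cut out by a half-space. *)
Lemma halfspace_shatter (F : {set {set 'I_n}}) (A : {set 'I_n}) :
  (forall H, H \in F -> exists a : 'rV[R]_M, H = [set j | 0 <= dotv a (x j)]%SET) ->
  shatters F A -> (#|A| <= M)%N.
Proof.
move=> hF /shattersP sh; rewrite leqNgt; apply/negP => MA.
pose V : 'M[R]_(#|A|, M) := \matrix_i x (enum_val i).
have : kermx V != 0.
  rewrite kermx_eq0; apply/negP => /eqP rV.
  by have := rank_leq_col V; rewrite rV leqNgt MA.
move=> /rowV0Pn[c /sub_kermxP cV c0].
wlog [i0 ci0] : c cV c0 / exists i0, c 0 i0 < 0.
  move=> H; have [i ci] : exists i, c 0 i != 0.
    apply/existsP; rewrite -negb_forall; apply: contraNN c0 => /forallP h.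
    by apply/eqP/rowP => i; rewrite mxE; apply/eqP/h.
  have [ci0|ci0] := ltP (c 0 i) 0; first by apply: (H c) => //; exists i.
  apply: (H (- c)); first by rewrite mulNmx cV oppr0.
    by rewrite oppr_eq0.
  by exists i; rewrite mxE oppr_lt0 lt_neqAle eq_sym ci.
pose B := [set j in A | [exists i, (enum_val i == j) && (0 <= c 0 i)]]%SET.
have [H HF HA] : exists2 H, H \in F & H :&: A = B.
  by apply: sh; apply/fintype.subsetP => j; rewrite inE => /andP[].
have [a Ha] := hF _ HF.
have key i : (0 <= dotv a (x (enum_val i))) = (0 <= c 0 i).
  move/finset.setP: HA => /(_ (enum_val i)); rewrite !inE Ha inE enum_valP andbT/= => ->.
  apply/existsP/idP => [[j /andP[/eqP/enum_val_inj -> //]]|ci].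
  by exists i; rewrite eqxx.
have : \sum_i c 0 i * dotv a (x (enum_val i)) = 0.
  transitivity (dotv a (c *m V)); last by rewrite cV dotvE big1// => k _; rewrite mxE mulr0.
  rewrite dotvE; under [RHS]eq_bigr do rewrite mxE mulr_sumr.
  rewrite exchange_big/=; apply: eq_bigr => i _.
  by rewrite dotvE mulr_sumr; apply: eq_bigr => k _; rewrite /V !mxE; ring.
have pos i : 0 <= c 0 i * dotv a (x (enum_val i)).
  have [ci|ci] := leP 0 (c 0 i); first by rewrite mulr_ge0// key.
  by rewrite mulr_le0// ltW// ltNge key -ltNge.
rewrite (bigD1 i0)//= => /eqP; rewrite paddr_eq0//; last exact: sumr_ge0.
move=> /andP[+ _]; rewrite mulf_eq0 (lt_eqF ci0)/= => /eqP e0.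
by have := key i0; rewrite e0 lexx leNgt ci0.
Qed.

Lemma card_halfspace_patterns (F : {set {set 'I_n}}) :
  (forall H, H \in F -> exists a : 'rV[R]_M, H = [set j | 0 <= dotv a (x j)]%SET) ->
  (#|F| <= n.+1 ^ M)%N.
Proof.
move=> hF; rewrite -[n in n.+1]card_ord; apply: sauer_shelah => A.
exact: halfspace_shatter.
Qed.

End halfspace_patterns.

(** * Uniform deviation over half-spaces *)

Lemma expR_le_quadratic (R : realType) (y : R) : y <= 1 / 2 ->
  expR y <= 1 + y + 2 * y ^+ 2.
Proof.
move=> y2; have h := expR_ge1Dx (- y).
have y1 : 0 < 1 + - y by lra.
have : (expR (- y))^-1 <= (1 + - y)^-1 by rewrite lef_pV2// posrE expR_gt0.
rewrite expRN invrK => /le_trans; apply.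
rewrite -[leLHS]mul1r ler_pdivrMr//.
have : 0 <= y ^+ 2 * (1 - 2 * y) by rewrite mulr_ge0 ?sqr_ge0//; lra.
lra.
Qed.

Section finite_class_deviation.
Context {d : measure_display} {T : measurableType d} {R : realType}.
Variable P : probability T R.
Context {ds : measure_display} {S : measurableType ds}.
Variable X : nat -> T -> S.
Hypothesis iidX : iid P X.
Variables (xi : S -> R) (K : R).
Hypotheses (bxi : bmfun xi) (xiK : forall x, `|xi x| <= K).
Variables (N : nat) (b : 'I_N -> S -> bool).
Hypothesis mb : forall p, measurable_fun setT (b p).

Let tp (x : S) : {ffun 'I_N -> bool} := [ffun p => b p x].

Hypothesis xi0 : forall f : {ffun 'I_N -> bool},
  \int[P]_w ((tp (X 0%N w) == f)%:R * xi (X 0%N w)) = 0.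

Let btp f : bmfun (fun x => (tp x == f)%:R : R).
Proof.
apply: bmfun_bool.
rewrite (_ : (fun x => _) = (fun x => \big[andb/true]_(p < N) (b p x == f p))).
  elim: (index_enum _) => [|p s IH].
    by under eq_fun do rewrite big_nil; exact: measurable_cst.
  under eq_fun do rewrite big_cons; apply: measurable_and => //.
  case: (f p); first by under eq_fun do rewrite eqb_id; exact: mb.
  by under eq_fun do rewrite eqbF_neg; apply: measurable_neg; exact: mb.
apply/funext => x; apply/eqP/idP => [<-|h].
  by rewrite big_andE; apply/forallP => p; rewrite ffunE eqxx.
apply/ffunP => p; rewrite ffunE.
by move: h; rewrite big_andE => /forallP/(_ p)/eqP.
Qed.

Let bexp (s c : R) : bmfun (fun x => expR (s * xi x * c)).
Proof.
have [mxi _] := bxi; split.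
  apply: measurableT_comp; first exact: measurable_expR.
  by apply: measurable_funM => //; exact: measurable_funM.
exists (expR (`|s| * K * `|c|)) => x; rewrite ger0_norm ?expR_ge0// ler_expR.
apply: (le_trans (ler_norm _)); rewrite !normrM ler_wpM2r// ler_wpM2l//.
Qed.

Let mgf f (lam s c : R) : lam * K <= 1 / 2 -> `|s| <= lam -> `|c| <= 1 ->
  \int[P]_w ((tp (X 0%N w) == f)%:R * expR (s * xi (X 0%N w) * c)) <=
  (\int[P]_w (tp (X 0%N w) == f)%:R) * (1 + 2 * (lam * K) ^+ 2).
Proof.
move=> lamK sl c1.
have m0 := iid_measurable iidX 0%N.
have l0 : 0 <= lam by exact: le_trans sl.
have b1 := bmfun_comp m0 (btp f).
have b2 := bmfun_comp m0 bxi.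
have b3 : bmfun (fun w => (tp (X 0 w) == f)%:R * xi (X 0 w)) by exact: bmfunM.
apply: (@le_trans _ _ (\int[P]_w ((s * c) * ((tp (X 0%N w) == f)%:R * xi (X 0%N w)) +
    (tp (X 0%N w) == f)%:R * (1 + 2 * (lam * K) ^+ 2)))).
  apply: le_ex.
  - by apply: bmfunM => //; exact: (bmfun_comp m0 (bexp s c)).
  - apply: bmfunD; first exact: bmfunZ.
    by apply: bmfunM => //; exact: bmfun_cst.
  move=> w; case: (_ == f); rewrite ?mul0r ?mulr0 ?addr0// !mul1r.
  have ab : `|s * xi (X 0 w) * c| <= lam * K.
    rewrite !normrM -[leRHS]mulr1; apply: ler_pM => //.
    by apply: ler_pM.
  apply: (le_trans (expR_le_quadratic _)).
    by apply: le_trans lamK; exact: le_trans (ler_norm _) ab.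
  have : (s * xi (X 0 w) * c) ^+ 2 <= (lam * K) ^+ 2.
    by rewrite -[X in X <= _]real_normK ?num_real// lerXn2r ?nnegrE// (le_trans _ ab).
  lra.
rewrite exD; [|exact: bmfunZ|by apply: bmfunM => //; exact: bmfun_cst].
by rewrite exZ// xi0 mulr0 add0r exZr.
Qed.

Variables (n D : nat).
Let pat (k : {ffun 'I_n -> {ffun 'I_N -> bool}}) : {set {set 'I_n}} :=
  [set [set j | k j p]%SET | p : 'I_N]%SET.

Hypothesis VC : forall x : 'I_n -> S, (#|pat [ffun j => tp (x j)]| <= D)%N.

Let Sp (p : 'I_N) w : R := \sum_(j < n) xi (X j w) * (b p (X j w))%:R.

(** Given the pattern of the sets the summands are independent and centred, so
    Bernstein's exponential bound holds; one sums over the finitely many patterns. *)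
Lemma finite_class_deviation (lam x : R) : lam * K <= 1 / 2 -> 0 <= lam ->
  pr P [set w | [exists p, x <= `|Sp p w|]] <=
  2 * D%:R * (1 + 2 * (lam * K) ^+ 2) ^+ n * expR (- (lam * x)).
Proof.
move=> lamK lam0.
have mX := iid_measurable iidX.
pose g (k : {ffun 'I_n -> {ffun 'I_N -> bool}}) (H : {set 'I_n}) (s : R) (j : nat) (y : S) : R :=
  if insub j is Some j' then (tp y == k j')%:R * expR (s * xi y * (j' \in H)%:R) else 1.
have bg k H s j : bmfun (g k H s j).
  rewrite /g; case: insubP => [j' _ _|_]; last exact: bmfun_cst.
  by apply: bmfunM => //; exact: (bexp s (j' \in H)%:R).
pose G k H s w := \prod_(j < n) g k H s j (X j w).
have bG k H s : bmfun (G k H s).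
  by apply: bmfun_prod => j; exact: bmfun_comp (bg _ _ _ _).
have gE k H s (j : 'I_n) y : g k H s j y =
    (tp y == k j)%:R * expR (s * xi y * (j \in H)%:R) by rewrite /g valK.
pose bad w := [exists p, x <= `|Sp p w|].
have mbad : measurable_fun setT bad.
  rewrite (_ : bad = fun w => \big[orb/false]_(p < N) (x <= `|Sp p w|)); last first.
    by apply/funext => w; rewrite big_orE.
  elim: (index_enum _) => [|p s IH].
    by under eq_fun do rewrite big_nil; exact: measurable_cst.
  under eq_fun do rewrite big_cons; apply: measurable_or => //.
  apply: measurable_fun_ler; first exact: measurable_cst.
  apply: measurableT_comp => //; apply: bmfun_measurable; apply: bmfun_sum => j.
  by apply: bmfunM; [exact: bmfun_comp bxi|apply: bmfun_bool; exact: measurableT_comp].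
rewrite -ex_bool//.
have GE k H s w : k = [ffun j : 'I_n => tp (X j w)] ->
    G k H s w = expR (s * \sum_(j < n) xi (X j w) * (j \in H)%:R).
  move=> ->; rewrite mulr_sumr expR_sum; apply: eq_bigr => j _.
  by rewrite gE ffunE eqxx mul1r mulrA.
have G0 k H s w : 0 <= G k H s w.
  by apply: prodr_ge0 => j _; rewrite gE mulr_ge0// expR_ge0.
pose B := expR (- (lam * x)).
have B0 : 0 <= B by exact: expR_ge0.
have step1 : \int[P]_w (bad w)%:R <= \int[P]_w (\sum_(k : {ffun 'I_n -> {ffun 'I_N -> bool}})
    \sum_(H in pat k) (G k H lam w + G k H (- lam) w) * B).
  apply: le_ex; first exact: bmfun_bool.
    apply: bmfun_sum => k; apply: bmfun_sum => H; apply: bmfunM; last exact: bmfun_cst.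
    exact: bmfunD.
  move=> w; have nneg k H : 0 <= (G k H lam w + G k H (- lam) w) * B.
    by rewrite mulr_ge0// addr_ge0.
  case: (boolP (bad w)) => [/existsP[p xp]|_]; last first.
    by apply: sumr_ge0 => k _; apply: sumr_ge0 => H _.
  pose k := [ffun j : 'I_n => tp (X j w)].
  pose H := [set j | k j p]%SET.
  rewrite (bigD1 k)//= (bigD1 H)/=; last by apply/imsetP; exists p.
  rewrite -addrA -[leLHS]addr0 lerD//; last first.
    rewrite addr_ge0//; first by apply: sumr_ge0 => H' _.
    by apply: sumr_ge0 => k' _; apply: sumr_ge0 => H' _.
  have SH : \sum_(j < n) xi (X j w) * (j \in H)%:R = Sp p w.
    by apply: eq_bigr => j _; rewrite inE !ffunE.
  rewrite !GE// SH mulrDl /B -!expRD mulNr -!mulrBr -opprD -mulrDr.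
  have [S0|S0] := leP 0 (Sp p w).
    rewrite ger0_norm// in xp; apply: ler_wpDr; first exact: expR_ge0.
    by rewrite -[leLHS]expR0 ler_expR mulr_ge0// subr_ge0.
  rewrite ltr0_norm// in xp; apply: ler_wpDl; first exact: expR_ge0.
  rewrite -[leLHS]expR0 ler_expR -mulrN mulr_ge0// opprD subr_ge0//.
apply: (le_trans step1).
rewrite ex_sum; last first.
  move=> k; apply: bmfun_sum => H; apply: bmfunM; last exact: bmfun_cst.
  exact: bmfunD.
pose q (f : {ffun 'I_N -> bool}) : R := \int[P]_w (tp (X 0%N w) == f)%:R.
have q0 f : 0 <= q f by apply: ex_ge0.
pose c := 1 + 2 * (lam * K) ^+ 2.
have c0 : 0 <= c by rewrite addr_ge0// mulr_ge0// sqr_ge0.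
have exG k H s : `|s| <= lam -> \int[P]_w G k H s w <= c ^+ n * \prod_(j < n) q (k j).
  move=> sl; rewrite (iid_ex_prod iidX n (f := g k H s))//.
  rewrite -[n in c ^+ n]card_ord -prodr_const -big_split/=.
  apply: ler_prod => j _; rewrite (iid_ex iidX j)//.
  rewrite ex_ge0/=; last by move=> w; rewrite gE mulr_ge0// expR_ge0.
  under ex_eq do rewrite gE.
  rewrite mulrC; apply: mgf => //.
  by case: (j \in H); rewrite ?normr1 ?normr0.
have step2 k : \int[P]_w (\sum_(H in pat k) (G k H lam w + G k H (- lam) w) * B) <=
    2 * D%:R * c ^+ n * B * \prod_(j < n) q (k j).
  rewrite ex_sum; last by move=> H; apply: bmfunM; [exact: bmfunD|exact: bmfun_cst].
  have [/existsP[j /eqP qj]|] := boolP [exists j, q (k j) == 0].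
    have -> : \prod_(j < n) q (k j) = 0 by rewrite (bigD1 j)//= qj mul0r.
    rewrite mulr0; apply: sumr_le0 => H _.
    rewrite exZr; last exact: bmfunD.
    rewrite mulr_le0_ge0// exD//.
    have z : \prod_(j < n) q (k j) = 0 by rewrite (bigD1 j)//= qj mul0r.
    have e1 := exG k H lam; have e2 := exG k H (- lam).
    rewrite z mulr0 normrN ger0_norm// in e1 e2.
    by rewrite -[leRHS]addr0 lerD// ?e1 ?e2// ?normrN ger0_norm.
  rewrite negb_exists => /forallP qn.
  have cardk : (#|pat k| <= D)%N.
    have w j : exists y, tp y = k j.
      apply: contrapT => h; move/eqP: (qn j); apply.
      rewrite /q -[RHS](ex_cst P); apply: ex_eq => w.
      by case: eqP => // e; exfalso; apply: h; exists (X 0%N w).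
    have [y yk] := choice w.
    rewrite (_ : k = [ffun j => tp (y j)]); first exact: VC.
    by apply/ffunP => j; rewrite ffunE yk.
  apply: (@le_trans _ _ (\sum_(H in pat k) (2 * c ^+ n * B * \prod_(j < n) q (k j)))).
    apply: ler_sum => H _; rewrite exZr; last exact: bmfunD.
    rewrite exD//.
    have e1 := exG k H lam; have e2 := exG k H (- lam).
    rewrite normrN !ger0_norm// in e1 e2.
    have := lerD (e1 (lexx _)) (e2 (lexx _)).
    move=> /(ler_wpM2r B0)/le_trans; apply.
    by apply: le_of_eq; ring.
  rewrite sumr_const -[leLHS]mulr_natl !mulrA ler_wpM2r//.
    by apply: prodr_ge0.
  rewrite ler_wpM2r// ler_wpM2r ?exprn_ge0//.
  by rewrite mulrC ler_wpM2l// ler_nat.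
apply: (le_trans (ler_sum _ (fun k _ => step2 k))).
rewrite -mulr_sumr -(bigA_distr_bigA (fun _ f => q f))/=.
have -> : \sum_f q f = 1.
  rewrite /q -ex_sum; last by move=> f; exact: (bmfun_comp (mX 0%N) (btp f)).
  rewrite -[RHS](ex_cst P); apply: ex_eq => w.
  rewrite (bigD1 (tp (X 0 w)))//= eqxx big1 ?addr0// => f /negbTE.
  by rewrite eq_sym => ->.
by rewrite big1// mulr1.
Qed.

End finite_class_deviation.

Section halfspace_deviation.
Context {d : measure_display} {T : measurableType d} {R : realType}.
Variable P : probability T R.
Context {ds : measure_display} {S : measurableType ds}.
Variable X : nat -> T -> S.
Hypothesis iidX : iid P X.
Variables (xi : S -> R) (K : R).
Hypotheses (bxi : bmfun xi) (xiK : forall x, `|xi x| <= K).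
Context {d2 : measure_display} {S2 : measurableType d2} (V : S -> S2).
Hypothesis mV : measurable_fun setT V.
Hypothesis xi0 : forall B, measurable B ->
  \int[P]_w (\1_B (V (X 0%N w)) * xi (X 0%N w)) = 0.
Variables (m : nat) (phi : S2 -> 'rV[R]_m).
Hypothesis mphi : forall a, measurable_fun setT (fun x => dotv a (phi x)).

Definition halfspace (a : 'rV[R]_m) (c : R) (x : S) : bool :=
  0 <= dotv a (phi (V x)) + c.

Lemma measurable_halfspace a c : measurable_fun setT (halfspace a c).
Proof.
apply: measurable_fun_ler; first exact: measurable_cst.
apply: measurable_funD; last exact: measurable_cst.
exact: (measurableT_comp (mphi a)).
Qed.

Let dotv_row_mx (a b : 'rV[R]_m) (c : R) :
  dotv (row_mx a c%:M) (row_mx b 1%:M) = dotv a b + c.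
Proof. by rewrite /dotv tr_row_mx mul_row_col mxE tr_scalar_mx mulmx1 [in X in _ + X]mxE eqxx. Qed.

Let card_patterns n (I : finType) (a : I -> 'rV[R]_m) (c : I -> R) (x : 'I_n -> S) :
  (#|[set [set j | halfspace (a p) (c p) (x j)]%SET | p : I]%SET| <= n.+1 ^ (m + 1))%N.
Proof.
apply: (card_halfspace_patterns (x := fun j => row_mx (phi (V (x j))) 1%:M)).
move=> H /imsetP[p _ ->]; exists (row_mx (a p) (c p)%:M).
by apply/finset.setP => j; rewrite !inE dotv_row_mx.
Qed.

Let coef (p : nat) : 'rV[rat]_m * rat := odflt (0, -1) (unpickle p).
Let hp (p : nat) : S -> bool :=
  halfspace (map_mx ratr (coef p).1) (ratr (coef p).2).

Let gap n (v : nat -> R) : exists2 dl : R, 0 < dl &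
  forall j, (j < n)%N -> v j < 0 -> v j <= - dl.
Proof.
elim: n => [|n [dl dl0 IH]]; first by exists 1.
have [vn|vn] := leP 0 (v n).
  exists dl => // j; rewrite ltnS leq_eqVlt => /predU1P[->|jn]; last exact: IH.
  by rewrite ltNge vn.
exists (Num.min dl (- v n)); first by rewrite lt_min dl0 oppr_gt0.
move=> j; rewrite ltnS leq_eqVlt => /predU1P[-> _|jn vj].
  by rewrite lerNr ge_min lexx orbT.
by apply: (le_trans (IH _ jn vj)); rewrite lerN2 ge_min lexx.
Qed.

Let bounded_phi n (x : nat -> S) : exists2 B : R, 0 <= B &
  forall j k, (j < n)%N -> `|phi (V (x j)) 0 k| <= B.
Proof.
elim: n => [|n [B B0 IH]]; first by exists 0.
exists (B + `|phi (V (x n))|); first by rewrite addr_ge0.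
move=> j k; rewrite ltnS leq_eqVlt => /predU1P[->|jn].
  by rewrite ler_wpDl//; exact: norm_coord_le.
by rewrite ler_wpDr// IH.
Qed.

(** On finitely many points every half-space agrees with one of countably many,
    which makes the supremum below measurable. *)
Let rational_halfspace n (x : nat -> S) a c : exists p, forall j, (j < n)%N ->
  hp p (x j) = halfspace a c (x j).
Proof.
have [dl dl0 dlP] := gap n (fun j => dotv a (phi (V (x j))) + c).
have [B B0 BP] := bounded_phi n x.
pose e := dl / (8 * (m%:R * B + 1)).
have mB : 0 < m%:R * B + 1 by rewrite ltr_wpDl// mulr_ge0.
have e0 : 0 < e by rewrite divr_gt0// mulr_gt0.
have ratr_approx (y : R) : exists q : rat, `|ratr q - y| < e.
  have [|q] := @rat_in_itvoo R (y - e) (y + e); first by rewrite ltrD2l gtrN.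
  by rewrite in_itv/= => /andP[h1 h2]; exists q; rewrite ltr_norml; lra.
have /choice[a' a'P] k := ratr_approx (a 0 k).
have [c' c'P] := ratr_approx (c + dl / 2).
exists (pickle (\row_k a' k, c')) => j jn.
rewrite /hp /coef pickleK/= /halfspace.
set v := dotv a (phi (V (x j))).
set v' := dotv _ (phi (V (x j))).
have e8 : e * (m%:R * B + 1) = dl / 8.
  by rewrite /e; field; rewrite gt_eqF.
have vv : `|v' - v| <= m%:R * e * B.
  rewrite /v' /v -dotvBl dotvE; apply: (le_trans (ler_norm_sum _ _ _)).
  rewrite -mulrA -[in leRHS](card_ord m) mulr_natl -sumr_const.
  apply: ler_sum => k _; rewrite normrM ler_pM// ?BP// ltW// !mxE; exact: a'P.
have vc : `|v' + ratr c' - (v + c + dl / 2)| <= dl / 8.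
  rewrite (_ : _ - _ = (v' - v) + (ratr c' - (c + dl / 2))); last by ring.
  rewrite (le_trans (ler_normD _ _))// -e8.
  have := ltW c'P; move: vv; lra.
move: vc; rewrite ler_norml => /andP[h1 h2].
have [vp|vn] := leP 0 (v + c); first by apply/idP; lra.
by apply/negbTE; rewrite -ltNge; have := dlP _ jn vn; rewrite -/v; lra.
Qed.

Lemma halfspace_deviation n (lam x : R) : lam * K <= 1 / 2 -> 0 <= lam ->
  exists E, [/\ measurable E,
    pr P E <= 2 * (n.+1 ^ (m + 1))%:R * (1 + 2 * (lam * K) ^+ 2) ^+ n * expR (- (lam * x)) &
    forall w, ~ E w -> forall a c,
      `|\sum_(j < n) xi (X j w) * (halfspace a c (X j w))%:R| < x].
Proof.
move=> lamK lam0; pose bound : R := 2 * (n.+1 ^ (m + 1))%:R * (1 + 2 * (lam * K) ^+ 2) ^+ n *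
  expR (- (lam * x)).
have mX := iid_measurable iidX.
pose Sp p w : R := \sum_(j < n) xi (X j w) * (hp p (X j w))%:R.
pose EN N := [set w | [exists p : 'I_N, x <= `|Sp p w|]].
have mhp p : measurable_fun setT (hp p) by exact: measurable_halfspace.
have mSp p : measurable_fun setT (Sp p).
  apply: bmfun_measurable; apply: bmfun_sum => j.
  by apply: bmfunM; [exact: bmfun_comp bxi|apply: bmfun_bool; exact: measurableT_comp].
have mEN N : measurable (EN N).
  apply: measurable_set_bool.
  rewrite (_ : (fun w => _) = fun w => \big[orb/false]_(p < N) (x <= `|Sp p w|)); last first.
    by apply/funext => w; rewrite big_orE.
  elim: (index_enum _) => [|p s IH].
    by under eq_fun do rewrite big_nil; exact: measurable_cst.
  under eq_fun do rewrite big_cons; apply: measurable_or => //.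
  apply: measurable_fun_ler; first exact: measurable_cst.
  exact: measurableT_comp.
have EN_bound N : pr P (EN N) <= bound.
  apply: (finite_class_deviation iidX bxi xiK (b := fun p : 'I_N => hp p)) => //.
  - move=> f.
    pose B := [set y : S2 | [forall p : 'I_N,
      (0 <= dotv (map_mx ratr (coef p).1) (phi y) + ratr (coef p).2) == f p]].
    rewrite -[RHS](xi0 (B := B)); last first.
      apply: measurable_set_bool.
      rewrite (_ : (fun y => _) = fun y => \big[andb/true]_(p < N)
          ((0 <= dotv (map_mx ratr (coef p).1) (phi y) + ratr (coef p).2) == f p)); last first.
        by apply/funext => y; rewrite big_andE.
      elim: (index_enum _) => [|p s IH].
        by under eq_fun do rewrite big_nil; exact: measurable_cst.
      under eq_fun do rewrite big_cons; apply: measurable_and => //.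
      have mq : measurable_fun setT (fun y : S2 =>
          0 <= dotv (map_mx ratr (coef p).1) (phi y) + ratr (coef p).2).
        apply: measurable_fun_ler; first exact: measurable_cst.
        by apply: measurable_funD; [exact: mphi|exact: measurable_cst].
      case: (f p); first by under eq_fun do rewrite eqb_id; exact: mq.
      by under eq_fun do rewrite eqbF_neg; apply: measurable_neg; exact: mq.
    apply: ex_eq => w; congr (_ * _); rewrite /indic; congr (nat_of_bool _)%:R.
    apply/eqP/idP => [h|].
      apply/mem_set/forallP => p; move/ffunP: h => /(_ p).
      by rewrite ffunE => <-; rewrite eqxx.
    move=> /set_mem /forallP h; apply/ffunP => p; rewrite ffunE.
    exact/eqP/h.
  - move=> y.
    rewrite (_ : (fun p : 'I_N => _) = (fun p : 'I_N => [set j | hp p (y j)]%SET)).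
      exact: card_patterns.
    by apply/funext => p; apply/finset.setP => j; rewrite !inE !ffunE.
have EN_nd : nondecreasing_seq EN.
  move=> i j ij; apply/subsetPset => w /existsP[p xp]; apply/existsP.
  by exists (widen_ord ij p).
have mE : measurable (\bigcup_N EN N) by exact: bigcupT_measurable.
exists (\bigcup_N EN N); split => //.
  rewrite -lee_fin -prE//.
  have cv := nondecreasing_cvg_mu (mu := P) mEN mE EN_nd.
  rewrite -(cvg_lim _ cv)//; apply: lime_le; first by apply/cvg_ex; eexists; exact: cv.
  by apply: nearW => N /=; rewrite prE// lee_fin.
move=> w Ew a c.
have [p pP] := rational_halfspace n (fun j => X j w) a c.
rewrite ltNge; apply/negP => h; apply: Ew; exists p.+1 => //.
apply/existsP; exists ord_max; apply: (le_trans h).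
rewrite le_eqVlt /Sp; apply/orP; left; apply/eqP; congr `|_|; apply: eq_bigr => j _.
by rewrite pP//.
Qed.

End halfspace_deviation.

(** * Outer probability and small events *)

Section negligible_events.
Context {d : measure_display} {T : measurableType d} {R : realType}.
Variable P : probability T R.
Implicit Types B : nat -> set T.

(** Outer probability tending to 0, phrased with measurable covers. *)
Definition negl B := forall eps : R, 0 < eps -> \forall n \near \oo,
  exists E, [/\ measurable E, B n `<=` E & pr P E <= eps].

Lemma negl_sub B B' : (\forall n \near \oo, B n `<=` B' n) -> negl B' -> negl B.
Proof.
move=> BB' nB eps e0; near=> n.
have [E [mE BE PE]] : exists E, [/\ measurable E, B' n `<=` E & pr P E <= eps].
  by near: n; exact: nB.
by exists E; split=> //; apply: subset_trans BE; near: n.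
Unshelve. all: by end_near. Qed.

Lemma negl_setU B B' : negl B -> negl B' -> negl (fun n => B n `|` B' n).
Proof.
move=> nB nB' eps e0; have e2 : 0 < eps / 2 by lra.
near=> n.
have [E [mE BE PE]] : exists E, [/\ measurable E, B n `<=` E & pr P E <= eps / 2].
  by near: n; exact: nB.
have [E' [mE' BE' PE']] : exists E, [/\ measurable E, B' n `<=` E & pr P E <= eps / 2].
  by near: n; exact: nB'.
exists (E `|` E'); split; [exact: measurableU|exact: setUSS|].
by apply: (le_trans (pr_setU P mE mE')); lra.
Unshelve. all: by end_near. Qed.

Lemma negl_bound B (u : nat -> R) : u @ \oo --> 0 ->
  (\forall n \near \oo, exists E, [/\ measurable E, B n `<=` E & pr P E <= u n]) ->
  negl B.
Proof.
move=> u0 nB eps e0; near=> n.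
have [E [mE BE PE]] : exists E, [/\ measurable E, B n `<=` E & pr P E <= u n].
  by near: n.
exists E; split => //; apply: (le_trans PE); apply/ltW.
by near: n; exact: (cvgr_lt (0 : R) u0).
Unshelve. all: by end_near. Qed.

Lemma negl_near0 B : (\forall n \near \oo, B n = set0) -> negl B.
Proof.
move=> h eps e0; near=> n; exists set0; split => //.
  by rewrite (near h n).
by rewrite /pr measure0 ltW.
Unshelve. all: by end_near. Qed.

Lemma negl_null B : (forall n, exists E, [/\ measurable E, B n `<=` E & pr P E = 0]) ->
  negl B.
Proof.
move=> h eps e0; near=> n; have [E [mE BE PE]] := h n.
by exists E; split => //; rewrite PE ltW.
Unshelve. all: by end_near. Qed.

Lemma mu_ext_lt_cover (A : set T) (eps : R) : (mu_ext P A < eps%:E)%E ->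
  exists E, [/\ measurable E, A `<=` E & pr P E <= eps].
Proof.
rewrite /mu_ext => /ereal_inf_lt[_ [F [mF AF] <-] Fe].
exists (\bigcup_k F k); split => //; first exact: bigcupT_measurable.
rewrite -lee_fin -prE; last exact: bigcupT_measurable.
apply: le_trans (ltW Fe).
by apply: measure_sigma_subadditive => //; exact: bigcupT_measurable.
Qed.

Lemma mu_ext_le_pr (A E : set T) : measurable E -> A `<=` E ->
  (mu_ext P A <= (pr P E)%:E)%E.
Proof.
move=> mE AE; rewrite -prE// -(measurable_mu_extE P mE).
exact: le_mu_ext.
Qed.

Lemma negl_mu_ext B : (fun n => mu_ext P (B n)) @ \oo --> 0%E <-> negl B.
Proof.
split=> [h eps e0|nB].
  have : \forall n \near \oo, (mu_ext P (B n) < eps%:E)%E.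
    move/fine_cvgP: h => [hf /cvgr_lt/(_ eps e0) hl].
    near=> n; have fn : mu_ext P (B n) \is a fin_num by near: n.
    by rewrite -(fineK fn) lte_fin; near: n.
  by apply: filterS => n; exact: mu_ext_lt_cover.
have le1 n : (mu_ext P (B n) <= 1)%E.
  apply: (le_trans (mu_ext_le_pr measurableT (@subsetT _ _))).
  by rewrite pr_setT.
have fn n : mu_ext P (B n) \is a fin_num.
  rewrite ge0_fin_numE ?mu_ext_ge0//.
  by apply: (le_lt_trans (le1 n)); rewrite ltry.
apply/fine_cvgP; split; first by near=> n.
apply/cvgrPdist_le => eps e0; near=> n.
rewrite /= sub0r normrN ger0_norm; last by rewrite fine_ge0// mu_ext_ge0.
have [E [mE BE PE]] : exists E, [/\ measurable E, B n `<=` E & pr P E <= eps].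
  by near: n; exact: nB.
rewrite -lee_fin fineK//; apply: (le_trans (mu_ext_le_pr mE BE)).
by rewrite lee_fin.
Unshelve. all: by end_near. Qed.

Lemma op_starP (V : normedModType R) (X : nat -> T -> V) r :
  op_star P X r <->
  forall eps : R, 0 < eps -> negl (fun n => [set w | eps * r n < `|X n w|]).
Proof. by split=> h eps e0; apply/negl_mu_ext; exact: h. Qed.

Lemma Op_star_negl (V : normedModType R) (X : nat -> T -> V) r (L : nat -> R) :
  (forall n, 0 <= r n) -> L @ \oo --> +oo ->
  Op_star P X r -> negl (fun n => [set w | L n * r n < `|X n w|]).
Proof.
move=> r0 Ly OX eps e0; have e2 : 0 < eps / 2 by lra.
have [K hK] := OX _ e2.
near=> n; apply: mu_ext_lt_cover.
apply: (@le_lt_trans _ _ (eps / 2)%:E); last by rewrite lte_fin; lra.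
have h1 : (mu_ext P [set w | (K * r n < `|X n w|)%R] <= (eps / 2)%:E)%E.
  by near: n; exact: hK.
apply: le_trans h1.
apply: le_mu_ext => w /=; apply: le_lt_trans.
rewrite ler_wpM2r//; near: n; by move/cvgryPge : Ly => /(_ K).
Unshelve. all: by end_near. Qed.

End negligible_events.

Lemma cvg_invr_pinfty (R : realType) (L : nat -> R) (c : R) (v : nat -> R) :
  L @ \oo --> +oo -> (\forall n \near \oo, 0 <= v n <= c / L n) -> v @ \oo --> 0.
Proof.
move=> Ly vL; apply/cvgrPdist_le => eps e0; near=> n.
have /andP[v0 vc] : 0 <= v n <= c / L n by near: n.
have Ln : 1 + `|c| / eps <= L n by near: n; move/cvgryPge : Ly; exact.
have L0 : 0 < L n.
  by apply: lt_le_trans Ln; rewrite ltr_wpDr// divr_ge0// ltW.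
rewrite sub0r normrN ger0_norm//; apply: (le_trans vc).
rewrite ler_pdivrMr//; apply: (le_trans (ler_norm c)).
rewrite -ler_pdivrMl// mulrC; apply: le_trans Ln.
by rewrite lerDr.
Unshelve. all: by end_near. Qed.

(** A small power of n: slow against every power of n^-1/2 that occurs, fast
    enough that exp(-L) beats polynomial covering numbers. *)
Lemma exists_slow_sequence (R : realType) (d M : nat) : exists L : nat -> R,
  [/\ forall n, (0 < n)%N -> 1 <= L n, L @ \oo --> +oo,
      (fun n => (1 + L n ^+ 2) ^+ d.+1 / Num.sqrt n%:R) @ \oo --> 0 &
      (fun n => (n.+1%:R) ^+ M * expR (- L n)) @ \oo --> 0].
Proof.
pose q := (8 * d.+1)%N.
have q0 : q%:R != 0 :> R by rewrite pnatr_eq0.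
have qi0 : 0 <= (q%:R^-1 : R) by rewrite invr_ge0.
pose L n : R := n%:R `^ (q%:R^-1).
have Lq n : L n ^+ q = n%:R.
  by rewrite -powR_mulrn ?powR_ge0// /L -powRrM mulVf// powRr1.
have L1 n : (0 < n)%N -> 1 <= L n.
  move=> n0; have -> : 1 = 1 `^ q%:R^-1 :> R by rewrite powR1.
  by apply: ge0_ler_powR; rewrite // ?nnegrE// ler1n.
have Ly : L @ \oo --> +oo.
  apply/cvgryPge => A; near=> n.
  have An : (Num.max A 0) ^+ q <= n%:R by near: n; exact: nbhs_infty_ger.
  have mA : 0 <= Num.max A 0 by rewrite le_max lexx orbT.
  apply: (@le_trans _ _ (Num.max A 0)); first by rewrite le_max lexx.
  rewrite /L -[leLHS]powRr1// -[in leLHS](divff q0) powRrM powR_mulrn//.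
  by apply: ge0_ler_powR => //; rewrite nnegrE// exprn_ge0.
exists L; split => //.
  apply: (cvg_invr_pinfty (c := 2 ^+ d.+1) Ly); near=> n.
  have n0 : (0 < n)%N by near: n; exact: nbhs_infty_gt.
  have L1n := L1 _ n0; have L0 : 0 < L n by lra.
  have sq : Num.sqrt n%:R = (L n ^+ 4) ^+ d.+1.
    rewrite -Lq (_ : L n ^+ q = ((L n ^+ 4) ^+ d.+1) ^+ 2).
      by rewrite sqrtr_sqr ger0_norm// !exprn_ge0// ltW.
    by rewrite -!exprM; congr (_ ^+ _); rewrite /q; lia.
  rewrite sq; apply/andP; split.
    by rewrite divr_ge0// exprn_ge0 ?addr_ge0 ?exprn_ge0// ltW.
  rewrite ler_pdivrMr ?exprn_gt0// -mulrA.
  apply: (@le_trans _ _ ((2 * L n ^+ 2) ^+ d.+1)).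
    rewrite lerXn2r ?nnegrE ?addr_ge0 ?mulr_ge0 ?sqr_ge0// ?(ltW L0)//.
    have : 1 <= L n ^+ 2 by rewrite exprn_ege1.
    lra.
  rewrite exprMn ler_wpM2l ?exprn_ge0//.
  rewrite ler_pdivlMl// -!exprM -exprS ler_weXn2l//; lia.
apply: (cvg_invr_pinfty (c := 2 ^+ M * (q * M).+1`!%:R) Ly); near=> n.
have n0 : (0 < n)%N by near: n; exact: nbhs_infty_gt.
have L1n := L1 _ n0; have L0 : 0 < L n by lra.
rewrite mulr_ge0 ?exprn_ge0 ?expR_ge0//=.
have h1 : n.+1%:R <= 2 * L n ^+ q.
  by rewrite Lq -natrM ler_nat; lia.
have h2 : expR (- L n) <= (q * M).+1`!%:R / L n ^+ (q * M).+1.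
  rewrite expRN -[leRHS]invrK lef_pV2 ?posrE ?expR_gt0//; last first.
    by rewrite invr_gt0 divr_gt0 ?ltr0n ?fact_gt0 ?exprn_gt0.
  rewrite invf_div; apply: le_trans (expR_ge1Dxn (q * M) (ltW L0)).
  by rewrite lerDr.
apply: (@le_trans _ _ ((2 * L n ^+ q) ^+ M * ((q * M).+1`!%:R / L n ^+ (q * M).+1))).
  by apply: ler_pM; rewrite ?exprn_ge0 ?expR_ge0// lerXn2r ?nnegrE// mulr_ge0// exprn_ge0// ltW.
rewrite exprMn -exprM exprS le_eqVlt; apply/orP; left; apply/eqP.
have : L n ^+ (q * M) != 0 by rewrite expf_neq0// gt_eqF.
have : L n != 0 by rewrite gt_eqF.
move: (L n ^+ (q * M)) => x Ln0 x0; field.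
by rewrite Ln0 x0.
Unshelve. all: by end_near. Qed.

(** * Equicontinuity of the rank process *)

Ltac nonneg := first [assumption | match goal with
  | H : is_true (0 < ?x) |- is_true (0 <= ?x) => exact: (ltW H)
  | |- is_true (0 <= ?x) => lazymatch x with
     | (_ * _)%R => apply: mulr_ge0; nonneg
     | (_ ^+ _)%R => apply: exprn_ge0; nonneg
     | (_ ^-1)%R => rewrite invr_ge0; nonneg
     | (_ %:R)%R => exact: ler0n
     | (_ + _)%R => apply: addr_ge0; nonneg
     | _ => first [exact: ler01 | exact: normr_ge0 | done]
     end
  end].

Lemma sqr_le_sqr_norm (R : realDomainType) (x y : R) : `|x| <= y -> x ^+ 2 <= y ^+ 2.
Proof.
by move=> xy; rewrite -[leLHS](real_normK (num_real x)) lerXn2r ?nnegrE// (le_trans _ xy).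
Qed.

Lemma pr_bigcup_fin d (T : measurableType d) (R : realType) (P : probability T R)
    (I : finType) (A : I -> set T) : (forall i, measurable (A i)) ->
  measurable (\bigcup_(i in [set: I]) A i) /\
  pr P (\bigcup_(i in [set: I]) A i) <= \sum_i pr P (A i).
Proof.
move=> mA; have mU : measurable (\bigcup_(i in [set: I]) A i).
  by apply: fin_bigcup_measurable => //; exact: finite_finset.
split=> //; rewrite -ex_indic//.
under eq_bigr do rewrite -ex_indic//.
rewrite -ex_sum; last by move=> i; exact: bmfun_indic.
apply: le_ex; first exact: bmfun_indic.
  by apply: bmfun_sum => i; exact: bmfun_indic.
move=> w; have pos i : 0 <= \1_(A i) w :> R by rewrite /indic.
rewrite {1}/indic; have [/set_mem[i _ Aiw]|_]/= := boolP (w \in _); last exact: sumr_ge0.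
rewrite (bigD1 i)//= {1}/indic (mem_set Aiw)/= lerDl.
exact: sumr_ge0.
Qed.

Lemma offdiag_sum_deviation d (T : measurableType d) (R : realType) (P : probability T R)
    ds (S : measurableType ds) (X : nat -> T -> S) (k : S * S -> R) (n : nat) (x v : R) :
  iid P X -> bmfun k -> (0 < n)%N -> 0 < x -> ex2 P X (fun z => k z ^+ 2) <= v ->
  let A := [set w | x <= `|n%:R ^- 2 * offdiag_sum X k n w - (1 - n%:R^-1) * ex2 P X k|] in
  measurable A /\ pr P A <= 4 * v / (n%:R * x ^+ 2).
Proof.
move=> iidX bk n0 x0 kv A.
have n0R : 0 < n%:R :> R by rewrite ltr0n.
have nn : (n * n.-1)%:R = n%:R ^+ 2 * (1 - n%:R^-1) :> R.
  rewrite natrM; case: n n0 n0R {A} => // n _ n0R; rewrite -[n.+1.-1]/n.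
  have -> : n%:R = n.+1%:R - 1 :> R by rewrite -natr1 addrK.
  by field; rewrite gt_eqF.
have bo := bmfun_offdiag_sum iidX n bk.
set g := fun w => n%:R ^- 2 * offdiag_sum X k n w - (1 - n%:R^-1) * ex2 P X k.
have bg : bmfun g by apply: bmfunB; [exact: bmfunZ|exact: bmfun_cst].
split.
  apply: measurable_set_bool; apply: measurable_fun_ler; first exact: measurable_cst.
  by apply: measurableT_comp => //; exact: bmfun_measurable.
apply: (le_trans (chebyshev_bmfun P bg x0)).
have gE w : g w ^+ 2 = n%:R ^- 4 * (offdiag_sum X k n w - (n * n.-1)%:R * ex2 P X k) ^+ 2.
  by rewrite /g nn; field; rewrite gt_eqF.
under ex_eq do rewrite gE.
rewrite exZ; last by apply: bmfunX; apply: bmfunB => //; exact: bmfun_cst.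
rewrite ler_pdivrMr ?exprn_gt0//.
have -> : 4 * v / (n%:R * x ^+ 2) * x ^+ 2 = n%:R ^- 4 * (4 * n%:R ^+ 3 * v).
  by field; rewrite !gt_eqF.
rewrite ler_wpM2l ?invr_ge0 ?exprn_ge0 ?(ltW n0R)//.
apply: (le_trans (ex_sqr_offdiag_sum iidX n bk)).
by rewrite ler_wpM2l// mulr_ge0// exprn_ge0// ltW.
Qed.

(* Linear arithmetic of the error budget in the equicontinuity proof below. *)
Lemma rank_budget1 (R : realFieldType) (M e s : R) : 16 * M <= s * e -> 2 * M <= e / 8 * s.
Proof. lra. Qed.

Lemma rank_budget2 (R : realFieldType) (t : R) : 0 <= t ->
  2 * (t / 8) + t / 8 + t / 8 + t / 8 <= t.
Proof. lra. Qed.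

Lemma rank_decomposition (R : realFieldType) d (x x0 xv u u0 uv : 'rV[R]_d) (i : R) :
  x - x0 - (u - u0) =
  (x - xv) - (u - uv) + (xv - x0 - (1 - i) *: (uv - u0)) - i *: (uv - u0).
Proof. by apply/rowP => l; rewrite !mxE; ring. Qed.

Section rank_process.
Context {dT : measure_display} {T : measurableType dT} {R : realType}.
Variable P : probability T R.
Context {ds : measure_display} {S : measurableType ds}.
Variable X : nat -> T -> S.
Hypothesis iidX : iid P X.
Let mX := iid_measurable iidX.
Context {d : nat}.
Variables (y : S -> R) (z : S -> 'rV[R]_d) (Kz : R).
Hypotheses (my : measurable_fun setT y)
  (mz : forall k, measurable_fun setT (fun s => z s 0 k))
  (zK : forall s, `|z s| <= Kz).

Let Kz0 : 0 <= Kz.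
Proof. exact: le_trans (zK point). Qed.

Definition rs (theta : 'rV[R]_d) (s : S) : R := y s - dotv theta (z s).

Lemma measurable_dotv_z theta : measurable_fun setT (fun s => dotv theta (z s)).
Proof.
under eq_fun do rewrite dotvE.
apply: measurable_sum => k; apply: measurable_funM => //; exact: measurable_cst.
Qed.

Lemma measurable_rs theta : measurable_fun setT (rs theta).
Proof. by apply: measurable_funB => //; exact: measurable_dotv_z. Qed.

Definition rank_le theta (p : S * S) : bool := rs theta p.1 <= rs theta p.2.

Lemma bmfun_rank_le theta : bmfun (fun p => (rank_le theta p)%:R : R).
Proof.
apply: bmfun_bool; apply: measurable_fun_ler.
  by apply: measurableT_comp; [exact: measurable_rs|exact: measurable_fst].
by apply: measurableT_comp; [exact: measurable_rs|exact: measurable_snd].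
Qed.

Lemma bmfun_z k : bmfun (fun s => z s 0 k).
Proof. by split=> //; exists Kz => s; exact: le_trans (norm_coord_le _ _) (zK s). Qed.

Definition rank_kernel (a b : S -> R) theta l (p : S * S) : R :=
  a p.1 * b p.2 * (rank_le theta p)%:R * (z p.1 0 l - z p.2 0 l).

Lemma bmfun_fst (a : S -> R) : bmfun a -> bmfun (fun p : S * S => a p.1).
Proof. by move=> ba; apply: bmfun_comp ba; exact: measurable_fst. Qed.

Lemma bmfun_snd (a : S -> R) : bmfun a -> bmfun (fun p : S * S => a p.2).
Proof. by move=> ba; apply: bmfun_comp ba; exact: measurable_snd. Qed.

Lemma bmfun_rank_kernel a b theta l : bmfun a -> bmfun b ->
  bmfun (rank_kernel a b theta l).
Proof.
move=> ba bb; apply: bmfunM; last first.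
  by apply: bmfunB; [exact: (bmfun_fst (bmfun_z l))|exact: (bmfun_snd (bmfun_z l))].
apply: bmfunM; last exact: bmfun_rank_le.
by apply: bmfunM; [exact: bmfun_fst|exact: bmfun_snd].
Qed.

Definition rank_stat a b n theta (w : T) : 'rV[R]_d :=
  \row_l (n%:R ^- 2 * offdiag_sum X (rank_kernel a b theta l) n w).

Definition rank_mean a b theta : 'rV[R]_d := \row_l ex2 P X (rank_kernel a b theta l).

Variable C : R.
Hypothesis C0 : 0 <= C.
Hypothesis anticoncentration : forall theta t h, 0 <= h ->
  pr P [set w | t <= rs theta (X 0%N w) <= t + h] <= C * h.

(** The comparison of two residuals can change with theta only on near ties. *)
Definition near_tie theta h (p : S * S) : bool := `|rs theta p.2 - rs theta p.1| <= h.

Lemma bmfun_near_tie theta h : bmfun (fun p => (near_tie theta h p)%:R : R).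
Proof.
apply: bmfun_bool; apply: measurable_fun_ler; last exact: measurable_cst.
apply: measurableT_comp => //; apply: measurable_funB.
  by apply: measurableT_comp; [exact: measurable_rs|exact: measurable_snd].
by apply: measurableT_comp; [exact: measurable_rs|exact: measurable_fst].
Qed.

Let bmfun_section2 (f : S * S -> R) : bmfun f ->
  bmfun (fun w => \int[P]_w' f (X 0%N w, X 0%N w')).
Proof.
move=> bf; exact: (@bmfun_comp _ _ _ _ _ (fun x => \int[P]_w' f (x, X 0%N w')) _
  (mX 0%N) (bmfun_section P (mX 0%N) (mX 0%N) bf)).
Qed.

Let bmfun_pair1 (f : S * S -> R) s : bmfun f -> bmfun (fun w => f (s, X 0%N w)).
Proof.
move=> bf; apply: (@bmfun_comp _ _ _ _ _ (fun s' => f (s, s')) _ (mX 0%N)).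
by apply: bmfun_comp bf; exact: pair1_measurable.
Qed.

Lemma le_ex2 (f g : S * S -> R) : bmfun f -> bmfun g -> (forall p, f p <= g p) ->
  ex2 P X f <= ex2 P X g.
Proof.
move=> bf bg fg; rewrite /ex2; apply: le_ex; [exact: bmfun_section2|exact: bmfun_section2|].
by move=> w; apply: le_ex => //; exact: bmfun_pair1.
Qed.

Lemma ex2Z c (f : S * S -> R) : bmfun f -> ex2 P X (fun p => c * f p) = c * ex2 P X f.
Proof.
move=> bf; rewrite /ex2 -exZ; last exact: bmfun_section2.
by apply: ex_eq => w; rewrite exZ//; exact: bmfun_pair1.
Qed.

Lemma ex2D (f g : S * S -> R) : bmfun f -> bmfun g ->
  ex2 P X (fun p => f p + g p) = ex2 P X f + ex2 P X g.
Proof.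
move=> bf bg; rewrite /ex2 -exD; [|exact: bmfun_section2|exact: bmfun_section2].
by apply: ex_eq => w; rewrite exD//; exact: bmfun_pair1.
Qed.

Lemma ex2B (f g : S * S -> R) : bmfun f -> bmfun g ->
  ex2 P X (fun p => f p - g p) = ex2 P X f - ex2 P X g.
Proof.
move=> bf bg; rewrite /ex2 -exB; [|exact: bmfun_section2|exact: bmfun_section2].
by apply: ex_eq => w; rewrite exB//; exact: bmfun_pair1.
Qed.

Lemma norm_ex2_le (f g : S * S -> R) : bmfun f -> bmfun g -> (forall p, `|f p| <= g p) ->
  `|ex2 P X f| <= ex2 P X g.
Proof.
move=> bf bg fg; rewrite ler_norml; apply/andP; split.
  rewrite lerNl -mulN1r -ex2Z//; apply: le_ex2 => //; first exact: bmfunZ.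
  by move=> p; rewrite mulN1r (le_trans (ler_norm _))// normrN.
by apply: le_ex2 => // p; exact: le_trans (ler_norm _) (fg p).
Qed.

Lemma ex2_near_tie theta h : 0 <= h ->
  ex2 P X (fun p => (near_tie theta h p)%:R) <= 2 * C * h.
Proof.
move=> h0; rewrite /ex2 -[leRHS](ex_cst P); apply: le_ex.
- exact: (bmfun_section2 (bmfun_near_tie theta h)).
- exact: bmfun_cst.
move=> w; set t := rs theta (X 0%N w).
rewrite (_ : 2 * C * h = C * (2 * h)); last by ring.
apply: le_trans (anticoncentration theta (t - h) (_ : 0 <= 2 * h)); last by lra.
rewrite -ex_bool; last first.
  by apply: measurable_and; apply: measurable_fun_ler; (try exact: measurable_cst);
    exact: measurableT_comp (measurable_rs theta) (mX 0%N).
apply: le_of_eq; apply: ex_eq => w'.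
congr (nat_of_bool _)%:R; rewrite /near_tie/= -/t ler_norml.
apply/andP/andP => -[h1 h2]; split; lra.
Qed.

Lemma rs_lipschitz th th' s s' :
  `|(rs th s' - rs th s) - (rs th' s' - rs th' s)| <= 2 * d%:R * Kz * `|th - th'|.
Proof.
have -> : (rs th s' - rs th s) - (rs th' s' - rs th' s) = dotv (th - th') (z s - z s').
  by rewrite /rs dotvBl !dotvBr; ring.
apply: (le_trans (norm_dotv_le _ _)).
rewrite (_ : 2 * d%:R * Kz * `|th - th'| = d%:R * `|th - th'| * (2 * Kz)); last by ring.
rewrite ler_wpM2l ?mulr_ge0//.
apply: (le_trans (ler_normB _ _)).
have := zK s; have := zK s'; lra.
Qed.

Variables (a b : S -> R) (Ka Kb : R).
Hypotheses (ba : bmfun a) (bb : bmfun b).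
Hypotheses (aK : forall s, `|a s| <= Ka) (bK : forall s, `|b s| <= Kb).

Let Ka0 : 0 <= Ka. Proof. exact: le_trans (aK point). Qed.
Let Kb0 : 0 <= Kb. Proof. exact: le_trans (bK point). Qed.
Let M : R := Ka * Kb * (2 * Kz).
Let c : R := 2 * d%:R * Kz.
Let M0 : 0 <= M. Proof. by rewrite !mulr_ge0. Qed.
Let c0 : 0 <= c. Proof. by rewrite !mulr_ge0. Qed.

Let zdiff l p : `|z p.1 0 l - z p.2 0 l| <= 2 * Kz.
Proof.
apply: (le_trans (ler_normB _ _)).
have := le_trans (norm_coord_le (z p.1) l) (zK p.1).
have := le_trans (norm_coord_le (z p.2) l) (zK p.2); lra.
Qed.

Lemma norm_rank_kernel_le th l p : `|rank_kernel a b th l p| <= M.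
Proof.
rewrite /rank_kernel !normrM; apply: ler_pM => //.
rewrite -[leRHS]mulr1; apply: ler_pM => //; first by apply: ler_pM.
by case: (rank_le _ _); rewrite ?normr1 ?normr0.
Qed.

Lemma rank_kernel_osc th th' h l p : c * `|th - th'| <= h ->
  `|rank_kernel a b th l p - rank_kernel a b th' l p| <= M * (near_tie th' h p)%:R.
Proof.
move=> ch; rewrite /rank_kernel -mulrBl -mulrBr.
have [|nt] := boolP (near_tie th' h p).
  move=> _; rewrite mulr1 !normrM; apply: ler_pM => //.
  rewrite -[leRHS]mulr1; apply: ler_pM => //; first by apply: ler_pM.
  by do 2 case: (rank_le _ _); rewrite ?subrr ?subr0 ?sub0r ?normrN ?normr0 ?normr1.
suff -> : rank_le th p = rank_le th' p by rewrite subrr mulr0 mul0r normr0 mulr0.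
have := le_trans (rs_lipschitz th th' p.1 p.2) ch; rewrite ler_norml => /andP[h1 h2].
move: nt; rewrite /near_tie -ltNge ltr_normr => /orP[] h3; rewrite /rank_le.
  by apply/idP/idP => _; lra.
by apply/idP/idP => h4; exfalso; lra.
Qed.

Let bmker th l : bmfun (rank_kernel a b th l). Proof. exact: bmfun_rank_kernel. Qed.

Lemma rank_stat_osc th th' h n w : c * `|th - th'| <= h ->
  `|rank_stat a b n th w - rank_stat a b n th' w| <=
    M * (n%:R ^- 2 * offdiag_sum X (fun p => (near_tie th' h p)%:R) n w).
Proof.
move=> ch; have nn : 0 <= n%:R ^- 2 :> R by rewrite invr_ge0 exprn_ge0.
have o0 : 0 <= offdiag_sum X (fun p => (near_tie th' h p)%:R : R) n w by apply: sumr_ge0.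
apply: norm_row_le; first by rewrite !mulr_ge0.
move=> l; rewrite !mxE -mulrBr normrM (ger0_norm nn) mulrCA ler_wpM2l//.
rewrite /offdiag_sum -sumrB mulr_sumr; apply: (le_trans (ler_norm_sum _ _ _)).
by apply: ler_sum => p _; exact: rank_kernel_osc.
Qed.

Lemma rank_mean_osc th th' : `|rank_mean a b th - rank_mean a b th'| <=
  M * (2 * C * (c * `|th - th'|)).
Proof.
have h0 : 0 <= c * `|th - th'| by rewrite mulr_ge0.
apply: norm_row_le; first by rewrite !mulr_ge0.
move=> l; rewrite !mxE -ex2B//.
have bn := bmfun_near_tie th' (c * `|th - th'|).
apply: (@le_trans _ _ (ex2 P X (fun p => M * (near_tie th' (c * `|th - th'|) p)%:R))).
  apply: norm_ex2_le; [exact: bmfunB|exact: bmfunZ|].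
  by move=> p; exact: rank_kernel_osc.
by rewrite ex2Z// ler_wpM2l// ex2_near_tie.
Qed.

Lemma norm_rank_mean_le th : `|rank_mean a b th| <= M.
Proof.
apply: norm_row_le => // l; rewrite mxE.
apply: (@le_trans _ _ (ex2 P X (fun=> M))).
  by apply: norm_ex2_le => //; [exact: bmfun_cst|move=> p; exact: norm_rank_kernel_le].
by rewrite /ex2 !ex_cst.
Qed.

Let ex2_sqr_diff th th' l :
  ex2 P X (fun p => (rank_kernel a b th l p - rank_kernel a b th' l p) ^+ 2) <=
  M ^+ 2 * (2 * C * (c * `|th - th'|)).
Proof.
have h0 : 0 <= c * `|th - th'| by rewrite mulr_ge0.
have bn := bmfun_near_tie th' (c * `|th - th'|).
apply: (@le_trans _ _ (ex2 P X (fun p => M ^+ 2 * (near_tie th' (c * `|th - th'|) p)%:R))).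
  apply: le_ex2; [by apply: bmfunX; exact: bmfunB|exact: bmfunZ|].
  move=> p; have := sqr_le_sqr_norm (rank_kernel_osc (th := th) (th' := th') l p (lexx _)).
  by rewrite exprMn; case: (near_tie _ _ _); rewrite ?expr1n// expr0n.
by rewrite ex2Z// ler_wpM2l ?exprn_ge0// ex2_near_tie.
Qed.

(** Chaining in one step: a net of mesh n^-1/2, Chebyshev at its points, and
    counting near ties between them. The variance of a kernel increment is
    bounded by the probability of a near tie, hence the factor r. *)
Lemma rank_stat_equicontinuity (th0 : 'rV[R]_d) (eps : R) : 0 < eps ->
  exists A n0, 0 <= A /\ forall n (r : R), (n0 <= n)%N -> 0 <= r ->
    exists E, [/\ measurable E,
      pr P E <= A * ((1 + r * Num.sqrt n%:R) ^+ d * (r + (Num.sqrt n%:R)^-1)) &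
      forall w, ~ E w -> forall th, `|th - th0| <= r ->
        `|rank_stat a b n th w - rank_stat a b n th0 w -
          (rank_mean a b th - rank_mean a b th0)| <= eps / Num.sqrt n%:R].
Proof.
move=> e0.
pose dl : R := eps / (8 * (2 * M * C * c + 1)).
have MC0 : 0 <= M * C * c by rewrite !mulr_ge0.
have dl0 : 0 < dl by rewrite divr_gt0// mulr_gt0//; lra.
have dlE : M * (2 * C * (c * dl)) <= eps / 8.
  rewrite (_ : eps / 8 = dl * (2 * M * C * c + 1)); last first.
    by rewrite /dl; field; rewrite gt_eqF//; lra.
  rewrite (_ : M * _ = dl * (2 * M * C * c)); last by ring.
  by rewrite ler_wpM2l// ?ltW//; lra.
pose A1 : R := 2 / dl + 3.
have A10 : 0 <= A1 by rewrite addr_ge0// divr_ge0// ltW.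
pose A2 : R := d%:R * (256 * (M ^+ 2 * (2 * C * c)) / eps ^+ 2) * (1 + dl) +
               256 * (2 * C * c * dl) * (M + 1) ^+ 2 / eps ^+ 2.
have A20 : 0 <= A2.
  by rewrite /A2; nonneg.
exists (A1 ^+ d * A2), (Num.truncn ((16 * M / eps) ^+ 2)).+1.
split; first by rewrite mulr_ge0 ?exprn_ge0.
move=> n r n0n r0.
have n0 : (0 < n)%N by exact: leq_trans n0n.
set sn := Num.sqrt n%:R.
have sn0 : 0 < sn by rewrite sqrtr_gt0 ltr0n.
have sn2 : sn ^+ 2 = n%:R by rewrite sqr_sqrtr.
have snM : 16 * M / eps <= sn.
  have q0 : 0 <= 16 * M / eps by rewrite divr_ge0 ?mulr_ge0// ltW.
  rewrite -[leLHS](ger0_norm q0) -sqrtr_sqr ler_wsqrtr//.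
  apply: ltW; apply: lt_le_trans (_ : (Num.truncn ((16 * M / eps) ^+ 2)).+1%:R <= _); last by rewrite ler_nat.
  by apply: truncnS_gt.
pose mesh := dl / sn.
have mesh0 : 0 < mesh by rewrite divr_gt0.
pose q := (Num.truncn (r / mesh)).+1.
have qr : r / mesh <= q%:R by apply: ltW; apply: truncnS_gt.
have qub : q%:R <= r / mesh + 1.
  by rewrite -natr1 lerD2r truncn_le// divr_ge0// ltW.
pose I := {ffun 'I_d -> 'I_(2 * q).+1}.
pose thg (v : I) : 'rV[R]_d := th0 + \row_k (mesh * ((v k)%:R - q%:R)).
have thg_near v : `|thg v - th0| <= r + mesh.
  apply: norm_row_le; first by rewrite addr_ge0// ltW.
  move=> k; rewrite /thg !mxE addrAC subrr add0r normrM gtr0_norm//.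
  apply: (@le_trans _ _ (mesh * q%:R)).
    rewrite ler_wpM2l ?(ltW mesh0)// ler_norml.
    have := ltn_ord (v k); rewrite ltnS -(ler_nat R) natrM => vq.
    have : 0 <= (v k)%:R :> R by []. lra.
  apply: (le_trans (ler_wpM2l (ltW mesh0) qub)).
  by rewrite mulrDr mulr1 mulrCA divff ?mulr1 ?gt_eqF.
have cover th : `|th - th0| <= r -> exists v, `|th - thg v| <= mesh.
  move=> thr.
  pose x k := (th 0 k - th0 0 k) / mesh + q%:R.
  have xb k : 0 <= x k <= (2 * q)%:R.
    have : `|(th - th0) 0 k| <= r by exact: le_trans (norm_coord_le _ _) thr.
    rewrite !mxE => hk; have : `|(th 0 k - th0 0 k) / mesh| <= q%:R.
      rewrite normrM normfV (gtr0_norm mesh0); apply: le_trans qr.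
      by rewrite ler_wpM2r// invr_ge0 ltW.
    rewrite ler_norml natrM /x; lra.
  have xt k : (Num.truncn (x k) < (2 * q).+1)%N.
    have /andP[x0 xq] := xb k.
    by rewrite ltnS -(ler_nat R); apply: le_trans xq; rewrite truncn_le.
  exists [ffun k => Ordinal (xt k)].
  apply: norm_row_le; first exact: ltW.
  move=> k; rewrite /thg !mxE ffunE/=.
  have -> : th 0 k - (th0 0 k + mesh * ((Num.truncn (x k))%:R - q%:R)) =
      mesh * (x k - (Num.truncn (x k))%:R).
    by rewrite /x; field; rewrite gt_eqF.
  rewrite normrM gtr0_norm// -[leRHS]mulr1 ler_wpM2l ?(ltW mesh0)//.
  have /andP[x0 xq] := xb k.
  have h1 : (Num.truncn (x k))%:R <= x k by rewrite truncn_le.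
  have h2 : x k < (Num.truncn (x k)).+1%:R by apply: truncnS_gt.
  by rewrite ger0_norm ?subr_ge0//; rewrite -natr1 in h2; lra.
pose kd v l p := rank_kernel a b (thg v) l p - rank_kernel a b th0 l p.
have bkd v l : bmfun (kd v l) by exact: bmfunB.
pose x1 := eps / (8 * sn).
have x10 : 0 < x1 by rewrite divr_gt0// mulr_gt0.
pose x2 := eps / (8 * (M + 1) * sn).
have M1 : 0 < M + 1 by rewrite ltr_wpDl.
have x20 : 0 < x2 by rewrite divr_gt0// !mulr_gt0.
pose h := c * mesh.
have h0 : 0 <= h by rewrite mulr_ge0// ltW.
pose E1 (v : I) l := [set w | x1 <= `|n%:R ^- 2 * offdiag_sum X (kd v l) n w -
  (1 - n%:R^-1) * ex2 P X (kd v l)|].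
pose nt v := fun p => (near_tie (thg v) h p)%:R : R.
pose E2 (v : I) := [set w | x2 <= `|n%:R ^- 2 * offdiag_sum X (nt v) n w -
  (1 - n%:R^-1) * ex2 P X (nt v)|].
have v1P v l : ex2 P X (fun p => kd v l p ^+ 2) <= M ^+ 2 * (2 * C * (c * (r + mesh))).
  apply: (le_trans (ex2_sqr_diff _ _ _)).
  by rewrite ler_wpM2l ?exprn_ge0// ler_wpM2l ?mulr_ge0// ler_wpM2l.
have v2P v : ex2 P X (fun p => nt v p ^+ 2) <= 2 * C * h.
  rewrite (_ : (fun p => nt v p ^+ 2) = nt v); first exact: ex2_near_tie.
  by apply/funext => p; rewrite /nt; case: (near_tie _ _ _); rewrite ?expr1n// expr0n.
have E1P v l := offdiag_sum_deviation iidX (bkd v l) n0 x10 (v1P v l).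
have bnt v : bmfun (nt v) := bmfun_near_tie (thg v) h.
have E2P v := offdiag_sum_deviation iidX (bnt v) n0 x20 (v2P v).
pose B1 : R := 4 * (M ^+ 2 * (2 * C * (c * (r + mesh)))) / (n%:R * x1 ^+ 2).
have [mE1v PE1v] : (forall v, measurable (\bigcup_(l in [set: 'I_d]) E1 v l)) /\
    forall v, pr P (\bigcup_(l in [set: 'I_d]) E1 v l) <= d%:R * B1.
  split=> v; have [m1 p1] := pr_bigcup_fin P (fun l => (E1P v l).1); first exact: m1.
  apply: (le_trans p1); rewrite mulr_natl -[in leRHS](card_ord d) -sumr_const.
  by apply: ler_sum => l _; exact: (E1P v l).2.
have mF v : measurable ((\bigcup_(l in [set: 'I_d]) E1 v l) `|` E2 v).
  by apply: measurableU => //; exact: (E2P v).1.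
have [mE PE] := pr_bigcup_fin P mF.
exists (\bigcup_(v in [set: I]) ((\bigcup_(l in [set: 'I_d]) E1 v l) `|` E2 v)).
split => //.
  apply: (le_trans PE).
  apply: (@le_trans _ _ (\sum_(v : I) A2 * (r + sn^-1))).
    apply: ler_sum => v _; apply: (le_trans (pr_setU P (mE1v v) (E2P v).1)).
    apply: (le_trans (lerD (PE1v v) (E2P v).2)).
    rewrite /A2 [leRHS]mulrDl; apply: lerD.
      pose Q : R := 256 * (M ^+ 2 * (2 * C * c)) / eps ^+ 2.
      have Q0 : 0 <= Q by rewrite /Q; nonneg.
      have -> : B1 = Q * (r + dl / sn).
        by rewrite /B1 /Q -sn2 /x1 /mesh; field; rewrite !gt_eqF.
      rewrite -/Q mulrA -[leRHS]mulrA; apply: ler_wpM2l; first by nonneg.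
      have : 0 <= sn^-1 by nonneg.
      have := ltW dl0; nra.
    rewrite -sn2 /x2 /h /mesh.
    have -> : 4 * (2 * C * (c * (dl / sn))) / (sn ^+ 2 * (eps / (8 * (M + 1) * sn)) ^+ 2) =
       256 * (2 * C * c * dl) * (M + 1) ^+ 2 / eps ^+ 2 * sn^-1.
      by field; rewrite !gt_eqF.
    by apply: ler_wpM2l; [nonneg|rewrite lerDr].
  rewrite sumr_const card_ffun !card_ord -[leLHS]mulr_natl.
  have -> : A1 ^+ d * A2 * ((1 + r * sn) ^+ d * (r + sn^-1)) =
    (A1 * (1 + r * sn)) ^+ d * (A2 * (r + sn^-1)) by rewrite exprMn; ring.
  apply: ler_wpM2r; first by nonneg.
  rewrite natrX; apply: lerXn2r; rewrite ?nnegrE; [by nonneg|by nonneg|].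
  rewrite -natr1 natrM; apply: (@le_trans _ _ (2 * (r / mesh + 1) + 1)).
    by rewrite lerD2r ler_wpM2l.
  rewrite /mesh invf_div mulrA /A1.
  have dli : 0 <= dl^-1 by rewrite invr_ge0 ltW.
  have rs0 : 0 <= r * sn by rewrite mulr_ge0// ltW.
  nra.
move=> w Ew th thr.
have [v thv] := cover _ thr.
have nE1 l : `|n%:R ^- 2 * offdiag_sum X (kd v l) n w - (1 - n%:R^-1) * ex2 P X (kd v l)| < x1.
  by rewrite ltNge; apply/negP => hx; apply: Ew; exists v => //; left; exists l.
have nE2 : `|n%:R ^- 2 * offdiag_sum X (nt v) n w - (1 - n%:R^-1) * ex2 P X (nt v)| < x2.
  by rewrite ltNge; apply/negP => hx; apply: Ew; exists v => //; right.
have nR0 : 0 < n%:R :> R by rewrite ltr0n.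
have ni : 0 <= (n%:R^-1 : R) <= 1.
  by rewrite invr_ge0 ler0n/= invf_le1// ler1n.
have Me8 : M * (2 * C * h) <= eps / 8 / sn.
  rewrite /h /mesh (_ : M * _ = M * (2 * C * (c * dl)) / sn); last by ring.
  by rewrite ler_wpM2r// invr_ge0 ltW.
have hch : c * `|th - thg v| <= h by rewrite ler_wpM2l.
have P1 : `|rank_stat a b n th w - rank_stat a b n (thg v) w| <= 2 * (eps / 8 / sn).
  apply: (le_trans (rank_stat_osc n w hch)).
  have e2 : ex2 P X (nt v) <= 2 * C * h by exact: ex2_near_tie.
  have e20 : 0 <= ex2 P X (nt v) by apply: ex2_ge0.
  have q1 : n%:R ^- 2 * offdiag_sum X (nt v) n w <= 2 * C * h + x2.
    move: nE2; rewrite ltr_norml => /andP[_ h2].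
    have : (1 - n%:R^-1) * ex2 P X (nt v) <= ex2 P X (nt v).
      by rewrite ler_piMl//; case/andP: ni; lra.
    lra.
  apply: (le_trans (ler_wpM2l M0 q1)); rewrite mulrDr.
  have : M * x2 <= eps / 8 / sn.
    rewrite (_ : M * x2 = eps / 8 / sn * (M / (M + 1))); last first.
      by rewrite /x2; field; rewrite !gt_eqF.
    rewrite ler_piMr ?divr_ge0 ?(ltW e0) ?(ltW sn0)//.
    by rewrite ler_pdivrMr// mul1r lerDl.
  lra.
have P2 : `|rank_mean a b th - rank_mean a b (thg v)| <= eps / 8 / sn.
  apply: (le_trans (rank_mean_osc _ _)); apply: le_trans Me8.
  by rewrite ler_wpM2l// ler_wpM2l// mulr_ge0.
have P3 : `|rank_stat a b n (thg v) w - rank_stat a b n th0 w -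
    (1 - n%:R^-1) *: (rank_mean a b (thg v) - rank_mean a b th0)| <= eps / 8 / sn.
  apply: norm_row_le; first by rewrite !divr_ge0// ltW.
  move=> l; rewrite !mxE -mulrBr -ex2B//.
  have -> : eps / 8 / sn = x1 by rewrite /x1 invfM mulrA.
  apply: ltW; apply: le_lt_trans (nE1 l); apply: le_of_eq.
  by congr `|_ * _ - _|; rewrite /offdiag_sum -sumrB.
have P4 : `|n%:R^-1 *: (rank_mean a b (thg v) - rank_mean a b th0)| <= eps / 8 / sn.
  rewrite normrZ ger0_norm; last by case/andP: ni.
  apply: (@le_trans _ _ (n%:R^-1 * (2 * M))).
    apply: ler_wpM2l; first by case/andP: ni.
    apply: (le_trans (ler_normB _ _)).
    by rewrite mulr_natl mulr2n lerD// norm_rank_mean_le.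
  rewrite -sn2 (_ : eps / 8 / sn = (sn ^+ 2)^-1 * (eps / 8 * sn)); last first.
    by field; rewrite gt_eqF.
  rewrite ler_wpM2l ?invr_ge0 ?exprn_ge0 ?(ltW sn0)//.
  by apply: rank_budget1; rewrite -ler_pdivrMr.
rewrite (rank_decomposition _ _ (rank_stat a b n (thg v) w) _ _
  (rank_mean a b (thg v)) n%:R^-1).
apply: (le_trans (ler_normB _ _)).
apply: (le_trans (lerD (ler_normD _ _) P4)).
apply: (le_trans (lerD (lerD (ler_normB _ _) P3) (lexx _))).
apply: (le_trans (lerD (lerD (lerD P1 P2) (lexx _)) (lexx _))).
by rewrite (mulrAC eps 8^-1); apply: rank_budget2; rewrite divr_ge0// ltW.
Qed.

End rank_process.

(** * Removing the weights, uniformly *)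

Section conditional_zero.
Context {dT : measure_display} {T : measurableType dT} {R : realType}.
Variable P : probability T R.
Context {d2 : measure_display} {S2 : measurableType d2}.
Variables (V : T -> S2) (xi : T -> R).
Hypotheses (mV : measurable_fun setT V) (bxi : bmfun xi).
Hypothesis xi0 : forall B, measurable B -> \int[P]_w (\1_B (V w) * xi w) = 0.

(** From indicators of sets to bounded functions of the conditioning variable. *)
Lemma ex_conditional_zero (g : S2 -> R) : bmfun g -> \int[P]_w (g (V w) * xi w) = 0.
Proof.
move=> bg.
have [K K0 gK] := bmfun_bound bg; have [Kx Kx0 xK] := bmfun_bound bxi.
pose g' x := g x + K.
have g'0 x : 0 <= g' x by have := gK x; rewrite ler_norml /g' => /andP[]; lra.
have g'K x : g' x <= 2 * K by have := gK x; rewrite ler_norml /g' => /andP[]; lra.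
have bg' : bmfun g' by apply: bmfunD => //; exact: bmfun_cst.
have b1 := bmfun_comp mV bg; have b2 := bmfun_comp mV bg'.
have -> : \int[P]_w (g (V w) * xi w) = \int[P]_w (g' (V w) * xi w).
  under [RHS]ex_eq do rewrite /g' mulrDl.
  rewrite exD; [|exact: bmfunM|exact: bmfunZ].
  have := xi0 measurableT; under ex_eq do rewrite indicT mul1r.
  by move=> x0; rewrite exZ// x0 mulr0 addr0.
apply/eqP; rewrite -normr_le0; apply/ler_addgt0Pl => eps e0; rewrite addr0.
pose h := eps / (Kx + 1).
have Kx1 : 0 < Kx + 1 by lra.
have h0 : 0 < h by rewrite divr_gt0.
have hK : h * Kx <= eps.
  by rewrite /h mulrAC ler_pdivrMr// ler_wpM2l ?(ltW e0)//; lra.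
pose N := (Num.truncn (2 * K / h)).+1.
pose A (k : nat) : set S2 := [set x | (k%:R <= g' x / h) && (g' x / h < k.+1%:R)].
have mg' := bmfun_measurable bg'.
have mgh : measurable_fun setT (fun x => g' x / h).
  by apply: measurable_funM => //; exact: measurable_cst.
have mA k : measurable (A k).
  apply: measurable_set_bool; apply: measurable_and.
    by apply: measurable_fun_ler => //; exact: measurable_cst.
  by apply: measurable_fun_ltr => //; exact: measurable_cst.
pose gh x := \sum_(k < N) h * k%:R * \1_(A k) x.
have ghE x : gh x = h * (Num.truncn (g' x / h))%:R.
  have q0 : 0 <= g' x / h by rewrite divr_ge0// ltW.
  have tN : (Num.truncn (g' x / h) < N)%N.
    rewrite ltnS; apply: le_truncn; rewrite ler_wpM2r ?invr_ge0 ?(ltW h0)//.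
  rewrite /gh (bigD1 (Ordinal tN))//= big1.
    rewrite addr0 /indic mem_set ?mulr1//=; exact: truncn_itv.
  move=> k kn; rewrite /indic memNset ?mulr0//= => /truncn_def e.
  by move/negP: kn; apply; apply/eqP/val_inj.
have bgh : bmfun gh.
  by apply: bmfun_sum => k; apply: bmfunZ; exact: bmfun_indic.
have close x : `|g' x - gh x| <= h.
  have q0 : 0 <= g' x / h by rewrite divr_ge0// ltW.
  have /andP[h1 h2] := truncn_itv q0; rewrite ghE.
  move: h1 h2; rewrite -natr1 ler_pdivlMr// ltr_pdivrMr// => h1 h2.
  by rewrite ler_norml; lra.
have b3 := bmfun_comp mV bgh.
have z : \int[P]_w (gh (V w) * xi w) = 0.
  under ex_eq do rewrite /gh mulr_suml.
  rewrite ex_sum; last first.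
    move=> k; apply: bmfunM => //; apply: bmfunZ.
    by apply: (bmfun_comp mV); exact: bmfun_indic.
  apply: big1 => k _; under ex_eq do rewrite -mulrA.
  rewrite exZ ?xi0 ?mulr0//; apply: bmfunM => //.
  by apply: (bmfun_comp mV); exact: bmfun_indic.
rewrite -[X in `|X|]subr0 -z -exB; [|exact: bmfunM|exact: bmfunM].
apply: norm_ex_bound; first by apply: bmfunB; exact: bmfunM.
move=> w; rewrite -mulrBl normrM; apply: le_trans hK.
by apply: ler_pM.
Qed.

End conditional_zero.

Section rank_uniform.
Context {dT : measure_display} {T : measurableType dT} {R : realType}.
Variable P : probability T R.
Context {ds : measure_display} {S : measurableType ds}.
Variable X : nat -> T -> S.
Hypothesis iidX : iid P X.
Let mX := iid_measurable iidX.
Context {d2 : measure_display} {S2 : measurableType d2} (V : S -> S2).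
Hypothesis mV : measurable_fun setT V.
Context {d : nat}.
Variables (y : S2 -> R) (z : S2 -> 'rV[R]_d) (Kz : R).
Hypotheses (my : measurable_fun setT y)
  (mz : forall k, measurable_fun setT (fun s => z s 0 k))
  (zK : forall s, `|z s| <= Kz).
Variable L : nat -> R.
Hypotheses (L1 : forall n, (0 < n)%N -> 1 <= L n)
  (Lexp : (fun n => (n.+1%:R) ^+ (d + 2) * expR (- L n)) @ \oo --> 0).

Let rV theta (s : S) : R := rs (y \o V) (z \o V) theta s.

(** Conditional mean zero given V, expressed at the first observation. *)
Definition uncorrelated (xi : S -> R) := bmfun xi /\
  forall B, measurable B -> \int[P]_w (\1_B (V (X 0%N w)) * xi (X 0%N w)) = 0.

Lemma uncorrelatedM xi (g : S2 -> R) : bmfun g -> uncorrelated xi ->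
  uncorrelated (fun s => xi s * g (V s)).
Proof.
move=> bg [bxi h]; split; first by apply: bmfunM => //; exact: bmfun_comp bg.
move=> B mB; have := @ex_conditional_zero _ _ _ P _ _ (fun w => V (X 0%N w))
   (fun w => xi (X 0%N w)) _ _ h (fun s => \1_B s * g s).
move=> H; rewrite -[RHS]H.
- by apply: ex_eq => w; ring.
- exact: (measurableT_comp mV).
- exact: bmfun_comp bxi.
- by apply: bmfunM => //; exact: bmfun_indic.
Qed.

(** The event that a residual exceeds t is a half-space of (y, z), so its
    deviations are controlled uniformly in theta and t at once. *)
Lemma residual_deviation xi : uncorrelated xi ->
  negl P (fun n => [set w | exists theta t,
    Num.sqrt n%:R * L n <= `|\sum_(j < n) xi (X j w) * (t <= rV theta (X j w))%R%:R| \/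
    Num.sqrt n%:R * L n <= `|\sum_(j < n) xi (X j w) * (rV theta (X j w) <= t)%R%:R|]).
Proof.
move=> [bxi xi0].
have [K K0 xK] := bmfun_bound bxi.
pose phi (s : S2) : 'rV[R]_(1 + d) := row_mx (y s)%:M (z s).
have dphi (a0 : R) a s : dotv (row_mx a0%:M a) (phi s) = a0 * y s + dotv a (z s).
  rewrite /dotv tr_row_mx mul_row_col mxE tr_scalar_mx -scalar_mxM.
  by rewrite [in X in X + _]mxE eqxx mulr1n.
have mphi a : measurable_fun setT (fun x => dotv a (phi x)).
  under eq_fun do rewrite dotvE; apply: measurable_sum => k.
  apply: measurable_funM; first exact: measurable_cst.
  under eq_fun do rewrite /phi mxE; case: (fintype.split k) => j; last exact: mz.
  by under eq_fun do rewrite mxE ord1 eqxx mulr1n; exact: my.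
have xi0' B : measurable B -> \int[P]_w (\1_B (V (X 0%N w)) * xi (X 0%N w)) = 0 by exact: xi0.
have c0 : (fun n => 2 * expR (2 * K ^+ 2) * ((n.+1%:R) ^+ (d + 2) * expR (- L n))) @ \oo --> 0.
  by rewrite -[X in _ --> X](mulr0 (2 * expR (2 * K ^+ 2))); apply: cvgM => //; exact: cvg_cst.
apply: (negl_bound c0); near=> n.
have n0 : (0 < n)%N by near: n; exact: nbhs_infty_gt.
have sn0 : 0 < Num.sqrt n%:R :> R by rewrite sqrtr_gt0 ltr0n.
have sn2 : Num.sqrt n%:R ^+ 2 = n%:R :> R by rewrite sqr_sqrtr.
pose lam : R := (Num.sqrt n%:R)^-1.
have lam0 : 0 <= lam by rewrite invr_ge0 ltW.
have lamK : lam * K <= 1 / 2.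
  rewrite /lam mulrC ler_pdivrMr// mulrC.
  have : (2 * K) ^+ 2 <= Num.sqrt n%:R ^+ 2 by rewrite sn2; near: n; exact: nbhs_infty_ger.
  rewrite ler_pXn2r ?nnegrE ?mulr_ge0 ?(ltW sn0)// => h.
  by rewrite mulrA mulr1 ler_pdivlMr// mulrC.
have [E [mE PE hE]] := halfspace_deviation iidX bxi xK mV xi0' mphi n
  (Num.sqrt n%:R * L n) lamK lam0.
exists E; split => //.
  move=> w [theta [t h]]; apply: contrapT => /hE H; case: h => h.
    have := H (row_mx 1%:M (- theta)) (- t); rewrite ltNge => /negP; apply.
    apply: (le_trans h); apply: le_of_eq.
    congr `|_|; apply: eq_bigr => j _; congr (_ * (nat_of_bool _)%:R).
    by rewrite /halfspace dphi mul1r dotvNl subr_ge0.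
  have := H (row_mx (-1)%:M theta) t; rewrite ltNge => /negP; apply.
  apply: (le_trans h); apply: le_of_eq.
  congr `|_|; apply: eq_bigr => j _; congr (_ * (nat_of_bool _)%:R).
  rewrite /halfspace dphi /rV /rs/= mulN1r.
  by apply/idP/idP => ?; lra.
apply: (le_trans PE).
have lx : lam * (Num.sqrt n%:R * L n) = L n by rewrite /lam mulKf// gt_eqF.
rewrite lx natrX (_ : (1 + d + 1 = d + 2)%N); last by lia.
suff H : (1 + 2 * (lam * K) ^+ 2) ^+ n <= expR (2 * K ^+ 2).
  have -> : 2 * expR (2 * K ^+ 2) * (n.+1%:R ^+ (d + 2) * expR (- L n)) =
    2 * n.+1%:R ^+ (d + 2) * expR (2 * K ^+ 2) * expR (- L n) by ring.
  apply: ler_wpM2r; first exact: expR_ge0.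
  by apply: ler_wpM2l => //; nonneg.
apply: (@le_trans _ _ (expR (2 * (lam * K) ^+ 2) ^+ n)).
  by rewrite lerXn2r ?nnegrE ?expR_ge0 ?expR_ge1Dx// addr_ge0// mulr_ge0// sqr_ge0.
rewrite -expRM_natl ler_expR exprMn /lam exprVn sn2.
apply: le_of_eq; field.
by rewrite pnatr_eq0 -lt0n.
Unshelve. all: by end_near. Qed.

Variables (a a2 b : S -> R) (Ka : R).
Hypotheses (ba : bmfun a) (ba2 : bmfun a2) (bb : bmfun b)
  (aK : forall s, `|a s| <= Ka).
Hypotheses (ua : uncorrelated (fun s => a s - a2 s))
  (ub : uncorrelated (fun s => b s - 1)).

Let rk a b theta l := rank_kernel (y \o V) (z \o V) a b theta l.
Let rst a b n theta w := rank_stat X (y \o V) (z \o V) a b n theta w.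

Let Kz0 : 0 <= Kz. Proof. exact: le_trans (zK point). Qed.
Let Ka0 : 0 <= Ka. Proof. exact: le_trans (aK point). Qed.

Lemma offdiag_full (k : S * S -> R) n w : (forall s, k (s, s) = 0) ->
  offdiag_sum X k n w = \sum_(i < n) \sum_(j < n) k (X i w, X j w).
Proof.
move=> k0; rewrite /offdiag_sum pair_bigA/= big_mkcond/=.
apply: eq_bigr => -[i j] _ /=; case: eqP => // ->; by rewrite k0.
Qed.

Lemma rank_kernel_diag u v theta l s : rk u v theta l (s, s) = 0.
Proof. by rewrite /rk /rank_kernel/= subrr mulr0. Qed.

Let bz l : bmfun (fun s => z s 0 l).
Proof. by split=> //; exists Kz => s; exact: le_trans (norm_coord_le _ _) (zK s). Qed.

(** Freeze one index: the difference is then an average of sums over residual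
    half-lines, which are uniformly small. *)
Lemma rank_stat_reweight :
  negl P (fun n => [set w | exists theta,
    (Ka + 1) * (Kz + 1) * (L n / Num.sqrt n%:R) <
    `|rst a b n theta w - rst a2 (cst 1) n theta w|]).
Proof.
have N1 := residual_deviation ub; have N2 := residual_deviation ua.
have ubz l := residual_deviation (uncorrelatedM (bz l) ub).
have uaz l := residual_deviation (uncorrelatedM (bz l) ua).
pose bad xi n := [set w | exists theta t,
    Num.sqrt n%:R * L n <= `|\sum_(j < n) xi (X j w) * (t <= rV theta (X j w))%R%:R| \/
    Num.sqrt n%:R * L n <= `|\sum_(j < n) xi (X j w) * (rV theta (X j w) <= t)%R%:R|].
have negl_all (xi : 'I_d -> S -> R) : (forall l, negl P (bad (xi l))) ->
    negl P (fun n => [set w | exists l, bad (xi l) n w]).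
  move=> h; apply: (@negl_sub _ _ _ _ _ (fun n => \big[setU/set0]_(l <- enum 'I_d) bad (xi l) n)).
    near=> n => w [l hl]; rewrite -bigcup_seq; exists l => //=.
    by rewrite mem_enum.
  elim: (enum 'I_d) => [|l s IH].
    by apply: negl_near0; near=> n; rewrite big_nil.
  by under eq_fun do rewrite big_cons; exact: negl_setU.
have NB := negl_setU (negl_setU N1 N2) (negl_setU
  (negl_all (fun l s => (b s - 1) * z (V s) 0 l) ubz)
  (negl_all (fun l s => (a s - a2 s) * z (V s) 0 l) uaz)).
apply: negl_sub NB; near=> n.
have n0 : (0 < n)%N by near: n; exact: nbhs_infty_gt.
have sn0 : 0 < Num.sqrt n%:R :> R by rewrite sqrtr_gt0 ltr0n.
have sn2 : Num.sqrt n%:R ^+ 2 = n%:R :> R by rewrite sqr_sqrtr.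
have Ln := L1 n0.
move=> w [theta hw]; apply: contrapT => good.
set D := Num.sqrt n%:R * L n.
have D0 : 0 <= D by rewrite mulr_ge0 ?(ltW sn0)//; lra.
have gen xi : ~ bad xi n w ->
   forall t, `|\sum_(j < n) xi (X j w) * (t <= rV theta (X j w))%R%:R| <= D /\
             `|\sum_(j < n) xi (X j w) * (rV theta (X j w) <= t)%R%:R| <= D.
  by move=> nb t; split; apply: ltW; rewrite ltNge; apply/negP => h; apply: nb;
    exists theta, t; [left|right].
have g1 := gen (fun s => b s - 1) (fun h => good (or_introl (or_introl h))).
have g2 := gen (fun s => a s - a2 s) (fun h => good (or_introl (or_intror h))).
have g3 l := gen (fun s => (b s - 1) * z (V s) 0 l)
  (fun h => good (or_intror (or_introl (ex_intro _ l h)))).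
have g4 l := gen (fun s => (a s - a2 s) * z (V s) 0 l)
  (fun h => good (or_intror (or_intror (ex_intro _ l h)))).
move: hw; rewrite ltNge => /negP; apply.
apply: norm_row_le; first by rewrite !mulr_ge0 ?addr_ge0 ?invr_ge0 ?(ltW sn0)//; lra.
move=> l; rewrite !mxE !offdiag_full; last 2 first.
- by move=> s; exact: rank_kernel_diag.
- by move=> s; exact: rank_kernel_diag.
rewrite -mulrBr normrM ger0_norm ?invr_ge0 ?exprn_ge0//.
have -> : \sum_(i < n) \sum_(j < n) rank_kernel (y \o V) (z \o V) a b theta l (X i w, X j w) -
    \sum_(i < n) \sum_(j < n) rank_kernel (y \o V) (z \o V) a2 (cst 1) theta l (X i w, X j w) =
  \sum_(i < n) a (X i w) * (z (V (X i w)) 0 l *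
      (\sum_(j < n) (b (X j w) - 1) * (rV theta (X i w) <= rV theta (X j w))%R%:R) -
      \sum_(j < n) (b (X j w) - 1) * z (V (X j w)) 0 l * (rV theta (X i w) <= rV theta (X j w))%R%:R) +
  \sum_(j < n) (\sum_(i < n) (a (X i w) - a2 (X i w)) * z (V (X i w)) 0 l *
       (rV theta (X i w) <= rV theta (X j w))%R%:R -
    z (V (X j w)) 0 l * \sum_(i < n) (a (X i w) - a2 (X i w)) *
       (rV theta (X i w) <= rV theta (X j w))%R%:R).
  rewrite -sumrB; under eq_bigr do rewrite -sumrB.
  have -> : \sum_(j < n) (\sum_(i < n) (a (X i w) - a2 (X i w)) * z (V (X i w)) 0 l *
       (rV theta (X i w) <= rV theta (X j w))%R%:R -
    z (V (X j w)) 0 l * \sum_(i < n) (a (X i w) - a2 (X i w)) *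
       (rV theta (X i w) <= rV theta (X j w))%R%:R) =
    \sum_(i < n) \sum_(j < n) ((a (X i w) - a2 (X i w)) *
      (rV theta (X i w) <= rV theta (X j w))%R%:R * (z (V (X i w)) 0 l - z (V (X j w)) 0 l)).
    rewrite exchange_big/=; apply: eq_bigr => j _.
    by rewrite mulr_sumr -sumrB; apply: eq_bigr => i _; ring.
  rewrite -big_split/=; apply: eq_bigr => i _.
  rewrite mulr_sumr -sumrB mulr_sumr -big_split/=; apply: eq_bigr => j _.
  by rewrite /rank_kernel /rank_le/= /rV; ring.
have zb s : `|z s 0 l| <= Kz by exact: le_trans (norm_coord_le _ _) (zK s).
have b1 (i : 'I_n) : `|a (X i w) * (z (V (X i w)) 0 l *
      (\sum_(j < n) (b (X j w) - 1) * (rV theta (X i w) <= rV theta (X j w))%R%:R) -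
      \sum_(j < n) (b (X j w) - 1) * z (V (X j w)) 0 l * (rV theta (X i w) <= rV theta (X j w))%R%:R)|
    <= Ka * (Kz * D + D).
  rewrite normrM; apply: ler_pM => //; apply: (le_trans (ler_normB _ _)); apply: lerD.
    by rewrite normrM; apply: ler_pM => //; exact: (g1 _).1.
  exact: (g3 l _).1.
have b2 (j : 'I_n) : `|\sum_(i < n) (a (X i w) - a2 (X i w)) * z (V (X i w)) 0 l *
       (rV theta (X i w) <= rV theta (X j w))%R%:R -
    z (V (X j w)) 0 l * \sum_(i < n) (a (X i w) - a2 (X i w)) *
       (rV theta (X i w) <= rV theta (X j w))%R%:R| <= D + Kz * D.
  apply: (le_trans (ler_normB _ _)); apply: lerD; first exact: (g4 l _).2.
  by rewrite normrM; apply: ler_pM => //; exact: (g2 _).2.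
apply: (@le_trans _ _ (n%:R ^- 2 * (n%:R * (Ka * (Kz * D + D)) + n%:R * (D + Kz * D)))).
  apply: ler_wpM2l; first by nonneg.
  apply: (le_trans (ler_normD _ _)); apply: lerD.
    apply: (le_trans (ler_norm_sum _ _ _)).
    rewrite mulr_natl -[n in _ *+ n]card_ord -sumr_const.
    by apply: ler_sum => i _; exact: b1.
  apply: (le_trans (ler_norm_sum _ _ _)).
  rewrite mulr_natl -[n in _ *+ n]card_ord -sumr_const.
  by apply: ler_sum => i _; exact: b2.
apply: le_of_eq.
rewrite /D; move: (Num.sqrt n%:R) sn0 sn2 => sn sn0 <-.
by field; rewrite gt_eqF.
Unshelve. all: by end_near. Qed.

End rank_uniform.

(** * Roots of monotone perturbed scores *)

Section bounded_in_probability.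
Context {dT : measure_display} {T : measurableType dT} {R : realType}.
Variable P : probability T R.

Definition tight (X : nat -> T -> R) := forall eps : R, 0 < eps -> exists K : R,
  \forall n \near \oo, exists E, [/\ measurable E, [set w | K < X n w] `<=` E & pr P E <= eps].

Lemma tight_negl (X : nat -> T -> R) (B : nat -> set T) : tight X ->
  (forall K, negl P (fun n => B n `&` [set w | X n w <= K])) -> negl P B.
Proof.
move=> tX h eps e0; have e2 : 0 < eps / 2 by lra.
have [K hK] := tX _ e2; have hB := h K _ e2.
near=> n.
have [E [mE BE PE]] : exists E, [/\ measurable E, [set w | K < X n w] `<=` E & pr P E <= eps / 2].
  by near: n.
have [E' [mE' BE' PE']] : exists E, [/\ measurable E,
   B n `&` [set w | X n w <= K] `<=` E & pr P E <= eps / 2] by near: n.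
exists (E `|` E'); split; first exact: measurableU.
  move=> w Bw; have [XK|KX] := leP (X n w) K; first by right; exact: BE'.
  by left; exact: BE.
by apply: (le_trans (pr_setU P mE mE')); lra.
Unshelve. all: by end_near. Qed.

Lemma tight_le (X Y : nat -> T -> R) (B : nat -> set T) (c1 c2 : R) : 0 <= c1 ->
  tight X -> negl P B ->
  (\forall n \near \oo, forall w, ~ B n w -> Y n w <= c1 * X n w + c2) -> tight Y.
Proof.
move=> c10 tX nB h eps e0; have e2 : 0 < eps / 2 by lra.
have [K hK] := tX _ e2; exists (c1 * K + c2); near=> n.
have [E [mE BE PE]] : exists E, [/\ measurable E, [set w | K < X n w] `<=` E & pr P E <= eps / 2].
  by near: n.
have [E' [mE' BE' PE']] : exists E, [/\ measurable E, B n `<=` E & pr P E <= eps / 2].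
  by near: n; exact: nB.
have hn : forall w, ~ B n w -> Y n w <= c1 * X n w + c2 by near: n.
exists (E `|` E'); split; first exact: measurableU.
  move=> w /= Yw; have [XK|KX] := leP (X n w) K; last by left; exact: BE.
  right; apply: BE'; apply: contrapT => /hn nb.
  move: Yw; rewrite ltNge => /negP; apply; apply: (le_trans nb).
  by rewrite lerD2r ler_wpM2l.
by apply: (le_trans (pr_setU P mE mE')); lra.
Unshelve. all: by end_near. Qed.

Lemma tight_OpP (V : normedModType R) (X : nat -> T -> V) :
  Op_star P X (fun=> 1) -> tight (fun n w => `|X n w|).
Proof.
move=> OX eps e0; have e2 : 0 < eps / 2 by lra.
have [K hK] := OX _ e2; exists K; near=> n.
have h1 : (mu_ext P [set w | (K * 1 < `|X n w|)%R] <= (eps / 2)%:E)%E by near: n.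
have := @mu_ext_lt_cover _ _ _ P [set w | (K * 1 < `|X n w|)%R] eps.
rewrite mulr1 in h1 *; apply.
by apply: (le_lt_trans h1); rewrite lte_fin; lra.
Unshelve. all: by end_near. Qed.

Lemma tight_negl_slow (X : nat -> T -> R) (L : nat -> R) : L @ \oo --> +oo ->
  tight X -> negl P (fun n => [set w | L n < X n w]).
Proof.
move=> Ly tX; apply: (tight_negl tX) => K; apply: negl_near0; near=> n.
have KL : K <= L n by near: n; move/cvgryPge : Ly; exact.
by apply/seteqP; split => // w [/= h1 h2]; have := lt_le_trans (le_lt_trans KL h1) h2; rewrite ltxx.
Unshelve. all: by end_near. Qed.

End bounded_in_probability.

Lemma estimator_budget1 (R : realFieldType) (c dd L K1 K2 e0 r sn v : R) :
  0 < c -> 0 <= dd -> 1 <= L -> 0 <= K1 -> 0 <= K2 -> 0 < sn -> L ^+ 2 <= sn ->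
  r = L ^+ 2 / sn -> e0 = c / (2 * (dd + 1)) -> 0 < v ->
  2 * dd * (6 + K1 + K2) < c * L ->
  ~ (r * (c * v) - dd * v * (L / sn + 1 / sn + e0 * r) <=
     dd * v * (K2 * (L / sn) + K1 * (L ^+ 2 / sn ^+ 2) + 2 * (1 / sn))).
Proof.
move=> c0 dd0 L1 K10 K20 sn0 Lsn re e0E v0 big h.
have L0 : 0 < L by lra.
have : r * c - dd * (L / sn + 1 / sn + e0 * r) <=
    dd * (K2 * (L / sn) + K1 * (L ^+ 2 / sn ^+ 2) + 2 * (1 / sn)).
  by rewrite -(ler_pM2l v0); lra.
rewrite re; rewrite -(ler_pM2r sn0).
have -> : (L ^+ 2 / sn * c - dd * (L / sn + 1 / sn + e0 * (L ^+ 2 / sn))) * sn =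
   L ^+ 2 * c - dd * (L + 1 + e0 * L ^+ 2) by field; rewrite gt_eqF.
have -> : dd * (K2 * (L / sn) + K1 * (L ^+ 2 / sn ^+ 2) + 2 * (1 / sn)) * sn =
   dd * (K2 * L + K1 * (L ^+ 2 / sn) + 2) by field; rewrite gt_eqF.
have q1 : L ^+ 2 / sn <= 1 by rewrite ler_pdivrMr// mul1r.
have de : dd * e0 <= c / 2.
  rewrite e0E mulrA ler_pdivrMr; last by lra.
  nra.
have h2 : dd * (K2 * L + K1 * (L ^+ 2 / sn) + 2) <= dd * (K2 * L + K1 * L + 2 * L).
  by apply: ler_wpM2l => //; nra.
have h3 : dd * (L + 1 + e0 * L ^+ 2) <= dd * (2 * L) + c / 2 * L ^+ 2.
  have : dd * e0 * L ^+ 2 <= c / 2 * L ^+ 2 by rewrite ler_wpM2r// exprn_ge0// ltW.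
  have : dd * (L + 1) <= dd * (2 * L) by apply: ler_wpM2l => //; lra.
  lra.
have h4 : 2 * dd * (6 + K1 + K2) * L < c * L * L by rewrite ltr_pM2r.
have : 0 <= dd * L by rewrite mulr_ge0// ltW.
nra.
Qed.

Lemma estimator_budget2 (R : realType) (d : nat) (eps K K1 L sn a nn : R)
    (J : 'M[R]_d) (st s0 Ut U0 ut v : 'rV[R]_d) :
  0 < eps -> 0 <= K1 -> 0 < sn -> sn ^+ 2 = nn -> 1 <= L ->
  `|a *: st - Ut| <= K1 * (L ^+ 2 / nn) -> `|a *: s0 - U0| <= K1 * (L ^+ 2 / nn) ->
  `|Ut - U0 - ut| <= eps / 8 / sn -> `|st| <= 1 / sn -> `|a - 1| <= L / sn ->
  sn * `|U0| <= L -> `|ut - v *m J| <= eps / 8 / (`|K| + 1) * `|v| ->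
  sn * `|v| <= K -> L / sn <= 1 / 2 -> L ^+ 2 / sn <= 1 ->
  L ^+ 2 / sn <= eps / 8 / (3 + 2 * K1) ->
  `|sn *: st - (sn *: s0 + (sn *: v) *m J)| <= eps.
Proof.
move=> e0 K10 s00 <- L1 h1 h2 h3 h4 h5 h6 h7 h8 q1 q2 q3.
have K30 : 0 < 3 + 2 * K1 by rewrite ltr_pwDl// mulr_ge0.
have KK : 0 < `|K| + 1 by rewrite ltr_wpDl.
have L0 : 0 < L by lra.
have LL : K1 * (L ^+ 2 / sn ^+ 2) = K1 * (L ^+ 2 / sn) / sn.
  by field; rewrite gt_eqF.
have a2 : 1 / 2 <= `|a|.
  have : `|1 : R| <= `|1 - a| + `|a| by rewrite -{1}(subrK a 1) ler_normD.
  by rewrite normr1 distrC; lra.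
set x := L ^+ 2 / sn in q2 q3 LL.
have x0 : 0 <= x by rewrite /x divr_ge0 ?exprn_ge0// ltW.
rewrite LL in h1 h2.
have h3' : sn * `|Ut - U0 - ut| <= eps / 8 by rewrite mulrC -ler_pdivlMr.
have h1' : sn * `|a *: st - Ut| <= K1 * x by rewrite mulrC -ler_pdivlMr.
have h2' : sn * `|a *: s0 - U0| <= K1 * x by rewrite mulrC -ler_pdivlMr.
have h4' : sn * `|st| <= 1 by rewrite mulrC -ler_pdivlMr.
have h7' : sn * `|ut - v *m J| <= eps / 8.
  apply: (le_trans (ler_wpM2l (ltW s00) h7)); rewrite mulrCA.
  have kk : sn * `|v| <= `|K| + 1 by have := ler_norm K; lra.
  rewrite -[leRHS](divfK (lt0r_neq0 KK)).
  by rewrite ler_wpM2l// !divr_ge0// ltW.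
have hs0 : sn * `|s0| <= 2 * (L + K1 * x).
  have : `|a *: s0| <= `|a *: s0 - U0| + `|U0| by rewrite -{1}(subrK U0 (a *: s0)) ler_normD.
  rewrite normrZ => /(ler_wpM2l (ltW s00)); rewrite mulrDr => h.
  have : sn * (1 / 2 * `|s0|) <= sn * (`|a| * `|s0|) by rewrite ler_wpM2l ?(ltW s00)// ler_wpM2r.
  lra.
have -> : sn *: st - (sn *: s0 + (sn *: v) *m J) =
  sn *: (a *: st - Ut) - sn *: (a *: s0 - U0) + sn *: (Ut - U0 - ut) + sn *: (ut - v *m J)
  - (a - 1) *: (sn *: st - sn *: s0).
  by rewrite -scalemxAl; apply/rowP => k; rewrite !mxE; ring.
have nZ (y : 'rV[R]_d) : `|sn *: y| = sn * `|y| by rewrite normrZ gtr0_norm.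
apply: (le_trans (ler_normB _ _)).
apply: (@le_trans _ _ (K1 * x + K1 * x + eps / 8 + eps / 8 + L / sn * (1 + 2 * (L + K1 * x)))).
  apply: lerD.
    apply: (le_trans (ler_normD _ _)); rewrite nZ; apply: lerD => //.
    apply: (le_trans (ler_normD _ _)); rewrite nZ; apply: lerD => //.
    by apply: (le_trans (ler_normB _ _)); rewrite !nZ; apply: lerD.
  rewrite normrZ; apply: ler_pM => //.
  by apply: (le_trans (ler_normB _ _)); rewrite !nZ; apply: lerD.
have xL : L / sn * L = x by rewrite /x; field; rewrite gt_eqF.
have Ls : L / sn <= x by rewrite -xL ler_peMr// divr_ge0// ltW.
have Ls0 : 0 <= L / sn by rewrite divr_ge0// ltW.
have y1 : x * (3 + 2 * K1) <= eps / 8 by rewrite -ler_pdivlMr.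
have y2 : L / sn * (K1 * x) <= K1 * x.
  apply: ler_piMl; first exact: mulr_ge0.
  by apply: (le_trans q1); rewrite ler_pdivrMr// mul1r ler1n.
have y3 : L / sn * (1 + 2 * (L + K1 * x)) = L / sn + 2 * x + 2 * (L / sn * (K1 * x)).
  by transitivity (L / sn + 2 * (L / sn * L) + 2 * (L / sn * (K1 * x))); [ring|rewrite xL].
have y4 : 0 <= K1 * x by rewrite mulr_ge0.
rewrite {}y3; move: e0 Ls y1 y2 y4 x0; rewrite mulrDr (mulrCA x 2).
move: (L / sn * (K1 * x)) (L / sn) (x * K1) (K1 * x) (mulrC x K1) => p l _ k -> //.
move: (l * k) => m; clear; lra.
Qed.

Section estimator.
Context {dT : measure_display} {T : measurableType dT} {R : realType}.
Variable P : probability T R.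
Context {d : nat}.
Variables (sc U H : nat -> 'rV[R]_d -> T -> 'rV[R]_d) (An : nat -> T -> R).
Variables (u : 'rV[R]_d -> 'rV[R]_d) (th0 : 'rV[R]_d) (J : 'M[R]_d) (L : nat -> R).
Variables (K1 K2 : R).
Hypotheses (K10 : 0 <= K1) (K20 : 0 <= K2).
Hypotheses (L1 : forall n, (0 < n)%N -> 1 <= L n) (Ly : L @ \oo --> +oo)
  (Lsn : (fun n => (1 + L n ^+ 2) ^+ d.+1 / Num.sqrt n%:R) @ \oo --> 0).
Hypothesis u0 : u th0 = 0.
Hypothesis uJ : forall eps : R, 0 < eps -> exists2 dl : R, 0 < dl & forall th,
  `|th - th0| <= dl -> `|u th - (th - th0) *m J| <= eps * `|th - th0|.
Let sn (n : nat) : R := Num.sqrt n%:R.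
Let r n : R := L n ^+ 2 / sn n.
Hypothesis scU : negl P (fun n => [set w | exists th,
  K1 * (L n ^+ 2 / n%:R) < `|An n w *: sc n th w - U n th w|]).
Hypothesis UH : negl P (fun n => [set w | exists th, K2 * (L n / sn n) < `|U n th w - H n th w|]).
Hypothesis Ueq : forall eps : R, 0 < eps -> negl P (fun n => [set w | exists th,
  `|th - th0| <= r n /\ eps / sn n < `|U n th w - U n th0 w - (u th - u th0)|]).
Hypothesis Heq : forall eps : R, 0 < eps -> negl P (fun n => [set w | exists th,
  `|th - th0| <= r n /\ eps / sn n < `|H n th w - H n th0 w - (u th - u th0)|]).
Hypothesis tU : tight P (fun n w => sn n * `|U n th0 w|).
Hypothesis tH : tight P (fun n w => sn n * `|H n th0 w|).
Hypothesis An1 : negl P (fun n => [set w | L n / sn n < `|An n w - 1|]).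
Hypothesis Hmono : forall n v s s' w, s <= s' ->
  dotv v (H n (th0 + s *: v) w) <= dotv v (H n (th0 + s' *: v) w).

Let sn_gt0 n : (0 < n)%N -> 0 < sn n.
Proof. by move=> n0; rewrite /sn sqrtr_gt0 ltr0n. Qed.

Let sn2 n : sn n ^+ 2 = n%:R.
Proof. by rewrite sqr_sqrtr. Qed.

Let Lsn_le (e : R) : 0 < e -> \forall n \near \oo, 1 + L n ^+ 2 <= e * sn n.
Proof.
move=> e0; near=> n.
have n0 : (0 < n)%N by near: n; exact: nbhs_infty_gt.
have s0 := sn_gt0 n0.
have : (1 + L n ^+ 2) ^+ d.+1 / Num.sqrt n%:R <= e.
  by near: n; move/cvgr_le : Lsn; apply.
rewrite ler_pdivrMr//; apply: le_trans.
by apply: ler_eXnr => //; rewrite lerDl sqr_ge0.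
Unshelve. all: by end_near. Qed.

Let r_small (e : R) : 0 < e -> \forall n \near \oo, r n <= e.
Proof.
move=> e0; near=> n.
have n0 : (0 < n)%N by near: n; exact: nbhs_infty_gt.
rewrite /r ler_pdivrMr ?sn_gt0//.
apply: (@le_trans _ _ (1 + L n ^+ 2)); first by rewrite lerDr.
by near: n; exact: Lsn_le.
Unshelve. all: by end_near. Qed.

Let Lsn1 : \forall n \near \oo, L n / sn n <= 1 / 2.
Proof.
near=> n.
have n0 : (0 < n)%N by near: n; exact: nbhs_infty_gt.
have h : r n <= 1 / 2 by near: n; apply: r_small; lra.
apply: le_trans h; rewrite /r ler_wpM2r ?invr_ge0 ?(ltW (sn_gt0 n0))//.
by have := L1 n0 => ?; rewrite expr2 ler_peMr//; lra.
Unshelve. all: by end_near. Qed.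

Section rate.
Variable tht : nat -> T -> 'rV[R]_d.
Variable c : R.
Hypothesis c0 : 0 < c.
Hypothesis q : forall n w, let v := tht n w - th0 in c * `|v| ^+ 2 <= dotv v (v *m J).
Hypothesis root : op_star P (fun n w => sc n (tht n w) w) (fun n => (sn n)^-1).

Let e0 : R := c / (2 * (d%:R + 1)).
Let d1 : 0 < d%:R + 1 :> R. Proof. by rewrite ltr_wpDl. Qed.
Let e00 : 0 < e0. Proof. by rewrite divr_gt0// mulr_gt0. Qed.

(** At a distance r from theta0 the drift of H along v is at least of order r,
    more than the noise L / sqrt n; by monotonicity of H it cannot shrink
    further out, so no approximate root lies there. *)
Lemma estimator_localized : negl P (fun n => [set w | r n < `|tht n w - th0|]).
Proof.
have root1 : negl P (fun n => [set w | 1 * (sn n)^-1 < `|sc n (tht n w) w|]).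
  by move/op_starP: root; apply.
have H1 := Heq ltr01.
have tHL := tight_negl_slow Ly tH.
have [dl dl0 udl] := uJ e00.
apply: (negl_sub _ (negl_setU (negl_setU (negl_setU scU UH) (negl_setU H1 tHL))
  (negl_setU root1 An1))).
near=> n; move=> w hw; apply: contrapT => good.
have n0 : (0 < n)%N by near: n; exact: nbhs_infty_gt.
have s0 := sn_gt0 n0; have Ln := L1 n0.
have b1 th : `|An n w *: sc n th w - U n th w| <= K1 * (L n ^+ 2 / n%:R).
  by rewrite leNgt; apply/negP => h; apply: good; do 3 left; exists th.
have b2 th : `|U n th w - H n th w| <= K2 * (L n / sn n).
  by rewrite leNgt; apply/negP => h; apply: good; do 2 left; right; exists th.
have b3 th : `|th - th0| <= r n -> `|H n th w - H n th0 w - (u th - u th0)| <= 1 / sn n.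
  by move=> tr; rewrite leNgt; apply/negP => h; apply: good; left; right; left; exists th.
have b4 : sn n * `|H n th0 w| <= L n.
  by rewrite leNgt; apply/negP => h; apply: good; left; right; right.
have b5 : `|sc n (tht n w) w| <= 1 / sn n.
  by rewrite leNgt; apply/negP => h; apply: good; right; left.
have b6 : `|An n w - 1| <= L n / sn n.
  by rewrite leNgt; apply/negP => h; apply: good; right; right.
set v := tht n w - th0.
have v0 : 0 < `|v|.
  by apply: le_lt_trans hw; rewrite /r divr_ge0 ?sqr_ge0// ltW.
pose s := r n / `|v|.
have s1 : s <= 1 by rewrite /s ler_pdivrMr// mul1r ltW.
have r0 : 0 <= r n by rewrite /r divr_ge0 ?sqr_ge0// ltW.
have s00 : 0 <= s by rewrite /s divr_ge0.
have thr : `|(th0 + s *: v) - th0| = r n.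
  by rewrite addrAC subrr add0r normrZ ger0_norm// /s divfK// gt_eqF.
have mono := Hmono n v w s1; rewrite scale1r {1}/v addrCA subrr addr0 in mono.
have dabs (x y' : 'rV[R]_d) : dotv x y' <= d%:R * `|x| * `|y'|.
  exact: le_trans (ler_norm _) (norm_dotv_le _ _).
have A2 : `|An n w| <= 2.
  have h1 : L n / sn n <= 1 / 2 by near: n; exact: Lsn1.
  have : `|An n w| <= `|An n w - 1| + `|1 : R|.
    by rewrite -{1}(subrK 1 (An n w)) ler_normD.
  rewrite normr1; lra.
have upper : dotv v (H n (tht n w) w) <= d%:R * `|v| *
    (K2 * (L n / sn n) + K1 * (L n ^+ 2 / sn n ^+ 2) + 2 * (1 / sn n)).
  apply: (le_trans (dabs _ _)); apply: ler_wpM2l; first by rewrite mulr_ge0.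
  have -> : H n (tht n w) w = - (U n (tht n w) w - H n (tht n w) w) -
     (An n w *: sc n (tht n w) w - U n (tht n w) w) + An n w *: sc n (tht n w) w.
    by apply/rowP => k; rewrite !mxE; ring.
  rewrite sn2; apply: (le_trans (ler_normD _ _)); apply: lerD; last first.
    by rewrite normrZ ler_pM.
  by apply: (le_trans (ler_normB _ _)); rewrite normrN lerD.
have lower : r n * (c * `|v|) - d%:R * `|v| * (L n / sn n + 1 / sn n + e0 * r n) <=
    dotv v (H n (th0 + s *: v) w).
  have -> : H n (th0 + s *: v) w = H n th0 w +
      (H n (th0 + s *: v) w - H n th0 w - (u (th0 + s *: v) - u th0)) +
      (u (th0 + s *: v) - ((th0 + s *: v) - th0) *m J) + ((th0 + s *: v) - th0) *m J.
    by rewrite u0; apply/rowP => k; rewrite !mxE; ring.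
  rewrite dotvDr [leRHS]addrC; apply: lerD.
    rewrite addrAC subrr add0r -scalemxAl dotvZr.
    rewrite (_ : r n * (c * `|v|) = s * (c * `|v| ^+ 2)); last first.
      by rewrite /s; field; rewrite gt_eqF.
    by apply: ler_wpM2l => //; exact: (q n w).
  rewrite lerNl -dotvNr; apply: (le_trans (dabs _ _)); rewrite normrN.
  apply: ler_wpM2l; first by rewrite mulr_ge0.
  apply: (le_trans (ler_normD _ _)); apply: lerD.
    apply: (le_trans (ler_normD _ _)); apply: lerD; last by apply: b3; rewrite thr.
    by rewrite ler_pdivlMr// mulrC.
  apply: (le_trans (udl _ _)); rewrite thr//.
  by near: n; exact: r_small.
apply: (@estimator_budget1 _ c d%:R (L n) K1 K2 e0 (r n) (sn n) `|v|) => //.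
- have h : 1 + L n ^+ 2 <= 1 * sn n by near: n; exact: Lsn_le.
  by apply: le_trans (le_trans h _); rewrite ?lerDr// mul1r.
- have h : 2 * d%:R * (6 + K1 + K2) / c < L n by near: n; move/cvgryPgt : Ly; exact.
  by move: h; rewrite ltr_pdivrMr// (mulrC (L n)).
- exact: le_trans lower (le_trans mono upper).
Unshelve. all: by end_near. Qed.

(** Inside the small ball the expansion of H is exact to o(n^-1/2), and the
    quadratic lower bound turns a small score into a small error. *)
Lemma estimator_rate : tight P (fun n w => sn n * `|tht n w - th0|).
Proof.
have root1 : negl P (fun n => [set w | 1 * (sn n)^-1 < `|sc n (tht n w) w|]).
  by move/op_starP: root; apply.
have U1 := Ueq ltr01.
have [dl dl0 udl] := uJ e00.
apply: (tight_le (c1 := 2 * d%:R / c) (c2 := 2 * d%:R / c * (3 + K1)) _ tU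
  (negl_setU (negl_setU scU U1) (negl_setU (negl_setU root1 An1) estimator_localized))).
  by rewrite divr_ge0 ?mulr_ge0// ltW.
near=> n; move=> w good.
have n0 : (0 < n)%N by near: n; exact: nbhs_infty_gt.
have s0 := sn_gt0 n0; have Ln := L1 n0.
have b1 th : `|An n w *: sc n th w - U n th w| <= K1 * (L n ^+ 2 / n%:R).
  by rewrite leNgt; apply/negP => h; apply: good; do 2 left; exists th.
have b3 th : `|th - th0| <= r n -> `|U n th w - U n th0 w - (u th - u th0)| <= 1 / sn n.
  by move=> tr; rewrite leNgt; apply/negP => h; apply: good; left; right; exists th.
have b5 : `|sc n (tht n w) w| <= 1 / sn n.
  by rewrite leNgt; apply/negP => h; apply: good; right; left; left.
have b6 : `|An n w - 1| <= L n / sn n.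
  by rewrite leNgt; apply/negP => h; apply: good; right; left; right.
have b7 : `|tht n w - th0| <= r n.
  by rewrite leNgt; apply/negP => h; apply: good; right; right.
set v := tht n w - th0 in b7 *.
have A2 : `|An n w| <= 2.
  have h1 : L n / sn n <= 1 / 2 by near: n; exact: Lsn1.
  have : `|An n w| <= `|An n w - 1| + `|1 : R|.
    by rewrite -{1}(subrK 1 (An n w)) ler_normD.
  rewrite normr1; lra.
have vJ : `|v *m J| <= 2 * (1 / sn n) + K1 * (L n ^+ 2 / n%:R) + `|U n th0 w| + 1 / sn n + e0 * `|v|.
  have -> : v *m J = An n w *: sc n (tht n w) w -
      (An n w *: sc n (tht n w) w - U n (tht n w) w) - U n th0 w -
      (U n (tht n w) w - U n th0 w - (u (tht n w) - u th0)) -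
      (u (tht n w) - v *m J).
    by rewrite u0; apply/rowP => k; rewrite !mxE; ring.
  apply: (le_trans (ler_normB _ _)); apply: lerD; last first.
    by apply: udl; apply: (le_trans b7); near: n; exact: r_small.
  apply: (le_trans (ler_normB _ _)); apply: lerD; last exact: b3.
  apply: (le_trans (ler_normB _ _)); apply: lerD => //.
  apply: (le_trans (ler_normB _ _)); apply: lerD => //.
  by rewrite normrZ ler_pM.
have cv : c * `|v| <= d%:R * `|v *m J|.
  have [->|vn] := eqVneq v 0; first by rewrite normr0 mulr0 mulr_ge0.
  have v0 : 0 < `|v| by rewrite normr_gt0.
  rewrite -(ler_pM2l v0); have := le_trans (le_trans (q n w) (ler_norm _)) (norm_dotv_le _ _).
  by rewrite -/v; lra.
have de : d%:R * e0 <= c / 2.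
  rewrite /e0 mulrA ler_pdivrMr ?mulr_gt0//; have : 0 <= d%:R :> R by []. 
  move: c0; nra.
have LK : sn n * (L n ^+ 2 / n%:R) <= 1.
  have h : r n <= 1 by near: n; exact: r_small.
  rewrite -sn2; apply: le_trans h; rewrite /r le_eqVlt; apply/orP; left; apply/eqP.
  by field; rewrite gt_eqF.
have fin : c / 2 * `|v| <= d%:R * (2 * (1 / sn n) + K1 * (L n ^+ 2 / n%:R) + `|U n th0 w| + 1 / sn n).
  have := le_trans cv (ler_wpM2l (ler0n _ d) vJ); rewrite mulrDr.
  have : d%:R * (e0 * `|v|) <= c / 2 * `|v| by rewrite mulrA ler_wpM2r.
  lra.
have h1 : sn n * `|v| <= 2 * d%:R / c * (sn n *
    (2 * (1 / sn n) + K1 * (L n ^+ 2 / n%:R) + `|U n th0 w| + 1 / sn n)).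
  rewrite [leRHS](_ : _ = sn n * (2 / c * (d%:R * (2 * (1 / sn n) + K1 * (L n ^+ 2 / n%:R) + `|U n th0 w| + 1 / sn n)))); last first.
    by ring.
  rewrite ler_wpM2l ?(ltW s0)// (_ : 2 / c = (c / 2)^-1); last by rewrite invf_div.
  by rewrite ler_pdivlMl// divr_gt0.
apply: (le_trans h1); rewrite -mulrDr ler_wpM2l//; first by rewrite divr_ge0 ?mulr_ge0// ltW.
rewrite !mulrDr mulrCA !(mulrA (sn n) 1) mulr1 divff ?gt_eqF// mulrCA.
have := ler_wpM2l K10 LK; lra.
Unshelve. all: by end_near. Qed.

End rate.

Lemma estimator_linearity (tht : nat -> T -> 'rV[R]_d) :
  op_star P (fun n w => sc n (tht n w) w) (fun n => (sn n)^-1) ->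
  negl P (fun n => [set w | r n < `|tht n w - th0|]) ->
  tight P (fun n w => sn n * `|tht n w - th0|) ->
  op_star P (fun n w => sn n *: sc n (tht n w) w -
    (sn n *: sc n th0 w + (sn n *: (tht n w - th0)) *m J)) (fun=> 1).
Proof.
move=> root loc rate; apply/op_starP => eps eps0.
apply: (tight_negl rate) => K.
pose e1 := eps / 8; have e10 : 0 < e1 by rewrite divr_gt0.
pose e2 := e1 / (`|K| + 1); have K10' : 0 < `|K| + 1 by rewrite ltr_wpDl.
have e20 : 0 < e2 by rewrite divr_gt0.
have [dl dl0 udl] := uJ e20.
have root1 : negl P (fun n => [set w | 1 * (sn n)^-1 < `|sc n (tht n w) w|]).
  by move/op_starP: root; apply.
have tUL := tight_negl_slow Ly tU.
apply: (negl_sub _ (negl_setU (negl_setU scU (Ueq e10)) (negl_setU (negl_setU root1 An1)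
  (negl_setU loc tUL)))).
near=> n; move=> w [hw vK]; apply: contrapT => good.
have n0 : (0 < n)%N by near: n; exact: nbhs_infty_gt.
have s0 := sn_gt0 n0; have Ln := L1 n0.
have b1 th : `|An n w *: sc n th w - U n th w| <= K1 * (L n ^+ 2 / n%:R).
  by rewrite leNgt; apply/negP => h; apply: good; do 2 left; exists th.
have b3 th : `|th - th0| <= r n -> `|U n th w - U n th0 w - (u th - u th0)| <= e1 / sn n.
  by move=> tr; rewrite leNgt; apply/negP => h; apply: good; left; right; exists th.
have b5 : `|sc n (tht n w) w| <= 1 / sn n.
  by rewrite leNgt; apply/negP => h; apply: good; right; left; left.
have b6 : `|An n w - 1| <= L n / sn n.
  by rewrite leNgt; apply/negP => h; apply: good; right; left; right.
have b7 : `|tht n w - th0| <= r n.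
  by rewrite leNgt; apply/negP => h; apply: good; right; right; left.
have b8 : sn n * `|U n th0 w| <= L n.
  by rewrite leNgt; apply/negP => h; apply: good; right; right; right.
move: hw; rewrite /= mulr1 ltNge => /negP; apply.
have q1 : L n / sn n <= 1 / 2 by near: n; exact: Lsn1.
have q2 : r n <= Num.min 1 (e1 / (3 + 2 * K1)).
  by near: n; apply: r_small; rewrite lt_min ltr01 divr_gt0// ltr_pwDl// mulr_ge0.
have q3 : `|tht n w - th0| <= dl by apply: (le_trans b7); near: n; exact: r_small.
move: q2; rewrite le_min => /andP[q2 q4].
have b3' := b3 _ b7; rewrite u0 subr0 in b3'.
exact: (estimator_budget2 eps0 K10 s0 (sn2 n) Ln (b1 _) (b1 _) b3' b5 b6 b8
  (udl _ q3) vK q1 q2 q4).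
Unshelve. all: by end_near. Qed.

End estimator.

(** * The score as a rank statistic *)

Section cancellation.
Context {R : realType} {n d : nat}.
Variables (ep om wt : 'I_n -> R) (dl : 'I_n -> bool) (z : 'I_n -> 'rV[R]_d).
Variables (Ko Kw Kz x : R).
Hypotheses (omK : forall i, `|om i| <= Ko) (wtK : forall i, `|wt i| <= Kw)
  (zK : forall i, `|z i| <= Kz).
Hypothesis dev : forall t, `|\sum_j (wt j - 1) * (t <= ep j)%R%:R| < x.
Hypothesis sw0 : \sum_j wt j != 0.

Let N i := \sum_j wt j * (ep i <= ep j)%R%:R.
Let M i := \sum_j (wt j * (ep i <= ep j)%R%:R) *: z j.
Let cnt i : R := \sum_j (ep i <= ep j)%R%:R.

Let cnt_small i : N i = 0 -> cnt i <= x.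
Proof.
move=> Ni; have := dev (ep i).
under eq_bigr do rewrite mulrBl mul1r.
rewrite sumrB -/(N i) Ni sub0r normrN => /ltW; apply: le_trans; exact: ler_norm.
Qed.

Let M_small i : N i = 0 -> `|M i| <= Kw * Kz * x.
Proof.
move=> Ni; have Kw0 : 0 <= Kw by exact: le_trans (wtK i).
have Kz0 : 0 <= Kz by exact: le_trans (zK i).
apply: (@le_trans _ _ (Kw * Kz * cnt i)); last by rewrite ler_wpM2l ?mulr_ge0// cnt_small.
apply: (le_trans (ler_norm_sum _ _ _)); rewrite mulr_sumr; apply: ler_sum => j _.
rewrite normrZ normrM mulrAC; apply: ler_pM => //; last by rewrite ger0_norm.
by apply: ler_pM.
Qed.

Let few : #|[pred i | N i == 0]|%:R <= x.
Proof.
have [i0 Bi0|B0] := pickP [pred i | N i == 0]; last first.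
  by rewrite eq_card0//; exact: le_trans (normr_ge0 _) (ltW (dev 0)).
have [i Bi imin] := @arg_minP _ R _ i0 [pred i | N i == 0] ep Bi0.
apply: (le_trans _ (cnt_small (eqP Bi))).
rewrite -sum1_card natr_sum /cnt [leLHS]big_mkcond/=; apply: ler_sum => j _.
by case: ifPn => // Bj; rewrite imin.
Qed.

(** The weighted risk set cancels against the denominator of the weighted mean
    except where its total weight N is 0; there few residuals are at risk, by the
    deviation bound, and the error is a product of two small factors. *)
Lemma self_normalized_sum_cancel :
  `|(\sum_j wt j / n%:R) *: (n%:R^-1 *: \sum_i
      (om i * (N i / \sum_j wt j) * (dl i)%:R) *: (z i - (N i)^-1 *: M i)) -
    n%:R ^- 2 *: \sum_i \sum_j (om i * (dl i)%:R * wt j * (ep i <= ep j)%R%:R) *: (z i - z j)|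
  <= Ko * Kw * Kz * (x ^+ 2 / n%:R ^+ 2).
Proof.
have -> : \sum_i \sum_j (om i * (dl i)%:R * wt j * (ep i <= ep j)%R%:R) *: (z i - z j) =
    \sum_i (om i * (dl i)%:R) *: (N i *: z i - M i).
  apply: eq_bigr => i _; rewrite /N /M scaler_suml -sumrB scaler_sumr.
  by apply: eq_bigr => j _; rewrite -scalerBr scalerA mulrA.
rewrite -mulr_suml scalerA -mulrA -expr2 -exprVn mulrC -scalerA -scalerBr exprVn.
rewrite scaler_sumr -sumrB normrZ ger0_norm ?invr_ge0 ?exprn_ge0// mulrA mulrC.
apply: ler_wpM2r; first by rewrite invr_ge0 exprn_ge0.
have x0 : 0 <= x by exact: le_trans (ltW (dev 0)).
apply: (@le_trans _ _ (\sum_(i | N i == 0) Ko * Kw * Kz * x)); last first.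
  rewrite sumr_const -mulr_natr expr2 mulrA.
  have [i0 _|B0] := pickP [pred i : 'I_n | true]; last first.
    by move: sw0; rewrite big_pred0 ?eqxx// => i; have := B0 i.
  apply: ler_wpM2l => //; rewrite !mulr_ge0//.
  - exact: le_trans (omK i0).
  - exact: le_trans (wtK i0).
  - exact: le_trans (zK i0).
apply: (le_trans (ler_norm_sum _ _ _)); rewrite [leRHS]big_mkcond/=; apply: ler_sum => i _.
case: ifPn => [/eqP Ni|Ni].
  rewrite Ni mul0r mulr0 mul0r !scale0r scaler0 !sub0r normrN normrZ normrN.
  rewrite -!mulrA; apply: ler_pM => //; last by rewrite mulrA M_small.
  rewrite normrM -[leRHS]mulr1; apply: ler_pM => //.
  by case: (dl i); rewrite ?normr1 ?normr0.
rewrite scalerA (_ : _ * (om i * _ * _) = om i * (dl i)%:R * N i); last first.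
  by field.
rewrite (_ : _ - _ = 0) ?normr0//; apply/rowP => k; rewrite !mxE; move: (N i) Ni => m m0.
by field.
Qed.

End cancellation.

Section clipping.
Context {R : realType}.

(** Weights and covariates are bounded only on the sample; clipping gives bounded
    functions on the whole observation space that agree with them on the data. *)
Definition clip (K x : R) : R := Num.max (- K) (Num.min K x).

Lemma norm_clip_le (K x : R) : 0 <= K -> `|clip K x| <= K.
Proof.
move=> K0; rewrite ler_norml /clip le_max lexx/= ge_max; apply/andP; split.
  by rewrite (@le_trans _ _ 0)// oppr_le0.
by rewrite ge_min lexx.
Qed.

Lemma clip_id (K x : R) : `|x| <= K -> clip K x = x.
Proof.
by rewrite ler_norml /clip => /andP[h1 h2]; rewrite (min_idPr h2) (max_idPr h1).
Qed.

Lemma measurable_clip (K : R) : measurable_fun setT (clip K).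
Proof.
apply: measurable_maxr; first exact: measurable_cst.
by apply: measurable_minr; [exact: measurable_cst|exact: measurable_id].
Qed.

Lemma measurable_coord d (k : 'I_d) :
  measurable_fun setT (fun v : borel 'rV[R]_d => (v : 'rV[R]_d) 0 k).
Proof.
apply: (measurability (@RGenOInfty.G R)) => [|/= _ [_] [r] -> <-].
  exact: RGenOInfty.measurableE.
rewrite setTI; apply: sub_sigma_algebra.
move/continuousP : (@coord_continuous R 1 d 0 k); apply.
exact: interval_open.
Qed.

Definition clipv d (K : R) (v : 'rV[R]_d) : 'rV[R]_d := \row_k clip K (v 0 k).

Lemma norm_clipv_le d (K : R) (v : 'rV[R]_d) : 0 <= K -> `|clipv K v| <= K.
Proof. by move=> K0; apply: norm_row_le => // k; rewrite mxE norm_clip_le. Qed.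

Lemma clipv_id d (K : R) (v : 'rV[R]_d) : `|v| <= K -> clipv K v = v.
Proof.
move=> vK; apply/rowP => k; rewrite mxE clip_id//.
exact: le_trans (norm_coord_le v k) vK.
Qed.

End clipping.

Section rank_mean_reweighting.
Context {dT : measure_display} {T : measurableType dT} {R : realType}.
Variable P : probability T R.
Context {ds : measure_display} {S : measurableType ds}.
Variable X : nat -> T -> S.
Hypothesis iidX : iid P X.
Let mX := iid_measurable iidX.
Context {d2 : measure_display} {S2 : measurableType d2} (V : S -> S2).
Hypothesis mV : measurable_fun setT V.
Let mVX : measurable_fun setT (fun w => V (X 0%N w)).
Proof. exact: measurableT_comp. Qed.

(** Integrating one variable at a time, a weight may be replaced by its
    conditional expectation. *)
Lemma ex2_reweight (a a2 b b2 : S -> R) (g : S2 * S2 -> R) :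
  bmfun a -> bmfun a2 -> bmfun b -> bmfun b2 -> bmfun g ->
  uncorrelated P X V (fun s => a s - a2 s) -> uncorrelated P X V (fun s => b s - b2 s) ->
  ex2 P X (fun p => a p.1 * b p.2 * g (V p.1, V p.2)) =
  ex2 P X (fun p => a2 p.1 * b2 p.2 * g (V p.1, V p.2)).
Proof.
move=> ba ba2 bb bb2 bg [bua ua] [bub ub].
have b1 (h : S -> R) : bmfun h -> bmfun (fun w => h (X 0%N w)).
  by move=> bh; apply: (bmfun_comp _ bh); exact: mX.
have bg1 s2 : bmfun (fun w => g (s2, V (X 0%N w))).
  apply: (@bmfun_comp _ _ _ _ _ (fun s => g (s2, s)) _ mVX).
  by apply: bmfun_comp bg; exact: pair1_measurable.
pose h s2 := \int[P]_w (b2 (X 0%N w) * g (s2, V (X 0%N w))).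
have bh : bmfun h.
  have bf : bmfun (fun p : S2 * S => b2 p.2 * g (p.1, V p.2)).
    apply: bmfunM; first by apply: (bmfun_comp _ bb2); exact: measurable_snd.
    apply: (bmfun_comp _ bg); apply: measurable_fun_pair; first exact: measurable_fst.
    by apply: measurableT_comp => //; exact: measurable_snd.
  exact: (bmfun_section P mVX (mX 0%N) bf).
have hb s2 : \int[P]_w (b (X 0%N w) * g (s2, V (X 0%N w))) = h s2.
  apply/eqP; rewrite -subr_eq0 -exB; [|exact: bmfunM (b1 _ _) _|exact: bmfunM (b1 _ _) _].
  under ex_eq => w do rewrite -mulrBl mulrC.
  apply/eqP; apply: (ex_conditional_zero mVX (b1 _ bub) ub (g := fun s => g (s2, s))).
  by apply: bmfun_comp bg; exact: pair1_measurable.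
have e2 (u v : S -> R) : bmfun v -> (forall s2, \int[P]_w (v (X 0%N w) * g (s2, V (X 0%N w))) = h s2) ->
    ex2 P X (fun p => u p.1 * v p.2 * g (V p.1, V p.2)) = \int[P]_w (h (V (X 0%N w)) * u (X 0%N w)).
  move=> bv vh; apply: ex_eq => w /=; rewrite -vh mulrC -exZ; last exact: bmfunM (b1 _ _) _.
  by apply: ex_eq => w'; rewrite mulrA.
rewrite (e2 a b)// (e2 a2 b2)//; apply/eqP; rewrite -subr_eq0.
have bhV : bmfun (fun w => h (V (X 0%N w))) by exact: bmfun_comp bh.
rewrite -exB; [|exact: bmfunM (b1 _ _)|exact: bmfunM (b1 _ _)].
under ex_eq => w do rewrite -mulrBr.
by apply/eqP; exact: (ex_conditional_zero mVX (b1 _ bua) ua bh).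
Qed.

End rank_mean_reweighting.

Section rank_statistic_rates.
Context {dT : measure_display} {T : measurableType dT} {R : realType}.
Variable P : probability T R.
Context {ds : measure_display} {S : measurableType ds}.
Variable X : nat -> T -> S.
Hypothesis iidX : iid P X.
Let mX := iid_measurable iidX.
Context {d : nat}.
Variables (y : S -> R) (z : S -> 'rV[R]_d) (Kz : R).
Hypotheses (my : measurable_fun setT y)
  (mz : forall k, measurable_fun setT (fun s => z s 0 k))
  (zK : forall s, `|z s| <= Kz).
Variables (a b : S -> R) (Ka Kb : R).
Hypotheses (ba : bmfun a) (bb : bmfun b).
Hypotheses (aK : forall s, `|a s| <= Ka) (bK : forall s, `|b s| <= Kb).
Let U n theta w := rank_stat X y z a b n theta w.
Let u theta := rank_mean P X y z a b theta.

Lemma rank_stat_tight th0 : u th0 = 0 ->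
  tight P (fun n w => Num.sqrt n%:R * `|U n th0 w|).
Proof.
move=> u0 eps e0.
pose M : R := (Ka * Kb * (2 * Kz)) ^+ 2.
have M0 : 0 <= M by rewrite sqr_ge0.
pose q : R := 4 * d%:R * M / eps + 1.
have q0 : 0 < q.
  rewrite ltr_wpDl//; apply: divr_ge0; last exact: ltW.
  by apply: mulr_ge0 => //; exact: mulr_ge0.
exists (Num.sqrt q); near=> n.
have n0 : (0 < n)%N by near: n; exact: nbhs_infty_gt.
have s0 : 0 < Num.sqrt n%:R :> R by rewrite sqrtr_gt0 ltr0n.
pose x : R := Num.sqrt q / Num.sqrt n%:R.
have x0 : 0 < x by rewrite divr_gt0// sqrtr_gt0.
have k2 l : ex2 P X (fun p => rank_kernel y z a b th0 l p ^+ 2) <= M.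
  have bk := bmfun_rank_kernel my mz zK th0 l ba bb.
  apply: (@le_trans _ _ (ex2 P X (fun=> M))); last by rewrite /ex2 !ex_cst.
  apply: (le_ex2 iidX) => //; [exact: bmfunX|exact: bmfun_cst|].
  by move=> p; apply: sqr_le_sqr_norm; exact: norm_rank_kernel_le.
pose A (l : 'I_d) := [set w | x <= `|n%:R ^- 2 * offdiag_sum X (rank_kernel y z a b th0 l) n w -
   (1 - n%:R^-1) * ex2 P X (rank_kernel y z a b th0 l)|].
have hA l : measurable (A l) /\ pr P (A l) <= 4 * M / (n%:R * x ^+ 2).
  apply: (offdiag_sum_deviation iidX) => //; exact: (bmfun_rank_kernel my mz zK).
have [mU PU] := pr_bigcup_fin P (fun l => (hA l).1).
exists (\bigcup_(l in [set: 'I_d]) A l); split => //.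
  move=> w /=; apply: contraPP => nA; apply/negP; rewrite -leNgt.
  rewrite mulrC -ler_pdivlMr//; apply: norm_row_le; first exact: ltW.
  move=> l; rewrite leNgt; apply/negP => h; apply: nA; exists l => //.
  have : u th0 0 l = 0 by rewrite u0 mxE.
  rewrite mxE => ul; rewrite /A /= ul mulr0 subr0; move/ltW : h; by rewrite mxE.
apply: (le_trans PU); apply: (le_trans (ler_sum _ (fun l _ => (hA l).2))).
rewrite sumr_const card_ord /x exprMn exprVn !sqr_sqrtr ?(ltW q0)//.
have -> : n%:R * (q / n%:R) = q by rewrite mulrC divfK// pnatr_eq0 -lt0n.
rewrite -[_ *+ d]mulr_natr mulrAC ler_pdivrMr//.
rewrite /q mulrDr mulr1 [leRHS](_ : _ = 4 * d%:R * M + eps); last by field; rewrite gt_eqF.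
by rewrite mulrAC lerDl ltW.
Unshelve. all: by end_near. Qed.

Variables (C : R) (L : nat -> R).
Hypothesis C0 : 0 <= C.
Hypothesis anticoncentration : forall theta t h, 0 <= h ->
  pr P [set w | t <= rs y z theta (X 0%N w) <= t + h] <= C * h.
Hypothesis Lsn : (fun n => (1 + L n ^+ 2) ^+ d.+1 / Num.sqrt n%:R) @ \oo --> 0.

(** Equicontinuity at radius L^2 / sqrt n: the bound is O((1 + L^2)^(d+1) / sqrt n). *)
Lemma rank_stat_local_linear th0 (eps : R) : 0 < eps ->
  negl P (fun n => [set w | exists th, `|th - th0| <= L n ^+ 2 / Num.sqrt n%:R /\
    eps / Num.sqrt n%:R < `|U n th w - U n th0 w - (u th - u th0)|]).
Proof.
move=> e0; have [A [n0 [A0 hA]]] :=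
  rank_stat_equicontinuity iidX my mz zK C0 anticoncentration ba bb aK bK th0 e0.
apply: (@negl_bound _ _ _ _ _ (fun n => A * ((1 + L n ^+ 2) ^+ d.+1 / Num.sqrt n%:R))).
  by rewrite -[X in _ --> X](mulr0 A); exact: cvgMr.
near=> n.
have n1 : (n0 <= n)%N by near: n; exact: nbhs_infty_ge.
have n00 : (0 < n)%N by near: n; exact: nbhs_infty_gt.
have s0 : 0 < Num.sqrt n%:R :> R by rewrite sqrtr_gt0 ltr0n.
have r0 : 0 <= L n ^+ 2 / Num.sqrt n%:R by rewrite divr_ge0 ?sqr_ge0.
have [E [mE PE hE]] := hA n _ n1 r0.
exists E; split => //.
  move=> w [th [thr h]]; apply: contrapT => /hE /(_ _ thr).
  by rewrite leNgt h.
apply: (le_trans PE); apply: ler_wpM2l => //.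
rewrite divfK ?gt_eqF// (exprSr _ d) -[leRHS]mulrA; apply: ler_wpM2l.
  by rewrite exprn_ge0// addr_ge0// sqr_ge0.
by rewrite [leRHS]mulrDl mul1r addrC.
Unshelve. all: by end_near. Qed.

End rank_statistic_rates.

Section observations.
Context {dT : measure_display} {T : measurableType dT} {R : realType}.
Variable P : probability T R.
Context {d : nat}.
Variables (Y : nat -> T -> R) (Delta : nat -> T -> bool) (Z : nat -> T -> 'rV[R]_d).
Variables (obs : nat -> T -> bool) (Om W : nat -> T -> R) (K Kz : R).

Local Notation core := (R * bool * borel 'rV[R]_d)%type.
Local Notation unit_data := (R * bool * borel 'rV[R]_d * bool * R * R)%type.

Definition core_of (s : unit_data) : core := s.1.1.1.
Let X i w : unit_data := (Y i w, Delta i w, Z i w, obs i w, Om i w, W i w).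

Definition core_time (x : core) : R := x.1.1.
Definition core_event (x : core) : R := (x.1.2)%:R.
Definition core_cov (x : core) : 'rV[R]_d := clipv Kz x.2.
Definition event (s : unit_data) : R := core_event (core_of s).
Definition weighted_event (s : unit_data) : R := clip K s.1.2 * event s.
Definition weight (s : unit_data) : R := clip K s.2.

Hypotheses (iidX : iid P X).
Hypotheses (ZK : forall i w, `|Z i w| <= Kz) (OmK : forall i w, `|Om i w| <= K)
  (WK : forall i w, `|W i w| <= K).
Let core0 w : core := (Y 0%N w, Delta 0%N w, Z 0%N w).
Hypotheses (Om1 : is_cond_exp P (Om 0%N) core0 (cst 1))
  (W1 : is_cond_exp P (W 0%N) core0 (cst 1)).

Let K0 : 0 <= K. Proof. exact: le_trans (OmK 0%N point). Qed.
Let Kz0 : 0 <= Kz. Proof. exact: le_trans (ZK 0%N point). Qed.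

Lemma measurable_core : measurable_fun setT core_of.
Proof.
exact: (measurableT_comp measurable_fst (measurableT_comp measurable_fst measurable_fst)).
Qed.
Hint Resolve measurable_core : core.

Lemma measurable_core_time : measurable_fun setT core_time.
Proof. exact: (measurableT_comp measurable_fst measurable_fst). Qed.

Lemma bmfun_core_event : bmfun core_event.
Proof.
by apply: bmfun_bool; exact: (measurableT_comp measurable_snd measurable_fst).
Qed.

Lemma measurable_core_cov k : measurable_fun setT (fun x => core_cov x 0 k).
Proof.
rewrite (_ : (fun _ => _) = clip Kz \o (fun x : core => (x.2 : 'rV[R]_d) 0 k)).
  apply: measurableT_comp; first exact: measurable_clip.
  by apply: (measurableT_comp (measurable_coord k)); exact: measurable_snd.
by apply/funext => x; rewrite /core_cov mxE.
Qed.

Lemma norm_core_cov_le x : `|core_cov x| <= Kz.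
Proof. exact: norm_clipv_le. Qed.

Lemma core_cov_data i w : core_cov (core_of (X i w)) = Z i w.
Proof. by rewrite /core_cov /= clipv_id//; exact: ZK. Qed.

Lemma bmfun_event : bmfun event.
Proof. exact: bmfun_comp measurable_core bmfun_core_event. Qed.

Let bmfun_clip (h : unit_data -> R) : measurable_fun setT h -> bmfun (fun s => clip K (h s)).
Proof.
move=> mh; split; first exact: (measurableT_comp (measurable_clip K) mh).
by exists K => s; exact: norm_clip_le.
Qed.

Lemma bmfun_weight : bmfun weight.
Proof. by apply: bmfun_clip; exact: measurable_snd. Qed.

Lemma bmfun_weighted_event : bmfun weighted_event.
Proof.
apply: bmfunM bmfun_event; apply: bmfun_clip.
exact: (measurableT_comp measurable_snd measurable_fst).
Qed.

Lemma norm_weight_le s : `|weight s| <= K.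
Proof. exact: norm_clip_le. Qed.

Lemma norm_event_le s : `|event s| <= 1.
Proof. by rewrite /event /core_event; case: (_.2); rewrite ?normr1 ?normr0. Qed.

Lemma norm_weighted_event_le s : `|weighted_event s| <= K.
Proof.
by rewrite normrM -[leRHS]mulr1; apply: ler_pM => //; [exact: norm_clip_le|exact: norm_event_le].
Qed.

Let mX := iid_measurable iidX.

Lemma measurable_core0 : measurable_fun setT core0.
Proof. exact: (measurableT_comp measurable_core (mX 0%N)). Qed.

Let centred (U : nat -> T -> R) (u : unit_data -> R) :
  is_cond_exp P (U 0%N) core0 (cst 1) -> (forall w, u (X 0%N w) = U 0%N w) -> bmfun u ->
  uncorrelated P X core_of (fun s => u s - 1).
Proof.
move=> [_ _ _ h] uU bu; split; first by apply: bmfunB => //; exact: bmfun_cst.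
move=> B mB; have mc : measurable (core0 @^-1` B).
  by rewrite -[_ @^-1` _]setTI; exact: measurable_core0.
have buX : bmfun (fun w => u (X 0%N w)) by apply: (bmfun_comp _ bu); exact: mX.
have b1 : bmfun (\1_(core0 @^-1` B) : T -> R) by exact: bmfun_indic.
have := h _ mB; rewrite [LHS]integral_mkcond [RHS]integral_mkcond.
have e (g : T -> R) : ((fun w => (g w)%:E) \_ (core0 @^-1` B))%E =
    (fun w => (\1_(core0 @^-1` B) w * g w)%:E).
  by apply/funext => w; rewrite patchE indicE; case: ifP; rewrite ?mul1r ?mul0r.
rewrite !e !integral_bmfun; last 2 first.
- by apply: bmfunM => //; exact: bmfun_cst.
- by apply: bmfunM => //; apply: bmfun_eq buX.
move=> [h1].
rewrite (@ex_eq _ _ _ _ _ (fun w => \1_(core0 @^-1` B) w * U 0%N w - \1_(core0 @^-1` B) w * 1)).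
  rewrite exB ?h1 ?subrr//; first by apply: bmfunM => //; apply: bmfun_eq buX.
  by apply: bmfunM => //; exact: bmfun_cst.
by move=> w; rewrite uU mulrBr.
Qed.

Lemma uncorrelated_weight : uncorrelated P X core_of (fun s => weight s - 1).
Proof.
by apply: (centred (U := W)) => // [w|]; [rewrite /weight/= clip_id|exact: bmfun_weight].
Qed.

Lemma uncorrelated_weighted_event :
  uncorrelated P X core_of (fun s => weighted_event s - event s).
Proof.
have bO : bmfun (fun s : unit_data => clip K s.1.2).
  by apply: bmfun_clip; exact: (measurableT_comp measurable_snd measurable_fst).
have h : uncorrelated P X core_of (fun s => clip K s.1.2 - 1).
  by apply: (centred (U := Om)) => // w; rewrite /= clip_id.
have := uncorrelatedM iidX measurable_core bmfun_core_event h.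
by congr uncorrelated; apply/funext => s; rewrite /weighted_event mulrBl mul1r.
Qed.

Let y s := core_time (core_of s).
Let z s := core_cov (core_of s).
Definition weighted_rank_stat n theta w := rank_stat X y z weighted_event weight n theta w.
Definition plain_rank_stat n theta w := rank_stat X y z event (cst 1) n theta w.
Definition plain_rank_mean theta := rank_mean P X y z event (cst 1) theta.

Let my : measurable_fun setT y.
Proof. exact: measurableT_comp measurable_core_time measurable_core. Qed.
Let mz k : measurable_fun setT (fun s => z s 0 k).
Proof. exact: (measurableT_comp (measurable_core_cov k) measurable_core). Qed.
Let zK s : `|z s| <= Kz.
Proof. exact: norm_core_cov_le. Qed.

Lemma rs_data theta i w : rs y z theta (X i w) = resid theta (Y i w) (Z i w).
Proof. by rewrite /rs /z core_cov_data. Qed.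

Lemma weighted_rank_mean theta :
  rank_mean P X y z weighted_event weight theta = plain_rank_mean theta.
Proof.
apply/rowP => l; rewrite [LHS]mxE [RHS]mxE.
have mcs := measurable_core_time; have mcc := measurable_core_cov.
pose g (p : core * core) : R :=
  (core_time p.1 - dotv theta (core_cov p.1) <= core_time p.2 - dotv theta (core_cov p.2))%R%:R *
  (core_cov p.1 0 l - core_cov p.2 0 l).
have bg : bmfun g.
  apply: bmfunM; first exact: (bmfun_rank_le mcs mcc).
  apply: bmfunB; apply: (bmfun_comp _ (bmfun_z mcc norm_core_cov_le l)).
    exact: measurable_fst.
  exact: measurable_snd.
have := ex2_reweight iidX measurable_core bmfun_weighted_event bmfun_event bmfun_weight
  (bmfun_cst 1) bg uncorrelated_weighted_event uncorrelated_weight.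
move=> h; transitivity (ex2 P X (fun p => weighted_event p.1 * weight p.2 * g (core_of p.1, core_of p.2))).
  by apply: ex_eq => w; apply: ex_eq => w'; rewrite /rank_kernel !mulrA.
rewrite h; apply: ex_eq => w; apply: ex_eq => w'; by rewrite /rank_kernel !mulrA.
Qed.

Let lt_all n (ep : 'I_n -> R) : exists t, forall j, t <= ep j.
Proof.
exists (- \sum_j `|ep j|) => j; rewrite lerNl (bigD1 j)//=.
apply: (@le_trans _ _ `|ep j|); first by rewrite -normrN ler_norm.
by rewrite lerDl sumr_ge0.
Qed.

Let mean_weight n w : R := \sum_(j < n) W j w / n%:R.

Variable L : nat -> R.
Hypotheses (L1 : forall n, (0 < n)%N -> 1 <= L n)
  (Lsn : (fun n => (1 + L n ^+ 2) ^+ d.+1 / Num.sqrt n%:R) @ \oo --> 0)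
  (Lexp : (fun n => (n.+1%:R) ^+ (d + 2) * expR (- L n)) @ \oo --> 0).

Let deviant n := [set w | exists theta t,
  Num.sqrt n%:R * L n <= `|\sum_(j < n) (weight (X j w) - 1) * (t <= rs y z theta (X j w))%R%:R| \/
  Num.sqrt n%:R * L n <= `|\sum_(j < n) (weight (X j w) - 1) * (rs y z theta (X j w) <= t)%R%:R|].

Let negl_deviant : negl P deviant.
Proof.
exact: (residual_deviation iidX measurable_core measurable_core_time measurable_core_cov
  Lexp uncorrelated_weight).
Qed.

Let not_deviant n w : ~ deviant n w -> forall theta t,
  `|\sum_(j < n) (W j w - 1) * (t <= resid theta (Y j w) (Z j w))%R%:R| < Num.sqrt n%:R * L n.
Proof.
move=> nd theta t; rewrite ltNge; apply/negP => h; apply: nd; exists theta, t; left.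
apply: (le_trans h); apply: le_of_eq; congr `|_|.
by apply: eq_bigr => j _; rewrite rs_data /weight/= clip_id.
Qed.

Let total_weight n w : ~ deviant n w -> `|\sum_(j < n) W j w - n%:R| < Num.sqrt n%:R * L n.
Proof.
move=> nd; have [t ht] := lt_all (fun j : 'I_n => resid 0 (Y j w) (Z j w)).
have := not_deviant nd 0 t; congr (`|_| < _).
under eq_bigr do rewrite ht mulr1.
by rewrite sumrB sumr_const card_ord.
Qed.

Lemma mean_weight_rate :
  negl P (fun n => [set w | L n / Num.sqrt n%:R < `|mean_weight n w - 1|]).
Proof.
apply: negl_sub negl_deviant; near=> n; move=> w /= h; apply: contrapT => /total_weight nd.
have n0 : (0 < n)%N by near: n; exact: nbhs_infty_gt.
have nn : 0 < n%:R :> R by rewrite ltr0n.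
move: h; rewrite ltNge => /negP; apply.
rewrite /mean_weight -mulr_suml -[X in _ - X](@divff _ n%:R) ?gt_eqF// -mulrBl normrM.
rewrite (gtr0_norm (x := n%:R^-1)) ?invr_gt0// ler_pdivrMr// (le_trans (ltW nd))// le_eqVlt; apply/orP; left.
apply/eqP; have : Num.sqrt n%:R * Num.sqrt n%:R = n%:R :> R by rewrite -expr2 sqr_sqrtr.
have : 0 < Num.sqrt n%:R :> R by rewrite sqrtr_gt0.
by move: (Num.sqrt _) => s s0 <-; field; rewrite gt_eqF.
Unshelve. all: by end_near. Qed.

Let Lsn_half : \forall n \near \oo, Num.sqrt n%:R * L n <= n%:R.
Proof.
near=> n.
have n0 : (0 < n)%N by near: n; exact: nbhs_infty_gt.
have s0 : 0 < Num.sqrt n%:R :> R by rewrite sqrtr_gt0 ltr0n.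
have : (1 + L n ^+ 2) ^+ d.+1 / Num.sqrt n%:R <= 1.
  by near: n; move/cvgr_le : Lsn; apply.
rewrite ler_pdivrMr// mul1r => h.
rewrite -[leRHS](@sqr_sqrtr _ n%:R)// expr2 ler_pM2l//; apply: le_trans h.
apply: (@le_trans _ _ (1 + L n ^+ 2)); last by rewrite ler_eXnr// lerDl sqr_ge0.
by have := L1 n0; nra.
Unshelve. all: by end_near. Qed.

Lemma score_rank_stat : negl P (fun n => [set w | exists theta,
  K * K * Kz * (L n ^+ 2 / n%:R) <
  `|mean_weight n w *: score Y Delta Z Om W n theta w - weighted_rank_stat n theta w|]).
Proof.
apply: negl_sub negl_deviant; near=> n; move=> w [theta h]; apply: contrapT => nd.
have n0 : (0 < n)%N by near: n; exact: nbhs_infty_gt.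
have nn : 0 < n%:R :> R by rewrite ltr0n.
move: h; rewrite ltNge => /negP; apply.
have sn : Num.sqrt n%:R * L n <= n%:R by near: n; exact: Lsn_half.
have sw0 : \sum_(j < n) W j w != 0.
  apply: contraTneq (total_weight nd) => ->.
  by rewrite sub0r normrN ger0_norm// -leNgt.
have := @self_normalized_sum_cancel R n d (fun i => resid theta (Y i w) (Z i w))
  (fun i => Om i w) (fun i => W i w) (fun i => Delta i w) (fun i => Z i w) K K Kz _
  (fun i => OmK i w) (fun i => WK i w) (fun i => ZK i w) (not_deviant nd theta) sw0.
have -> : (Num.sqrt n%:R * L n) ^+ 2 / n%:R ^+ 2 = L n ^+ 2 / n%:R.
  by rewrite exprMn sqr_sqrtr//; field; rewrite gt_eqF.
apply: le_trans; apply: le_of_eq; congr `|_ - _|.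
apply/rowP => l; rewrite !mxE offdiag_full; last first.
  by move=> s; rewrite /rank_kernel/= subrr mulr0.
congr (_ * _); rewrite summxE; apply: eq_bigr => i _; rewrite summxE; apply: eq_bigr => j _.
rewrite !mxE /rank_kernel /rank_le !rs_data /z !core_cov_data /weighted_event /weight/=.
by rewrite !clip_id.
Unshelve. all: by end_near. Qed.

Lemma rank_stat_weights : negl P (fun n => [set w | exists theta,
  (K + 1) * (Kz + 1) * (L n / Num.sqrt n%:R) <
  `|weighted_rank_stat n theta w - plain_rank_stat n theta w|]).
Proof.
exact: (rank_stat_reweight iidX measurable_core measurable_core_time measurable_core_cov
  norm_core_cov_le L1 Lexp norm_weighted_event_le uncorrelated_weighted_event
  uncorrelated_weight).
Qed.

(** Moving along v lowers the residual with the larger v'Z relative to the other,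
    so a comparison can only switch in the direction that increases its term. *)
Lemma plain_rank_stat_monotone n th0 v s s' w : s <= s' ->
  dotv v (plain_rank_stat n (th0 + s *: v) w) <= dotv v (plain_rank_stat n (th0 + s' *: v) w).
Proof.
move=> ss; have e r : dotv v (plain_rank_stat n (th0 + r *: v) w) =
  n%:R ^- 2 * \sum_(i < n) \sum_(j < n) event (X i w) *
    ((resid (th0 + r *: v) (Y i w) (Z i w) <= resid (th0 + r *: v) (Y j w) (Z j w))%R%:R *
     dotv v (Z i w - Z j w)).
  transitivity (\sum_l n%:R ^- 2 * (\sum_(i < n) \sum_(j < n) v 0 l *
      rank_kernel y z event (cst 1) (th0 + r *: v) l (X i w, X j w))).
    rewrite dotvE; apply: eq_bigr => l _; rewrite mxE offdiag_full; last first.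
      by move=> t; rewrite /rank_kernel/= subrr mulr0.
    by rewrite mulrCA mulr_sumr; congr (_ * _); apply: eq_bigr => i _; rewrite mulr_sumr.
  rewrite -mulr_sumr; congr (_ * _); rewrite exchange_big/=; apply: eq_bigr => i _.
  rewrite exchange_big/=; apply: eq_bigr => j _.
  rewrite dotvE !mulr_sumr; apply: eq_bigr => l _.
  by rewrite /rank_kernel /rank_le !rs_data /z !core_cov_data !mxE /=; ring.
rewrite !e; apply: ler_wpM2l; first by rewrite invr_ge0 exprn_ge0.
apply: ler_sum => i _; apply: ler_sum => j _; apply: ler_wpM2l; first by rewrite ler0n.
have re r : (resid (th0 + r *: v) (Y i w) (Z i w) <= resid (th0 + r *: v) (Y j w) (Z j w)) =
    (resid th0 (Y i w) (Z i w) - resid th0 (Y j w) (Z j w) <= r * dotv v (Z i w - Z j w)).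
  rewrite /resid !dotvDl !dotvZl dotvBr -subr_ge0 -[RHS]subr_ge0; congr (_ <= _); ring.
rewrite !re; move: (dotv v _) (resid _ _ _ - _) => x q.
have [x0|x0] := leP 0 x.
  apply: ler_wpM2r => //; case: (leP q (s * x)) => [h|_]; last exact: ler0n.
  by rewrite (le_trans h)// ler_wpM2r.
apply: ler_wnM2r; first exact: ltW.
case: (leP q (s' * x)) => [h|_]; last exact: ler0n.
by rewrite (le_trans h)// ler_wnM2r// ltW.
Qed.

End observations.

(** * Concentration of residuals and the population score *)

Section density.
Context {d : measure_display} {T : measurableType d} {R : realType}.
Variables (mu nu : {measure set T -> \bar R}) (g : T -> R).
Hypotheses (g0 : forall x, 0 <= g x) (mg : measurable_fun setT g).
Hypothesis nuE : forall A, measurable A -> nu A = (\int[mu]_(x in A) (g x)%:E)%E.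
Import HBNNSimple.

Let simple_density (h : {nnsfun T >-> R}) :
  (\int[nu]_x (h x)%:E = \int[mu]_x (h x * g x)%:E)%E.
Proof.
have nng r x : (0 <= (r * \1_(h @^-1` [set r]) x)%:E :> \bar R)%E.
  exact: nnfun_muleindic_ge0.
have mset r : measurable (h @^-1` [set r]) by exact: measurable_sfunP.
transitivity (\int[nu]_x (\sum_(r \in range h) (r * \1_(h @^-1` [set r]) x)%:E))%E.
  by apply: eq_integral => x _; rewrite fsumEFin// -fimfunE.
rewrite ge0_integral_fsum//; last first.
  by move=> r; apply/measurable_EFinP; apply: measurable_funM.
transitivity (\int[mu]_x (\sum_(r \in range h) (r * \1_(h @^-1` [set r]) x * g x)%:E))%E; last first.
  apply: eq_integral => x _; rewrite [in RHS](fimfunE h x) EFinM -fsumEFin//.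
  rewrite ge0_mule_fsuml => [|r]; last exact: nng.
  by apply: eq_fsbigr => r _; rewrite EFinM.
rewrite ge0_integral_fsum//; last 2 first.
- move=> r; apply/measurable_EFinP; apply: measurable_funM => //.
  exact: measurable_funM.
- by move=> r x _; rewrite EFinM mule_ge0// lee_fin.
apply: eq_fsbigr => r /[!inE] -[x _ rx].
have r0 : 0 <= r by rewrite -rx.
under [RHS]eq_integral => y _ do rewrite -mulrA EFinM.
under [LHS]eq_integral => y _ do rewrite EFinM.
rewrite !ge0_integralZl//.
- congr (_ * _)%E; rewrite integral_indic// setIT nuE// integral_mkcond.
  apply: eq_integral => y _; rewrite patchE indicE; case: ifP => _; rewrite ?mul1r//.
  by rewrite mul0r.
- by apply/measurable_EFinP; apply: measurable_funM.
- by move=> y _; rewrite lee_fin mulr_ge0.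
- exact/measurable_EFinP.
Qed.

Lemma ge0_integral_density (h : T -> R) : (forall x, 0 <= h x) -> measurable_fun setT h ->
  (\int[nu]_x (h x)%:E = \int[mu]_x (h x * g x)%:E)%E.
Proof.
move=> h0 mh; have mhE : measurable_fun setT (EFin \o h) by exact/measurable_EFinP.
pose k := nnsfun_approx measurableT mhE.
have kh x : (k n x)%:E @[n --> \oo] --> (h x)%:E.
  by apply: cvg_nnsfun_approx => // y _; rewrite lee_fin.
have nd x : nondecreasing_seq (fun n => (k n x)%:E).
  by move=> a b ab; rewrite lee_fin; exact/lefP/nd_nnsfun_approx.
have e1 : (\int[nu]_x (k n x)%:E)%E @[n --> \oo] --> (\int[nu]_x (h x)%:E)%E.
  have -> : (\int[nu]_x (h x)%:E = \int[nu]_x limn (fun n => (k n x)%:E))%E.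
    by apply: eq_integral => x _; apply/esym/cvg_lim.
  apply: cvg_monotone_convergence => // [n|n x _].
  - by apply/measurable_EFinP; exact: measurable_funP.
  - by rewrite lee_fin.
have e2 : (\int[mu]_x (k n x * g x)%:E)%E @[n --> \oo] --> (\int[mu]_x (h x * g x)%:E)%E.
  have -> : (\int[mu]_x (h x * g x)%:E = \int[mu]_x limn (fun n => (k n x * g x)%:E))%E.
    apply: eq_integral => x _; apply/esym/cvg_lim => //.
    under eq_fun do rewrite EFinM; rewrite EFinM; apply: cvgeZr => //; exact: kh.
  apply: cvg_monotone_convergence => // [n|n x _|x _ a b ab].
  - by apply/measurable_EFinP; apply: measurable_funM => //; exact: measurable_funP.
  - by rewrite lee_fin mulr_ge0.
  - by rewrite lee_fin ler_wpM2r//; have := nd x _ _ ab; rewrite lee_fin.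
have e3 : (fun n => (\int[nu]_x (k n x)%:E)%E) = (fun n => (\int[mu]_x (k n x * g x)%:E)%E).
  by apply/funext => n; exact: simple_density.
rewrite e3 in e1; exact: cvg_unique e1 e2.
Qed.

Lemma Rintegral_density (h : T -> R) : measurable_fun setT h ->
  \int[nu]_x h x = \int[mu]_x (h x * g x).
Proof.
move=> mh; rewrite /Rintegral; congr fine; rewrite integralE [RHS]integralE.
congr (_ - _)%E.
  have -> : ((fun x => (h x * g x)%:E)^\+)%E = (fun x => (h^\+ x * g x)%:E).
    by apply/funext => x; rewrite funeposE -EFin_max /funrpos maxr_pMl// mul0r.
  rewrite -ge0_integral_density//; last exact: measurable_funrpos.
  by apply: eq_integral => x _; rewrite funeposE -EFin_max.
have -> : ((fun x => (h x * g x)%:E)^\-)%E = (fun x => (h^\- x * g x)%:E).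
  by apply/funext => x; rewrite funenegE -EFinN -EFin_max /funrneg maxr_pMl// mul0r mulNr.
rewrite -ge0_integral_density//; last exact: measurable_funrneg.
by apply: eq_integral => x _; rewrite funenegE -EFinN -EFin_max.
Qed.

End density.

Section ex_swap.
Context {d1 d2 : measure_display} {T1 : measurableType d1} {T2 : measurableType d2}.
Context {R : realType} (P : probability T1 R) (Q : probability T2 R).
Variable f : T1 * T2 -> R.
Hypothesis bf : bmfun f.

Let fx x : bmfun (fun y => f (x, y)).
Proof. by apply: bmfun_comp bf; exact: pair1_measurable. Qed.

Let fy y : bmfun (fun x => f (x, y)).
Proof. by apply: bmfun_comp bf; exact: pair2_measurable. Qed.

Lemma bmfun_ex_r : bmfun (fun x => \int[Q]_y f (x, y)).
Proof.
have := measurable_fubini_F (bmfun_integrable (P \x Q)%E bf).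
rewrite /fubini_F/=; under eq_fun => x do rewrite (integral_bmfun Q (fx x)).
move/measurable_EFinP => m; split => //.
have [K K0 fK] := bmfun_bound bf; exists K => x; exact: norm_ex_bound.
Qed.

Lemma ex_swap : \int[P]_x \int[Q]_y f (x, y) = \int[Q]_y \int[P]_x f (x, y).
Proof.
rewrite {1}/Rintegral [in RHS]/Rintegral; congr fine.
have := Fubini (bmfun_integrable (P \x Q)%E bf) => /=.
under eq_integral => x _ do rewrite (integral_bmfun Q (fx x)).
under [RHS]eq_integral => y _ do rewrite (integral_bmfun P (fy y)).
by [].
Qed.

End ex_swap.

Section cells.
Context {R : realFieldType}.

Lemma cells_sum_le1 (n : nat) (h x : R) : 0 < h ->
  \sum_(j < n) (j%:R * h <= x < j.+1%:R * h)%R%:R <= 1 :> R.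
Proof.
move=> h0; have [j0 j0P|none] := pickP [pred j : 'I_n | j%:R * h <= x < j.+1%:R * h].
  rewrite (bigD1 j0)//= big1 ?addr0 ?lern1 ?leq_b1// => j jj0.
  case: (boolP (_ && _)) => // /andP[j1 j2]; move/andP: j0P => [k1 k2].
  have := le_lt_trans j1 k2; have := le_lt_trans k1 j2.
  rewrite !ltr_pM2r// !ltr_nat !ltnS => a b.
  by move/eqP : jj0; case; apply/val_inj/eqP; rewrite eqn_leq a b.
rewrite big1// => j _; by have /= -> := none j.
Qed.

End cells.

Lemma cells_cover (R : realType) (M h x : R) : 0 < h -> 0 <= x <= M ->
  exists j : 'I_(Num.truncn (M / h)).+1, j%:R * h <= x < j.+1%:R * h.
Proof.
move=> h0 /andP[x0 xM].
have xh0 : 0 <= x / h by rewrite divr_ge0// ltW.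
have jlt : (Num.truncn (x / h) < (Num.truncn (M / h)).+1)%N.
  rewrite ltnS; apply: le_truncn; by rewrite ler_pM2r ?invr_gt0.
exists (Ordinal jlt) => /=; have /andP[a b] := truncn_itv xh0.
by rewrite -ler_pdivlMr// a/= -ltr_pdivrMr.
Qed.

Lemma independent_pairC d (T : measurableType d) (R : realType) (P : probability T R)
    d1 d2 (S1 : measurableType d1) (S2 : measurableType d2) (U : T -> S1) (V : T -> S2) :
  independent_pair P U V -> independent_pair P V U.
Proof. by move=> h B1 B2 m1 m2; rewrite setIC h// muleC. Qed.

Section population.
Context {dT : measure_display} {T : measurableType dT} {R : realType}.
Variable P : probability T R.
Context {d : nat}.
Variables (e C Y : T -> R) (D : T -> bool) (Z : T -> 'rV[R]_d) (th0 : 'rV[R]_d).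
Variables (F : probability R R) (f : R -> R) (g : 'rV[R]_d -> R -> R) (Kz Kf Kg : R).
Local Notation rV := (borel 'rV[R]_d).
Hypotheses (YE : forall w, Y w = Num.min (dotv th0 (Z w) + e w) (C w))
  (DE : forall w, D w = (dotv th0 (Z w) + e w <= C w)).
Hypotheses (me : measurable_fun setT e) (mC : measurable_fun setT C)
  (mZ : measurable_fun setT (Z : T -> rV)).
Hypothesis eF : forall B : set R, measurable B -> P (e @^-1` B) = F B.
Let ZC w : (rV * R)%type := (Z w, C w).
Hypothesis e_ZC : independent_pair P e ZC.
Hypothesis ZK : forall w, `|Z w| <= Kz.
Hypotheses (f0 : forall t, 0 <= f t) (fK : forall t, f t <= Kf)
  (mf : measurable_fun setT f)
  (Ff : forall B : set R, measurable B -> F B = (\int[lebesgue_measure]_(t in B) (f t)%:E)%E).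
Hypotheses (gd : is_cond_density P (S := rV) C Z g) (gK : forall z c, g z c <= Kg).

Let Kz0 : 0 <= Kz. Proof. exact: le_trans (ZK point). Qed.
Let Kf0 : 0 <= Kf. Proof. exact: le_trans (fK 0). Qed.
Let Kg0 : 0 <= Kg. Proof. by case: gd => _ g0 _ _; exact: le_trans (g0 0 0) (gK 0 0). Qed.
Let mZC : measurable_fun setT ZC. Proof. exact: measurable_fun_pair. Qed.

Lemma error_interval_le t h : 0 <= h -> pr F `[t, t + h] <= Kf * h.
Proof.
move=> h0; have : (F `[t, (t + h)%R]%classic <= (Kf * h)%:E)%E.
  rewrite Ff//; apply: (@le_trans _ _ (\int[lebesgue_measure]_(x in `[t, (t + h)%R]%classic) (Kf)%:E)%E).
    apply: ge0_le_integral => //; try by move=> x _; rewrite lee_fin.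
    by apply/measurable_EFinP; exact: measurable_funTS.
  rewrite integral_cst//= lebesgue_measure_itv/= lte_fin ltrDl.
  case: ltP => [_|]; last by move=> h0'; rewrite mule0 lee_fin mulr_ge0.
  by rewrite -EFinB -EFinM lee_fin addrAC subrr add0r.
by rewrite -lee_fin /pr fineK// fin_num_measure.
Qed.

Let measurable_dotv th : measurable_fun setT (fun z : rV => dotv th (z : 'rV[R]_d)).
Proof.
under eq_fun do rewrite dotvE.
apply: measurable_sum => k; apply: measurable_funM; first exact: measurable_cst.
exact: measurable_coord.
Qed.

Let shifted_error th t h : 0 <= h ->
  pr P [set w | t <= e w + dotv th (Z w) <= t + h] <= Kf * h.
Proof.
move=> h0.
have mb : measurable_fun setT (fun p : (rV * R) * R =>
    (t <= p.2 + dotv th (p.1.1 : 'rV[R]_d)) && (p.2 + dotv th (p.1.1 : 'rV[R]_d) <= t + h)).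
  have ms : measurable_fun setT (fun p : (rV * R) * R => p.2 + dotv th (p.1.1 : 'rV[R]_d)).
    apply: measurable_funD; first exact: measurable_snd.
    apply: (measurableT_comp (measurable_dotv th)).
    exact: (measurableT_comp measurable_fst measurable_fst).
  by apply: measurable_and; apply: measurable_fun_ler => //; exact: measurable_cst.
have bb := @bmfun_bool _ _ R _ mb.
have mZe : measurable_fun setT (fun w => (ZC w, e w)) by exact: measurable_fun_pair.
rewrite -(@ex_bool _ _ _ P (fun w => (t <= e w + dotv th (Z w)) && (e w + dotv th (Z w) <= t + h))); last first.
  exact: (measurableT_comp mb mZe).
have := indep_Fubini mZC me (independent_pairC e_ZC) bb => /= ->.
rewrite -[leRHS](ex_cst P); apply: le_ex; last 1 first.
- move=> w; rewrite ex_bool; last first.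
    exact: (measurableT_comp (measurableT_comp mb (pair1_measurable (ZC w))) me).
  apply: (le_trans _ (error_interval_le (t - dotv th (Z w)) h0)).
  rewrite /pr -eF//= le_eqVlt; apply/orP; left; apply/eqP; congr (fine (P _)).
  apply/seteqP; split => w' /=; rewrite in_itv/=.
    by move=> /andP[a b]; apply/andP; split; lra.
  by move=> /andP[a b]; apply/andP; split; lra.
- have := bmfun_section P mZC me bb => h1; exact: (bmfun_comp mZC h1).
- exact: bmfun_cst.
Qed.

Let censoring_cell (A : set rV) a b : measurable A -> a <= b ->
  pr P (Z @^-1` A `&` C @^-1` `[a, b]) <= Kg * (b - a) * pr P (Z @^-1` A).
Proof.
move=> mA ab; have [mg g0 _ /(_ `[a, b]%classic)] := gd.
case => // mgJ _ _ /(_ _ mA) h.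
have mZA : measurable (Z @^-1` A) by rewrite -[_ @^-1` _]setTI; exact: mZ.
have mCJ : measurable (C @^-1` `[a, b]) by rewrite -[_ @^-1` _]setTI; exact: mC.
have h1 : P (Z @^-1` A `&` C @^-1` `[a, b]) =
    (\int[P]_(w in Z @^-1` A) (\1_(`[a, b]%classic : set R) (C w))%:E)%E.
  rewrite (_ : (fun w => _) = (fun w => (\1_(C @^-1` `[a, b]) w)%:E)); last first.
    by apply/funext => w; rewrite !indicE.
  by rewrite integral_indic// setIC.
rewrite -lee_fin -prE ?h1 ?h; last by exact: measurableI.
apply: (@le_trans _ _ (\int[P]_(w in Z @^-1` A) (Kg * (b - a))%:E)%E); last first.
  by rewrite integral_cst//= [leRHS]EFinM -(prE P mZA).
have mgz z : measurable_fun setT (g z).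
  exact: (measurableT_comp mg (pair1_measurable (z : rV))).
have Jle z : 0 <= \int[lebesgue_measure]_(c in `[a, b]) g z c <= Kg * (b - a).
  have gJ : (\int[lebesgue_measure]_(c in `[a, b]) (g z c)%:E <= (Kg * (b - a))%:E)%E.
    apply: (@le_trans _ _ (\int[lebesgue_measure]_(x in `[a, b]) (Kg)%:E)%E).
      apply: ge0_le_integral => //; try by move=> x _; rewrite lee_fin.
      by apply/measurable_EFinP; apply: measurable_funTS; exact: mgz.
    rewrite integral_cst//= lebesgue_measure_itv/= lte_fin.
    case: ltP => [_|]; last by move=> h0'; rewrite mule0 lee_fin mulr_ge0// subr_ge0.
    by rewrite -EFinB -EFinM.
  have gJ0 : (0 <= \int[lebesgue_measure]_(c in `[a, b]) (g z c)%:E)%E.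
    by apply: integral_ge0 => x _; rewrite lee_fin.
  rewrite /Rintegral fine_ge0//= -lee_fin fineK// ge0_fin_numE//.
  exact: le_lt_trans gJ (ltry _).
apply: ge0_le_integral => //.
- by move=> w _; rewrite lee_fin; have /andP[] := Jle (Z w).
- by apply/measurable_EFinP; apply: measurable_funTS; exact: (measurableT_comp mgJ mZ).
- by move=> w _; rewrite lee_fin; have /andP[] := Jle (Z w).
Qed.

Let shifted_censoring th t h : 0 < h ->
  pr P [set w | t <= C w - dotv th (Z w) <= t + h] <= 2 * Kg * h.
Proof.
move=> h0; pose M : R := d%:R * `|th| * Kz.
have thM w : `|dotv th (Z w)| <= M.
  by apply: (le_trans (norm_dotv_le _ _)); rewrite ler_wpM2l// mulr_ge0.
pose N := (Num.truncn (2 * M / h)).+1.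
pose cell (j : 'I_N) : set rV :=
  [set z | j%:R * h <= dotv th (z : 'rV[R]_d) + M < j.+1%:R * h].
have mcell0 (j : 'I_N) : measurable_fun setT
    (fun z : rV => (j%:R * h <= dotv th (z : 'rV[R]_d) + M) && (dotv th (z : 'rV[R]_d) + M < j.+1%:R * h)).
  have ms : measurable_fun setT (fun z : rV => dotv th (z : 'rV[R]_d) + M).
    by apply: measurable_funD => //; exact: measurable_cst.
  apply: measurable_and; first by apply: measurable_fun_ler => //; exact: measurable_cst.
  by apply: measurable_fun_ltr => //; exact: measurable_cst.
have mcell j : measurable (cell j) by exact: measurable_set_bool.
pose lo (j : 'I_N) : R := t - M + j%:R * h.
pose E (j : 'I_N) : set T := Z @^-1` cell j `&` C @^-1` `[lo j, lo j + 2 * h].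
have mZcell j : measurable (Z @^-1` cell j) by rewrite -[_ @^-1` _]setTI; exact: mZ.
have mE j : measurable (E j).
  by apply: measurableI => //; rewrite -[_ @^-1` _]setTI; exact: mC.
have [mU PU] := pr_bigcup_fin P mE.
have sub : [set w | t <= C w - dotv th (Z w) <= t + h] `<=` \bigcup_(j in [set: 'I_N]) E j.
  move=> w /= /andP[a b].
  have xM : 0 <= dotv th (Z w) + M <= 2 * M.
    by have := thM w; rewrite ler_norml => /andP[p q]; apply/andP; split; lra.
  have [j /andP[j1 j2]] := cells_cover h0 xM.
  exists j => //; split; first by rewrite /cell/= j1.
  rewrite /= in_itv/= /lo; move: j2; rewrite -natr1 mulrDl mul1r => j2.
  by apply/andP; split; lra.
have mB : measurable [set w | t <= C w - dotv th (Z w) <= t + h].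
  have ms : measurable_fun setT (fun w => C w - dotv th (Z w)).
    by apply: measurable_funB => //; exact: (measurableT_comp (measurable_dotv th) mZ).
  apply: measurable_set_bool; apply: measurable_and; apply: measurable_fun_ler => //; exact: measurable_cst.
apply: (le_trans (le_pr P mB mU sub)); apply: (le_trans PU).
apply: (@le_trans _ _ (\sum_j Kg * (2 * h) * pr P (Z @^-1` cell j))).
  apply: ler_sum => j _; have := @censoring_cell (cell j) (lo j) (lo j + 2 * h) (mcell j).
  rewrite (_ : lo j + 2 * h - lo j = 2 * h); last by rewrite addrAC subrr add0r.
  by apply; rewrite lerDl mulr_ge0// ltW.
rewrite -mulr_sumr (_ : 2 * Kg * h = Kg * (2 * h) * 1); last by ring.
apply: ler_wpM2l; first by rewrite mulr_ge0// mulr_ge0// ltW.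
under eq_bigr => j _ do rewrite -(ex_bool P (measurableT_comp (mcell0 j) mZ)).
rewrite -ex_sum => [|j]; last first.
  by apply: bmfun_bool; exact: (measurableT_comp (mcell0 j) mZ).
rewrite -[leRHS](ex_cst P); apply: le_ex; last by move=> w; exact: cells_sum_le1.
  apply: bmfun_sum => j; apply: bmfun_bool; exact: (measurableT_comp (mcell0 j) mZ).
exact: bmfun_cst.
Qed.

(** The residual is the smaller of two variables, one with a bounded density and
    one with a bounded conditional density; for the latter the condition is
    discretised by cutting the range of the shift into cells of the width of the
    interval. *)
Lemma residual_anticoncentration th t h : 0 <= h ->
  pr P [set w | t <= resid th (Y w) (Z w) <= t + h] <= (Kf + 2 * Kg) * h.
Proof.
have main h' : 0 < h' ->
    pr P [set w | t <= resid th (Y w) (Z w) <= t + h'] <= (Kf + 2 * Kg) * h'.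
  move=> h0.
  pose A := [set w | t <= e w + dotv (th0 - th) (Z w) <= t + h'].
  pose B := [set w | t <= C w - dotv th (Z w) <= t + h'].
  have mdZ v : measurable_fun setT (fun w => dotv v (Z w)).
    exact: (measurableT_comp (measurable_dotv v) mZ).
  have mitv (x : T -> R) : measurable_fun setT x -> measurable [set w | t <= x w <= t + h'].
    move=> mx; apply: measurable_set_bool.
    by apply: measurable_and; apply: measurable_fun_ler => //; exact: measurable_cst.
  have mA : measurable A by apply: mitv; exact: measurable_funD.
  have mB : measurable B by apply: mitv; exact: measurable_funB.
  have mY : measurable_fun setT Y.
    rewrite (_ : Y = (fun w => dotv th0 (Z w) + e w) \min C); last exact/funext.
    by apply: measurable_minr => //; exact: measurable_funD.
  have mR : measurable [set w | t <= resid th (Y w) (Z w) <= t + h'].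
    by apply: mitv; exact: measurable_funB.
  apply: (@le_trans _ _ (pr P (A `|` B))).
    apply: le_pr => //; first exact: measurableU.
    move=> w /=; rewrite /resid YE; rewrite /Num.min; case: ifP => _ hw.
      by left; rewrite /A/= dotvBl; move: hw => /andP[p q]; apply/andP; split; lra.
    by right.
  apply: (le_trans (pr_setU P mA mB)); rewrite mulrDl; apply: lerD.
    by apply: shifted_error; exact: ltW.
  exact: shifted_censoring.
rewrite le_eqVlt => /orP[/eqP <-|]; last exact: main.
rewrite mulr0; apply/ler_addgt0Pr => x x0; rewrite add0r.
have K10 : 0 < Kf + 2 * Kg + 1 by rewrite ltr_wpDl// addr_ge0// mulr_ge0.
have y0 : 0 < x / (Kf + 2 * Kg + 1) by rewrite divr_gt0.
have mR (k : R) : measurable [set w | t <= resid th (Y w) (Z w) <= t + k].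
  have mdZ v : measurable_fun setT (fun w => dotv v (Z w)).
    exact: (measurableT_comp (measurable_dotv v) mZ).
  have mY : measurable_fun setT Y.
    rewrite (_ : Y = (fun w => dotv th0 (Z w) + e w) \min C); last exact/funext.
    by apply: measurable_minr => //; exact: measurable_funD.
  apply: measurable_set_bool; apply: measurable_and; apply: measurable_fun_ler;
    (exact: measurable_cst || exact: measurable_funB).
apply: (le_trans _ (le_trans (main _ y0) _)).
  apply: le_pr => // w /= /andP[p q]; rewrite p/= (le_trans q)// lerD2l ltW//.
rewrite mulrA ler_pdivrMr// mulrC ler_wpM2l ?(ltW x0)//; lra.
Qed.

End population.

Section at_risk_means.
Context {dT : measure_display} {T : measurableType dT} {R : realType}.
Variable P : probability T R.
Context {d : nat}.
Variables (Y : nat -> T -> R) (D : nat -> T -> bool) (Z : nat -> T -> 'rV[R]_d) (Kz : R).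
Hypotheses (mY : measurable_fun setT (Y 0%N))
  (mZ : forall k, measurable_fun setT (fun w => Z 0%N w 0 k))
  (mD : measurable_fun setT (D 0%N)) (ZK : forall w, `|Z 0%N w| <= Kz).

Let Kz0 : 0 <= Kz. Proof. exact: le_trans (ZK point). Qed.
Let ep th w := resid th (Y 0%N w) (Z 0%N w).

Lemma bmfun_cov k : bmfun (fun w => Z 0%N w 0 k).
Proof. by split=> //; exists Kz => w; exact: le_trans (norm_coord_le _ _) (ZK w). Qed.

Lemma bmfun_event0 : bmfun (fun w => (D 0%N w)%:R : R).
Proof. exact: bmfun_bool. Qed.

Lemma measurable_resid th : measurable_fun setT (ep th).
Proof.
apply: measurable_funB => //; under eq_fun do rewrite dotvE.
apply: measurable_sum => k; apply: measurable_funM => //; exact: measurable_cst.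
Qed.

Lemma bmfun_at_risk t th : bmfun (at_risk Y Z t th 0%N).
Proof.
apply: bmfun_bool; apply: measurable_fun_ler; first exact: measurable_cst.
exact: measurable_resid.
Qed.

Lemma rho0E t th : rho0 P Y Z t th = \int[P]_w at_risk Y Z t th 0%N w.
Proof.
rewrite /at_risk ex_bool//; apply: measurable_fun_ler; first exact: measurable_cst.
exact: measurable_resid.
Qed.

Lemma rho0_ge0_le1 t th : 0 <= rho0 P Y Z t th <= 1.
Proof.
rewrite rho0E ex_ge0/=; last by move=> w; rewrite /at_risk.
rewrite -[leRHS](ex_cst P); apply: le_ex; [exact: bmfun_at_risk|exact: bmfun_cst|].
by move=> w; rewrite /at_risk lern1 leq_b1.
Qed.

Let num t th k := \int[P]_w (at_risk Y Z t th 0%N w * Z 0%N w 0 k).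

Let norm_num_le t th k : `|num t th k| <= rho0 P Y Z t th * Kz.
Proof.
rewrite rho0E -exZr; last exact: bmfun_at_risk.
apply: norm_ex_le.
- by apply: bmfunM; [exact: bmfun_at_risk|exact: bmfun_cov].
- by apply: bmfunM; [exact: bmfun_at_risk|exact: bmfun_cst].
move=> w; rewrite normrM ger0_norm; last by rewrite /at_risk.
apply: ler_wpM2l; first by rewrite /at_risk.
exact: le_trans (norm_coord_le _ _) (ZK w).
Qed.

Let eta0E t th k : eta0 P Y Z t th 0 k = (rho0 P Y Z t th)^-1 * num t th k.
Proof.
rewrite /eta0 mxE -rho0E [X in _ * X]mxE; congr (_ * _).
by apply: ex_eq => w; rewrite mxE.
Qed.

(** At a time that no residual exceeds the quotient is 0 / 0, and then both sides
    vanish. *)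
Lemma rho0_eta0 t th k : rho0 P Y Z t th * eta0 P Y Z t th 0 k =
  \int[P]_w (at_risk Y Z t th 0%N w * Z 0%N w 0 k).
Proof.
rewrite eta0E; have [r0|r0] := eqVneq (rho0 P Y Z t th) 0; last by rewrite mulVKf.
have n0 : num t th k = 0.
  by apply/eqP; rewrite -normr_le0 (le_trans (norm_num_le t th k))// r0 mul0r.
by rewrite r0 mul0r -/(num t th k) n0.
Qed.

Lemma norm_eta0_le t th k : `|eta0 P Y Z t th 0 k| <= Kz.
Proof.
have /andP[r0 _] := rho0_ge0_le1 t th.
rewrite eta0E; have [->|rn] := eqVneq (rho0 P Y Z t th) 0.
  by rewrite invr0 mul0r normr0.
have rp : 0 < rho0 P Y Z t th by rewrite lt0r rn.
by rewrite normrM gtr0_norm ?invr_gt0// mulrC ler_pdivrMr// mulrC norm_num_le.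
Qed.

Let bmfun_risk_mean th (h : T -> R) : bmfun h ->
  bmfun (fun t => \int[P]_w (at_risk Y Z t th 0%N w * h w)).
Proof.
move=> bh; have bf : bmfun (fun p : R * (R * R) => (p.1 <= p.2.1)%R%:R * clip (sval (cid (proj2 bh))) p.2.2).
  apply: bmfunM.
    apply: bmfun_bool; apply: measurable_fun_ler; first exact: measurable_fst.
    exact: (measurableT_comp measurable_fst measurable_snd).
  have K0 : 0 <= sval (cid (proj2 bh)).
    by case: cid => K /= hK; exact: le_trans (hK point).
  split; last by exists (sval (cid (proj2 bh))) => p; exact: norm_clip_le.
  apply: (measurableT_comp (measurable_clip _)).
  exact: (measurableT_comp measurable_snd measurable_snd).
have mV : measurable_fun setT (fun w => (ep th w, h w)).
  by apply: measurable_fun_pair; [exact: measurable_resid|exact: (proj1 bh)].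
apply: bmfun_eq (bmfun_section P (measurable_resid th) mV bf) => t.
by apply: ex_eq => w /=; case: cid => K /= hK; rewrite clip_id.
Qed.

Lemma bmfun_rho0 th : bmfun (fun t => rho0 P Y Z t th).
Proof.
apply: bmfun_eq (bmfun_risk_mean th (bmfun_cst 1)) => t.
by rewrite rho0E; apply: ex_eq => w; rewrite mulr1.
Qed.

Lemma bmfun_eta0 th k : bmfun (fun t => eta0 P Y Z t th 0 k).
Proof.
split; last by exists Kz => t; exact: norm_eta0_le.
rewrite (_ : (fun t => _) = (fun t => (rho0 P Y Z t th)^-1 * num t th k)); last first.
  by apply/funext => t; rewrite eta0E.
apply: measurable_funM; last exact: (proj1 (bmfun_risk_mean th (bmfun_cov k))).
rewrite (_ : (fun t => _) = (@powR R ^~ (-1)) \o (fun t => rho0 P Y Z t th)).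
  by apply: measurableT_comp; [exact: measurable_powR|exact: (proj1 (bmfun_rho0 th))].
by apply/funext => t /=; rewrite powR_inv1//; have /andP[] := rho0_ge0_le1 t th.
Qed.

Lemma Psi0_coord th k : Psi0 P Y D Z th 0 k =
  \int[P]_w ((D 0%N w)%:R * \int[P]_w' (at_risk Y Z (ep th w) th 0%N w' *
    (Z 0%N w 0 k - Z 0%N w' 0 k))).
Proof.
have e w : \int[P]_w' (at_risk Y Z (ep th w) th 0%N w' * (Z 0%N w 0 k - Z 0%N w' 0 k)) =
    rho0 P Y Z (ep th w) th * Z 0%N w 0 k - rho0 P Y Z (ep th w) th * eta0 P Y Z (ep th w) th 0 k.
  rewrite rho0_eta0 rho0E -exZr; last exact: bmfun_at_risk.
  rewrite -exB; [by apply: ex_eq => w'; rewrite mulrBr| |].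
  - by apply: bmfunM; [exact: bmfun_at_risk|exact: bmfun_cst].
  - by apply: bmfunM; [exact: bmfun_at_risk|exact: bmfun_cov].
rewrite /Psi0 /Psi mxE; apply: ex_eq => w; rewrite e mxE.
rewrite (_ : (_ - eta0 _ _ _ _ _) 0 k = Z 0%N w 0 k - eta0 P Y Z (ep th w) th 0 k); last by rewrite !mxE.
rewrite -/(ep th w); ring.
Qed.

End at_risk_means.

Section martingale.
Context {dT : measure_display} {T : measurableType dT} {R : realType}.
Variable P : probability T R.
Context {d : nat}.
Variables (Y : nat -> T -> R) (D : nat -> T -> bool) (Z : nat -> T -> 'rV[R]_d).
Variables (e C : T -> R) (th0 : 'rV[R]_d) (F : probability R R) (Kz : R).
Local Notation rV := (borel 'rV[R]_d).
Hypotheses (YE : forall w, Y 0%N w = Num.min (dotv th0 (Z 0%N w) + e w) (C w))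
  (DE : forall w, D 0%N w = (dotv th0 (Z 0%N w) + e w <= C w)).
Hypotheses (me : measurable_fun setT e) (mC : measurable_fun setT C)
  (mZ : measurable_fun setT (Z 0%N : T -> rV)).
Hypothesis eF : forall B : set R, measurable B -> P (e @^-1` B) = F B.
Let ZC w : (rV * R)%type := (Z 0%N w, C w).
Hypothesis e_ZC : independent_pair P e ZC.
Hypothesis ZK : forall w, `|Z 0%N w| <= Kz.

Implicit Types (u : R -> R) (v : rV -> R).

Let Kz0 : 0 <= Kz. Proof. exact: le_trans (ZK point). Qed.
Let mZC : measurable_fun setT ZC. Proof. exact: measurable_fun_pair. Qed.
Let mZk k : measurable_fun setT (fun w => Z 0%N w 0 k).
Proof. exact: (measurableT_comp (measurable_coord k) mZ). Qed.

Let mdot th : measurable_fun setT (fun z : rV => dotv th (z : 'rV[R]_d)).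
Proof.
under eq_fun do rewrite dotvE.
apply: measurable_sum => k; apply: measurable_funM; first exact: measurable_cst.
exact: measurable_coord.
Qed.

Let mY : measurable_fun setT (Y 0%N).
Proof.
rewrite (_ : Y 0%N = (fun w => dotv th0 (Z 0%N w) + e w) \min C); last exact/funext.
apply: measurable_minr => //; apply: measurable_funD => //.
exact: (measurableT_comp (mdot th0) mZ).
Qed.

Let mD : measurable_fun setT (D 0%N).
Proof.
rewrite (_ : D 0%N = fun w => dotv th0 (Z 0%N w) + e w <= C w); last exact/funext.
apply: measurable_fun_ler => //; apply: measurable_funD => //.
exact: (measurableT_comp (mdot th0) mZ).
Qed.

Definition resid_censoring (x : rV * R) : R := x.2 - dotv th0 (x.1 : 'rV[R]_d).
Let ep w := resid th0 (Y 0%N w) (Z 0%N w).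
Let cens t (v : rV -> R) := \int[P]_w ((t <= resid_censoring (ZC w))%R%:R * v (Z 0%N w)).
Let surv t := pr F `[t, +oo[%classic.

Let resid_min w : ep w = Num.min (e w) (resid_censoring (ZC w)).
Proof.
rewrite /ep /resid YE /resid_censoring /= /Num.min.
case: (ltP (dotv th0 (Z 0%N w) + e w)) => h1; case: ltP => h2 //; move: h1 h2; lra.
Qed.

Let event_cens w : D 0%N w = (e w <= resid_censoring (ZC w)).
Proof. by rewrite DE /resid_censoring /= lerBrDl. Qed.

Let measurable_censoring : measurable_fun setT resid_censoring.
Proof.
apply: measurable_funB; first exact: measurable_snd.
exact: (measurableT_comp (mdot th0) measurable_fst).
Qed.

Let bmfun_le_cens : bmfun (fun p : R * (rV * R) => (p.1 <= resid_censoring p.2)%R%:R : R).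
Proof.
apply: bmfun_bool; apply: measurable_fun_ler; first exact: measurable_fst.
exact: (measurableT_comp measurable_censoring measurable_snd).
Qed.

Let bmfun_v1 (v : rV -> R) : bmfun v -> bmfun (fun x : rV * R => v x.1).
Proof. by move=> bv; apply: bmfun_comp bv; exact: measurable_fst. Qed.

Let bmfun_le_cens_v v : bmfun v ->
  bmfun (fun p : R * (rV * R) => (p.1 <= resid_censoring p.2)%R%:R * v p.2.1).
Proof.
move=> bv; apply: bmfunM => //; apply: (bmfun_comp _ (bmfun_v1 bv)).
exact: measurable_snd.
Qed.

Let bmfun_cens_at t v : bmfun v ->
  bmfun (fun x : rV * R => (t <= resid_censoring x)%R%:R * v x.1).
Proof.
move=> bv; apply: bmfunM; last exact: bmfun_v1.
by apply: bmfun_bool; apply: measurable_fun_ler => //; exact: measurable_cst.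
Qed.

Let bmfun_cens v : bmfun v -> bmfun (fun t => cens t v).
Proof. by move=> bv; exact: (bmfun_section P me mZC (bmfun_le_cens_v bv)). Qed.

(** An uncensored residual is an error that precedes its own censoring time,
    which is independent of it. *)
Lemma event_mean u v : bmfun u -> bmfun v ->
  \int[P]_w ((D 0%N w)%:R * (u (ep w) * v (Z 0%N w))) = \int[F]_t (u t * cens t v).
Proof.
move=> bu bv.
have bu1 : bmfun (fun p : R * (rV * R) => u p.1) by apply: bmfun_comp bu; exact: measurable_fst.
have bf : bmfun (fun p : R * (rV * R) => u p.1 * ((p.1 <= resid_censoring p.2)%R%:R * v p.2.1)).
  by apply: bmfunM => //; exact: bmfun_le_cens_v.
have := indep_Fubini me mZC e_ZC bf => /= h.
transitivity (\int[P]_w (u (e w) * ((e w <= resid_censoring (ZC w))%R%:R * v (Z 0%N w)))).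
  apply: ex_eq => w; rewrite event_cens resid_min.
  case: leP => h'; rewrite ?(min_idPl h'); last by rewrite !mul0r mulr0.
  by rewrite !mul1r.
rewrite h.
have bF := bmfun_section P me mZC bf.
rewrite (@law_eq_ex _ _ _ _ _ P F _ _ e (fun x => x) _ me (@measurable_id _ _ _) eF bF).
apply: ex_eq => t /=; rewrite /cens exZ//.
apply: (bmfun_comp mZC (h := fun x => (t <= resid_censoring x)%R%:R * v x.1)).
exact: bmfun_cens_at.
Qed.

Let bmfun_le t : bmfun (fun x : R => (t <= x)%R%:R : R).
Proof. by apply: bmfun_bool; apply: measurable_fun_ler. Qed.

Lemma risk_mean t v : bmfun v ->
  \int[P]_w (at_risk Y Z t th0 0%N w * v (Z 0%N w)) = surv t * cens t v.
Proof.
move=> bv; rewrite /cens.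
have bg := bmfun_cens_at t bv.
have := indep_exM me mZC e_ZC (bmfun_le t) bg => /= h.
have -> : surv t = \int[P]_w (t <= e w)%R%:R.
  rewrite ex_bool; last by apply: measurable_fun_ler => //; exact: measurable_cst.
  rewrite /surv /pr -eF//; congr (fine (P _)).
  by apply/seteqP; split => w /=; rewrite in_itv/= andbT.
rewrite -h; apply: ex_eq => w; rewrite /at_risk -/(ep w) resid_min le_min.
by case: (t <= e w); rewrite ?mul1r// ?mul0r.
Qed.

Let bmfun_surv : bmfun surv.
Proof.
have -> : surv = (fun t => \int[P]_w (t <= e w)%R%:R).
  apply/funext => t; rewrite ex_bool; last by apply: measurable_fun_ler => //; exact: measurable_cst.
  rewrite /surv /pr -eF//; congr (fine (P _)).
  by apply/seteqP; split => w /=; rewrite in_itv/= andbT.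
have bf : bmfun (fun p : R * R => (p.1 <= p.2)%R%:R : R).
  by apply: bmfun_bool; apply: measurable_fun_ler; [exact: measurable_fst|exact: measurable_snd].
exact: (bmfun_section P me me bf).
Qed.

Let past t : R := (surv t == 0)%:R.

Let bmfun_past : bmfun past.
Proof.
apply: bmfun_bool; apply: measurable_fun_eqr; first exact: (proj1 bmfun_surv).
exact: measurable_cst.
Qed.

(* Of two independent errors beyond the support one would be at least as large
   as the other, which has probability 0 *)
Let ex_past : \int[F]_t past t = 0.
Proof.
have bp : bmfun (fun p : R * R => past p.1 * (p.1 <= p.2)%R%:R).
  apply: bmfunM; first by apply: (bmfun_comp _ bmfun_past); exact: measurable_fst.
  by apply: bmfun_bool; apply: measurable_fun_ler; [exact: measurable_fst|exact: measurable_snd].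
have bp' : bmfun (fun p : R * R => past p.2 * (p.2 <= p.1)%R%:R).
  apply: bmfunM; first by apply: (bmfun_comp _ bmfun_past); exact: measurable_snd.
  by apply: bmfun_bool; apply: measurable_fun_ler; [exact: measurable_snd|exact: measurable_fst].
have bpp : bmfun (fun p : R * R => past p.1 * past p.2).
  apply: bmfunM; first by apply: (bmfun_comp _ bmfun_past); exact: measurable_fst.
  by apply: (bmfun_comp _ bmfun_past); exact: measurable_snd.
have sx (f : R * R -> R) s : bmfun f -> bmfun (fun t => f (s, t)).
  by move=> bf; apply: bmfun_comp bf; exact: pair1_measurable.
have z1 s : \int[F]_t (past s * (s <= t)%R%:R) = 0.
  rewrite exZ//; rewrite (ex_bool F (b := fun t => s <= t)); last by apply: measurable_fun_ler.
  rewrite /past (_ : [set t | s <= t] = `[s, +oo[%classic); last first.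
    by apply/seteqP; split => t /=; rewrite in_itv/= andbT.
  by rewrite -/(surv s); case: eqP => [->|]; rewrite ?mulr0 ?mul0r.
have z2 : \int[F]_s \int[F]_t (past t * (t <= s)%R%:R) = 0.
  rewrite (ex_swap F F bp')/=.
  by transitivity (\int[F]_t (0 : R)); [exact: ex_eq|exact: ex_cst].
have : \int[F]_s \int[F]_t (past s * past t) <= 0.
  have <- : \int[F]_s (\int[F]_t (past s * (s <= t)%R%:R) + \int[F]_t (past t * (t <= s)%R%:R)) = 0.
    rewrite exD ?z2; last exact: (bmfun_ex_r F F bp'); last exact: (bmfun_ex_r F F bp).
    by rewrite addr0; transitivity (\int[F]_t (0 : R)); [exact: ex_eq|exact: ex_cst].
  apply: le_ex.
  - exact: (bmfun_ex_r F F bpp).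
  - by apply: bmfunD; [exact: (bmfun_ex_r F F bp)|exact: (bmfun_ex_r F F bp')].
  move=> s; rewrite -exD; [|exact: sx bp|exact: sx bp'].
  apply: le_ex; [exact: sx bpp|by apply: bmfunD; [exact: sx bp|exact: sx bp']|].
  move=> t; rewrite /past; case: (_ == _); case: (_ == _); rewrite ?mulr0 ?mul0r ?mul1r ?addr0 ?add0r//.
  by case/orP: (le_total s t) => ->; rewrite ?lerDl ?lerDr ler0n.
under ex_eq => s do rewrite (exZ _ _ bmfun_past).
rewrite exZr// -expr2 => h; apply/eqP; rewrite -sqrf_eq0 eq_le h/=; exact: sqr_ge0.
Qed.

Let cens_hazard u v : bmfun u -> bmfun v ->
  \int[F]_t (u t * cens t v) =
  \int[F]_t (u t * (surv t * cens t v) * inv_survival F t).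
Proof.
move=> bu bv; have bc := bmfun_cens bv.
have bz : bmfun (fun t => u t * cens t v * past t) by apply: bmfunM => //; exact: bmfunM.
have pz : \int[F]_t (u t * cens t v * past t) = 0.
  have [K K0 uK] := bmfun_bound (bmfunM bu bc).
  apply/eqP; rewrite -normr_le0; apply: (@le_trans _ _ (\int[F]_t (K * past t))).
    apply: norm_ex_le => //; first exact: bmfunZ.
    move=> t; rewrite normrM; apply: ler_pM => //.
    by rewrite /past; case: (_ == _); rewrite ?normr1 ?normr0.
  by rewrite exZ// ex_past mulr0.
rewrite -[LHS]subr0 -pz -exB//; last exact: bmfunM.
apply: ex_eq => t; rewrite /past /inv_survival -/(pr F _) -/(surv t).
case: eqP => [->|/eqP n0]; last by rewrite mulr0 subr0; field.
by rewrite mulr1 subrr mul0r mulr0 mul0r.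
Qed.

Let vk k : rV -> R := fun z => clip Kz ((z : 'rV[R]_d) 0 k).
Let bmfun_vk k : bmfun (vk k).
Proof.
split; first exact: (measurableT_comp (measurable_clip Kz) (measurable_coord k)).
by exists Kz => z; exact: norm_clip_le.
Qed.
Let vkE k w : vk k (Z 0%N w) = Z 0%N w 0 k.
Proof. by rewrite /vk clip_id//; exact: le_trans (norm_coord_le _ _) (ZK w). Qed.

Let rho0_surv t : rho0 P Y Z t th0 = surv t * cens t (cst 1).
Proof.
rewrite (rho0E P mY mZk) -risk_mean; last exact: bmfun_cst.
by apply: ex_eq => w; rewrite mulr1.
Qed.

Let rho0_eta0_surv t k : rho0 P Y Z t th0 * eta0 P Y Z t th0 0 k = surv t * cens t (vk k).
Proof.
rewrite (rho0_eta0 P mY mZk ZK) -risk_mean//.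
by apply: ex_eq => w; rewrite vkE.
Qed.

(** The integral form of the martingale property of the counting process of an
    uncensored error: at each t the event term has mean equal to the at-risk term
    integrated against the hazard. *)
Lemma compensator u a k : bmfun u ->
  \int[P]_w ((D 0%N w)%:R * (u (ep w) * (Z 0%N w 0 k - a))) =
  \int[cum_hazard F]_t (u t * (rho0 P Y Z t th0 * (eta0 P Y Z t th0 0 k - a))).
Proof.
move=> bu; pose v z := vk k z - a; have bv : bmfun v by apply: bmfunB => //; exact: bmfun_cst.
have br := bmfun_rho0 P mY mZk th0; have bh := bmfun_eta0 P mY mZk ZK th0 k.
have -> : \int[P]_w ((D 0%N w)%:R * (u (ep w) * (Z 0%N w 0 k - a))) =
    \int[P]_w ((D 0%N w)%:R * (u (ep w) * v (Z 0%N w))).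
  by apply: ex_eq => w; rewrite /v vkE.
rewrite event_mean// cens_hazard//.
rewrite (@Rintegral_density _ _ _ F (cum_hazard F) (inv_survival F)
  (inv_survival_ge0 F) (measurable_inv_survival F))//; last first.
  by apply: measurable_funM; [exact: (proj1 bu)|apply: measurable_funM;
    [exact: (proj1 br)|apply: measurable_funB; [exact: (proj1 bh)|exact: measurable_cst]]].
apply: ex_eq => t; congr (_ * _ * _).
rewrite mulrBr rho0_eta0_surv rho0_surv -risk_mean// /v.
have bat := bmfun_at_risk mY mZk t th0.
have bvZ : bmfun (fun w => vk k (Z 0%N w)) by exact: (bmfun_comp mZ (bmfun_vk k)).
rewrite -!risk_mean//; last exact: bmfun_cst.
rewrite -exZr -?exB; last 3 first.
- by apply: bmfunM.
- by apply: bmfunM; [apply: bmfunM|] => //; exact: bmfun_cst.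
- by apply: bmfunM => //; exact: bmfun_cst.
by apply: ex_eq => w; rewrite /=; ring.
Qed.

(** At theta0 the risk means factor into the survival of the error and a censoring
    mean, and both halves of the score become the same product. *)
Lemma Psi0_true : Psi0 P Y D Z th0 = 0.
Proof.
apply/rowP => k; rewrite (Psi0_coord P D mY mZk ZK) mxE.
have bat t := bmfun_at_risk mY mZk t th0.
have br := bmfun_rho0 P mY mZk th0; have bh := bmfun_eta0 P mY mZk ZK th0 k.
have bcov := bmfun_cov mZk ZK k; have bD := bmfun_event0 mD (R := R).
have mep := measurable_resid mY mZk th0.
transitivity (\int[P]_w ((D 0%N w)%:R * (rho0 P Y Z (ep w) th0 * vk k (Z 0%N w)) -
   (D 0%N w)%:R * (rho0 P Y Z (ep w) th0 * eta0 P Y Z (ep w) th0 0 k * cst 1 (Z 0%N w)))).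
  apply: ex_eq => w; rewrite -mulrBr vkE mulr1; congr (_ * _).
  rewrite (rho0_eta0 P mY mZk ZK) (rho0E P mY mZk) -exZr -?exB//; last 2 first.
  - by apply: bmfunM => //; exact: bmfun_cst.
  - exact: bmfunM.
  by apply: ex_eq => w'; rewrite mulrBr.
have bre : bmfun (fun t => rho0 P Y Z t th0 * eta0 P Y Z t th0 0 k) by exact: bmfunM.
rewrite exB; last 2 first.
- by apply: bmfunM => //; apply: bmfunM; [exact: (bmfun_comp mep br)|exact: (bmfun_comp mZ (bmfun_vk k))].
- by apply: bmfunM => //; apply: bmfunM; [exact: (bmfun_comp mep bre)|exact: bmfun_cst].
rewrite (event_mean br)// (event_mean bre); last exact: bmfun_cst.
apply/eqP; rewrite subr_eq0; apply/eqP; apply: ex_eq => t.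
by rewrite rho0_eta0_surv rho0_surv; ring.
Qed.

End martingale.

(** * Projection of U-statistics *)

Section hajek.
Context {dT : measure_display} {T : measurableType dT} {R : realType}.
Variable P : probability T R.
Context {ds : measure_display} {S : measurableType ds}.
Variable X : nat -> T -> S.
Hypothesis iidX : iid P X.
Let mX := iid_measurable iidX.
Variable k : S * S -> R.
Hypotheses (bk : bmfun k) (k0 : ex2 P X k = 0).

Let h1 s := \int[P]_w k (s, X 0%N w).
Let h2 s := \int[P]_w k (X 0%N w, s).
Definition hajek s := h1 s + h2 s.

Let bk' : bmfun (fun p : S * S => k (p.2, p.1)).
Proof.
apply: (bmfun_comp _ bk); apply: measurable_fun_pair; [exact: measurable_snd|exact: measurable_fst].
Qed.

Let bh1 : bmfun h1. Proof. exact: (bmfun_section P (mX 0%N) (mX 0%N) bk). Qed.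
Let bh2 : bmfun h2. Proof. exact: (bmfun_section P (mX 0%N) (mX 0%N) bk'). Qed.

Lemma bmfun_hajek : bmfun hajek. Proof. exact: bmfunD. Qed.

Let bhX (h : S -> R) i : bmfun h -> bmfun (fun w => h (X i w)).
Proof. by move=> bh; apply: bmfun_comp bh; exact: mX. Qed.

Let bkX s : bmfun (fun w => k (s, X 0%N w)).
Proof. by apply: (@bmfun_comp _ _ _ _ _ (fun s' => k (s, s'))) => //; apply: bmfun_comp bk; exact: pair1_measurable. Qed.

Let bkX' s : bmfun (fun w => k (X 0%N w, s)).
Proof. by apply: (@bmfun_comp _ _ _ _ _ (fun s' => k (s', s))) => //; apply: bmfun_comp bk; exact: pair2_measurable. Qed.

Let ex_h1 : \int[P]_w h1 (X 0%N w) = 0. Proof. exact: k0. Qed.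

Let ex_h2 : \int[P]_w h2 (X 0%N w) = 0.
Proof.
rewrite -k0 /h2 /ex2; have bf : bmfun (fun p : T * T => k (X 0%N p.1, X 0%N p.2)).
  apply: (bmfun_comp _ bk); apply: measurable_fun_pair.
    by apply: measurableT_comp => //; exact: measurable_fst.
  by apply: measurableT_comp => //; exact: measurable_snd.
by rewrite (ex_swap P P bf).
Qed.

Lemma ex_hajek : \int[P]_w hajek (X 0%N w) = 0.
Proof. by rewrite exD ?ex_h1 ?ex_h2 ?addr0//; exact: bhX. Qed.

Let g (p : S * S) := k p - h1 p.1 - h2 p.2.

Let bg : bmfun g.
Proof.
apply: bmfunB; first apply: bmfunB => //.
  by apply: bmfun_comp bh1; exact: measurable_fst.
by apply: bmfun_comp bh2; exact: measurable_snd.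
Qed.

Let g1 s : \int[P]_w g (s, X 0%N w) = 0.
Proof.
rewrite /g/= exB; [|by apply: bmfunB => //; exact: bmfun_cst|exact: bhX].
by rewrite exB//; [rewrite ex_h2 ex_cst subr0 subrr|exact: bmfun_cst].
Qed.

Let g2 s : \int[P]_w g (X 0%N w, s) = 0.
Proof.
rewrite /g/= exB; [|by apply: bmfunB => //; exact: bhX|exact: bmfun_cst].
by rewrite exB//; [rewrite ex_h1 ex_cst subr0 subrr|exact: bhX].
Qed.

Let offdiag_hajek n w : offdiag_sum X k n w =
  offdiag_sum X g n w + (n%:R - 1) * \sum_(i < n) hajek (X i w).
Proof.
have sD (F : 'I_n * 'I_n -> R) : \sum_(p : 'I_n * 'I_n | p.1 != p.2) F p =
    \sum_(i < n) \sum_(j < n) F (i, j) - \sum_(i < n) F (i, i).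
  rewrite pair_bigA/= [X in _ = X - _](bigID (fun p : 'I_n * 'I_n => p.1 != p.2))/= -addrA.
  rewrite -[LHS]addr0; congr (_ + _); first by apply: eq_bigr => -[].
  apply/esym/eqP; rewrite subr_eq0; apply/eqP.
  rewrite big_mkcond/= -(pair_bigA _ (fun i j => if ~~ (i != j) then F (i, j) else 0))/=.
  apply: eq_bigr => i _; rewrite (bigD1 i)//= eqxx/= big1 ?addr0// => j ji.
  by rewrite eq_sym ji.
rewrite /offdiag_sum /g !sD.
rewrite !mulrBl !mul1r mulr_sumr.
have e1 : \sum_(i < n) \sum_(j < n) (k (X i w, X j w) - h1 (X i w) - h2 (X j w)) =
   \sum_(i < n) \sum_(j < n) k (X i w, X j w) - \sum_(i < n) n%:R * hajek (X i w).
  under eq_bigr => i _ do rewrite sumrB sumrB sumr_const card_ord.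
  rewrite sumrB sumrB sumr_const card_ord -addrA -opprD; congr (_ - _).
  rewrite -mulr_sumr /hajek big_split/= mulrDr mulr_natl; congr (_ + _); last by rewrite mulr_natl.
  by rewrite -sumrMnl.
have e2 : \sum_(i < n) (k (X i w, X i w) - h1 (X i w) - h2 (X i w)) =
   \sum_(i < n) k (X i w, X i w) - \sum_(i < n) hajek (X i w).
  by rewrite -sumrB; apply: eq_bigr => i _; rewrite /hajek; ring.
rewrite /= e1 e2; ring.
Qed.

(** The completely degenerate remainder of the Hoeffding decomposition has
    variance of order n^-2, so a centred U-statistic of order 2 is an average up
    to o(n^-1/2). *)
Lemma hajek_projection (eps : R) : 0 < eps -> negl P (fun n => [set w | eps <
  `|Num.sqrt n%:R * (n%:R ^- 2 * offdiag_sum X k n w) -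
    Num.sqrt n%:R * (n%:R^-1 * \sum_(i < n) hajek (X i w))|]).
Proof.
move=> e0; have [Kg Kg0 gK] := bmfun_bound bg; have [Kh Kh0 hK] := bmfun_bound bmfun_hajek.
have e2 : 0 < eps / 2 by rewrite divr_gt0.
pose c : R := 2 * Kg ^+ 2 / (eps / 2) ^+ 2.
apply: (@negl_bound _ _ _ P _ (fun n => c / n%:R)).
  rewrite -(mulr0 c); apply: cvgMr; apply/gtr0_cvgV0; last exact: cvgr_idn.
  by near=> n; rewrite ltr0n; near: n; exact: nbhs_infty_gt.
near=> n.
have n0 : (0 < n)%N by near: n; exact: nbhs_infty_gt.
have nn : 0 < n%:R :> R by rewrite ltr0n.
have s0 : 0 < Num.sqrt n%:R :> R by rewrite sqrtr_gt0.
have s2 : Num.sqrt n%:R ^+ 2 = n%:R :> R by rewrite sqr_sqrtr.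
have nbig : 2 * Kh / eps < Num.sqrt n%:R.
  have h : (2 * Kh / eps) ^+ 2 < n%:R by near: n; exact: nbhs_infty_gtr.
  by rewrite -(ltr_pXn2r (n := 2))// ?nnegrE ?s2// ?(ltW s0)// divr_ge0 ?mulr_ge0// ltW.
pose x : R := eps / 2 / (Num.sqrt n%:R * n%:R ^- 2).
have q0 : 0 < Num.sqrt n%:R * n%:R ^- 2 :> R by rewrite mulr_gt0// invr_gt0 exprn_gt0.
have x0 : 0 < x by rewrite divr_gt0.
have bo := bmfun_offdiag_sum iidX n bg.
exists [set w | x <= `|offdiag_sum X g n w|]; split.
- apply: measurable_set_bool; apply: measurable_fun_ler; first exact: measurable_cst.
  by apply: measurableT_comp => //; exact: (proj1 bo).
- move=> w /= h; rewrite /x ler_pdivrMr//.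
  have sm : `|\sum_(i < n) hajek (X i w)| <= n%:R * Kh.
    apply: (le_trans (ler_norm_sum _ _ _)); rewrite mulr_natl -[n in leRHS]card_ord -sumr_const.
    by apply: ler_sum => i _.
  rewrite leNgt; apply/negP => hs; move: h; rewrite ltNge => /negP; apply.
  rewrite offdiag_hajek.
  rewrite (_ : _ - _ = (offdiag_sum X g n w) * (Num.sqrt n%:R * n%:R ^- 2) -
     (Num.sqrt n%:R * n%:R ^- 2) * \sum_(i < n) hajek (X i w)); last first.
    by field; rewrite gt_eqF.
  apply: (le_trans (ler_normB _ _)); rewrite !normrM (gtr0_norm (x := Num.sqrt n%:R)) //.
  rewrite (gtr0_norm (x := n%:R ^- 2)) ?invr_gt0 ?exprn_gt0//.
  rewrite [leRHS](splitr eps); apply: lerD; first exact: ltW.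
  apply: (le_trans (ler_wpM2l (ltW q0) sm)).
  rewrite [leLHS](_ : _ = Kh / Num.sqrt n%:R); last first.
    by move: (Num.sqrt n%:R) s0 s2 => s s0 <-; field; rewrite gt_eqF.
  by move: nbig; rewrite ltr_pdivrMr// ler_pdivrMr//; lra.
apply: (le_trans (chebyshev_bmfun _ bo x0)).
rewrite ler_pdivrMr ?exprn_gt0//.
apply: (le_trans (ex_sqr_degenerate_sum iidX n bg gK g1 g2)).
rewrite /c /x; move: (Num.sqrt n%:R) s0 s2 => s s0 <-.
apply: le_of_eq; field.
by rewrite !gt_eqF.
Unshelve. all: by end_near. Qed.

End hajek.

(** * Differentiability of the population score *)

Section bounded_convergence.
Context {dT : measure_display} {T : measurableType dT} {R : realType}.
Variable P : probability T R.

Lemma ex_bounded_cvg (q : nat -> T -> R) (q0 : T -> R) (K : R) :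
  (forall n, measurable_fun setT (q n)) -> (forall n w, `|q n w| <= K) ->
  (forall w, q^~ w @ \oo --> q0 w) ->
  bmfun q0 /\ \int[P]_w q n w @[n --> \oo] --> \int[P]_w q0 w.
Proof.
move=> mq qK qq0.
have bq n : bmfun (q n) by split=> //; exists K.
have bq0 : bmfun q0.
  split; last first.
    exists K => w; have c : `|q n w| @[n --> \oo] --> `|q0 w| by exact: cvg_norm.
    by rewrite -(cvg_lim _ c)//; apply: limr_le; [apply/cvg_ex; eexists; exact: c|exact: nearW].
  apply: (measurable_fun_cvg mq) => w _; exact: qq0.
split => //.
have := @dominated_cvg _ _ _ P setT measurableT (fun n w => (q n w)%:E) (fun w => (q0 w)%:E) (cst K%:E).
move=> /(_ _ _ _ _ _) h.
have : (\int[P]_w (q n w)%:E)%E @[n --> \oo] --> (\int[P]_w (q0 w)%:E)%E.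
  apply: h => //.
  - by move=> n; apply/measurable_EFinP; exact: mq.
  - by move=> w _; apply: cvg_EFin; [exact: nearW|exact: qq0].
  - exact: (bmfun_integrable P (bmfun_cst K)).
  - by move=> n w _; rewrite lee_fin.
rewrite integral_bmfun//; under eq_fun do rewrite integral_bmfun//.
by move/fine_cvgP => [].
Qed.

End bounded_convergence.

Lemma norm_mulmx_le (R : realType) (d m : nat) (v : 'rV[R]_d) (J : 'M[R]_(d, m)) :
  `|v *m J| <= (\sum_(p : 'I_d * 'I_m) `|J p.1 p.2|) * `|v|.
Proof.
have S0 : 0 <= \sum_(p : 'I_d * 'I_m) `|J p.1 p.2| by apply: sumr_ge0.
apply: norm_row_le => [|l]; first by rewrite mulr_ge0.
rewrite mxE (le_trans (ler_norm_sum _ _ _))// -(pair_bigA _ (fun i j => `|J i j|))/= mulr_suml.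
apply: ler_sum => i _; rewrite normrM mulrC; apply: ler_pM => //; last exact: norm_coord_le.
by rewrite (bigD1 l)//= lerDl sumr_ge0.
Qed.

Lemma differentiable_jacobian (R : realType) (d m : nat) (f : 'rV[R]_d -> 'rV[R]_m)
    (x : 'rV[R]_d) (J : 'M[R]_(d, m)) :
  (forall eps : R, 0 < eps -> \forall h \near (0 : 'rV[R]_d),
    `|f (h + x) - f x - h *m J| <= eps * `|h|) ->
  differentiable f x /\ 'J f x = J.
Proof.
move=> hf; pose df : {linear 'rV[R]_d -> 'rV[R]_m} := mulmxr J.
have dfc : continuous df.
  apply: bounded_linear_continuous; apply/linear_boundedP.
  apply: filterS (nbhs_pinfty_ge (num_real (\sum_(p : 'I_d * 'I_m) `|J p.1 p.2|))) => r hr v /=.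
  by apply: (le_trans (norm_mulmx_le v J)); rewrite ler_wpM2r.
have fo eps : 0 < eps -> \forall h \near (0 : 'rV[R]_d),
    `|(f \o shift x - (cst (f x) + df)) h| <= eps * `|id h|.
  move=> e0; near=> h.
  rewrite [X in `|X|](_ : _ = f (h + x) - f x - h *m J); first by near: h; exact: hf.
  by rewrite !fctE/= opprD addrA.
have dE := diff_unique dfc ((eqaddoP _ _ _ _).2 fo).
split.
  by apply/diff_locallyP; rewrite dE; split => //; exact/eqaddoP.
rewrite /jacobian; apply/matrixP => i j; rewrite mxE dE/= -rowE mxE.
by [].
Unshelve. all: by end_near. Qed.

Section under_expectation.
Context {dT : measure_display} {T : measurableType dT} {R : realType}.
Variable P : probability T R.
Context {d : nat}.
Local Notation V := 'rV[R]_d.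
Variables (G : V -> T -> R) (A : set V).
Let dG th w h := 'd (fun u : V => G u w : R^o) th h.
Hypothesis oA : open A.
Hypothesis bG : forall th, bmfun (G th).
Hypothesis diffG : forall th w, A th -> differentiable (fun u : V => G u w : R^o) th.
Hypothesis dG_bounded : forall h, exists K, forall th w, A th -> `|dG th w h| <= K.
Hypothesis dG_cont : forall h w (u : nat -> V) th, A th -> (forall n, A (u n)) ->
  u n @[n --> \oo] --> th -> dG (u n) w h @[n --> \oo] --> (dG th w h : R).

Let inv_seq0 : (n.+1%:R^-1 : R) @[n --> \oo] --> (0 : R).
Proof. exact: cvg_harmonic. Qed.

Lemma bmfun_diff th h : A th -> bmfun (fun w => dG th w h).
Proof.
move=> Ath; have [K hK] := dG_bounded h.
split; last by exists K => w; exact: hK.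
apply: (measurable_fun_cvg (h := fun n w =>
  (n.+1%:R^-1)^-1 * (G (n.+1%:R^-1 *: h + th) w - G th w))).
  move=> n; apply: measurable_funM; first exact: measurable_cst.
  by apply: measurable_funB; [exact: (proj1 (bG _))|exact: (proj1 (bG _))].
move=> w _; have dw := diffG w Ath.
have der := diff_derivable (v := h) dw.
have := der; rewrite /derivable => /cvg_ex[l hl].
have dl : dG th w h = l by rewrite /dG -deriveE// /derive; apply: cvg_lim.
rewrite dl; by move/cvgr_dnbhsP : hl; apply.
Qed.

Let Kof k := sval (cid (dG_bounded (delta_mx 0 k))).
Let KK : R := \sum_k `|Kof k|.
Let KK0 : 0 <= KK. Proof. exact: sumr_ge0. Qed.

Let dG_sum th w (h : V) : dG th w h = \sum_k h 0 k * dG th w (delta_mx 0 k).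
Proof.
rewrite /dG {1}(row_sum_delta h) linear_sum; apply: eq_bigr => k _.
by rewrite linearZ.
Qed.

Lemma norm_diff_le th w h : A th -> `|dG th w h| <= KK * `|h|.
Proof.
move=> Ath; rewrite dG_sum (le_trans (ler_norm_sum _ _ _))// mulr_suml.
apply: ler_sum => k _; rewrite normrM mulrC; apply: ler_pM => //; last exact: norm_coord_le.
rewrite /Kof; case: cid => K /= hK.
by apply: (le_trans (hK _ w Ath)); exact: ler_norm.
Qed.

Lemma norm_increment_le th (h : V) w : (forall s, 0 <= s <= 1 -> A (s *: h + th)) ->
  `|G (h + th) w - G th w| <= KK * `|h|.
Proof.
move=> seg; pose f (s : R) : R := G (s *: h + th) w.
have df (s : R) : 0 <= s <= 1 -> is_derive s 1 (f : R -> R^o) (dG (s *: h + th) w h).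
  move=> s01; have As := seg s s01; have dw := diffG w As.
  have e : (fun t : R => t^-1 *: (((f : R -> R^o) \o shift s) (t *: 1) - f s)) =
      (fun t : R => t^-1 *: ((((fun u => G u w) : V -> R^o) \o shift (s *: h + th)) (t *: h) - f s)).
    apply/funext => t /=; rewrite /f; congr (_ *: (G _ w - _)).
    by rewrite addrA -scalerDl -[t *: 1]/(t * 1) mulr1.
  have der := diff_derivable (v := h) dw.
  split; first by rewrite /derivable e.
  by rewrite /derive e -[LHS]/('D_h _ _) deriveE.
have cf : {within `[0, 1], continuous (f : R -> R^o)}.
  by apply: derivable_within_continuous => s; rewrite in_itv/= => /df[].
have [|c c01 fc] := @MVT_segment R f (fun s => dG (s *: h + th) w h) 0 1 ler01 _ cf.
  by move=> s; rewrite in_itv/= => /andP[a b]; apply: df; rewrite !ltW.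
move: fc; rewrite /f scale1r scale0r add0r subr0 mulr1 => ->.
by apply: norm_diff_le; apply: seg; move: c01; rewrite in_itv.
Qed.

Let phi th := \int[P]_w G th w.
Let L th h := \int[P]_w dG th w h.

(** Differentiation under the expectation, by bounded convergence. *)
Lemma ex_diff_estimate th : A th -> forall eps : R, 0 < eps ->
  \forall h \near (0 : V), `|phi (h + th) - phi th - L th h| <= eps * `|h|.
Proof.
move=> Ath eps e0.
have [r /= r0 rA] : exists2 r : R, 0 < r & forall h : V, `|h| < r -> A (h + th).
  have : nbhs th A by exact: open_nbhs_nbhs.
  move=> /nbhs_ballP[r /= r0 rA]; exists r => // h hr; apply: rA.
  by rewrite -ball_normE/= opprD addrCA subrr addr0 normrN.
apply: contrapT => bad.
have hex n : exists h : V, `|h| < r * n.+1%:R^-1 /\ eps * `|h| < `|phi (h + th) - phi th - L th h|.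
  apply: contrapT => none; apply: bad; near=> h.
  rewrite leNgt; apply/negP => hh; apply: none; exists h; split => //.
  near: h; apply/nbhs_ballP; exists (r * n.+1%:R^-1); first by rewrite /= mulr_gt0// invr_gt0.
  by move=> h; rewrite -ball_normE/= sub0r normrN.
pose h n := sval (cid (hex n)).
have [h1 h2] : (forall n, `|h n| < r * n.+1%:R^-1) /\
    (forall n, eps * `|h n| < `|phi (h n + th) - phi th - L th (h n)|).
  by split => n; rewrite /h; case: cid => ? [].
have hn0 n : 0 < `|h n|.
  rewrite normr_gt0; apply: contraTneq (h2 n) => ->.
  rewrite normr0 mulr0 add0r subrr sub0r normrN /L.
  rewrite (_ : \int[P]_w _ = 0) ?normr0 ?ltxx//.
  by rewrite -[RHS](ex_cst P 0); apply: ex_eq => w; rewrite /dG linear0.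
have hr n : `|h n| < r.
  apply: (lt_le_trans (h1 n)); apply: ler_piMr; first exact: ltW.
  by rewrite invf_le1// ler1n.
have h0 : h n @[n --> \oo] --> (0 : V).
  apply/cvgr0Pnorm_le => e ep; near=> n.
  apply/ltW/(lt_le_trans (h1 n)); rewrite mulrC -ler_pdivlMr//.
  near: n; have er : 0 < e / r by rewrite divr_gt0.
  have /cvgr0Pnorm_le /(_ _ er) := inv_seq0.
  by apply: filterS => n; rewrite ger0_norm.
pose q n w := `|h n|^-1 * (G (h n + th) w - G th w - dG th w (h n)).
have bd n := bmfun_diff (h n) Ath.
have bq n : bmfun (q n) by apply: bmfunZ; apply: bmfunB => //; exact: bmfunB.
have qK n w : `|q n w| <= 2 * KK.
  rewrite normrM normfV normr_id ler_pdivrMl// (le_trans (ler_normB _ _))//.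
  rewrite (_ : `|h n| * (2 * KK) = KK * `|h n| + KK * `|h n|); last by ring.
  apply: lerD; last exact: norm_diff_le.
  apply: norm_increment_le => s /andP[s0 s1]; apply: rA.
  by rewrite normrZ ger0_norm//; apply: le_lt_trans (hr n); rewrite ler_piMl.
have q0 w : q n w @[n --> \oo] --> (0 : R).
  apply/cvgr0Pnorm_le => e ep.
  have /eqaddoP := diff_locally (diffG w Ath); move=> /(_ e ep) /h0 lo; near=> n.
  rewrite normrM normfV normr_id ler_pdivrMl// mulrC.
  rewrite (_ : _ - dG th w (h n) = (((fun u => G u w) : V -> R^o) \o shift th -
    (cst (G th w : R^o) + 'd (fun u : V => G u w : R^o) th)) (h n)); first by near: n; exact: lo.
  by rewrite !fctE/= opprD addrA.
have [_] := ex_bounded_cvg P (fun n => proj1 (bq n)) qK q0.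
rewrite ex_cst => /cvgr0Pnorm_le /(_ _ e0)[N _ /(_ N (leqnn N))].
rewrite /q exZ; last by apply: bmfunB => //; exact: bmfunB.
rewrite exB//; last exact: bmfunB.
rewrite exB// normrM normfV normr_id ler_pdivrMl// leNgt mulrC.
by rewrite (h2 N).
Unshelve. all: by end_near. Qed.

Lemma ex_diff_cvg th (u : nat -> V) h : A th -> (forall n, A (u n)) ->
  u n @[n --> \oo] --> th -> L (u n) h @[n --> \oo] --> L th h.
Proof.
move=> Ath Au uth; have [K hK] := dG_bounded h.
have [|n w|w|_ //] := @ex_bounded_cvg _ _ _ P (fun n w => dG (u n) w h) (fun w => dG th w h) K.
- by move=> n; exact: (proj1 (bmfun_diff h (Au n))).
- exact: hK.
- exact: dG_cont.
Qed.

Lemma norm_ex_diff_le th h K : A th -> (forall th w, A th -> `|dG th w h| <= K) ->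
  `|L th h| <= K.
Proof. by move=> Ath hK; apply: norm_ex_bound => [|w]; [exact: bmfun_diff|exact: hK]. Qed.

Lemma ex_diff_sum th h : A th -> L th h = \sum_k h 0 k * L th (delta_mx 0 k).
Proof.
move=> Ath; rewrite /L; under ex_eq => w do rewrite dG_sum.
rewrite ex_sum; last by move=> k; apply: bmfunZ; exact: bmfun_diff.
by apply: eq_bigr => k _; rewrite exZ//; exact: bmfun_diff.
Qed.

End under_expectation.

Section sequences_and_derivatives.
Context {R : realType}.

Lemma norm_mx_le (m n : nat) (M : 'M[R]_(m, n)) (c : R) : 0 <= c ->
  (forall i j, `|M i j| <= c) -> `|M| <= c.
Proof.
by move=> c0 h; rewrite [leLHS]/Num.Def.normr/= mx_normrE (bigmax_le _ c0)// => -[i j] _; exact: h.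
Qed.

Lemma within_seq_cvg (U W : topologicalType) (A : set U) (f : U -> W) (x : U) (u : nat -> U) :
  {within A, continuous f} -> A x -> (forall n, A (u n)) ->
  u n @[n --> \oo] --> x -> f (u n) @[n --> \oo] --> f x.
Proof.
move=> /subspace_continuousP cf Ax Au ux B Bfx.
have h : \forall n \near \oo, A (u n) -> B (f (u n)) := ux _ (cf x Ax B Bfx).
change (\forall n \near \oo, B (f (u n))); near=> n.
have hn : A (u n) -> B (f (u n)) by near: n; exact: h.
exact: hn (Au n).
Unshelve. all: by end_near. Qed.

Lemma seq_cvg_within (d : nat) (W : normedModType R) (A : set 'rV[R]_d)
    (f : 'rV[R]_d -> W) :
  (forall x (u : nat -> 'rV[R]_d), A x -> (forall n, A (u n)) ->
    u n @[n --> \oo] --> x -> f (u n) @[n --> \oo] --> f x) ->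
  {within A, continuous f}.
Proof.
move=> hf; apply/subspace_continuousP => x Ax; apply/cvgrPdist_le => eps e0.
apply: contrapT => bad.
have hex n : exists u, [/\ A u, `|x - u| < n.+1%:R^-1 & eps < `|f x - f u|].
  apply: contrapT => none; apply: bad.
  have nb : nbhs x (fun u => `|x - u| < n.+1%:R^-1).
    apply/nbhs_ballP; exists n.+1%:R^-1; first by rewrite /= invr_gt0.
    by move=> u; rewrite -ball_normE.
  change (nbhs x (fun t => A t -> `|f x - f t| <= eps)).
  apply: filterS nb => u xu Au.
  by rewrite leNgt; apply/negP => h; apply: none; exists u.
pose u n := sval (cid (hex n)).
have h n : [/\ A (u n), `|x - u n| < n.+1%:R^-1 & eps < `|f x - f (u n)|].
  by rewrite /u; case: cid.
have ux : u n @[n --> \oo] --> x.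
  apply/cvgrPdist_le => e ep; near=> n.
  have [_ /ltW h1 _] := h n; apply: (le_trans h1).
  near: n; have /cvgr0Pnorm_le /(_ _ ep) := @cvg_harmonic R.
  by apply: filterS => n /=; rewrite ger0_norm.
have := hf x u Ax (fun n => let: And3 a _ _ := h n in a) ux.
move=> /cvgrPdist_le /(_ _ e0)[N _ /(_ N (leqnn N))].
by have [_ _ h3] := h N; rewrite leNgt h3.
Unshelve. all: by end_near. Qed.

Lemma diff_coord (d m : nat) (f : 'rV[R]_d -> 'rV[R]_m) (x : 'rV[R]_d) (k : 'I_m) :
  differentiable f x ->
  differentiable (fun u => f u 0 k : R^o) x /\
  forall h, 'd (fun u => f u 0 k : R^o) x h = 'd f x h 0 k.
Proof.
move=> df; have dk : differentiable (fun u => f u 0 k : R^o) x.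
  exact: (differentiable_comp df (differentiable_coord (f x) 0 k)).
split => // h; rewrite -!deriveE//.
have /cvg_ex[l hl] := diff_derivable (v := h) df.
have -> : 'D_h f x = l by apply: cvg_lim.
apply: cvg_lim => //.
have := cvg_comp _ _ hl (@coord_continuous R 1 m 0 k l).
apply: cvg_trans; apply: near_eq_cvg; near=> t.
by rewrite /= !mxE.
Unshelve. all: by end_near. Qed.

Lemma eq_cvg_seq (a b : nat -> R) (l m : R) : (forall n, b n = a n) -> m = l ->
  a n @[n --> \oo] --> l -> b n @[n --> \oo] --> m.
Proof. by move=> ba -> al; under eq_fun do rewrite ba. Qed.

Lemma diff_scaled_product (V : normedModType R) (f g : V -> R) (c a : R) (x : V) :
  differentiable (f : V -> R^o) x -> differentiable (g : V -> R^o) x ->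
  differentiable (fun u => c * (f u * (a - g u)) : R^o) x /\
  forall h, 'd (fun u => c * (f u * (a - g u)) : R^o) x h =
    c * ((a - g x) * 'd (f : V -> R^o) x h - f x * 'd (g : V -> R^o) x h).
Proof.
move=> df dg; have da := differentiable_cst (a : R^o) x.
have db : differentiable (cst (a : R^o) - (g : V -> R^o)) x by exact: differentiableB.
have dm := differentiableM df db.
split; first exact: (differentiableZ c dm).
move=> h.
have E1 := congr1 (fun F : V -> R => F h) (diffZ c dm).
have E2 := congr1 (fun F : V -> R => F h) (diffM df db).
have E3 := congr1 (fun F : V -> R => F h) (diffB da dg).
have E4 := congr1 (fun F : V -> R => F h) (diff_cst (a : R^o) x).
refine (etrans E1 _); refine (etrans (congr1 (fun t : R => c * t) E2) _); congr (c * _).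
refine (etrans (congr1 (fun t : R => f x * t + (a - g x) * 'd (f : V -> R^o) x h) E3) _).
refine (etrans (congr1 (fun t : R => f x * (t - 'd (g : V -> R^o) x h) + (a - g x) * 'd (f : V -> R^o) x h) E4) _).
rewrite -[(0 : V -> R^o) h]/(0 : R) sub0r mulrN addrC.
by [].
Qed.

End sequences_and_derivatives.

Section population_score_derivative.
Context {dT : measure_display} {T : measurableType dT} {R : realType}.
Variable P : probability T R.
Context {d : nat}.
Variables (Y : nat -> T -> R) (D : nat -> T -> bool) (Z : nat -> T -> 'rV[R]_d) (Kz : R).
Hypotheses (mY : measurable_fun setT (Y 0%N))
  (mZ : forall k, measurable_fun setT (fun w => Z 0%N w 0 k))
  (mD : measurable_fun setT (D 0%N)) (ZK : forall w, `|Z 0%N w| <= Kz).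
Variables (A : set 'rV[R]_d) (calY : set R) (calZ : set 'rV[R]_d).
Hypotheses (oA : open A) (cY : forall w, calY (Y 0%N w)) (cZ : forall w, calZ (Z 0%N w)).
Let rho (u : 'rV[R]_d) y z : R^o := rho0 P Y Z (resid u y z) u.
Let eta (u : 'rV[R]_d) y z := eta0 P Y Z (resid u y z) u.
Hypotheses (drho : bounded_cont_diff rho A calY calZ) (deta : bounded_cont_diff eta A calY calZ).

Let r w u : R^o := rho u (Y 0%N w) (Z 0%N w).
Let s k w u : R^o := eta u (Y 0%N w) (Z 0%N w) 0 k.
Let G k u w : R := (D 0%N w)%:R * (r w u * (Z 0%N w 0 k - s k w u)).

Let Kz0 : 0 <= Kz. Proof. exact: le_trans (ZK point). Qed.

Let bG k u : bmfun (G k u).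
Proof.
have mep := measurable_resid mY mZ u.
apply: bmfunM; first exact: bmfun_event0.
apply: bmfunM; first exact: (bmfun_comp mep (bmfun_rho0 P mY mZ u)).
apply: bmfunB; first exact: (bmfun_cov mZ ZK).
exact: (bmfun_comp mep (bmfun_eta0 P mY mZ ZK u k)).
Qed.

Let dr th w : A th -> differentiable (r w) th. Proof. by move=> Ath; exact: (proj1 drho). Qed.
Let ds k th w : A th -> differentiable (s k w) th.
Proof. by move=> Ath; apply: (proj1 (diff_coord k _)); exact: (proj1 deta). Qed.

Let dG k th w : A th -> differentiable (fun u => G k u w : R^o) th /\
  forall h, 'd (fun u => G k u w : R^o) th h =
    (D 0%N w)%:R * ((Z 0%N w 0 k - s k w th) * 'd (r w) th h - r w th * 'd (s k w) th h).
Proof. by move=> Ath; exact: (diff_scaled_product _ _ (dr w Ath) (ds k w Ath)). Qed.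

Let dr_bounded h : exists K, forall th w, A th -> `|'d (r w) th h| <= K.
Proof. by have [[K hK] _] := (proj2 drho) h; exists K => th w Ath; exact: hK. Qed.

Let ds_bounded k h : exists K, forall th w, A th -> `|'d (s k w) th h| <= K.
Proof.
have [[K hK] _] := (proj2 deta) h; exists K => th w Ath.
have [_ ->] := diff_coord k (proj1 deta th (Y 0%N w) (Z 0%N w) Ath (cY w) (cZ w)).
by apply: le_trans (norm_coord_le _ k) _; exact: hK.
Qed.

Let norm_r_le w u : `|r w u| <= 1.
Proof. by have /andP[a b] := rho0_ge0_le1 P mY mZ (resid u (Y 0%N w) (Z 0%N w)) u; rewrite ger0_norm. Qed.

Let norm_s_le k w u : `|Z 0%N w 0 k - s k w u| <= 2 * Kz.
Proof.
rewrite (le_trans (ler_normB _ _))// mulr_natl mulr2n lerD//; last exact: norm_eta0_le.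
exact: le_trans (norm_coord_le _ _) (ZK w).
Qed.

Let dG_bounded k h : exists K, forall th w, A th -> `|'d (fun u => G k u w : R^o) th h| <= K.
Proof.
have [K1 h1] := dr_bounded h; have [K2 h2] := ds_bounded k h.
exists (2 * Kz * K1 + 1 * K2) => th w Ath; have [_ ->] := dG k w Ath.
have K10 : 0 <= K1 by exact: le_trans (h1 th w Ath).
have K20 : 0 <= K2 by exact: le_trans (h2 th w Ath).
rewrite normrM -[leRHS]mul1r; apply: ler_pM => //; first by case: (D _ _); rewrite ?normr1 ?normr0.
rewrite (le_trans (ler_normB _ _))// lerD// normrM; apply: ler_pM => //.
- exact: h1.
- exact: h2.
Qed.

Let triple_cvg (u : nat -> 'rV[R]_d) (th : 'rV[R]_d) w : u n @[n --> \oo] --> th ->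
  (u n, Y 0%N w, Z 0%N w) @[n --> \oo] --> (th, Y 0%N w, Z 0%N w).
Proof.
move=> uth; have h1 : (u n, Y 0%N w) @[n --> \oo] --> (th, Y 0%N w).
  exact: (cvg_pair uth (cvg_cst _)).
exact: (cvg_pair h1 (cvg_cst _)).
Qed.

Let dG_cont k h w (u : nat -> 'rV[R]_d) (th : 'rV[R]_d) : A th -> (forall n, A (u n)) ->
  u n @[n --> \oo] --> th ->
  'd (fun v => G k v w : R^o) (u n) h @[n --> \oo] --> ('d (fun u => G k u w : R^o) th h : R).
Proof.
move=> Ath Au uth.
apply: (eq_cvg_seq (fun n => proj2 (dG k w (Au n)) h) (proj2 (dG k w Ath) h)).
have tA n : (A `*` calY `*` calZ) (u n, Y 0%N w, Z 0%N w).
  by split; [split; [exact: Au|exact: cY]|exact: cZ].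
have t0 : (A `*` calY `*` calZ) (th, Y 0%N w, Z 0%N w).
  by split; [split; [exact: Ath|exact: cY]|exact: cZ].
have cr : 'd (r w) (u n) h @[n --> \oo] --> ('d (r w) th h : R).
  have c1 := within_seq_cvg (proj2 ((proj2 drho) h)) t0 tA (@triple_cvg u th w uth).
  exact: c1.
have cs : 'd (s k w) (u n) h @[n --> \oo] --> ('d (s k w) th h : R).
  have cV := within_seq_cvg (proj2 ((proj2 deta) h)) t0 tA (@triple_cvg u th w uth).
  apply: (eq_cvg_seq
    (fun n => proj2 (diff_coord k (proj1 deta (u n) (Y 0%N w) (Z 0%N w) (Au n) (cY w) (cZ w))) h)
    (proj2 (diff_coord k (proj1 deta th (Y 0%N w) (Z 0%N w) Ath (cY w) (cZ w))) h)).
  exact: (cvg_comp _ _ cV (@coord_continuous R 1 d 0 k _)).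
have cr0 : r w (u n) @[n --> \oo] --> (r w th : R).
  exact: (cvg_comp _ _ uth (differentiable_continuous (dr w Ath))).
have cs0 : s k w (u n) @[n --> \oo] --> (s k w th : R).
  exact: (cvg_comp _ _ uth (differentiable_continuous (ds k w Ath))).
apply: cvgM; first exact: cvg_cst.
apply: cvgB; last exact: cvgM cr0 cs.
by apply: cvgM cr; apply: cvgB cs0; exact: cvg_cst.
Unshelve. all: by end_near. Qed.

Let Psi0_ex th k : Psi0 P Y D Z th 0 k = \int[P]_w G k th w.
Proof.
rewrite /Psi0 /Psi mxE; apply: ex_eq => w; rewrite mxE /G /r /s /rho /eta.
rewrite (_ : (_ - eta0 _ _ _ _ _) 0 k = Z 0%N w 0 k - eta0 P Y Z (resid th (Y 0%N w) (Z 0%N w)) th 0 k); last by rewrite !mxE.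
by rewrite -!mulrA mulrCA.
Qed.

Let L k th h : R := \int[P]_w 'd (fun u => G k u w : R^o) th h.
Let diffG k th w (Ath : A th) := proj1 (dG k w Ath).

Let Psi0_jacobian th : A th ->
  differentiable (Psi0 P Y D Z) th /\
  'J (Psi0 P Y D Z) th = \matrix_(i, k) L k th (delta_mx 0 i).
Proof.
move=> Ath; apply: differentiable_jacobian => eps e0.
have main k := ex_diff_estimate P oA (bG k) (diffG k) (dG_bounded k) Ath e0.
have main' := filter_forall (nbhs_filter (0 : 'rV[R]_d)) main.
have e3 k (a b c : 'rV[R]_d) : (a - b - c) 0 k = a 0 k - b 0 k - c 0 k by rewrite !mxE.
near=> h; apply: norm_row_le => [|k]; first by rewrite mulr_ge0// ltW.
have -> : (Psi0 P Y D Z (h + th) - Psi0 P Y D Z th - h *m \matrix_(i, k) L k th (delta_mx 0 i)) 0 k =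
   \int[P]_w G k (h + th) w - \int[P]_w G k th w - L k th h.
  have ec : (h *m \matrix_(i, k) L k th (delta_mx 0 i)) 0 k = L k th h.
    rewrite mxE /L (ex_diff_sum P (bG k) (diffG k) (dG_bounded k) h Ath).
    by apply: eq_bigr => i _; rewrite [X in _ * X]mxE.
  move: (Psi0_ex (h + th) k) (Psi0_ex th k) ec.
  move: (Psi0 P Y D Z (h + th)) (Psi0 P Y D Z th) (h *m _) => a b c <- <- <-.
  exact: e3.
by move: k; near: h.
Unshelve. all: by end_near. Qed.

Lemma Psi0_differentiable th : A th -> differentiable (Psi0 P Y D Z) th.
Proof. by move=> /Psi0_jacobian[]. Qed.

Lemma Psi0_jacobian_bounded : exists K, forall th, A th -> `|'J (Psi0 P Y D Z) th| <= K.
Proof.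
pose Kf i k : R := sval (cid (dG_bounded k (delta_mx 0 i))).
exists (\sum_i \sum_k `|Kf i k|) => th Ath; have [_ ->] := Psi0_jacobian Ath.
apply: norm_mx_le => [|i k]; first by apply: sumr_ge0 => i _; exact: sumr_ge0.
rewrite mxE; apply: (@le_trans _ _ `|Kf i k|).
  apply: (le_trans _ (ler_norm _)); apply: (norm_ex_diff_le P (bG k) (diffG k) (dG_bounded k) Ath).
  by rewrite /Kf; case: cid.
rewrite (bigD1 i)//= (bigD1 k)//= -addrA lerDl addr_ge0 ?sumr_ge0// => j _.
exact: sumr_ge0.
Qed.

Lemma Psi0_jacobian_continuous : {within A, continuous (fun th => 'J (Psi0 P Y D Z) th)}.
Proof.
apply: seq_cvg_within => th u Ath Au uth.
have [_ ->] := Psi0_jacobian Ath.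
under eq_fun => n do rewrite (proj2 (Psi0_jacobian (Au n))).
apply/cvgrPdist_le => eps e0.
have main : \forall n \near \oo, forall i k,
    `|L k th (delta_mx 0 i) - L k (u n) (delta_mx 0 i)| <= eps.
  apply: filter_forall => i; apply: filter_forall => k.
  have := ex_diff_cvg (P := P) (h := delta_mx 0 i) (bG k) (diffG k) (dG_bounded k) (@dG_cont k) Ath Au uth.
  by move/cvgrPdist_le => /(_ _ e0).
near=> n; apply: norm_mx_le => [|i k]; first exact: ltW.
rewrite [X in `|X|](_ : _ = L k th (delta_mx 0 i) - L k (u n) (delta_mx 0 i)); last by rewrite !mxE.
by move: i k; near: n.
Unshelve. all: by end_near. Qed.

End population_score_derivative.

(** * Curvature of the population score *)

Section curvature.
Context {dT : measure_display} {T : measurableType dT} {R : realType}.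
Variable P : probability T R.
Context {ds : measure_display} {S : measurableType ds}.
Variable X : nat -> T -> S.
Hypothesis iidX : iid P X.
Let mX := iid_measurable iidX.
Context {d : nat}.
Variables (y : S -> R) (z : S -> 'rV[R]_d) (Kz : R) (a : S -> R).
Hypotheses (my : measurable_fun setT y)
  (mz : forall k, measurable_fun setT (fun s => z s 0 k))
  (zK : forall s, `|z s| <= Kz) (ba : bmfun a) (a01 : forall s, 0 <= a s <= 1).
Variables (C : R) (th0 : 'rV[R]_d) (J : 'M[R]_d).
Hypothesis C0 : 0 <= C.
Hypothesis anticoncentration : forall theta t h, 0 <= h ->
  pr P [set w | t <= rs y z theta (X 0%N w) <= t + h] <= C * h.
Let u th := rank_mean P X y z a (cst 1) th.
Hypothesis u0 : u th0 = 0.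
Hypothesis uJ : forall eps : R, 0 < eps -> exists2 dl : R, 0 < dl & forall th,
  `|th - th0| <= dl -> `|u th - (th - th0) *m J| <= eps * `|th - th0|.

Let Kz0 : 0 <= Kz. Proof. exact: le_trans (zK point). Qed.
Let V (p : S * S) := rs y z th0 p.2 - rs y z th0 p.1.
Let dz v (p : S * S) := dotv v (z p.1 - z p.2).
Let flip s v (p : S * S) : R := (0 <= V p + s * dz v p)%R%:R - (0 <= V p)%R%:R.

Let rank_le_flip s v p : (rank_le y z (th0 + s *: v) p)%:R - (rank_le y z th0 p)%:R = flip s v p.
Proof.
have e1 : (rs y z (th0 + s *: v) p.1 <= rs y z (th0 + s *: v) p.2) = (0 <= V p + s * dz v p).
  rewrite -subr_ge0; congr (_ <= _).
  by rewrite /V /rs /dz !dotvDl !dotvZl dotvBr; ring.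
have e2 : (rs y z th0 p.1 <= rs y z th0 p.2) = (0 <= V p) by rewrite /V subr_ge0.
by rewrite /flip /rank_le e1 e2.
Qed.

Let flip_cases s v p : 0 < s ->
  [\/ flip s v p = 0,
      flip s v p = 1 /\ V p < 0 <= V p + s * dz v p |
      flip s v p = -1 /\ V p + s * dz v p < 0 <= V p].
Proof.
move=> s0; rewrite /flip; case: (leP 0 (V p + s * dz v p)) => h1; case: (leP 0 (V p)) => h2.
- by constructor 1; rewrite subrr.
- by constructor 2; rewrite subr0.
- by constructor 3; rewrite sub0r.
- by constructor 1; rewrite subrr.
Qed.

Let flip_dz_ge0 s v p : 0 < s -> 0 <= flip s v p * dz v p.
Proof.
move=> s0; case: (flip_cases v p s0) => [->|[-> /andP[h1 h2]]|[-> /andP[h1 h2]]].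
- by rewrite mul0r.
- rewrite mul1r -(pmulr_rge0 _ s0); lra.
- rewrite mulN1r oppr_ge0 -(pmulr_rle0 _ s0); lra.
Qed.

Let bflip s v : bmfun (flip s v).
Proof.
apply: (bmfun_eq (f := fun p => (rank_le y z (th0 + s *: v) p)%:R - (rank_le y z th0 p)%:R)).
  by move=> p; rewrite rank_le_flip.
by apply: bmfunB; exact: bmfun_rank_le.
Qed.

Let bdz v : bmfun (dz v).
Proof.
apply: (bmfun_eq (f := fun p => \sum_k v 0 k * (z p.1 0 k - z p.2 0 k))).
  by move=> p; rewrite /dz dotvE; apply: eq_bigr => k _; rewrite !mxE.
apply: bmfun_sum => k; apply: bmfunZ; apply: bmfunB.
  exact: (bmfun_fst (bmfun_z mz zK k)).
exact: (bmfun_snd (bmfun_z mz zK k)).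
Qed.

Let ba1 : bmfun (fun p : S * S => a p.1). Proof. exact: bmfun_fst. Qed.

Let baf s v : bmfun (fun p => a p.1 * flip s v p). Proof. exact: bmfunM. Qed.

Let uE th l : u th 0 l = ex2 P X (rank_kernel y z a (cst 1) th l).
Proof. by rewrite /u /rank_mean mxE. Qed.

Let u_coord s v l : u (th0 + s *: v) 0 l =
  ex2 P X (fun p => a p.1 * flip s v p * (z p.1 0 l - z p.2 0 l)).
Proof.
have bk th := bmfun_rank_kernel my mz zK th l ba (bmfun_cst 1).
have u0l : ex2 P X (rank_kernel y z a (cst 1) th0 l) = 0.
  by rewrite -uE u0 mxE.
rewrite uE -[LHS]subr0 -u0l -(ex2B iidX)//.
apply: ex_eq => w; apply: ex_eq => w'; rewrite -rank_le_flip /rank_kernel/=; ring.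
Qed.

Let u_direction s v : dotv v (u (th0 + s *: v)) = ex2 P X (fun p => a p.1 * (flip s v p * dz v p)).
Proof.
rewrite dotvE; under eq_bigr do rewrite u_coord.
have bc l : bmfun (fun p : S * S => z p.1 0 l - z p.2 0 l).
  apply: bmfunB; [exact: (bmfun_fst (bmfun_z mz zK l))|exact: (bmfun_snd (bmfun_z mz zK l))].
have ex2_sum (r : seq 'I_d) : \sum_(l <- r) v 0 l * ex2 P X (fun p => a p.1 * flip s v p * (z p.1 0 l - z p.2 0 l)) =
    ex2 P X (fun p => \sum_(l <- r) v 0 l * (a p.1 * flip s v p * (z p.1 0 l - z p.2 0 l))).
  elim: r => [|l r IH].
    rewrite big_nil -[LHS](ex_cst P 0); apply: ex_eq => w; rewrite -[LHS](ex_cst P 0).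
    by apply: ex_eq => w'; rewrite big_nil.
  rewrite big_cons IH -(ex2Z iidX); last by apply: bmfunM.
  rewrite -(ex2D iidX).
  - by apply: ex_eq => w; apply: ex_eq => w'; rewrite big_cons.
  - by apply: bmfunZ; exact: bmfunM.
  - by apply: bmfun_sum => k; apply: bmfunZ; exact: bmfunM.
rewrite ex2_sum; apply: ex_eq => w; apply: ex_eq => w'.
rewrite /dz dotvE !mulr_sumr; apply: eq_bigr => l _; rewrite !mxE; ring.
Qed.

Let line_close v (eps : R) : 0 < eps -> exists2 s0, 0 < s0 & forall s, 0 < s -> s <= s0 ->
  `|u (th0 + s *: v) - s *: (v *m J)| <= s * (eps * `|v|).
Proof.
move=> e0; have [dl dl0 h] := uJ e0.
exists (dl / (`|v| + 1)) => [|s s0 sle]; first by rewrite divr_gt0// ltr_wpDl.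
have vp : 0 < `|v| + 1 by rewrite ltr_wpDl.
have := h (th0 + s *: v); rewrite addrAC subrr add0r normrZ gtr0_norm//.
rewrite mulrCA scalemxAl; apply.
apply: (le_trans (ler_wpM2r (normr_ge0 v) sle)).
rewrite -mulrA ler_piMr ?(ltW dl0)// mulrC ler_pdivrMr// mul1r lerDl//.
Qed.

Let direction_close v (eps : R) : 0 < eps -> exists2 s0, 0 < s0 & forall s, 0 < s -> s <= s0 ->
  `|dotv v (u (th0 + s *: v)) - s * dotv v (v *m J)| <= s * (eps * (d%:R * `|v| ^+ 2)).
Proof.
move=> e0; have [s0 s00 h] := line_close v e0; exists s0 => // s sp sle.
rewrite -dotvZr -dotvBr (le_trans (norm_dotv_le _ _))//.
rewrite [leRHS](_ : _ = d%:R * `|v| * (s * (eps * `|v|))); last by ring.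
by rewrite ler_wpM2l// ?mulr_ge0// h.
Qed.

(** Along v every switched comparison has the sign of its coefficient. *)
Lemma curvature_ge0 v : 0 <= dotv v (v *m J).
Proof.
apply/ler_addgt0Pr => e e0.
have k0 : 0 < d%:R * `|v| ^+ 2 + 1 by rewrite ltr_wpDl// mulr_ge0// sqr_ge0.
have [s s0 h] := direction_close v (divr_gt0 e0 k0).
have := h s s0 (lexx _).
have : 0 <= dotv v (u (th0 + s *: v)).
  rewrite u_direction; apply: ex2_ge0 => p; rewrite mulr_ge0 ?flip_dz_ge0//.
  by have /andP[] := a01 p.1.
have : e / (d%:R * `|v| ^+ 2 + 1) * (d%:R * `|v| ^+ 2) <= e.
  by rewrite mulrAC ler_pdivrMr// ler_wpM2l ?(ltW e0)// lerDl.
move: (_ / _ * _) (dotv v (v *m J)) (dotv v _) => x q k xe k00.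
rewrite ler_norml => /andP[_] h1.
rewrite -(ler_pM2l s0) mulr0 mulrDr; have := ler_wpM2l (ltW s0) xe; lra.
Qed.

(** A switched pair with |v'(Z - Z')| >= k contributes to any coordinate at most
    2 Kz / k times its directional term; one with |v'(Z - Z')| < k is a near tie at
    distance s k, and k is arbitrarily small. *)
Lemma curvature_eq0 v : dotv v (v *m J) = 0 -> v *m J = 0.
Proof.
move=> q0; apply/rowP => l; rewrite [RHS]mxE; apply/eqP; rewrite -normr_le0.
apply/ler_addgt0Pr => e e0; rewrite add0r.
have e3 : 0 < e / 3 by rewrite divr_gt0.
pose k : R := e / 3 / (4 * Kz * C + 1).
have kk : 0 < 4 * Kz * C + 1 by rewrite ltr_wpDl// !mulr_ge0.
have k0 : 0 < k by rewrite divr_gt0.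
pose e1 : R := e / 3 / (2 * Kz / k * (d%:R * `|v| ^+ 2) + 1).
have kk1 : 0 < 2 * Kz / k * (d%:R * `|v| ^+ 2) + 1.
  by rewrite ltr_wpDl// mulr_ge0// ?mulr_ge0 ?sqr_ge0// ?invr_ge0 ltW.
have e10 : 0 < e1 by rewrite divr_gt0.
pose e2 : R := e / 3 / (`|v| + 1).
have vp : 0 < `|v| + 1 by rewrite ltr_wpDl.
have e20 : 0 < e2 by rewrite divr_gt0.
have [s1 s10 h1] := direction_close v e10.
have [s2 s20 h2] := line_close v e20.
pose s := Num.min s1 s2.
have s0 : 0 < s by rewrite lt_min s10.
have ss1 : s <= s1 by rewrite ge_min lexx.
have ss2 : s <= s2 by rewrite ge_min lexx orbT.
have {}h1 := h1 s s0 ss1; have {}h2 := h2 s s0 ss2.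
rewrite q0 mulr0 subr0 u_direction ger0_norm in h1; last first.
  apply: ex2_ge0 => p; rewrite mulr_ge0 ?flip_dz_ge0//; by have /andP[] := a01 p.1.
have bn := bmfun_near_tie (R := R) my mz th0 (s * k).
have bfd : bmfun (fun p => a p.1 * (flip s v p * dz v p)) by apply: bmfunM => //; exact: bmfunM.
have ub : `|u (th0 + s *: v) 0 l| <=
    2 * Kz / k * ex2 P X (fun p => a p.1 * (flip s v p * dz v p)) +
    2 * Kz * ex2 P X (fun p => (near_tie y z th0 (s * k) p)%:R).
  rewrite u_coord -!(ex2Z iidX)// -(ex2D iidX); [|exact: bmfunZ|exact: bmfunZ].
  apply: (norm_ex2_le iidX).
  - apply: bmfunM => //; apply: bmfunB; [exact: (bmfun_fst (bmfun_z mz zK l))|exact: (bmfun_snd (bmfun_z mz zK l))].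
  - by apply: bmfunD; exact: bmfunZ.
  move=> p; have /andP[a0 a1] := a01 p.1.
  have zd : `|z p.1 0 l - z p.2 0 l| <= 2 * Kz.
    rewrite (le_trans (ler_normB _ _))// mulr_natl mulr2n lerD//;
      exact: le_trans (norm_coord_le _ _) (zK _).
  rewrite !normrM (ger0_norm a0).
  have fd0 : 0 <= flip s v p * dz v p by exact: flip_dz_ge0.
  have [kd|kd] := leP k `|dz v p|.
    apply: (@le_trans _ _ (2 * Kz / k * (a p.1 * (flip s v p * dz v p)))); last first.
      by rewrite lerDl !mulr_ge0.
    rewrite -(ger0_norm fd0) normrM (mulrC (2 * Kz / k)) -!mulrA; apply: ler_wpM2l => //.
    apply: ler_wpM2l => //; rewrite mulrCA; apply: (le_trans zd).
    by rewrite ler_pM2l// mulrCA -[leLHS]mulr1 ler_wpM2l// ler_pdivlMr// mul1r.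
  apply: (@le_trans _ _ (2 * Kz * (near_tie y z th0 (s * k) p)%:R)); last first.
    rewrite lerDr; apply: mulr_ge0; last exact: mulr_ge0.
    by apply: mulr_ge0; [exact: mulr_ge0|rewrite invr_ge0 ltW].
  case: (flip_cases v p s0) => [->|[fe /andP[f1 f2]]|[fe /andP[f1 f2]]].
  - by rewrite normr0 mulr0 mul0r mulr_ge0 ?mulr_ge0// ler0n.
  - have nt : near_tie y z th0 (s * k) p.
      rewrite /near_tie -/(V p) ltr0_norm//; move: kd; rewrite ltr_norml => /andP[_ kd].
      by have := ler_wpM2l (ltW s0) (ltW kd); lra.
    by rewrite fe nt normr1 !mulr1 -[leRHS]mul1r; exact: ler_pM.
  - have nt : near_tie y z th0 (s * k) p.
      rewrite /near_tie -/(V p) ger0_norm//; move: kd; rewrite ltr_norml => /andP[kd _].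
      by have := ler_wpM2l (ltW s0) (ltW kd); lra.
    by rewrite fe nt normrN normr1 !mulr1 -[leRHS]mul1r; exact: ler_pM.
have nt := ex2_near_tie iidX my mz anticoncentration th0 (mulr_ge0 (ltW s0) (ltW k0)).
have ul : `|(v *m J) 0 l| * s <= `|u (th0 + s *: v) 0 l| + s * (e2 * `|v|).
  have h3 : `|(u (th0 + s *: v) - s *: (v *m J)) 0 l| <= s * (e2 * `|v|).
    exact: le_trans (norm_coord_le _ _) h2.
  rewrite mulrC -[s in leLHS](gtr0_norm s0) -normrM.
  rewrite -[leLHS](_ : `|u (th0 + s *: v) 0 l - (u (th0 + s *: v) - s *: (v *m J)) 0 l| = _).
    by apply: (le_trans (ler_normB _ _)); rewrite lerD.
  by congr `|_|; move: (u _) (v *m J) => p q; rewrite !mxE; ring.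
rewrite -(ler_pM2r s0); apply: (le_trans ul).
have b1 : 2 * Kz / k * ex2 P X (fun p => a p.1 * (flip s v p * dz v p)) <= e / 3 * s.
  have kz : 0 <= 2 * Kz / k by rewrite mulr_ge0 ?mulr_ge0// invr_ge0 ltW.
  apply: (le_trans (ler_wpM2l kz h1)).
  rewrite [leLHS](_ : _ = (e / 3) * ((2 * Kz / k * (d%:R * `|v| ^+ 2)) /
     (2 * Kz / k * (d%:R * `|v| ^+ 2) + 1)) * s); last by rewrite /e1; ring.
  rewrite ler_wpM2r ?(ltW s0)// ler_piMr ?(ltW e3)// ler_pdivrMr// mul1r lerDl//.
have b2 : 2 * Kz * ex2 P X (fun p => (near_tie y z th0 (s * k) p)%:R) <= e / 3 * s.
  have kz : 0 <= 2 * Kz by rewrite mulr_ge0.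
  apply: (le_trans (ler_wpM2l kz nt)).
  rewrite [leLHS](_ : _ = (e / 3) * ((4 * Kz * C) / (4 * Kz * C + 1)) * s); last by rewrite /k; ring.
  rewrite ler_wpM2r ?(ltW s0)// ler_piMr ?(ltW e3)// ler_pdivrMr// mul1r lerDl//.
have b3 : s * (e2 * `|v|) <= e / 3 * s.
  rewrite mulrC; apply: ler_wpM2r; first exact: ltW.
  rewrite [leLHS](_ : _ = e / 3 * (`|v| / (`|v| + 1))); last by rewrite /e2; ring.
  by rewrite ler_piMr ?(ltW e3)// ler_pdivrMr// mul1r lerDl.
rewrite [leRHS](_ : _ = e / 3 * s + e / 3 * s + e / 3 * s); last by rewrite -!mulrDl; congr (_ * _); lra.
by rewrite lerD// (le_trans ub)// lerD.
Qed.

Lemma curvature_lower_bound v (m : R) (sq : nat -> R) :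
  (forall n, 0 < sq n) -> sq n @[n --> \oo] --> (0 : R) ->
  (forall n, m * sq n <= dotv v (u (th0 + sq n *: v))) -> m <= dotv v (v *m J).
Proof.
move=> sq0 sqc hm; apply/ler_addgt0Pr => e e0.
have k0 : 0 < d%:R * `|v| ^+ 2 + 1 by rewrite ltr_wpDl// mulr_ge0// sqr_ge0.
have [s1 s10 h] := direction_close v (divr_gt0 e0 k0).
have [n sn1] : exists n, sq n <= s1.
  have /cvgr0Pnorm_le /(_ _ s10)[N _ hN] := sqc.
  by exists N; have := hN N (leqnn _); rewrite gtr0_norm.
have := h _ (sq0 n) sn1.
have xe : e / (d%:R * `|v| ^+ 2 + 1) * (d%:R * `|v| ^+ 2) <= e.
  by rewrite mulrAC ler_pdivrMr// ler_wpM2l ?(ltW e0)// lerDl.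
rewrite ler_norml => /andP[_ h1]; have h2 := hm n.
rewrite -(ler_pM2r (sq0 n)); have := ler_wpM2l (ltW (sq0 n)) xe.
move: h1 h2; move: (_ / _ * _) (dotv v (v *m J)) (dotv v _) (sq n) => x q k t; lra.
Qed.

Lemma direction_lower_bound v s (k : R) (g : T -> T -> R) :
  0 < s -> bmfun (fun p : T * T => g p.1 p.2) ->
  (forall w w', k * g w w' <= a (X 0%N w) *
     (((0 <= V (X 0%N w, X 0%N w') + s * dz v (X 0%N w, X 0%N w'))%R%:R -
       (0 <= V (X 0%N w, X 0%N w'))%R%:R) * dz v (X 0%N w, X 0%N w'))) ->
  k * \int[P]_w \int[P]_w' g w w' <= dotv v (u (th0 + s *: v)).
Proof.
move=> s0 bg hg; rewrite u_direction /ex2.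
have bgw w : bmfun (g w) by exact: (bmfun_comp (pair1_measurable w) bg).
rewrite -exZ; last exact: (bmfun_ex_r P P bg).
have bf : bmfun (fun p : S * S => a p.1 * (flip s v p * dz v p)) by apply: bmfunM => //; exact: bmfunM.
have mXX : measurable_fun setT (fun p : T * T => (X 0%N p.1, X 0%N p.2)).
  apply: measurable_fun_pair; first by apply: measurableT_comp => //; exact: measurable_fst.
  by apply: measurableT_comp => //; exact: measurable_snd.
have bfX := bmfun_comp mXX bf.
apply: le_ex.
- by apply: bmfunZ; exact: (bmfun_ex_r P P bg).
- exact: (bmfun_ex_r P P bfX).
move=> w; rewrite -exZ//; apply: le_ex; first exact: bmfunZ.
  exact: (bmfun_comp (pair1_measurable w) bfX).
by move=> w'; exact: hg.
Qed.

Variables (e c : T -> R) (F : probability R R) (tau : R).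
Hypotheses (me : measurable_fun setT e) (mc : measurable_fun setT c)
  (rsE : forall w, rs y z th0 (X 0%N w) = Num.min (e w) (c w))
  (aE : forall w, a (X 0%N w) = (e w <= c w)%R%:R).
Let low v t w := (dotv v (z (X 0%N w)) <= t) && (tau <= c w).
Let high v t w := (t <= dotv v (z (X 0%N w))) && (tau <= c w).
Hypothesis e_low : forall v t (B : set R), measurable B ->
  pr P (e @^-1` B `&` [set w | low v t w]) = pr F B * pr P [set w | low v t w].
Hypothesis e_high : forall v t (B : set R), measurable B ->
  pr P (e @^-1` B `&` [set w | high v t w]) = pr F B * pr P [set w | high v t w].

Let mdv v : measurable_fun setT (fun w => dotv v (z (X 0%N w))).
Proof.
under eq_fun do rewrite dotvE.
apply: measurable_sum => k; apply: measurable_funM; first exact: measurable_cst.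
exact: (measurableT_comp (mz k) (mX 0%N)).
Qed.

Let mlow v t : measurable_fun setT (low v t).
Proof. by apply: measurable_and; apply: measurable_fun_ler => //; exact: measurable_cst. Qed.

Let mhigh v t : measurable_fun setT (high v t).
Proof. by apply: measurable_and; apply: measurable_fun_ler => //; exact: measurable_cst. Qed.

Let cell (a0 h : R) (j : nat) (x : R) := j%:R * h <= x - a0 < j.+1%:R * h.

Let mcell a0 h j : measurable_fun setT (fun w => cell a0 h j (e w)).
Proof.
apply: measurable_and; [apply: measurable_fun_ler|apply: measurable_fun_ltr];
  by [exact: measurable_cst|apply: measurable_funB => //; exact: measurable_cst].
Qed.

Let cell_prob a0 h j (b : T -> bool) (c0 : R) :
  (forall B, measurable B -> pr P (e @^-1` B `&` [set w | b w]) = pr F B * pr P [set w | b w]) ->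
  measurable_fun setT b -> c0 * h <= pr F `[a0 + j%:R * h, a0 + j.+1%:R * h[%classic ->
  c0 * h * pr P [set w | b w] <= \int[P]_w (cell a0 h j (e w) && b w)%:R.
Proof.
move=> eb mb cF; rewrite ex_bool; last by apply: measurable_and.
rewrite [X in _ <= pr P X](_ : _ = e @^-1` `[a0 + j%:R * h, a0 + j.+1%:R * h[ `&` [set w | b w]).
  by rewrite eb// ler_wpM2r ?pr_ge0.
apply/seteqP; split => w /=; rewrite in_itv/= /cell lerBrDl ltrBlDl.
  by move=> /andP[].
by move=> [-> ->].
Qed.

(** Cut an interval where errors have density at least c0 into cells of width h.
    Two errors in adjacent cells whose values of v'Z are kappa apart switch order
    at step 2 h / kappa. There are about 1 / h cells, each pair having probability
    of order h^2, so the switches have probability of order h, the step itself. *)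
Lemma curvature_gt0 v t kappa a0 b0 c0 : 0 < kappa -> a0 < b0 -> b0 <= tau -> 0 < c0 ->
  (forall s1 s2, a0 <= s1 -> s1 <= s2 -> s2 <= b0 -> c0 * (s2 - s1) <= pr F `[s1, s2[%classic) ->
  0 < pr P [set w | low v t w] -> 0 < pr P [set w | high v (t + kappa) w] ->
  0 < dotv v (v *m J).
Proof.
move=> k0 ab bt c00 cF p10 p20; set p1 := pr P _ in p10; set p2 := pr P _ in p20.
have ab0 : 0 < b0 - a0 by rewrite subr_gt0.
pose h n : R := (b0 - a0) / n.+2%:R; have h0 n : 0 < h n by rewrite divr_gt0.
apply: (@lt_le_trans _ _ (kappa ^+ 2 * c0 ^+ 2 * (p1 * p2) * (b0 - a0) / 4)).
  by rewrite divr_gt0// !mulr_gt0// exprn_gt0.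
apply: (@curvature_lower_bound _ _ (fun n => 2 * h n / kappa)) => [n||n].
- by rewrite divr_gt0// mulr_gt0.
- rewrite (_ : (0 : R) = 2 * ((b0 - a0) * 0) / kappa); last by rewrite !(mulr0, mul0r).
  apply: cvgMl; apply: cvgMr; apply: cvgMr.
  have := @cvg_harmonic R; rewrite -(cvg_shiftn 1); apply: cvg_trans.
  by apply: near_eq_cvg; near=> m; rewrite /= addn1.
pose g (w w' : T) : R := \sum_(j < n.+1) (cell a0 (h n) j.+1 (e w) && high v (t + kappa) w)%:R *
   (cell a0 (h n) j (e w') && low v t w')%:R.
have b2 j : bmfun (fun w => (cell a0 (h n) j (e w) && high v (t + kappa) w)%:R : R).
  by apply: bmfun_bool; apply: measurable_and.
have b1 j : bmfun (fun w => (cell a0 (h n) j (e w) && low v t w)%:R : R).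
  by apply: bmfun_bool; apply: measurable_and.
have bg : bmfun (fun p : T * T => g p.1 p.2).
  by apply: bmfun_sum => j; apply: bmfunM; [exact: (bmfun_fst (b2 _))|exact: (bmfun_snd (b1 _))].
have cellF j : (j <= n.+1)%N -> c0 * h n <= pr F `[a0 + j%:R * h n, a0 + j.+1%:R * h n[%classic.
  move=> jn; apply: le_trans (cF _ _ _ _ _).
  - rewrite -natr1; rewrite [leRHS](_ : _ = c0 * h n)//; ring.
  - by rewrite lerDl mulr_ge0// ltW.
  - by rewrite lerD2l ler_wpM2r ?(ltW (h0 n))// ler_nat.
  - rewrite -lerBrDl /h mulrCA ler_piMr ?(ltW ab0)// ler_pdivrMr// mul1r ler_nat.
    by rewrite ltnS.
have gint : n.+1%:R * ((c0 * h n * p2) * (c0 * h n * p1)) <= \int[P]_w \int[P]_w' g w w'.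
  have gE w : \int[P]_w' g w w' = \sum_(j < n.+1) (cell a0 (h n) j.+1 (e w) && high v (t + kappa) w)%:R *
     \int[P]_w' (cell a0 (h n) j (e w') && low v t w')%:R.
    rewrite /g ex_sum; last by move=> j; exact: bmfunZ.
    by apply: eq_bigr => j _; rewrite exZ.
  rewrite (ex_eq P gE) ex_sum; last by move=> j; apply: bmfunM => //; exact: bmfun_cst.
  under eq_bigr do rewrite exZr//.
  rewrite mulr_natl -[X in _ *+ X]card_ord -sumr_const; apply: ler_sum => j _.
  have chn : 0 <= c0 * h n by rewrite mulr_ge0 ?ltW.
  apply: ler_pM; try by apply: mulr_ge0 => //; exact: pr_ge0.
  - apply: cell_prob; [exact: e_high|exact: mhigh|apply: cellF; exact: ltn_ord].
  - apply: cell_prob; [exact: e_low|exact: mlow|apply: cellF; exact: ltnW (ltn_ord _)].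
have sn0 : 0 < 2 * h n / kappa by rewrite divr_gt0// mulr_gt0.
apply: (@le_trans _ _ (kappa * \int[P]_w \int[P]_w' g w w')); last first.
  apply: direction_lower_bound => // w w'.
  have step j : (cell a0 (h n) j.+1 (e w) && high v (t + kappa) w) ->
      (cell a0 (h n) j (e w') && low v t w') -> (j < n.+1)%N ->
      kappa <= a (X 0%N w) * (((0 <= V (X 0%N w, X 0%N w') + 2 * h n / kappa * dz v (X 0%N w, X 0%N w'))%R%:R -
       (0 <= V (X 0%N w, X 0%N w'))%R%:R) * dz v (X 0%N w, X 0%N w')).
    move=> /andP[/andP[c1 c2] /andP[c3 c4]] /andP[/andP[c5 c6] /andP[c7 c8]] jn.
    have ub (x : R) k : (k <= n.+1)%N -> x - a0 < k.+1%:R * h n -> x < b0.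
      move=> kn xk; rewrite -(ltrD2r (- a0)); apply: (lt_le_trans xk).
      rewrite /h mulrCA ler_piMr ?(ltW ab0)// ler_pdivrMr// mul1r ler_nat.
      by rewrite ltnS.
    have ew : e w <= c w by exact: (le_trans (ltW (ub _ _ jn c2)) (le_trans bt c4)).
    have ew' : e w' <= c w' by exact: (le_trans (ltW (ub _ _ (ltnW jn) c6)) (le_trans bt c8)).
    rewrite aE ew mul1r /V /= !rsE (min_l ew) (min_l ew').
    have dk : kappa <= dz v (X 0%N w, X 0%N w') by rewrite /dz dotvBr/=; lra.
    rewrite (_ : (0 <= e w' - e w) = false); last by apply/negbTE; rewrite -ltNge subr_lt0; lra.
    have := ler_wpM2l (ltW sn0) dk; rewrite divfK ?gt_eqF// => hd.
    have {}c2 : e w - a0 < j%:R * h n + 2 * h n by move: c2; rewrite -addn2 natrD mulrDl.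
    have -> : 0 <= e w' - e w + 2 * h n / kappa * dz v (X 0%N w, X 0%N w').
      by apply: le_trans (_ : e w' - e w + 2 * h n <= _); [lra|rewrite lerD2l].
    by rewrite subr0 mul1r.
  have [j0 j0P|none] := pickP [pred j : 'I_n.+1 | (cell a0 (h n) j.+1 (e w) && high v (t + kappa) w) &&
      (cell a0 (h n) j (e w') && low v t w')].
    move: j0P => /= /andP[x1 x2]; apply: le_trans (step _ x1 x2 (ltn_ord _)).
    rewrite ler_piMr ?(ltW k0)// (le_trans _ (cells_sum_le1 n.+1 (e w' - a0) (h0 n)))//.
    apply: ler_sum => j _; rewrite -natrM ler_nat mulnb/=.
    by rewrite -/(cell a0 (h n) j (e w')); case: (cell _ _ j _); rewrite /= ?andbF ?leq_b1.
  rewrite /g big1 ?mulr0; last first.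
    by move=> j _; rewrite -natrM mulnb; have /= -> := none j.
  rewrite -/(flip _ _ _) mulr_ge0 ?flip_dz_ge0//; by have /andP[] := a01 (X 0%N w).
apply: le_trans (ler_wpM2l (ltW k0) gint).
rewrite [leLHS](_ : _ = kappa * (c0 ^+ 2 * (p1 * p2) * h n * ((b0 - a0) / 2))); last by field; rewrite gt_eqF.
rewrite [leRHS](_ : _ = kappa * (c0 ^+ 2 * (p1 * p2) * h n * (n.+1%:R * h n))); last by ring.
apply: ler_wpM2l; first exact: ltW.
apply: ler_wpM2l; first by rewrite !mulr_ge0 ?ltW// ?sqr_ge0.
rewrite /h mulrCA ler_wpM2l ?(ltW ab0)// ler_pdivlMr// mulrC ler_pdivrMr// -natrM ler_nat.
by rewrite muln2 -addnn addSn ltnS leq_addl.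
Unshelve. all: by end_near. Qed.

End curvature.

Lemma positive_density_interval (R : realType) (F : probability R R) (f : R -> R) (tau : R) :
  (forall t, 0 <= f t) -> (forall t : R, {for t, continuous f}) ->
  (forall B : set R, measurable B -> F B = (\int[lebesgue_measure]_(t in B) (f t)%:E)%E) ->
  (0 < F `]-oo, tau]%classic)%E ->
  exists a0 b0 c0 : R, [/\ a0 < b0, b0 <= tau, 0 < c0 &
    forall s1 s2, a0 <= s1 -> s1 <= s2 -> s2 <= b0 -> c0 * (s2 - s1) <= pr F `[s1, s2[%classic].
Proof.
move=> f0 cf Ff F0.
have [x xt fx] : exists2 x, x <= tau & 0 < f x.
  apply: contrapT => h; move: F0; rewrite Ff// integral0_eq ?ltxx// => t /=.
  rewrite in_itv/= => tt; congr (_%:E); apply/eqP; rewrite eq_le f0 andbT leNgt.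
  by apply/negP => ft; apply: h; exists t.
have mf : measurable_fun setT f by apply: continuous_measurable_fun => t; exact: cf.
have fx2 : 0 < f x / 2 by rewrite divr_gt0.
have := cf x; move=> /cvgrPdist_lt /(_ _ fx2)/nbhs_ballP[dl /= dl0 hdl].
exists (x - dl / 2), x, (f x / 2); split=> //.
  by rewrite ltrBlDl ltrDr divr_gt0.
move=> s1 s2 s1a s12 s2b.
rewrite -lee_fin /pr fineK ?fin_num_measure// Ff//.
apply: (@le_trans _ _ (\int[lebesgue_measure]_(t in `[s1, s2[%classic) (f x / 2)%:E)%E).
  rewrite integral_cst//= lebesgue_measure_itv/= lte_fin.
  have [->|s12'] := eqVneq s1 s2; first by rewrite ltxx subrr mulr0 mule0.
  by rewrite lt_neqAle s12' s12 -EFinB EFinM.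
apply: ge0_le_integral => //; try by move=> t _; rewrite lee_fin ?ltW.
  by apply/measurable_EFinP; exact: measurable_funTS.
move=> t /=; rewrite in_itv/= => /andP[ts1 ts2]; rewrite lee_fin.
have := hdl t; rewrite /ball/= => /(_ _).
have ball_t : `|x - t| < dl.
  have xt0 : 0 <= x - t by rewrite subr_ge0 (le_trans (ltW ts2)).
  rewrite ger0_norm//; apply: (@le_lt_trans _ _ (dl / 2)).
    by rewrite lerBlDr -lerBlDl (le_trans s1a).
  by rewrite ltr_pdivrMr// mulr_natr mulr2n ltrDl.
move=> /(_ ball_t); rewrite ltr_norml => /andP[_]; move: (f x) (f t) => p q; lra.
Qed.

Lemma constant_of_no_spread d (T : measurableType d) (R : realType) (P : probability T R)
    (U : T -> R) (K : R) :
  measurable_fun setT U -> (forall w, `|U w| <= K) ->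
  (forall t k, 0 < k -> pr P [set w | U w <= t] = 0 \/ pr P [set w | t + k <= U w] = 0) ->
  exists c, P.-negligible [set w | U w != c].
Proof.
move=> mU UK h.
have mle t : measurable [set w | U w <= t].
  by apply: measurable_set_bool; apply: measurable_fun_ler => //; exact: measurable_cst.
have mge t : measurable [set w | t <= U w].
  by apply: measurable_set_bool; apply: measurable_fun_ler => //; exact: measurable_cst.
pose A := [set t | pr P [set w | U w <= t] = 0].
have sA : has_sup A.
  split.
    exists (- K - 1); rewrite /A/= (_ : [set w | _] = set0) ?/pr ?measure0//.
    rewrite -subset0 => w /=; have := UK w; rewrite ler_norml => /andP[a _] b; lra.
  exists K => t; rewrite /A/= => pt; rewrite leNgt; apply/negP => Kt.
  move: pt; rewrite (_ : [set w | _] = setT) ?pr_setT; first by move/eqP; rewrite oner_eq0.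
  by rewrite -subTset => w _ /=; have := UK w; rewrite ler_norml => /andP[_ b]; lra.
exists (sup A).
have null (B : set T) : measurable B -> pr P B = 0 -> P.-negligible B.
  by move=> mB B0; exists B; split => //; rewrite prE// B0.
apply: (@negligibleS _ _ _ P (\bigcup_n ([set w | U w <= sup A - n.+1%:R^-1] `|`
    [set w | sup A + n.+1%:R^-1 + n.+1%:R^-1 <= U w]))).
  move=> w /= Uw.
  have e0 : 0 < `|U w - sup A| / 2 by rewrite divr_gt0// normr_gt0 subr_eq0.
  have [n hn] : exists n, n.+1%:R^-1 < `|U w - sup A| / 2.
    have := near_infty_natSinv_lt (PosNum e0) => -[N _ hN]; exists N; exact: hN N (leqnn _).
  exists n => //=; case: (leP 0 (U w - sup A)) => s.
    by right; move: hn; rewrite ger0_norm//; move: (_^-1) => x; lra.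
  by left; move: hn; rewrite ltr0_norm//; move: (_^-1) (invr_ge0 (n.+1%:R : R)) => x; rewrite ler0n; lra.
apply: negligible_bigcup => n; apply: negligibleU; apply: null => //.
- have n0 : 0 < n.+1%:R^-1 :> R by rewrite invr_gt0.
  have [t At tlt] := sup_adherent n0 sA.
  apply/eqP; rewrite eq_le pr_ge0 andbT -[leRHS]At.
  by apply: le_pr => // w /= /le_trans; apply; exact: ltW.
- have n0 : 0 < n.+1%:R^-1 :> R by rewrite invr_gt0.
  have [Ac|//] := h (sup A + n.+1%:R^-1) _ n0.
  have : sup A + n.+1%:R^-1 <= sup A by apply: (@ub_le_sup _ A) => //; case: sA.
  by rewrite gerDl leNgt n0.
Qed.

Lemma mulmx_coord_continuous (R : realType) (d m : nat) (J : 'M[R]_(d, m)) k :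
  continuous (fun v : 'rV[R]_d => (v *m J) 0 k).
Proof.
rewrite (_ : (fun v => _) = (fun v : 'rV[R]_d => \sum_i v 0 i * J i k)); last first.
  by apply/funext => v; rewrite mxE.
apply: (continuous_big (op := +%R)) => [|i _ v]; first exact: add_continuous.
apply: continuousM; first exact: (@coord_continuous R 1 d 0 i v).
by apply: cvg_cst; exact: nbhs_filter.
Qed.

(** Compactness of the unit sphere of the range of Pi. *)
Lemma quadratic_lower_bound (R : realType) (d : nat) (J Pi : 'M[R]_d) :
  (forall v : 'rV[R]_d, 0 <= dotv v (v *m J)) ->
  (forall v : 'rV[R]_d, v *m Pi = v -> dotv v (v *m J) = 0 -> v = 0) ->
  exists2 c, 0 < c & forall v : 'rV[R]_d, v *m Pi = v -> c * `|v| ^+ 2 <= dotv v (v *m J).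
Proof.
move=> q0 qnd.
pose A : set 'rV[R]_d := [set v | `|v| = 1 /\ v *m Pi = v].
have cq : continuous (fun v : 'rV[R]_d => dotv v (v *m J)).
  rewrite (_ : (fun v => _) = (fun v : 'rV[R]_d => \sum_k v 0 k * (v *m J) 0 k)); last first.
    by apply/funext => v; rewrite dotvE.
  apply: (continuous_big (op := +%R)) => [x|k _ v]; first exact: add_continuous.
  by apply: continuousM; [exact: (@coord_continuous R 1 d 0 k v)|exact: mulmx_coord_continuous].
have cA : compact A.
  apply: bounded_closed_compact.
    by exists 1; split => // x x1 v [v1 _]; apply: le_trans (ltW x1); rewrite -v1.
  apply: closedI.
    apply: (closed_comp (f := fun v : 'rV[R]_d => `|v|) (D := [set 1])).
      by move=> v _; exact: norm_continuous.
    exact: closed_eq.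
  rewrite (_ : (fun v => _) = \bigcap_(k in [set: 'I_d])
      (fun v : 'rV[R]_d => (v *m Pi) 0 k - v 0 k) @^-1` [set 0]).
    apply: closed_bigI => k _; apply: closed_comp; last exact: closed_eq.
    move=> v _; apply: continuousB; first exact: mulmx_coord_continuous.
    exact: (@coord_continuous R 1 d 0 k v).
  apply/seteqP; split => v /= => [vPi k _ /=|h]; first by rewrite vPi subrr.
  by apply/rowP => k; apply/eqP; rewrite -subr_eq0; apply/eqP; exact: h.
have scale (c : R) : 0 <= c -> (forall v, A v -> c <= dotv v (v *m J)) ->
    forall v : 'rV[R]_d, v *m Pi = v -> c * `|v| ^+ 2 <= dotv v (v *m J).
  move=> c0 h v vPi; have [->|v0] := eqVneq v 0; first by rewrite normr0 expr0n mulr0.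
  have nv : 0 < `|v| by rewrite normr_gt0.
  have := h (`|v|^-1 *: v); rewrite -scalemxAl dotvZl dotvZr.
  have Av : A (`|v|^-1 *: v).
    split; last by rewrite -scalemxAl vPi.
    by rewrite normrZ normfV normr_id mulVf// gt_eqF.
  move=> /(_ Av); rewrite mulrA -expr2 exprVn -ler_pdivrMl ?invr_gt0 ?exprn_gt0//.
  by rewrite invrK mulrC.
have [[v0 Av0]|A0] := pselect (A !=set0); last first.
  by exists 1 => //; apply: scale => // v Av; case: A0; exists v.
have [v1 /set_mem Av1 h1] := EVT_min_rV (ex_intro _ v0 Av0) cA (continuous_subspaceT cq).
have [v11 v1P] := Av1.
exists (dotv v1 (v1 *m J)); last by apply: scale => // v Av; apply: h1; rewrite inE.
rewrite lt_neqAle q0 andbT eq_sym; apply/eqP => /(qnd _ v1P) v10.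
by move: v11; rewrite v10 normr0 => /eqP; rewrite eq_sym oner_eq0.
Qed.

(** * Stochastic order calculus *)

Lemma jacobian_estimate (R : realType) (d m : nat) (g : 'rV[R]_d -> 'rV[R]_m) (x : 'rV[R]_d) :
  differentiable g x -> forall eps : R, 0 < eps -> exists2 dl : R, 0 < dl & forall th,
    `|th - x| <= dl -> `|g th - g x - (th - x) *m 'J g x| <= eps * `|th - x|.
Proof.
move=> dg eps e0; have /diff_locallyP[_ /eqaddoP/(_ _ e0)/nbhs_ballP[dl /= dl0 h]] := dg.
exists (dl / 2) => [|th thx]; first by rewrite divr_gt0.
have := h (th - x); rewrite -ball_normE /= sub0r normrN /= => /(_ _).
rewrite !fctE /= subrK mul_rV_lin1 /= opprD addrA; apply.
by apply: (le_lt_trans thx); rewrite ltr_pdivrMr// mulr_natr mulr2n ltrDl.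
Qed.

(** A common shift of all residuals preserves their order. *)
Lemma score_shift (dT : measure_display) (T : measurableType dT) (R : realType) (d n : nat) (Y : nat -> T -> R)
    (Delta : nat -> T -> bool) (Z : nat -> T -> 'rV[R]_d) (Om W : nat -> T -> R)
    (th th' : 'rV[R]_d) (c : R) (w : T) :
  (forall i, resid th (Y i w) (Z i w) = resid th' (Y i w) (Z i w) + c) ->
  score Y Delta Z Om W n th w = score Y Delta Z Om W n th' w.
Proof.
move=> h; rewrite /score /Psi_n; congr (_ *: _); apply: eq_bigr => i _.
have ar j : at_risk Y Z (resid th (Y i w) (Z i w)) th j w =
    at_risk Y Z (resid th' (Y i w) (Z i w)) th' j w.
  by rewrite /at_risk !h lerD2r.
have e1 : rho_hat Y Z W n w (resid th (Y i w) (Z i w)) th =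
    rho_hat Y Z W n w (resid th' (Y i w) (Z i w)) th'.
  by rewrite /rho_hat; congr (_ / _); apply: eq_bigr => j _; rewrite ar.
have e2 : eta_hat Y Z W n w (resid th (Y i w) (Z i w)) th =
    eta_hat Y Z W n w (resid th' (Y i w) (Z i w)) th'.
  rewrite /eta_hat; congr (_^-1 *: _); apply: eq_bigr => j _; by rewrite ar.
by rewrite e1 e2.
Qed.

Section small_o.
Context {dT : measure_display} {T : measurableType dT} {R : realType}.
Variable P : probability T R.

Lemma op_starD (V : normedModType R) (X1 X2 : nat -> T -> V) :
  op_star P X1 (fun=> 1) -> op_star P X2 (fun=> 1) ->
  op_star P (fun n w => X1 n w + X2 n w) (fun=> 1).
Proof.
move=> /op_starP h1 /op_starP h2; apply/op_starP => eps e0.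
have e2 : 0 < eps / 2 by rewrite divr_gt0.
apply: (negl_sub _ (negl_setU (h1 _ e2) (h2 _ e2))); apply: nearW => n w /=; rewrite !mulr1 => h.
have [x1|x1] := ltP (eps / 2) `|X1 n w|; first by left.
have [x2|x2] := ltP (eps / 2) `|X2 n w|; first by right.
have := le_trans (ler_normD _ _) (lerD x1 x2); by rewrite -splitr leNgt h.
Qed.

Lemma op_starN (V : normedModType R) (X1 : nat -> T -> V) :
  op_star P X1 (fun=> 1) -> op_star P (fun n w => - X1 n w) (fun=> 1).
Proof.
move=> /op_starP h; apply/op_starP => eps e0.
by apply: (negl_sub _ (h _ e0)); apply: nearW => n w /=; rewrite normrN.
Qed.

Lemma op_star_mulmxr (d m : nat) (X1 : nat -> T -> 'rV[R]_d) (M : 'M[R]_(d, m)) :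
  op_star P X1 (fun=> 1) -> op_star P (fun n w => X1 n w *m M) (fun=> 1).
Proof.
move=> /op_starP h; apply/op_starP => eps e0.
pose S := \sum_(p : 'I_d * 'I_m) `|M p.1 p.2|.
have S0 : 0 <= S by apply: sumr_ge0.
have S1 : 0 < S + 1 by rewrite ltr_wpDl.
have e1 : 0 < eps / (S + 1) by rewrite divr_gt0.
apply: (negl_sub _ (h _ e1)); apply: nearW => n w /=; rewrite !mulr1 => hw.
rewrite ltr_pdivrMr// (lt_le_trans hw)// (le_trans (norm_mulmx_le _ _))// -/S mulrC.
by rewrite ler_wpM2l// lerDl.
Qed.

Lemma op_star_rescale (V : normedModType R) (X1 : nat -> T -> V) (a : nat -> R) :
  (forall n, (0 < n)%N -> 0 < a n) -> op_star P X1 (fun n => (a n)^-1) ->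
  op_star P (fun n w => a n *: X1 n w) (fun=> 1).
Proof.
move=> a0 /op_starP h; apply/op_starP => eps e0.
apply: (negl_sub _ (h _ e0)); near=> n => w /=; rewrite mulr1.
have an : 0 < a n by apply: a0; near: n; exact: nbhs_infty_gt.
by rewrite normrZ gtr0_norm// ltr_pdivrMr// mulrC.
Unshelve. all: by end_near. Qed.

End small_o.

(** * Central limit theorem for cosines *)

Lemma derivative_growth (R : realType) (f df : R -> R) (c : R) (k : nat) :
  (forall x : R, is_derive x (1 : R) f (df x)) -> f 0 = 0 ->
  (forall x, `|df x| <= c * `|x| ^+ k) -> forall x, `|f x| <= c * `|x| ^+ k.+1.
Proof.
move=> fd f0 dfk x.
have cf (y : R) : {for y, continuous f}.
  by apply: differentiable_continuous; apply/derivable1_diffP; case: (fd y).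
have c0 : 0 <= c.
  by have := le_trans (normr_ge0 _) (dfk 1); rewrite normr1 expr1n mulr1.
have main (y : R) : `|y| <= `|x| -> `|df y * x| <= c * `|x| ^+ k.+1.
  move=> yx; rewrite normrM exprSr mulrA ler_wpM2r// (le_trans (dfk y))// ler_wpM2l//.
  by rewrite lerXn2r ?nnegrE.
have cs (a b : R) : {within `[a, b], continuous f} by apply: continuous_subspaceT => y; exact: cf.
have [x0|x0] := leP 0 x.
  have [y] := MVT_segment x0 (fun y _ => fd y) (cs _ _).
  rewrite f0 !subr0 in_itv/= => /andP[y0 yx] ->.
  by apply: main; rewrite !ger0_norm.
have [y] := MVT_segment (ltW x0) (fun y _ => fd y) (cs _ _).
rewrite f0 !sub0r in_itv/= => /andP[yx y0] fx.
rewrite -normrN fx mulrN normrN; apply: main.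
by rewrite (ler0_norm y0) (ltr0_norm x0) lerN2.
Qed.

Section trigonometric_bounds.
Context {R : realType}.
Implicit Types x : R.

Lemma norm_sin_le x : `|sin x| <= `|x|.
Proof.
have h := @derivative_growth R sin cos 1 0 (fun x => is_derive_sin x) (sin0 R).
rewrite -[leRHS]mul1r -[`|x|]expr1; apply: h => y; rewrite expr0 mulr1; exact: cos_max.
Qed.

Lemma norm_cos_sub1_le x : `|cos x - 1| <= `|x| ^+ 2.
Proof.
rewrite -[leRHS]mul1r.
apply: (@derivative_growth R (fun x => cos x - 1) (fun x => - sin x) 1 1) => [y||y].
- by rewrite -[- sin y]subr0; apply: is_deriveB.
- by rewrite cos0 subrr.
- by rewrite normrN mul1r expr1 norm_sin_le.
Qed.

Lemma norm_sin_sub_le x : `|sin x - x| <= `|x| ^+ 3.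
Proof.
have h (y : R) : is_derive y (1 : R) (fun x => sin x - x) (cos y - 1) by apply: is_deriveB.
rewrite -[leRHS]mul1r; apply: (derivative_growth (k := 2) h) => [|y]; first by rewrite sin0 subrr.
by rewrite mul1r norm_cos_sub1_le.
Qed.

Lemma norm_cos_quadratic_le x : `|cos x - 1 + x ^+ 2 / 2| <= `|x| ^+ 4.
Proof.
have h (y : R) : is_derive y (1 : R) (fun x => cos x - 1 + x ^+ 2 / 2) (- sin y + y).
  by apply: trigger_derive; rewrite /GRing.scale/=; field.
rewrite -[leRHS]mul1r; apply: (derivative_growth (k := 3) h) => [|y].
  by rewrite cos0 subrr expr0n mul0r addr0.
by rewrite mul1r addrC -normrN opprB norm_sin_sub_le.
Qed.

Lemma expR_quadratic x : 0 <= x -> `|expR (- x) - 1 + x| <= x ^+ 2.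
Proof.
move=> x0; have h1 := expR_ge1Dx (- x); have h2 := expR_ge1Dx x.
rewrite ger0_norm; last by lra.
have x1 : 0 < 1 + x by rewrite ltr_wpDr.
have : expR (- x) <= (1 + x)^-1 by rewrite expRN lef_pV2// posrE expR_gt0.
have : (1 + x)^-1 <= 1 - x + x ^+ 2.
  rewrite -[leLHS]mul1r ler_pdivrMr//.
  have -> : (1 - x + x ^+ 2) * (1 + x) = 1 + x ^+ 3 by ring.
  by rewrite lerDl exprn_ge0.
by move: (expR _) (_^-1) => a b; lra.
Qed.

End trigonometric_bounds.

Section central_limit_cosine.
Context {dT : measure_display} {T : measurableType dT} {R : realType}.
Variable P : probability T R.
Context {ds : measure_display} {S : measurableType ds}.
Variable X : nat -> T -> S.
Hypothesis iidX : iid P X.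
Let mX := iid_measurable iidX.
Variables (xi : S -> R) (B : R).
Hypotheses (bxi : bmfun xi) (xiB : forall s, `|xi s| <= B).
Hypothesis xi0 : \int[P]_w xi (X 0%N w) = 0.
Let s2 := \int[P]_w xi (X 0%N w) ^+ 2.
Let Tk (k : nat) w := \sum_(i < k) xi (X i w).

Let B0 : 0 <= B. Proof. exact: le_trans (xiB point). Qed.
Let bX0 : bmfun (fun w => xi (X 0%N w)). Proof. exact: (bmfun_comp (mX 0%N) bxi). Qed.
Let s20 : 0 <= s2. Proof. by apply: ex_ge0 => w; exact: sqr_ge0. Qed.
Let s2B : s2 <= B ^+ 2.
Proof.
rewrite -[leRHS](ex_cst P); apply: le_ex; [exact: bmfunX|exact: bmfun_cst|move=> w].
by rewrite -[leLHS]real_normK ?num_real// lerXn2r ?nnegrE// normr_ge0.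
Qed.

Let Tk_indep k : measurable_fun setT (Tk k) /\ independent_pair P (Tk k) (X k).
Proof.
apply: (@iid_indep_fold _ _ _ _ _ _ _ iidX _ R (fun (j : nat) (p : R * S) => p.1 + xi p.2) Tk 0).
- move=> j; apply: measurable_funD; first exact: measurable_fst.
  by apply: measurableT_comp; [exact: (bmfun_measurable bxi)|exact: measurable_snd].
- by move=> w; rewrite /Tk big_ord0.
- by move=> j w; rewrite /Tk big_ord_recr.
Qed.

Let bcos (g : R -> R) (c : R) : continuous g -> bmfun (fun t => cos (g t + c)).
Proof.
move=> cg; split; last by exists 1 => t; exact: cos_max.
apply: measurableT_comp; first exact: continuous_measurable_fun (@continuous_cos R).
by apply: measurable_funD; [exact: continuous_measurable_fun|exact: measurable_cst].
Qed.

Let bcosZ (h c : R) : bmfun (fun t => cos (h * t + c)).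
Proof. by apply: bcos => t; apply: cvgMr; exact: cvg_id. Qed.

Let bsinZ (h c : R) : bmfun (fun t => sin (h * t + c)).
Proof.
apply: (bmfun_eq (f := fun t => cos (h * t + (c - pi / 2)))); last exact: bcosZ.
by move=> t; rewrite addrA cosBpihalf.
Qed.

Let step (h c : R) (k : nat) : 0 < h -> h <= 1 ->
  `|\int[P]_w cos (h * Tk k.+1 w + c) - expR (- (s2 / 2 * h ^+ 2)) * \int[P]_w cos (h * Tk k w + c)| <=
  (B ^+ 3 + 2 * B ^+ 4) * h ^+ 3.
Proof.
move=> h0 h1; have [mT iT] := Tk_indep k.
have bc := bcosZ h 0; have bs := bsinZ h 0.
have bcx : bmfun (fun s => cos (h * xi s)).
  by apply: (bmfun_eq (f := fun s => cos (h * xi s + 0))) => [s|]; [rewrite addr0|exact: (bmfun_comp (bmfun_measurable bxi) bc)].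
have bsx : bmfun (fun s => sin (h * xi s)).
  by apply: (bmfun_eq (f := fun s => sin (h * xi s + 0))) => [s|]; [rewrite addr0|exact: (bmfun_comp (bmfun_measurable bxi) bs)].
have bcT : bmfun (fun w => cos (h * Tk k w + c)) by exact: (bmfun_comp mT (bcosZ h c)).
have bsT : bmfun (fun w => sin (h * Tk k w + c)) by exact: (bmfun_comp mT (bsinZ h c)).
have e1 : \int[P]_w cos (h * Tk k.+1 w + c) =
    (\int[P]_w cos (h * Tk k w + c)) * (\int[P]_w cos (h * xi (X 0%N w))) -
    (\int[P]_w sin (h * Tk k w + c)) * (\int[P]_w sin (h * xi (X 0%N w))).
  rewrite -(iid_ex iidX k bcx) -(iid_ex iidX k bsx).
  rewrite -(indep_exM mT (mX k) iT (bcosZ h c) bcx) -(indep_exM mT (mX k) iT (bsinZ h c) bsx).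
  rewrite -exB; last 2 first.
  - by apply: bmfunM => //; exact: (bmfun_comp (mX k) bcx).
  - by apply: bmfunM => //; exact: (bmfun_comp (mX k) bsx).
  apply: ex_eq => w; rewrite -cosD; congr cos.
  by rewrite /Tk big_ord_recr/= mulrDr -addrA -addrA (addrC c).
have bX00 : bmfun (fun w => h * xi (X 0%N w)) by exact: bmfunZ.
have hx w : `|h * xi (X 0%N w)| <= h * B by rewrite normrM gtr0_norm// ler_pM2l.
have ecos : `|\int[P]_w cos (h * xi (X 0%N w)) - (1 - s2 / 2 * h ^+ 2)| <= (h * B) ^+ 4.
  rewrite (_ : 1 - s2 / 2 * h ^+ 2 = \int[P]_w (1 - (h * xi (X 0%N w)) ^+ 2 / 2)); last first.
    rewrite exB; [|exact: bmfun_cst|apply: bmfunM; [exact: bmfunX|exact: bmfun_cst]].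
    rewrite ex_cst; congr (1 - _); rewrite exZr; last exact: bmfunX.
    under ex_eq do rewrite exprMn.
    by rewrite exZ; [rewrite /s2; ring|exact: bmfunX].
  rewrite -exB; [|exact: (bmfun_comp (mX 0%N) bcx)|apply: bmfunB; [exact: bmfun_cst|apply: bmfunM; [exact: bmfunX|exact: bmfun_cst]]].
  apply: norm_ex_bound => [|w].
    by apply: bmfunB; [exact: (bmfun_comp (mX 0%N) bcx)|apply: bmfunB; [exact: bmfun_cst|apply: bmfunM; [exact: bmfunX|exact: bmfun_cst]]].
  rewrite opprB addrA (addrAC _ _ (- 1)) (le_trans (norm_cos_quadratic_le _))//.
  by rewrite lerXn2r ?nnegrE// ?mulr_ge0// ltW.
have esin : `|\int[P]_w sin (h * xi (X 0%N w))| <= (h * B) ^+ 3.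
  rewrite -[X in `|X|]subr0 -[X in _ - X](mulr0 h) -xi0 -exZ//.
  have bsX := bmfun_comp (mX 0%N) bsx.
  rewrite -exB//; apply: norm_ex_bound => [|w]; first exact: bmfunB.
  by rewrite (le_trans (norm_sin_sub_le _))// lerXn2r ?nnegrE// ?mulr_ge0// ltW.
have rho : `|expR (- (s2 / 2 * h ^+ 2)) - 1 + s2 / 2 * h ^+ 2| <= (h * B) ^+ 4.
  have x0 : 0 <= s2 / 2 * h ^+ 2 by rewrite mulr_ge0 ?divr_ge0// sqr_ge0.
  apply: (le_trans (expR_quadratic x0)).
  rewrite -[4%N]/(2 * 2)%N exprM lerXn2r ?nnegrE ?sqr_ge0// exprMn mulrC.
  by rewrite ler_wpM2l ?sqr_ge0//; apply: le_trans s2B; rewrite ler_pdivrMr// mulr_natr mulr2n lerDl.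
have cle := norm_ex_bound P bcT (fun w => cos_max _).
have sle := norm_ex_bound P bsT (fun w => sin_max _).
have hB3 : 0 <= (h * B) ^+ 3 by rewrite exprn_ge0// mulr_ge0// ltW.
have hB4 : (h * B) ^+ 4 <= B ^+ 4 * h ^+ 3.
  rewrite exprMn mulrC ler_wpM2l ?exprn_ge0// -[leRHS]mulr1 exprSr ler_wpM2l// exprn_ge0//; exact: ltW.
have hB3' : (h * B) ^+ 3 = B ^+ 3 * h ^+ 3 by rewrite exprMn mulrC.
have -> : (B ^+ 3 + 2 * B ^+ 4) * h ^+ 3 = B ^+ 3 * h ^+ 3 + 2 * (B ^+ 4 * h ^+ 3) by ring.
rewrite hB3' in esin; rewrite e1; move: ecos esin rho cle sle hB4.
move: (\int[P]_w cos (h * Tk k w + c)) (\int[P]_w sin (h * Tk k w + c)) (\int[P]_w cos _)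
  (\int[P]_w sin _) (s2 / 2 * h ^+ 2) (B ^+ 3 * _) (B ^+ 4 * _) ((h * B) ^+ 4) (expR _)
  => C0 S0 c1 s1 q b3 b4 hb r ecos esin rho cle sle hB4.
have -> : C0 * c1 - S0 * s1 - r * C0 = C0 * (c1 - (1 - q)) - S0 * s1 - C0 * (r - 1 + q) by ring.
rewrite (le_trans (ler_normB _ _))// [leRHS](_ : _ = b4 + b3 + b4); last by ring.
apply: lerD; first (apply: (le_trans (ler_normB _ _)); apply: lerD); rewrite normrM.
- by rewrite -[leRHS]mul1r ler_pM// (le_trans ecos).
- by rewrite -[leRHS]mul1r ler_pM.
- by rewrite -[leRHS]mul1r ler_pM// (le_trans rho).
Qed.

(** Adding the summands one at a time, the pair of expectations of cosine and sine
    is multiplied at each step by 1 - s2 / (2 n) up to O(n^-3/2), as in Lindeberg's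
    argument. *)
Lemma cosine_mean_rate (n : nat) (c : R) : (0 < n)%N ->
  `|\int[P]_w cos ((Num.sqrt n%:R)^-1 * (\sum_(i < n) xi (X i w)) + c) - expR (- (s2 / 2)) * cos c| <=
  (B ^+ 3 + 2 * B ^+ 4) * (Num.sqrt n%:R)^-1.
Proof.
move=> n0; set h := _^-1; set D := _ + 2 * _.
have sn0 : 0 < Num.sqrt (n%:R : R) by rewrite sqrtr_gt0 ltr0n.
have h0 : 0 < h by rewrite invr_gt0.
have h1 : h <= 1.
  by rewrite invf_le1// -[leLHS]sqrtr1 ler_sqrt ?ler1n// ler01.
have h2 : n%:R * h ^+ 2 = 1.
  by rewrite /h exprVn sqr_sqrtr// divff// pnatr_eq0 -lt0n.
have D0 : 0 <= D by rewrite addr_ge0 ?mulr_ge0 ?exprn_ge0.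
pose rho := expR (- (s2 / 2 * h ^+ 2)).
have rho1 : 0 <= rho <= 1.
  rewrite expR_ge0/= -[leRHS]expR0 /rho ler_expR oppr_le0; apply: mulr_ge0; last exact: sqr_ge0.
  exact: divr_ge0.
have main k : `|\int[P]_w cos (h * Tk k w + c) - rho ^+ k * cos c| <= k%:R * (D * h ^+ 3).
  elim: k => [|k IH].
    rewrite expr0 mul1r mul0r -[X in _ - X](ex_cst P) (_ : \int[P]_w _ = \int[P]_w (cos c)) ?subrr ?normr0//.
    by apply: ex_eq => w; rewrite /Tk big_ord0 mulr0 add0r.
  have st := step c k h0 h1; have /andP[r0 r1] := rho1.
  rewrite -[X in X - _](subrK (rho * \int[P]_w cos (h * Tk k w + c))) -addrA exprS -mulrA -mulrBr.
  rewrite -natr1 mulrDl mul1r addrC (le_trans (ler_normD _ _))// lerD//.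
  by rewrite normrM ger0_norm// -[leRHS]mul1r ler_pM.
have := main n; rewrite [n%:R * _](_ : _ = D * h).
  congr (`|_ - _ * _| <= _); rewrite /rho -expRM_natl; congr expR.
  by rewrite mulrN mulrCA h2 mulr1.
by rewrite mulrCA exprSr (mulrA n%:R) h2 mul1r.
Qed.

End central_limit_cosine.

(** * Trigonometric approximation and weak convergence *)

Lemma uniformly_continuous_on_compact (R : realType) (d : nat) (h : 'rV[R]_d -> R)
    (A : set 'rV[R]_d) (eps : R) : continuous h -> compact A -> 0 < eps ->
  exists2 dl : R, 0 < dl & forall x y, A x -> `|x - y| <= dl -> `|h x - h y| <= eps.
Proof.
move=> ch /compact_near_coveringP cA e0.
have /= := cA R (0 : R)^'+ (fun dl x => forall y, `|x - y| <= dl -> `|h x - h y| <= eps) _.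
case=> [x Ax|dl /= dl0 hdl]; last first.
  exists (dl / 2) => [|x y Ax xy]; first by rewrite divr_gt0.
  apply: (hdl (dl / 2)) => //=; last by rewrite divr_gt0.
  by rewrite sub0r normrN gtr0_norm ?divr_gt0// ltr_pdivrMr// mulr_natr mulr2n ltrDl.
have e2 : 0 < eps / 2 by rewrite divr_gt0.
have /cvgrPdist_le/(_ _ e2)/nbhs_ballP[r /= r0 hr] := ch x.
have r2 : 0 < r / 2 by rewrite divr_gt0.
exists (ball x (r / 2), [set dl : R | dl < r / 2]); first split => /=.
- exact: nbhsx_ballx.
- by apply: nbhs_right_lt.
move=> [x' dl] /= [xx' dlr] y x'y.
have hx z : `|x - z| < r -> `|h x - h z| <= eps / 2.
  by move=> xz; apply: hr; rewrite -ball_normE.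
rewrite -ball_normE/= in xx'.
rewrite -(subrK (h x) (h x')) -addrA (le_trans (ler_normD _ _))// (splitr eps) lerD//.
  by rewrite distrC hx// (lt_trans xx')// ltr_pdivrMr// mulr_natr mulr2n ltrDl.
apply: hx; rewrite -(subrK x' x) -addrA (le_lt_trans (ler_normD _ _))// (splitr r) ltrD//.
exact: le_lt_trans dlr.
Qed.

Section borel_vectors.
Context {dT : measure_display} {T : measurableType dT} {R : realType} {d : nat}.
Local Notation rV := (borel 'rV[R]_d).

Lemma measurable_rV (f : T -> 'rV[R]_d) :
  (forall k, measurable_fun setT (fun w => f w 0 k)) -> measurable_fun setT (f : T -> rV).
Proof.
move=> mf; apply: (@measurability _ _ T rV setT f (@open 'rV[R]_d)) => // _ [U oU <-]; rewrite setTI.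
pose box (q : 'rV[rat]_d) (m : nat) : set 'rV[R]_d :=
  \bigcap_(k in [set: 'I_d]) [set x | `|x 0 k - ratr (q 0 k)| < m.+1%:R^-1].
pose A (n : nat) : set 'rV[R]_d :=
  if (unpickle n : option ('rV[rat]_d * nat)) is Some qm then
    if `[< box qm.1 qm.2 `<=` U >] then box qm.1 qm.2 else set0 else set0.
have mbox q m : measurable (f @^-1` box q m).
  rewrite preimage_bigcap; apply: fin_bigcap_measurable => // k _.
  rewrite (_ : _ @^-1` _ = [set w | `|f w 0 k - ratr (q 0 k)| < m.+1%:R^-1])//.
  apply: measurable_set_bool; apply: measurable_fun_ltr => //.
  by apply: measurableT_comp => //; apply: measurable_funB.
suff -> : f @^-1` U = \bigcup_n (f @^-1` A n).
  apply: bigcup_measurable => n _; rewrite /A; case: unpickle => [[q m]|]; last by rewrite preimage_set0.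
  by case: ifP => // _; rewrite preimage_set0.
rewrite -preimage_bigcup; congr (f @^-1` _); apply/seteqP; split => x; last first.
  move=> [n _]; rewrite /A; case: unpickle => [[q m]|]//=.
  by case: asboolP => // h /h.
move=> Ux; have /nbhs_ballP[e /= e0 he] : nbhs x U by exact: open_nbhs_nbhs.
have [m hm] : exists m, m.+1%:R^-1 < e / 2.
  have e2 : 0 < e / 2 by rewrite divr_gt0.
  have := near_infty_natSinv_lt (PosNum e2) => -[N _ hN]; exists N; exact: hN N (leqnn _).
have m0 : 0 < m.+1%:R^-1 :> R by rewrite invr_gt0.
have /choice[q hq] k : exists q : rat, `|x 0 k - ratr q| < m.+1%:R^-1.
  have xlt : x 0 k - m.+1%:R^-1 < x 0 k + m.+1%:R^-1.
    by rewrite ltrD2l (lt_trans _ m0)// oppr_lt0.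
  have [q] := rat_in_itvoo xlt; rewrite in_itv/= => /andP[q1 q2].
  by exists q; rewrite distrC ltr_distl q1.
pose qv := \row_k q k.
have bU : box qv m `<=` U.
  move=> z hz; apply: he; rewrite -ball_normE /=.
  apply: (@le_lt_trans _ _ (m.+1%:R^-1 + m.+1%:R^-1)); last by rewrite (splitr e) ltrD.
  apply: norm_row_le => [|k]; first by rewrite addr_ge0// ltW.
  rewrite !mxE -(subrK (ratr (q k)) (x 0 k)) -addrA (le_trans (ler_normD _ _))// lerD//.
    exact: ltW (hq k).
  have := hz k I; rewrite /= mxE distrC => /ltW; exact.
exists (pickle (qv, m)) => //; rewrite /A pickleK/=; case: asboolP => // _ k _ /=.
by rewrite mxE; exact: hq.
Qed.

End borel_vectors.

Section trigonometric_polynomials.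
Context {R : realType} {d : nat}.
Local Notation V := 'rV[R]_d.

(** Real trigonometric polynomials in linear forms: an algebra whose expectations
    are determined by those of cosines. *)
Inductive trig : (V -> R) -> Prop :=
| trig_cos a c : trig (fun x => cos (dotv a x + c))
| trigD f g : trig f -> trig g -> trig (fun x => f x + g x)
| trigZ k f : trig f -> trig (fun x => k * f x).

Lemma trig_eq f g : f =1 g -> trig f -> trig g.
Proof. by move=> /funext ->. Qed.

Lemma trig_cst k : trig (cst k).
Proof.
apply: (trig_eq (f := fun x => k * cos (dotv 0 x + 0))); last exact/trigZ/trig_cos.
by move=> x; rewrite /dotv mul0mx mxE addr0 cos0 mulr1.
Qed.

Lemma trigM f g : trig f -> trig g -> trig (fun x => f x * g x).
Proof.
move=> tf tg; elim: tf => [a c|f1 f2 _ h1 _ h2|k f1 _ h1]; last 2 first.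
- by apply: (trig_eq _ (trigD h1 h2)) => x; rewrite mulrDl.
- by apply: (trig_eq _ (trigZ k h1)) => x; rewrite mulrA.
elim: tg => [b e|g1 g2 _ h1 _ h2|k g1 _ h1]; last 2 first.
- by apply: (trig_eq _ (trigD h1 h2)) => x; rewrite mulrDr.
- by apply: (trig_eq _ (trigZ k h1)) => x; rewrite mulrCA.
apply: (trig_eq _ (trigZ (1 / 2) (trigD (trig_cos (a + b) (c + e)) (trig_cos (a - b) (c - e))))) => x.
rewrite dotvDl dotvBl.
rewrite (_ : dotv a x + dotv b x + _ = (dotv a x + c) + (dotv b x + e)); last by ring.
rewrite (_ : dotv a x - dotv b x + _ = (dotv a x + c) - (dotv b x + e)); last by ring.
rewrite cosD cosB; by move: (cos _) (cos _) (sin _ * _) => p q s; field.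
Qed.

Lemma trig_sum (I : Type) (s : seq I) (F : I -> V -> R) :
  (forall i, trig (F i)) -> trig (fun x => \sum_(i <- s) F i x).
Proof.
move=> tF; elim: s => [|i s IH].
  by apply: (trig_eq _ (trig_cst 0)) => x; rewrite big_nil.
by apply: (trig_eq _ (trigD (tF i) IH)) => x; rewrite big_cons.
Qed.

Lemma trig_prod (I : Type) (s : seq I) (F : I -> V -> R) :
  (forall i, trig (F i)) -> trig (fun x => \prod_(i <- s) F i x).
Proof.
move=> tF; elim: s => [|i s IH].
  by apply: (trig_eq _ (trig_cst 1)) => x; rewrite big_nil.
by apply: (trig_eq _ (trigM (tF i) IH)) => x; rewrite big_cons.
Qed.

Lemma trig_exp f n : trig f -> trig (fun x => f x ^+ n).
Proof.
move=> tf; elim: n => [|n IH]; first exact: (trig_eq _ (trig_cst 1)).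
by apply: (trig_eq _ (trigM tf IH)) => x; rewrite exprS.
Qed.

End trigonometric_polynomials.

Section cosine_kernel.
Context {R : realType}.

(** A nonnegative trigonometric kernel concentrated near multiples of 2 pi; its
    translates over N + 1 equally spaced nodes have a constant sum. *)
Definition cosine_kernel (N : nat) (u : R) := ((1 + cos u) / 2) ^+ N.

Lemma cosine_kernel_ge0_le1 N u : 0 <= cosine_kernel N u <= 1.
Proof.
have := cos_geN1 u; have := cos_le1 u => c1 c2.
have b0 : 0 <= (1 + cos u) / 2 by lra.
by rewrite exprn_ge0//= exprn_ile1//; lra.
Qed.

Inductive harmonic (N : nat) : (R -> R) -> Prop :=
| harmonic_cos k c : (k <= N)%N -> harmonic N (fun u => cos (k%:R * u + c))
| harmonicD f g : harmonic N f -> harmonic N g -> harmonic N (fun x => f x + g x)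
| harmonicZ a f : harmonic N f -> harmonic N (fun x => a * f x).

Let harmonic_eq N f g : f =1 g -> harmonic N f -> harmonic N g.
Proof. by move=> /funext ->. Qed.

Let harmonic_step N f : harmonic N f -> harmonic N.+1 (fun u => f u * ((1 + cos u) / 2)).
Proof.
elim=> [k c kN|f1 f2 _ h1 _ h2|a f1 _ h1]; last 2 first.
- by apply: (harmonic_eq _ (harmonicD h1 h2)) => x; rewrite [RHS]mulrDl.
- by apply: (harmonic_eq _ (harmonicZ a h1)) => x; rewrite mulrA.
have t1 : harmonic N.+1 (fun u => cos (k%:R * u + c)) by apply: harmonic_cos; exact: leqW.
have t2 : harmonic N.+1 (fun u => cos (k.+1%:R * u + c)) by exact: harmonic_cos.
have t3 : harmonic N.+1 (fun u => cos (k%:R * u - u + c)).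
  case: k kN t1 t2 => [|k] kN t1 t2.
    apply: (harmonic_eq (f := fun u => cos (1%:R * u + (- c)))) => [u|]; last exact: harmonic_cos.
    by rewrite -cosN; congr cos; ring.
  apply: (harmonic_eq (f := fun u => cos (k%:R * u + c))) => [u|].
    by congr cos; rewrite -natr1; ring.
  by apply: harmonic_cos; exact: ltnW (leqW kN).
apply: (harmonic_eq _ (harmonicD (harmonicZ (1 / 2) t1) (harmonicZ (1 / 4) (harmonicD t2 t3)))) => u.
rewrite (_ : k.+1%:R * u + c = (k%:R * u + c) + u); last by rewrite -natr1; ring.
rewrite (_ : k%:R * u - u + c = (k%:R * u + c) - u); last by ring.
rewrite (cosD (k%:R * u + c) u) (cosB (k%:R * u + c) u).
by move: (cos _) (cos _) (sin _ * _) => p q s; field.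
Qed.

Let harmonic_kernel N : harmonic N (cosine_kernel N).
Proof.
elim: N => [|N IH].
  apply: (harmonic_eq (f := fun u => cos (0%:R * u + 0))) => [u|]; last exact: harmonic_cos.
  by rewrite mul0r addr0 cos0 /cosine_kernel expr0.
by apply: (harmonic_eq _ (harmonic_step IH)) => u; rewrite /cosine_kernel exprSr.
Qed.

Let node (M j : nat) : R := 2 * pi / M%:R * j%:R.

Let harmonic_shift_sum N M f u : harmonic N f -> (N < M)%N ->
  \sum_(j < M) f (u + node M j) = \sum_(j < M) f (node M j).
Proof.
move=> hf NM; elim: hf => [k c kN|f1 f2 _ h1 _ h2|a f1 _ h1]; last 2 first.
- by rewrite !big_split/= h1 h2.
- by rewrite -!mulr_sumr h1.
have [->|k0] := posnP k; first by apply: eq_bigr => j _; rewrite !mul0r.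
have M0 : 0 < M%:R :> R by rewrite ltr0n; exact: leq_ltn_trans NM.
pose al : R := k%:R * pi / M%:R.
have al0 : 0 < al < pi.
  apply/andP; split; first by rewrite divr_gt0// mulr_gt0 ?ltr0n ?pi_gt0.
  rewrite ltr_pdivrMr// mulrC ltr_pM2l ?pi_gt0//.
  by rewrite ltr_nat (leq_ltn_trans kN).
suff zero v : \sum_(j < M) cos (k%:R * (v + node M j) + c) = 0.
  transitivity (0 : R); first exact: zero.
  by rewrite -[LHS](zero 0); apply: eq_bigr => j _; rewrite add0r.
have sal : 2 * sin al != 0 by rewrite mulf_neq0// gt_eqF// sin_gt0_pi.
apply: (mulfI sal); rewrite mulr0 mulr_sumr.
pose g j := sin (k%:R * v + c + (2 * j%:R - 1) * al).
rewrite (eq_bigr (fun j : 'I_M => g j.+1 - g j)); last first.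
  move=> j _; rewrite /g.
  rewrite (_ : _ + (2 * j.+1%:R - 1) * al = (k%:R * (v + node M j) + c) + al); last first.
    by rewrite /node /al -[j.+1%:R]natr1; field; rewrite gt_eqF.
  rewrite (_ : _ + (2 * j%:R - 1) * al = (k%:R * (v + node M j) + c) - al); last first.
    by rewrite /node /al; field; rewrite gt_eqF.
  by rewrite (sinD (k%:R * (v + node M j) + c) al) (sinB (k%:R * (v + node M j) + c) al); ring.
rewrite -(big_mkord xpredT (fun j => g j.+1 - g j)) telescope_sumr// /g mulr0 sub0r.
rewrite (_ : _ + (2 * M%:R - 1) * al = (k%:R * v + c + - 1 * al) + pi *+ 2 *+ k).
  have per m x : sin (x + pi *+ 2 *+ m) = sin x :> R.
    elim: m => [|m IH]; first by rewrite mulr0n addr0.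
    by rewrite mulrSr addrA sinD2pi IH.
  by rewrite per subrr.
by rewrite /al -[pi *+ 2 *+ k]mulr_natr -[pi *+ 2]mulr_natr; field; rewrite gt_eqF.
Qed.

Definition kernel_mass N : R := \sum_(j < N.+1) cosine_kernel N (2 * pi / N.+1%:R * j%:R).

Lemma kernel_mass_ge1 N : 1 <= kernel_mass N.
Proof.
rewrite /kernel_mass big_ord_recl mulr0.
have -> : cosine_kernel N 0 = 1.
  by rewrite /cosine_kernel cos0 -[1 + 1]/(2%:R) divff// expr1n.
by rewrite lerDl sumr_ge0// => j _; have /andP[] := cosine_kernel_ge0_le1 N (2 * pi / N.+1%:R * (lift ord0 j)%:R).
Qed.

Lemma kernel_partition N u :
  \sum_(j < N.+1) cosine_kernel N (u + 2 * pi / N.+1%:R * j%:R) = kernel_mass N.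
Proof. exact: (harmonic_shift_sum u (harmonic_kernel N) (ltnSn N)). Qed.

End cosine_kernel.

Lemma power_times_geometric (R : realType) (d : nat) (rho C eps : R) :
  0 < rho < 1 -> 0 <= C -> 0 < eps -> exists N, C * (N.+1%:R ^+ d * rho ^+ N) <= eps.
Proof.
move=> /andP[r0 r1] C0 e0.
pose s := - ln rho; have s0 : 0 < s by rewrite oppr_gt0 ln_lt0// r0.
pose B := C * (2 ^+ d * (d.+1`!%:R / s ^+ d.+1)) / eps.
have B0 : 0 <= B.
  apply: divr_ge0; last exact: ltW.
  by rewrite !mulr_ge0// ?exprn_ge0// invr_ge0 exprn_ge0// ltW.
pose N := (Num.truncn B).+1; exists N.
have NB : B <= N%:R by rewrite ltW// truncnS_gt.
have N0 : 0 < N%:R :> R by rewrite ltr0n.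
have rhoN : rho ^+ N <= d.+1`!%:R / (s * N%:R) ^+ d.+1.
  rewrite -[rho](lnK (x := rho)) ?posrE// -expRM_natl -[ln rho]opprK -/s mulrN expRN.
  have sN : 0 <= N%:R * s by rewrite mulr_ge0// ltW.
  rewrite -[leRHS]invrK lef_pV2 ?posrE ?expR_gt0//; last first.
    by rewrite invr_gt0 divr_gt0 ?ltr0n ?fact_gt0// exprn_gt0// mulr_gt0.
  by rewrite invf_div (mulrC s); apply: le_trans (expR_ge1Dxn d sN); rewrite lerDr.
apply: (@le_trans _ _ (C * ((2 * N%:R) ^+ d * (d.+1`!%:R / (s * N%:R) ^+ d.+1)))).
  rewrite ler_wpM2l//; apply: ler_pM; [exact: exprn_ge0|by rewrite exprn_ge0// ltW| |exact: rhoN].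
  rewrite lerXn2r ?nnegrE ?mulr_ge0//.
  by rewrite -natr1 mulr_natl mulr2n lerD2l ler1n.
have -> : C * ((2 * N%:R) ^+ d * (d.+1`!%:R / (s * N%:R) ^+ d.+1)) = B * eps / N%:R.
  rewrite /B !exprMn [N%:R ^+ d.+1]exprS; field.
  by rewrite !gt_eqF ?exprn_gt0// /s.
by rewrite ler_pdivrMr// mulrC ler_pM2l.
Qed.

Lemma cos_le_cos_far (R : realType) (a v : R) : 0 < a -> a <= pi / 2 ->
  a <= `|v| -> `|v| <= pi + pi / 2 -> cos v <= cos a.
Proof.
move=> a0 api av vpi; rewrite -cos_norm; move: av vpi; move: `|v| => x ax xpi.
have pi0 := @pi_gt0 R.
have [xp|xp] := leP x pi.
  have [->//|xa] := eqVneq x a.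
  have xi : x \in `[0, pi] by rewrite in_itv/= xp (le_trans (ltW a0) ax).
  have ai : a \in `[0, pi] by rewrite in_itv/= (ltW a0)/=; lra.
  by rewrite ltW// ltr_cos// lt_neqAle eq_sym xa.
apply: (@le_trans _ _ 0).
  rewrite -(subrK pi x) cosDpi oppr_le0 cos_ge0_pihalf//; apply/andP; split; lra.
by apply: cos_ge0_pihalf; apply/andP; split; lra.
Qed.

Section trigonometric_approximation.
Context {R : realType} {d : nat}.
Local Notation V := 'rV[R]_d.
Variables (h : V -> R) (K r eps : R).
Hypotheses (ch : continuous h) (hK : forall x, `|h x| <= K) (r0 : 0 < r) (eps0 : 0 < eps).

Let L := 2 * r.
Let L0 : 0 < L. Proof. by rewrite mulr_gt0. Qed.
Let node N (j : nat) : R := - L + 2 * L / N.+1%:R * j%:R.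
Let wt N (j : nat) (t : R) : R := cosine_kernel N (pi * (node N j - t) / L) / kernel_mass N.

Let mass0 N : 0 < kernel_mass N :> R. Proof. exact: lt_le_trans (kernel_mass_ge1 N). Qed.

Let wt_ge0_le1 N j t : 0 <= wt N j t <= 1.
Proof.
have /andP[k0 k1] := cosine_kernel_ge0_le1 N (pi * (node N j - t) / L).
rewrite divr_ge0 ?(ltW (mass0 N))//= ler_pdivrMr// mul1r.
exact: le_trans (kernel_mass_ge1 N).
Qed.

Let wt_sum N t : \sum_(j < N.+1) wt N j t = 1.
Proof.
rewrite -mulr_suml -(kernel_partition N (- pi - pi * t / L)).
rewrite (eq_bigr (fun j : 'I_N.+1 => cosine_kernel N (- pi - pi * t / L + 2 * pi / N.+1%:R * j%:R))).
  by rewrite divff// kernel_partition gt_eqF.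
move=> j _; congr (cosine_kernel N _); rewrite /node; field.
by rewrite !gt_eqF// ltr0n.
Qed.

Let node_bound N (j : 'I_N.+1) : `|node N j| <= L.
Proof.
have j1 : j%:R / N.+1%:R <= 1 :> R by rewrite ler_pdivrMr ?ltr0n// mul1r ler_nat ltnW.
have j0 : 0 <= j%:R / N.+1%:R :> R by rewrite divr_ge0.
rewrite /node (_ : 2 * L / N.+1%:R * j%:R = 2 * (L * (j%:R / N.+1%:R))); last by ring.
have := ler_wpM2l (ltW L0) j1; have := mulr_ge0 (ltW L0) j0.
rewrite mulr1; move: (L * _) => x x0 x1; rewrite ler_norml; apply/andP; split; lra.
Qed.

Let wt_far N (j : 'I_N.+1) t dl : 0 < dl -> dl <= r -> `|t| <= r -> dl < `|t - node N j| ->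
  wt N j t <= ((1 + cos (pi * dl / L)) / 2) ^+ N.
Proof.
move=> dl0 dlr tr far.
apply: (@le_trans _ _ (cosine_kernel N (pi * (node N j - t) / L))).
  rewrite /wt ler_pdivrMr// ler_peMr ?kernel_mass_ge1//.
  by have /andP[] := cosine_kernel_ge0_le1 N (pi * (node N j - t) / L).
have pi0 := @pi_gt0 R.
have c1 : cos (pi * (node N j - t) / L) <= cos (pi * dl / L).
  apply: cos_le_cos_far.
  - by rewrite divr_gt0// mulr_gt0.
  - rewrite ler_pdivrMr// -mulrA ler_pM2l// (le_trans dlr)// /L mulKf//.
  - rewrite normrM (gtr0_norm (_ : 0 < L^-1)) ?invr_gt0// ler_pM2r ?invr_gt0//.
    by rewrite normrM gtr0_norm// ler_pM2l// distrC ltW.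
  - rewrite normrM (gtr0_norm (_ : 0 < L^-1)) ?invr_gt0// ler_pdivrMr//.
    rewrite normrM gtr0_norm// (_ : (pi + pi / 2) * L = pi * (L + r)); last by rewrite /L; field.
    by rewrite ler_pM2l// (le_trans (ler_normB _ _))// lerD// node_bound.
have cg := cos_geN1 (pi * (node N j - t) / L).
by rewrite /cosine_kernel lerXn2r ?nnegrE//; lra.
Qed.

Let trig_wt N j k : trig (fun x : V => wt N j (x 0 k)).
Proof.
have tc : trig (fun x : V => cos (dotv (- (pi / L) *: delta_mx 0 k) x + pi * node N j / L)).
  exact: trig_cos.
apply: (trig_eq _ (trigZ (kernel_mass N)^-1 (trig_exp N (trigZ (1 / 2) (trigD (trig_cst 1) tc))))) => x.
rewrite /wt mulrC; congr (_ / _); rewrite /cosine_kernel; congr (_ ^+ _).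
rewrite mulrC mul1r; congr ((1 + cos _) / _).
rewrite dotvZl (_ : dotv (delta_mx 0 k) x = x 0 k); first by ring.
rewrite dotvE (bigD1 k)//= big1 ?addr0; first by rewrite mxE !eqxx mul1r.
by move=> l lk; rewrite mxE (negbTE lk) andbF mul0r.
Qed.

(** Average the values of h at the nodes of a grid of side 2 L = 4 r with product
    cosine kernels as weights: a trigonometric Bernstein operator. The period
    exceeds the cube, so distant nodes have geometrically small weight. *)
Lemma trig_approximation : exists q : V -> R, [/\ trig q, forall x, `|q x| <= K &
  forall x, `|x| <= r -> `|q x - h x| <= eps].
Proof.
have K0 : 0 <= K by exact: le_trans (hK 0).
have cb : compact [set x : V | `|x| <= r].
  apply: bounded_closed_compact.
    by exists r; split; [exact: num_real|] => x x1 v /= vr; apply: le_trans (ltW x1).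
  rewrite (_ : [set x | _] = (fun v : V => `|v|) @^-1` [set t | t <= r])//.
  by apply: closed_comp => [v _|]; [exact: norm_continuous|exact: closed_le].
have e2 : 0 < eps / 2 by rewrite divr_gt0.
have [dl1 dl10 hdl1] := uniformly_continuous_on_compact ch cb e2.
pose dl := Num.min dl1 r.
have dl0 : 0 < dl by rewrite lt_min dl10.
have dlr : dl <= r by rewrite ge_min lexx orbT.
have hdl x y : `|x| <= r -> `|x - y| <= dl -> `|h x - h y| <= eps / 2.
  by move=> xr xy; apply: hdl1 => //; rewrite (le_trans xy)// ge_min lexx.
pose rho := (1 + cos (pi * dl / L)) / 2.
have pi0 := @pi_gt0 R.
have adl : 0 < pi * dl / L <= pi / 2.
  rewrite divr_gt0 ?mulr_gt0//= ler_pdivrMr// -mulrA ler_pM2l// (le_trans dlr)// /L mulKf//.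
have rho01 : 0 < rho < 1.
  have /andP[a0 a1] := adl.
  have c0 : 0 <= cos (pi * dl / L) by apply: cos_ge0_pihalf; apply/andP; split; lra.
  have c1 : cos (pi * dl / L) < 1.
    by rewrite -[ltRHS]cos0 ltr_cos ?in_itv/= ?lexx ?(ltW pi0)//; apply/andP; split; lra.
  by rewrite /rho; apply/andP; split; lra.
have [N hN] := power_times_geometric d rho01 (mulr_ge0 (ler0n R 2) K0) e2.
pose pt (j : {ffun 'I_d -> 'I_N.+1}) : V := \row_k node N (j k).
pose w (j : {ffun 'I_d -> 'I_N.+1}) (x : V) := \prod_k wt N (j k) (x 0 k).
have w01 j x : 0 <= w j x <= 1.
  rewrite prodr_ge0/=; last by move=> k _; have /andP[] := wt_ge0_le1 N (j k) (x 0 k).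
  by apply: prodr_ile1 => k _; exact: wt_ge0_le1.
have w1 x : \sum_j w j x = 1.
  rewrite /w -(bigA_distr_bigA (fun k (j : 'I_N.+1) => wt N j (x 0 k))).
  by rewrite big1// => k _; exact: wt_sum.
have avg x (g : {ffun 'I_d -> 'I_N.+1} -> R) c : (forall j, w j x * `|g j| <= w j x * c) ->
    `|\sum_j w j x * g j| <= c.
  move=> gc; rewrite (le_trans (ler_norm_sum _ _ _))// -[leRHS]mul1r -(w1 x) mulr_suml.
  by apply: ler_sum => j _; rewrite normrM ger0_norm//; have /andP[] := w01 j x.
exists (fun x => \sum_j w j x * h (pt j)); split => [|x|x xr].
- apply: trig_sum => j.
  apply: (trig_eq (f := fun x => h (pt j) * w j x)) => [x|]; first by rewrite mulrC.
  by apply: trigZ; apply: trig_prod => k; exact: trig_wt.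
- by apply: avg => j; rewrite ler_wpM2l//; have /andP[] := w01 j x.
rewrite -[X in _ - X]mul1r -(w1 x) mulr_suml -sumrB.
rewrite (le_trans (ler_norm_sum _ _ _))//.
apply: (@le_trans _ _ (\sum_j (w j x * (eps / 2) + rho ^+ N * (2 * K)))).
  apply: ler_sum => j _; have /andP[wj0 wj1] := w01 j x.
  rewrite -mulrBr normrM (ger0_norm wj0).
  have rN : 0 <= rho ^+ N by rewrite exprn_ge0//; have /andP[/ltW] := rho01.
  have [near|far] := leP `|x - pt j| dl.
    rewrite (@le_trans _ _ (w j x * (eps / 2)))//.
      by rewrite ler_wpM2l// distrC hdl.
    by rewrite lerDl mulr_ge0// mulr_ge0.
  have [k hk] : exists k, dl < `|x 0 k - node N (j k)|.
    apply: contrapT => no; move: far; rewrite ltNge => /negP; apply.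
    apply: norm_row_le => [|k]; first exact: ltW.
    by rewrite !mxE leNgt; apply/negP => kk; apply: no; exists k.
  rewrite (@le_trans _ _ (rho ^+ N * (2 * K)))//; last by rewrite lerDr mulr_ge0// ltW.
  apply: ler_pM => //; last by rewrite (le_trans (ler_normB _ _))// mulr_natl mulr2n lerD.
  rewrite /w (bigD1 k)//= -[leRHS]mulr1; apply: ler_pM.
  - by have /andP[] := wt_ge0_le1 N (j k) (x 0 k).
  - by apply: prodr_ge0 => l _; have /andP[] := wt_ge0_le1 N (j l) (x 0 l).
  - by apply: wt_far => //; rewrite (le_trans (norm_coord_le x k)).
  - by apply: prodr_ile1 => l _; exact: wt_ge0_le1.
rewrite big_split/= -mulr_suml w1 mul1r sumr_const card_ffun !card_ord -[X in _ + X]mulr_natl natrX.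
by rewrite [leRHS](splitr eps) lerD2l mulrA [leLHS]mulrC.
Qed.

End trigonometric_approximation.

Section random_vectors.
Context {dT : measure_display} {T : measurableType dT} {R : realType}.
Variable P : probability T R.
Context {d : nat}.
Variable f : T -> 'rV[R]_d.
Hypothesis mf : forall k, measurable_fun setT (fun w => f w 0 k).

Lemma measurable_dotv_rv a : measurable_fun setT (fun w => dotv a (f w)).
Proof.
rewrite (_ : (fun w => _) = (fun w => \sum_k a 0 k * f w 0 k)); last by apply/funext => w; rewrite dotvE.
by apply: measurable_sum => k; apply: measurable_funM.
Qed.

Lemma bmfun_cos_dotv a c : bmfun (fun w => cos (dotv a (f w) + c)).
Proof.
split; last by exists 1 => w; exact: cos_max.
apply: (measurableT_comp (continuous_measurable_fun (@continuous_cos R))).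
by apply: measurable_funD => //; exact: measurable_dotv_rv.
Qed.

Lemma bmfun_trig q : trig q -> bmfun (fun w => q (f w)).
Proof.
elim=> [a c|q1 q2 _ h1 _ h2|k q1 _ h1]; [exact: bmfun_cos_dotv|exact: bmfunD|exact: bmfunZ].
Qed.

Lemma measurable_continuous_rv (h : 'rV[R]_d -> R) : continuous h ->
  measurable_fun setT (fun w => h (f w)).
Proof.
move=> ch.
have mh : measurable_fun setT (h : borel 'rV[R]_d -> R).
  apply: (@measurability _ _ (borel 'rV[R]_d) R setT h (@RGenOInfty.G R)) => [|_ [_ [r ->] <-]].
    exact: RGenOInfty.measurableE.
  rewrite setTI.
  by apply: sub_sigma_algebra; apply: open_comp => //.
exact: (measurableT_comp mh (measurable_rV mf)).
Qed.

Lemma measurable_norm_rv : measurable_fun setT (fun w => `|f w|).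
Proof. by apply: measurable_continuous_rv; exact: norm_continuous. Qed.

Lemma measurable_tail_rv r : measurable [set w | r < `|f w|].
Proof.
by apply: measurable_set_bool; apply: measurable_fun_ltr => //; exact: measurable_norm_rv.
Qed.

Lemma rv_tail eps : 0 < eps -> exists2 r, 0 < r & pr P [set w | r < `|f w|] <= eps.
Proof.
move=> e0.
pose q (n : nat) w : R := (n.+1%:R < `|f w|)%R%:R.
have mq n : measurable_fun setT (fun w => n.+1%:R < `|f w|).
  by apply: measurable_fun_ltr => //; exact: measurable_norm_rv.
have bq n : bmfun (q n) by exact: bmfun_bool (mq n).
have /= [|n w|w|_ q0] := @ex_bounded_cvg _ _ _ P q (cst 0) 1.
- by move=> n; case: (bq n).
- by rewrite /q; case: (_ < _); rewrite ?normr1 ?normr0.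
- apply: cvg_near_cst; near=> n; rewrite /q (_ : _ < _ = false)//; apply/negbTE; rewrite -leNgt.
  rewrite -natr1 (@le_trans _ _ n%:R) ?lerDl//; near: n; exact: nbhs_infty_ger.
rewrite ex_cst in q0.
have /cvgr0Pnorm_le/(_ _ e0)[N _ /(_ N (leqnn N)) hN] := q0.
exists N.+1%:R; first by rewrite ltr0n.
by rewrite -ex_bool//; exact: le_trans (ler_norm _) hN.
Unshelve. all: by end_near. Qed.

Lemma ex_trig_approximation (h q : 'rV[R]_d -> R) (K r eps : R) :
  continuous h -> (forall x, `|h x| <= K) -> trig q -> (forall x, `|q x| <= K) ->
  (forall x, `|x| <= r -> `|q x - h x| <= eps) -> 0 <= eps ->
  `|\int[P]_w q (f w) - \int[P]_w h (f w)| <= eps + 2 * K * pr P [set w | r < `|f w|].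
Proof.
move=> ch hK tq qK qh e0.
have K0 : 0 <= K by exact: le_trans (hK 0).
have bh : bmfun (fun w => h (f w)) by split; [exact: measurable_continuous_rv|exists K].
have mr : measurable_fun setT (fun w => r < `|f w|).
  by apply: measurable_fun_ltr => //; exact: measurable_norm_rv.
have br : bmfun (fun w => (r < `|f w|)%R%:R : R) by exact: bmfun_bool.
rewrite -exB//; last exact: bmfun_trig.
rewrite -ex_bool// -exZ// -[eps in leRHS](ex_cst P) -exD; [|exact: bmfun_cst|exact: bmfunZ].
apply: norm_ex_le => [||w].
- by apply: bmfunB => //; exact: bmfun_trig.
- by apply: bmfunD; [exact: bmfun_cst|exact: bmfunZ].
have [rf|fr] := ltP r `|f w|; last by rewrite mulr0 addr0; exact: qh.
rewrite mulr1 (le_trans (ler_normB _ _))// mulr_natl mulr2n ler_wpDl// lerD//.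
Qed.

End random_vectors.

Section cosine_transforms.
Context {dT dT' : measure_display} {T : measurableType dT} {T' : measurableType dT'}.
Context {R : realType} (P : probability T R) (Q : probability T' R) {d : nat}.

(** Approximate h by a trigonometric polynomial on a large ball; the bound K
    controls the rest through tightness. *)
Lemma cosine_cvg_ex (f : nat -> T -> 'rV[R]_d) (g : T' -> 'rV[R]_d) (h : 'rV[R]_d -> R) (K : R) :
  (forall n k, measurable_fun setT (fun w => f n w 0 k)) ->
  (forall k, measurable_fun setT (fun w => g w 0 k)) ->
  (forall eps : R, 0 < eps -> exists2 r, 0 < r &
    \forall n \near \oo, pr P [set w | r < `|f n w|] <= eps) ->
  (forall a c, \int[P]_w cos (dotv a (f n w) + c) @[n --> \oo] -->
    \int[Q]_w cos (dotv a (g w) + c)) ->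
  continuous h -> (forall x, `|h x| <= K) ->
  \int[P]_w h (f n w) @[n --> \oo] --> \int[Q]_w h (g w).
Proof.
move=> mf mg tf fg ch hK.
have trig_cvg q : trig q -> \int[P]_w q (f n w) @[n --> \oo] --> \int[Q]_w q (g w).
  elim=> [a c|q1 q2 t1 h1 t2 h2|k q1 t1 h1]; first exact: fg.
    by apply: (eq_cvg_seq _ _ (cvgD h1 h2)) => [n|]; rewrite exD//; exact: bmfun_trig.
  have hk : (k * \int[P]_w q1 (f n w)) @[n --> \oo] --> k * \int[Q]_w q1 (g w) by exact: cvgMr.
  by apply: (eq_cvg_seq _ _ hk) => [n|]; rewrite exZ//; exact: bmfun_trig.
have K0 : 0 <= K by exact: le_trans (hK 0).
apply/cvgrPdist_le => eps e0.
pose e1 := eps / (4 * K + 3).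
have k3 : 0 < 4 * K + 3 by rewrite ltr_wpDl// mulr_ge0.
have e10 : 0 < e1 by rewrite divr_gt0.
have [r1 r10 tf1] := tf _ e10; have [r2 r20 tg] := rv_tail Q mg e10.
pose r := Num.max r1 r2.
have r0 : 0 < r by rewrite lt_max r10.
have [q [tq qK qh]] := trig_approximation ch hK r0 e10.
have /cvgrPdist_le/(_ _ e10) tq1 := trig_cvg _ tq.
have bg : 2 * K * pr Q [set w | r < `|g w|] <= 2 * K * e1.
  rewrite ler_wpM2l ?mulr_ge0// (le_trans _ tg)//.
  apply: le_pr; [exact: measurable_tail_rv|exact: measurable_tail_rv|move=> w /=].
  by apply: le_lt_trans; rewrite le_max lexx orbT.
have hg := ex_trig_approximation Q mg ch hK tq qK qh (ltW e10).
near=> n.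
have bf : 2 * K * pr P [set w | r < `|f n w|] <= 2 * K * e1.
  rewrite ler_wpM2l ?mulr_ge0//.
  apply: (@le_trans _ _ (pr P [set w | r1 < `|f n w|])); last by near: n.
  apply: le_pr; [exact: measurable_tail_rv|exact: measurable_tail_rv|move=> w /=].
  by apply: le_lt_trans; rewrite le_max lexx.
have hf := ex_trig_approximation P (mf n) ch hK tq qK qh (ltW e10).
have hq : `|\int[Q]_w q (g w) - \int[P]_w q (f n w)| <= e1 by near: n.
have -> : eps = (4 * K + 3) * e1 by rewrite mulrCA divff ?mulr1// gt_eqF.
move: hf hg hq bf bg; move: (2 * K * _) (2 * K * pr Q _) (\int[P]_w q _) (\int[Q]_w q _)
  (\int[P]_w h _) (\int[Q]_w h _) => tP tQ a b c e' hf hg hq bf bg.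
rewrite (_ : e' - c = - (b - e') + (b - a) + (a - c)); last by ring.
apply: (le_trans (ler_normD _ _)); apply: (le_trans (lerD (ler_normD _ _) (lexx _))).
rewrite normrN (_ : (4 * K + 3) * e1 = (e1 + 2 * K * e1) + e1 + (e1 + 2 * K * e1)); last by ring.
apply: lerD; first apply: lerD => //.
- by apply: (le_trans hg); rewrite lerD2l.
- by apply: (le_trans hf); rewrite lerD2l.
Unshelve. all: by end_near. Qed.

End cosine_transforms.

Section cosine_uniqueness.
Context {dT dT' : measure_display} {T : measurableType dT} {T' : measurableType dT'}.
Context {R : realType} (P : probability T R) (Q : probability T' R).

Lemma cosine_unique (f : T -> R) (g : T' -> R) :
  measurable_fun setT f -> measurable_fun setT g ->
  (forall a c, \int[P]_w cos (a * f w + c) = \int[Q]_w cos (a * g w + c)) ->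
  forall B : set R, measurable B -> P (f @^-1` B) = Q (g @^-1` B).
Proof.
move=> mf mg fg.
pose F (w : T) : 'rV[R]_1 := \row__ f w; pose G (w : T') : 'rV[R]_1 := \row__ g w.
have mF k : measurable_fun setT (fun w => F w 0 k).
  by rewrite (_ : (fun w => _) = f)//; apply/funext => w; rewrite mxE.
have mG k : measurable_fun setT (fun w => G w 0 k).
  by rewrite (_ : (fun w => _) = g)//; apply/funext => w; rewrite mxE.
have dF (a : 'rV[R]_1) w : dotv a (F w) = a 0 0 * f w by rewrite dotvE big_ord1 mxE.
have dG (a : 'rV[R]_1) w : dotv a (G w) = a 0 0 * g w by rewrite dotvE big_ord1 mxE.
have eh (h : 'rV[R]_1 -> R) K : continuous h -> (forall x, `|h x| <= K) ->
    \int[P]_w h (F w) = \int[Q]_w h (G w).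
  move=> ch hK.
  have hc : \int[P]_w h (F w) @[n --> \oo] --> \int[Q]_w h (G w).
    apply: (cosine_cvg_ex (f := fun=> F) (g := G) (K := K)) => //.
    - move=> eps e0; have [r r0 hr] := rv_tail P mF e0; exists r => //; exact: nearW.
    - move=> a c; rewrite (_ : \int[Q]_w _ = \int[P]_w cos (dotv a (F w) + c)); first exact: cvg_cst.
      under [RHS]ex_eq do rewrite dF; under ex_eq do rewrite dG.
      by rewrite fg.
  by have := cvg_unique _ (cvg_cst (\int[P]_w h (F w))) hc; apply.
pose ramp (t : R) (n : nat) (x : R) : R := (`|1 + n%:R * (x - t)| - `|n%:R * (x - t)| + 1) / 2.
have cr t n : continuous (ramp t n).
  have cu (x : R) : {for x, continuous (fun v : R => n%:R * (v - t))}.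
    by apply: cvgMr; apply: cvgB; [exact: cvg_id|exact: cvg_cst].
  move=> x; apply: cvgMl; apply: cvgD; last exact: cvg_cst.
  by apply: cvgB; apply: cvg_norm; [apply: cvgD; [exact: cvg_cst|exact: cu]|exact: cu].
have cramp t n : continuous (fun v : 'rV[R]_1 => ramp t n (v 0 0)).
  move=> v; apply: (@continuous_comp _ _ _ (fun v : 'rV[R]_1 => v 0 0) (ramp t n)); last exact: cr.
  exact: coord_continuous.
have ramp1 t n x : `|ramp t n x| <= 1.
  have h1 := ler_normD 1 (n%:R * (x - t)).
  have h2 := ler_normB (1 + n%:R * (x - t)) 1.
  rewrite (addrC 1) addrK (addrC _ 1) normr1 in h2; rewrite normr1 in h1.
  rewrite /ramp ler_norml; move: h1 h2; move: `|1 + _| `|n%:R * _| => a b h1 h2.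
  by apply/andP; split; lra.
have rampE t x : ramp t n x @[n --> \oo] --> ((t <= x)%R%:R : R).
  have [tx|xt] := leP t x.
    rewrite (_ : (fun n => _) = cst (1 : R)); first exact: cvg_cst.
    apply/funext => n; rewrite /ramp !ger0_norm ?addr_ge0 ?mulr_ge0 ?subr_ge0//=.
    by rewrite addrK -[1 + 1]/(2%:R) divff.
  apply: cvg_near_cst; near=> n.
  have n1 : 1 <= n%:R * (t - x).
    rewrite -ler_pdivrMr ?subr_gt0//; near: n; exact: nbhs_infty_ger.
  have {}n1 : n%:R * (x - t) <= - 1 by rewrite -lerN2 opprK -mulrN opprB.
  rewrite /ramp; move: n1; move: (n%:R * _) => u u1.
  rewrite (@ler0_norm _ (1 + u)); last by lra.
  by rewrite (@ler0_norm _ u) ?mulr0n; lra.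
have ray (U : measure_display) (S : measurableType U) (M : probability S R) (u : S -> R) t :
    measurable_fun setT u ->
    \int[M]_w ramp t n (u w) @[n --> \oo] --> pr M (u @^-1` `[t, +oo[).
  move=> mu; have mt : measurable_fun setT (fun w => t <= u w) by apply: measurable_fun_ler.
  have [|n w|w|_] := @ex_bounded_cvg _ _ _ M (fun n w => ramp t n (u w)) (fun w => (t <= u w)%R%:R) 1.
  - move=> n; apply: (measurableT_comp (f := ramp t n)) => //.
    by apply: continuous_measurable_fun; exact: cr.
  - exact: ramp1.
  - exact: rampE.
  rewrite ex_bool// (_ : [set w | _] = u @^-1` `[t, +oo[)//.
  by apply/seteqP; split => w /=; rewrite in_itv/= andbT.
have eray t : P (f @^-1` `[t, +oo[) = Q (g @^-1` `[t, +oo[).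
  have mfr : measurable (f @^-1` `[t, +oo[) by rewrite -[X in measurable X]setTI; exact: mf.
  have mgr : measurable (g @^-1` `[t, +oo[) by rewrite -[X in measurable X]setTI; exact: mg.
  rewrite !prE//; congr (_%:E).
  have c1 := ray _ _ P f t mf; have c2 := ray _ _ Q g t mg.
  have c3 : \int[P]_w ramp t n (f w) @[n --> \oo] --> pr Q (g @^-1` `[t, +oo[).
    apply: (eq_cvg_seq _ _ c2) => // n.
    have := eh _ 1 (cramp t n) (fun v => ramp1 t n (v 0 0)).
    by under ex_eq do rewrite mxE; under [X in _ = X -> _]ex_eq do rewrite mxE.
  by rewrite -(cvg_lim _ c1)// -(cvg_lim _ c3).
move=> B mB.
pose f' : {mfun T >-> R} := HB.pack f (isMeasurableFun.Build _ _ _ _ _ mf).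
pose g' : {mfun T' >-> R} := HB.pack g (isMeasurableFun.Build _ _ _ _ _ mg).
apply: (@measure_unique _ R _ (@RGenCInfty.G R) (fun n => `[- n%:R, +oo[%classic) _ _ _ _
  (distribution P f') (distribution Q g')) => //.
- exact: RGenCInfty.measurableE.
- move=> _ _ [x ->] [y ->]; exists (Num.max x y); apply/seteqP; split => v /=.
    by rewrite !in_itv/= !andbT ge_max => -[-> ->].
  by rewrite !in_itv/= !andbT ge_max => /andP[].
- by move=> n; exists (- n%:R).
- rewrite -subTset => x _; exists (Num.truncn `|x|).+1 => //=; rewrite in_itv/= andbT.
  by rewrite lerNl (le_trans (ler_norm _))// normrN ltW// truncnS_gt.
- by move=> A [t ->]; exact: eray.
- by move=> n; apply: le_lt_trans (probability_le1 (distribution P f') (measurable_itv _)) (ltry _).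
Unshelve. all: by end_near. Qed.

End cosine_uniqueness.

Section normal_cosine_transform.
Context {R : realType}.
Variable sigma : R.
Hypothesis sigma0 : 0 < sigma.
Let mu := @lebesgue_measure R.
Let p := normal_pdf 0 sigma.
Let s0 : sigma != 0. Proof. by rewrite gt_eqF. Qed.
Let p0 x : 0 <= p x. Proof. exact: normal_pdf_ge0. Qed.
Let mp : measurable_fun setT p. Proof. exact: measurable_normal_pdf. Qed.
Let ip : mu.-integrable setT (EFin \o p). Proof. exact: integrable_normal_pdf. Qed.
Let peak := normal_peak sigma.
Let peak0 : 0 < peak. Proof. exact: normal_peak_gt0. Qed.
Let pE x : p x = peak * expR (- (x ^+ 2 / (2 * sigma ^+ 2))).
Proof.
rewrite /p normal_pdfE// /peak; congr (_ * _).
by rewrite /normal_fun subr0 mulNr -mulr_natl.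
Qed.

Let D : R := 8 / 3 * sigma ^+ 2 * (peak / normal_peak (2 * sigma)).

Let square_domination x : x ^+ 2 * p x <= D * normal_pdf 0 (2 * sigma) x.
Proof.
have s20 : 2 * sigma != 0 by rewrite mulf_neq0// pnatr_eq0.
have q0 : 0 < normal_peak (2 * sigma) by exact: normal_peak_gt0.
rewrite normal_pdfE// /normal_fun subr0 pE /D.
rewrite [leRHS](_ : _ = peak * (8 / 3 * sigma ^+ 2 * expR (- x ^+ 2 / ((2 * sigma) ^+ 2 *+ 2)))); last first.
  by move: (expR _) => E; field; rewrite gt_eqF.
rewrite [leLHS](_ : _ = peak * (x ^+ 2 * expR (- (x ^+ 2 / (2 * sigma ^+ 2))))); last by ring.
rewrite ler_wpM2l ?(ltW peak0)//.
pose t := 3 * x ^+ 2 / (8 * sigma ^+ 2).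
have t1 : t <= expR t by have := expR_ge1Dx t; lra.
have -> : expR (- x ^+ 2 / ((2 * sigma) ^+ 2 *+ 2)) = expR t * expR (- (x ^+ 2 / (2 * sigma ^+ 2))).
  rewrite -expRD; congr expR; rewrite /t -mulr_natl; field.
  by rewrite s0.
rewrite [leRHS]mulrA ler_wpM2r ?expR_ge0//.
apply: (@le_trans _ _ (8 / 3 * sigma ^+ 2 * t)); last first.
  by rewrite ler_wpM2l// mulr_ge0 ?sqr_ge0.
by apply: le_of_eq; rewrite /t; field; rewrite s0.
Qed.

Let D0 : 0 <= D.
Proof. apply: mulr_ge0; first by apply: mulr_ge0 => //; exact: sqr_ge0.
by apply: divr_ge0; [exact: ltW|exact: normal_peak_ge0]. Qed.

Let integrable_p (u : R -> R) (c : R) : measurable_fun setT u ->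
  (forall x, `|u x| <= c * (1 + x ^+ 2)) -> mu.-integrable setT (EFin \o (fun x => u x * p x)).
Proof.
move=> mu_ uc.
have c0 : 0 <= c.
  by have := le_trans (normr_ge0 _) (uc 0); rewrite expr0n addr0 mulr1.
apply: (@le_integrable _ _ _ mu _ _ _ (EFin \o (fun x => c * (p x + D * normal_pdf 0 (2 * sigma) x)))) => //.
- by apply/measurable_EFinP; exact: measurable_funM.
- move=> x _ /=; rewrite lee_fin normrM (ger0_norm (p0 x)).
  rewrite [leRHS]ger0_norm; last first.
    by apply: mulr_ge0 => //; apply: addr_ge0 => //; apply: mulr_ge0; [exact: D0|exact: normal_pdf_ge0].
  apply: (le_trans (ler_wpM2r (p0 x) (uc x))).
  by rewrite -mulrA mulrDl mul1r ler_wpM2l// lerD2l square_domination.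
- have i2 : mu.-integrable setT (EFin \o normal_pdf 0 (2 * sigma)) by exact: integrable_normal_pdf.
  rewrite (_ : EFin \o _ = (fun x => c%:E * ((p x)%:E + D%:E * (normal_pdf 0 (2 * sigma) x)%:E))%E)//.
  by apply: integrableZl => //; apply: integrableD => //; exact: integrableZl.
Qed.

Let mcos (s c : R) : measurable_fun setT (fun x : R => cos (s * x + c)).
Proof.
apply: (measurableT_comp (continuous_measurable_fun (@continuous_cos R))).
by apply: measurable_funD => //; apply: measurable_funM.
Qed.

Let msin (s c : R) : measurable_fun setT (fun x : R => sin (s * x + c)).
Proof.
apply: (measurableT_comp (continuous_measurable_fun (@continuous_sin R))).
by apply: measurable_funD => //; apply: measurable_funM.
Qed.

Let abs_le (x : R) : `|x| <= 1 + x ^+ 2.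
Proof. by rewrite -[x ^+ 2]real_normK ?num_real//; move: (normr_ge0 x); move: `|x| => y; nra. Qed.

Let icos s c : mu.-integrable setT (EFin \o (fun x => cos (s * x + c) * p x)).
Proof.
apply: (integrable_p (c := 1)) => // x; rewrite mul1r (le_trans (cos_max _))// lerDl sqr_ge0//.
Qed.

Let ixsin s c : mu.-integrable setT (EFin \o (fun x => x * sin (s * x + c) * p x)).
Proof.
apply: (integrable_p (c := 1)) => [|x]; first exact: measurable_funM.
by rewrite mul1r normrM (le_trans _ (abs_le x))// ler_piMr// sin_max.
Qed.

Let g (c s : R) := \int[mu]_x (cos (s * x + c) * p x).
Let m (c s : R) := \int[mu]_x (x * sin (s * x + c) * p x).

Let cosine_increment (A B : R) : `|cos (A + B) - cos A + B * sin A| <= 2 * B ^+ 2.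
Proof.
have c1 : `|cos B - 1| <= B ^+ 2 by rewrite -[B ^+ 2]real_normK ?num_real// norm_cos_sub1_le.
have s1 : `|sin B - B| <= B ^+ 2.
  have h (y : R) : is_derive y (1 : R) (fun x => sin x - x) (cos y - 1) by apply: is_deriveB.
  have cb (y : R) : `|cos y - 1| <= 1 * `|y| ^+ 1.
    have h' (x : R) : is_derive x (1 : R) (fun x => cos x - 1) (- sin x).
      by rewrite -[- sin x]subr0; apply: is_deriveB.
    rewrite expr1; have := @derivative_growth R _ _ 1 0 h' _ _ y; rewrite expr1; apply.
      by rewrite cos0 subrr.
    by move=> x; rewrite normrN expr0 mulr1 sin_max.
  have := derivative_growth h _ cb B; rewrite mul1r -normrX [`|B ^+ 2|]ger0_norm ?sqr_ge0//.
  by apply; rewrite sin0 subrr.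
rewrite cosD (_ : _ - _ + _ = cos A * (cos B - 1) - sin A * (sin B - B)); last by ring.
rewrite (le_trans (ler_normB _ _))// !normrM mulr_natl mulr2n lerD//.
  by rewrite -[leRHS]mul1r ler_pM// cos_max.
by rewrite -[leRHS]mul1r ler_pM// sin_max.
Qed.

Let M2 := \int[mu]_x (x ^+ 2 * p x).
Let ix2 : mu.-integrable setT (EFin \o (fun x => x ^+ 2 * p x)).
Proof.
apply: (integrable_p (c := 1)) => [|x]; first exact: measurable_funX.
by rewrite mul1r ger0_norm ?sqr_ge0// lerDr.
Qed.

Let g_increment c s h : `|g c (s + h) - g c s + h * m c s| <= 2 * h ^+ 2 * M2.
Proof.
rewrite /g /m /M2 -!RintegralZl//.
rewrite -RintegralB//.
have i1 : mu.-integrable setT (EFin \o (fun x => cos ((s + h) * x + c) * p x - cos (s * x + c) * p x)).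
  exact: (integrableB measurableT (icos (s + h) c) (icos s c)).
have i2 : mu.-integrable setT (EFin \o (fun x => h * (x * sin (s * x + c) * p x))).
  exact: (integrableZl measurableT h (ixsin s c)).
rewrite -RintegralD//.
have i3 := integrableD measurableT i1 i2.
apply: (le_trans (le_normr_Rintegral measurableT i3)).
apply: le_Rintegral => //.
- exact: (integrable_norm i3).
- exact: (integrableZl measurableT (2 * h ^+ 2) ix2).
move=> x _ /=.
rewrite (_ : _ + h * _ = (cos ((s * x + c) + h * x) - cos (s * x + c) + (h * x) * sin (s * x + c)) * p x); last first.
  by rewrite (_ : (s + h) * x + c = s * x + c + h * x); ring.
rewrite normrM (ger0_norm (p0 x)) mulrA ler_wpM2r//.
by rewrite (le_trans (cosine_increment _ _))// exprMn mulrA.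
Qed.

Let is_derive_p (x : R) : is_derive x (1 : R) p (- (x / sigma ^+ 2) * p x).
Proof.
rewrite (_ : p = (fun x => peak * expR (- (x ^+ 2 / (2 * sigma ^+ 2))))); last by apply/funext => y; exact: pE.
by apply: trigger_derive; rewrite /GRing.scale/=; field; rewrite s0.
Qed.

Let stein c s : m c s = sigma ^+ 2 * s * g c s.
Proof.
pose F x := sin (s * x + c) * p x.
pose F' x := s * (cos (s * x + c) * p x) - (sigma ^+ 2)^-1 * (x * sin (s * x + c) * p x).
have dF (x : R) : is_derive x (1 : R) F (F' x).
  have d1 : is_derive x (1 : R) (fun x => sin (s * x + c)) (s * cos (s * x + c)).
    by apply: trigger_derive; rewrite /GRing.scale/= mulr1 addr0 mulrC.
  apply: (is_derive_eq (is_deriveM d1 (is_derive_p x))).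
  by rewrite /F' /GRing.scale/=; field; rewrite s0.
have iF' : mu.-integrable setT (EFin \o F').
  exact: (integrableB measurableT (integrableZl measurableT s (icos s c))
    (integrableZl measurableT (sigma ^+ 2)^-1 (ixsin s c))).
suff F'0 : \int[mu]_x F' x = 0.
  move: F'0; rewrite /F' RintegralB//; last 2 first.
  - exact: (integrableZl measurableT s (icos s c)).
  - exact: (integrableZl measurableT (sigma ^+ 2)^-1 (ixsin s c)).
  rewrite !RintegralZl// -/(g c s) -/(m c s) => /eqP; rewrite subr_eq0 => /eqP h.
  by rewrite -mulrA h mulrA divff ?mul1r// expf_neq0.
have F'n (n : nat) : (0 < n)%N -> \int[mu]_x (F' x * \1_(`[- n%:R, n%:R]%classic : set R) x) = F n%:R - F (- n%:R).
  move=> n0.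
  have nn : - n%:R < n%:R :> R by apply: gtrN; rewrite ltr0n.
  have cF' : continuous F'.
    have cg (s1 c1 : R) : continuous (fun x : R => s1 * x + c1).
      by move=> x; apply: cvgD; [apply: cvgMr; exact: cvg_id|exact: cvg_cst].
    have cp : continuous p by exact: continuous_normal_pdf.
    move=> x; apply: cvgB; apply: cvgMr.
      apply: cvgM; last exact: cp.
      exact: (continuous_comp (cg s c x) (@continuous_cos R _)).
    apply: cvgM; last exact: cp.
    apply: cvgM; first exact: cvg_id.
    exact: (continuous_comp (cg s c x) (@continuous_sin R _)).
  have cF : continuous F.
    by move=> x; apply: differentiable_continuous; apply/derivable1_diffP; case: (dF x).
  have := @continuous_FTC2 R F' F _ _ nn (continuous_subspaceT cF').
  move=> /(_ _ _) h.
  rewrite /Rintegral.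
  rewrite [X in fine X](_ : _ = (\int[mu]_(x in `[(- n%:R)%R, n%:R%R]%classic) (F' x)%:E)%E); last first.
    rewrite [RHS]integral_mkcond; apply: eq_integral => x _; rewrite patchE indicE.
    by case: ifP => _; rewrite ?mulr1// mulr0.
  rewrite h//.
  - split=> [x _||]; first by case: (dF x).
    + by apply: cvg_at_right_filter; exact: cF.
    + by apply: cvg_at_left_filter; exact: cF.
  - by move=> x _; rewrite derive1E; case: (dF x).
have mF' : measurable_fun setT F' by have /integrableP[/measurable_EFinP] := iF'.
have EI (u : R -> R) : mu.-integrable setT (EFin \o u) -> (\int[mu]_x (u x)%:E = (\int[mu]_x u x)%:E)%E.
  by move=> iu; rewrite /Rintegral fineK//; exact: (integrable_fin_num _ iu).
pose un (n : nat) x := F' x * \1_(`[- n%:R, n%:R]%classic : set R) x.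
have mun n : measurable_fun setT (un n) by apply: measurable_funM.
have un_le n x : `|un n x| <= `|F' x|.
  by rewrite /un normrM ler_piMr// indicE; case: (_ \in _); rewrite ?normr1 ?normr0.
have iun n : mu.-integrable setT (EFin \o un n).
  apply: (le_integrable measurableT _ _ (integrable_norm iF')); first by apply/measurable_EFinP; exact: mun.
  by move=> x _ /=; rewrite lee_fin normr_id.
have lim1 : \int[mu]_x un n x @[n --> \oo] --> \int[mu]_x F' x.
  have := @dominated_cvg _ _ _ mu setT measurableT (fun n x => (un n x)%:E) (fun x => (F' x)%:E)
    (fun x => `|F' x|%:E).
  move=> /(_ _ _ _ _ _) h.
  have : (\int[mu]_x (un n x)%:E)%E @[n --> \oo] --> (\int[mu]_x (F' x)%:E)%E.
    apply: h => //.
    - by move=> n; apply/measurable_EFinP; exact: mun.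
    - move=> x _; apply: cvg_near_cst; near=> n; congr (_%:E); rewrite /un indicE mem_set ?mulr1//=.
      rewrite in_itv/= -ler_norml; near: n; exact: nbhs_infty_ger.
    - exact: (integrable_norm iF').
    - by move=> n x _; rewrite lee_fin.
  by rewrite EI//; under eq_fun do rewrite EI//; move/fine_cvgP => [].
have p_le (n : nat) : (0 < n)%N -> p n%:R <= peak * (2 * sigma ^+ 2) / n%:R.
  move=> n0; have n1 : 1 <= n%:R :> R by rewrite ler1n.
  have ng : 0 < n%:R :> R by rewrite ltr0n.
  have sg : 0 < 2 * sigma ^+ 2 by rewrite mulr_gt0// exprn_gt0.
  rewrite pE -mulrA ler_wpM2l ?(ltW peak0)// expRN.
  rewrite -[leRHS]invrK lef_pV2 ?posrE ?expR_gt0//; last by rewrite invr_gt0 divr_gt0.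
  rewrite invf_div (le_trans _ (expR_ge1Dx _))//.
  apply: (@le_trans _ _ (n%:R ^+ 2 / (2 * sigma ^+ 2))); last by rewrite lerDr.
  by rewrite ler_pM2r ?invr_gt0// expr2 ler_peMr// ltW.
have lim2 : \int[mu]_x un n x @[n --> \oo] --> (0 : R).
  apply/norm_cvg0P; apply: (cvg_invr_pinfty (L := fun n => n%:R) (c := 2 * (peak * (2 * sigma ^+ 2)))).
    exact: cvgr_idn.
  near=> n; have n0 : (0 < n)%N by near: n; exact: nbhs_infty_gt.
  rewrite normr_ge0/= F'n// /F (le_trans (ler_normB _ _))// !normrM !(ger0_norm (p0 _)).
  have -> : p (- n%:R) = p n%:R by rewrite !pE sqrrN.
  have ps (x : R) : `|sin x| * p n%:R <= peak * (2 * sigma ^+ 2) / n%:R.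
    by apply: le_trans (p_le n n0); rewrite ler_piMl// sin_max.
  by apply: (le_trans (lerD (ps _) (ps _))); apply: le_of_eq; ring.
by rewrite -(cvg_lim _ lim1)// -(cvg_lim _ lim2).
Unshelve. all: by end_near. Qed.

Let g_derive c s : is_derive s (1 : R) (g c) (- (sigma ^+ 2 * s * g c s)).
Proof.
rewrite -stein.
have M20 : 0 <= M2 by apply: Rintegral_ge0 => x _; rewrite mulr_ge0// sqr_ge0.
have key : (h^-1 *: (g c (h + s) - g c s)) @[h --> (0 : R)^'] --> - m c s.
  apply/cvgrPdist_le => e e0; near=> h.
  have h0 : h != 0 by near: h; exact: nbhs_dnbhs_neq.
  have hn : 0 < `|h| by rewrite normr_gt0.
  have he : `|h| * (2 * M2 + 1) <= e.
    rewrite -ler_pdivlMr; last by rewrite ltr_wpDl// mulr_ge0.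
    near: h; apply: dnbhs0_le; rewrite divr_gt0// ltr_wpDl// mulr_ge0//.
  rewrite -[leLHS](_ : `|h|^-1 * `|g c (s + h) - g c s + h * m c s| = _).
    rewrite ler_pdivrMl// (le_trans (g_increment c s h))//.
    rewrite (_ : 2 * h ^+ 2 * M2 = `|h| * (`|h| * (2 * M2))); last first.
      by rewrite -[h ^+ 2]real_normK ?num_real//; ring.
    rewrite ler_pM2l// (le_trans _ he)// ler_pM2l// lerDl//.
  rewrite -normfV -normrM -normrN (addrC h s); congr `|_|.
  by rewrite /GRing.scale/=; field.
have dg : derivable (g c) s 1.
  apply/cvg_ex; exists (- m c s); apply: cvg_trans key; apply: near_eq_cvg.
  by near=> h; rewrite /= [h *: 1]mulr1.
split => //; rewrite /derive; apply: (cvg_lim (@norm_hausdorff _ _)).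
by apply: cvg_trans key; apply: near_eq_cvg; near=> h; rewrite /= [h *: 1]mulr1.
Unshelve. all: by end_near. Qed.

(** By Stein's identity the transform g satisfies g' = - sigma^2 s g. *)
Lemma normal_cosine_transform s c :
  \int[normal_prob 0 sigma]_x cos (s * x + c) = expR (- (s ^+ 2 * sigma ^+ 2 / 2)) * cos c.
Proof.
have -> : \int[normal_prob 0 sigma]_x cos (s * x + c) = g c s.
  exact: (Rintegral_density (nu := normal_prob 0 sigma) p0 mp (fun A mA => erefl) (mcos s c)).
pose G t := g c t * expR (t ^+ 2 * sigma ^+ 2 / 2).
have dG (t : R) : is_derive t (1 : R) G 0.
  have d2 : is_derive t (1 : R) (fun t => expR (t ^+ 2 * sigma ^+ 2 / 2))
      (t * sigma ^+ 2 * expR (t ^+ 2 * sigma ^+ 2 / 2)).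
    by apply: trigger_derive; rewrite /GRing.scale/=; field.
  apply: (is_derive_eq (is_deriveM (g_derive c t) d2)).
  by rewrite /GRing.scale/=; ring.
have := is_derive_0_is_cst s 0 dG; rewrite /G expr0n/= !mul0r expR0 mulr1.
have -> : g c 0 = cos c.
  rewrite /g; under eq_Rintegral do rewrite mul0r add0r.
  rewrite RintegralZl// [X in _ * X](_ : _ = 1) ?mulr1//.
  by rewrite /Rintegral integral_normal_pdf.
by move=> <-; rewrite expRN mulrC mulfK// gt_eqF ?expR_gt0.
Qed.

End normal_cosine_transform.

(** * Gaussian laws and the central limit theorem *)

(** Recursive Cholesky factorization; a zero pivot of a positive semidefinite
    matrix has a zero row. *)
Lemma psd_factor (R : realType) (d : nat) (M : 'M[R]_d) :
  M^T = M -> (forall a : 'rV[R]_d, 0 <= dotv (a *m M) a) -> exists B : 'M[R]_d, M = B^T *m B.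
Proof.
elim: d M => [|d IH] M MT pos.
  by exists 0; apply/matrixP => -[].
pose a : R := M 0 0.
pose r : 'rV[R]_d := ursubmx (M : 'M[R]_(1 + d)).
pose N : 'M[R]_d := drsubmx (M : 'M[R]_(1 + d)).
have ME : (M : 'M[R]_(1 + d)) = block_mx a%:M r r^T N.
  rewrite -[LHS](@submxK _ 1 d 1 d M); congr block_mx.
    by rewrite [LHS]mx11_scalar; congr (_%:M); rewrite !mxE; congr (M _ _); exact/val_inj.
  by rewrite /r trmx_ursub MT.
have NT : N^T = N by rewrite /N trmx_drsub MT.
clearbody a r N.
have q (t : R) (v : 'rV[R]_d) : 0 <= t ^+ 2 * a + 2 * t * dotv r v + dotv (v *m N) v.
  have : 0 <= (row_mx t%:M v *m block_mx a%:M r r^T N *m (row_mx t%:M v)^T) 0 0.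
    by rewrite -ME; exact: (pos (row_mx t%:M v : 'rV[R]_(1 + d))).
  rewrite /dotv mul_row_block tr_row_mx mul_row_col.
  rewrite !mul_scalar_mx tr_scalar_mx mul_mx_scalar !mulmxDl -!scalemxAl !scalerDr.
  rewrite (_ : v *m r^T = r *m v^T); last by rewrite -[LHS]trmxK [(v *m _)^T]trmx_mul trmxK [LHS]mx11_scalar [RHS]mx11_scalar mxE.
  rewrite ![in X in _ <= X]mxE !eqxx/= !mulr1n => h; apply: (le_trans h).
  rewrite [(r *m v^T) 0 0]mxE [(v *m N *m v^T) 0 0]mxE.
  move: (\sum_(j < d) r 0 j * _) (\sum_(j < d) (v *m N) 0 j * _) => x y.
  by apply: le_of_eq; ring.
have a0 : 0 <= a.
  by have := q 1 0; rewrite /dotv trmx0 mulmx0 mul0mx mul0mx mxE !mulr0 !addr0 expr1n mul1r.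
have ar : a = 0 -> r = 0.
  move=> az; apply/rowP => k; rewrite [RHS]mxE.
  have dr : dotv r (delta_mx 0 k) = r 0 k.
    rewrite dotvE (bigD1 k)//= big1 ?addr0; first by rewrite mxE !eqxx mulr1.
    by move=> l lk; rewrite mxE (negbTE lk) andbF mulr0.
  apply/eqP; apply: contraT => rk.
  have := q (- (dotv (delta_mx 0 k *m N) (delta_mx 0 k) + 1) / (2 * r 0 k)) (delta_mx 0 k).
  rewrite az mulr0 add0r dr; move: (dotv _ _) => s.
  move: (r 0 k) rk => x x0; have -> : 2 * (- (s + 1) / (2 * x)) * x = - (s + 1) by field.
  by rewrite opprD addrAC addNr add0r ler0N1.
have [B' B'E] : exists B' : 'M[R]_d, N - a^-1 *: (r^T *m r) = B'^T *m B'.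
  apply: IH => [|v]; first by rewrite linearB/= linearZ/= NT trmx_mul trmxK.
  have dE : dotv (v *m (N - a^-1 *: (r^T *m r))) v = dotv (v *m N) v - a^-1 * dotv r v ^+ 2.
    rewrite mulmxBr dotvBl; congr (_ - _).
    rewrite -scalemxAr dotvZl; congr (_ * _).
    rewrite /dotv (_ : v *m (r^T *m r) *m v^T = (v *m r^T) *m (r *m v^T)); last by rewrite !mulmxA.
    rewrite expr2 [v *m r^T]mx11_scalar mul_scalar_mx mxE.
    by congr (_ * _); rewrite !mxE; apply: eq_bigr => k _; rewrite !mxE mulrC.
  rewrite dE; have [az|an] := eqVneq a 0.
    rewrite az invr0 mul0r subr0; have := q 0 v.
    by rewrite expr0n/= mul0r mulr0 mul0r !add0r.
  have := q (- (dotv r v / a)) v; move: (dotv r v) (dotv (v *m N) v) => x y.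
  have -> : (- (x / a)) ^+ 2 * a + 2 * - (x / a) * x + y = y - a^-1 * x ^+ 2 by field.
  by [].
pose s := Num.sqrt a.
have s2 : s * s = a by rewrite -expr2 sqr_sqrtr.
have sv : s^-1 * s^-1 = a^-1 by rewrite -invfM s2.
have sr : (s * s^-1) *: r = r.
  have [az|an] := eqVneq a 0; first by rewrite ar// scaler0.
  by rewrite divff ?scale1r// gt_eqF// sqrtr_gt0 lt_neqAle eq_sym an.
pose B : 'M[R]_(1 + d) := block_mx s%:M (s^-1 *: r) 0 B'.
have BE : block_mx a%:M r r^T N = B^T *m B; last by exists B; exact: etrans ME BE.
rewrite /B tr_block_mx mulmx_block !trmx0 !mul0mx !mulmx0 !addr0 -B'E.
rewrite tr_scalar_mx -scalar_mxM s2 mul_scalar_mx scalerA sr linearZ/= -scalemxAl.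
rewrite mul_mx_scalar scalerA (mulrC s^-1) -[(s * s^-1) *: r^T]linearZ/= sr.
by rewrite -scalemxAr -scalemxAl scalerA sv addrC subrK.
Qed.

Lemma product_prob_fst d1 d2 (T1 : measurableType d1) (T2 : measurableType d2) (R : realType)
    (P : probability T1 R) (Q : probability T2 R) (f : T1 * T2 -> R) : bmfun f ->
  \int[(P \x Q)%E]_z f z = \int[P]_x \int[Q]_y f (x, y).
Proof.
move=> bf; pose M : probability (T1 * T2)%type R := (P \x Q)%E.
have fstE A : measurable A -> M (fst @^-1` A) = P A.
  move=> mA; have -> : fst @^-1` A = A `*` [set: T2] by apply/seteqP; split => -[x y] //= [].
  by transitivity (P A * Q setT)%E; [exact: product_measure1E|rewrite probability_setT mule1].
have sndE B : measurable B -> M (snd @^-1` B) = Q B.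
  move=> mB; have -> : snd @^-1` B = [set: T1] `*` B by apply/seteqP; split => -[x y] //= [].
  by transitivity (P setT * Q B)%E; [exact: product_measure1E|rewrite probability_setT mul1e].
have ind : independent_pair M (fst : T1 * T2 -> T1) snd.
  move=> A B mA mB; rewrite fstE// sndE//.
  exact: product_measure1E.
have h := indep_Fubini measurable_fst measurable_snd ind bf.
transitivity (\int[M]_z f (fst z, snd z)); first by apply: ex_eq => -[].
rewrite h.
have in_snd x : \int[M]_w' f (x, snd w') = \int[Q]_y f (x, y).
  have bfx : bmfun (fun y => f (x, y)) by exact: (bmfun_comp (pair1_measurable x) bf).
  exact: (@law_eq_ex _ _ _ _ _ M Q _ T2 snd id (fun y => f (x, y)) measurable_snd (@measurable_id _ _ _) sndE).
under ex_eq do rewrite in_snd.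
apply: (@law_eq_ex _ _ _ _ _ M P _ T1 fst id (fun x => \int[Q]_y f (x, y)) measurable_fst (@measurable_id _ _ _) fstE).
exact: (bmfun_ex_r P Q bf).
Qed.

Lemma standard_normal_sequence (R : realType) (d : nat) :
  exists (dT : measure_display) (T : measurableType dT) (P : probability T R) (xi : nat -> T -> R),
    (forall k, measurable_fun setT (xi k)) /\
    forall (a : nat -> R) c, \int[P]_w cos (\sum_(k < d) a k * xi k w + c) =
      expR (- ((\sum_(k < d) a k ^+ 2) / 2)) * cos c.
Proof.
elim: d => [|d [dT [T [P [xi [mxi xiE]]]]]].
  pose Q : probability (measurableTypeR R) R := normal_prob 0 1.
  exists _, (measurableTypeR R), Q, (fun=> cst 0); split => [k|a c].
    exact: measurable_cst.
  rewrite big_ord0 mul0r oppr0 expR0 mul1r -[RHS](ex_cst Q).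
  by apply: ex_eq => w; rewrite big_ord0 add0r.
pose Q : probability (measurableTypeR R) R := normal_prob 0 1.
exists _, (T * measurableTypeR R)%type, ((P \x Q)%E : probability (T * measurableTypeR R)%type R),
  (fun k z => if k == d then z.2 else xi k z.1); split => [k|a c].
  case: eqVneq => _; first exact: measurable_snd.
  by apply: measurableT_comp => //; exact: measurable_fst.
pose S w := \sum_(k < d) a k * xi k w.
have mS : measurable_fun setT S by apply: measurable_sum => k; apply: measurable_funM.
have bf : bmfun (fun z : T * measurableTypeR R => cos (S z.1 + a d * z.2 + c)).
  split; last by exists 1 => z; exact: cos_max.
  apply: (measurableT_comp (continuous_measurable_fun (@continuous_cos R))).
  apply: measurable_funD => //; apply: measurable_funD.
    by apply: (measurableT_comp mS); exact: measurable_fst.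
  by apply: measurable_funM => //; exact: measurable_snd.
transitivity (\int[(P \x Q)%E]_z cos (S z.1 + a d * z.2 + c)).
  apply: ex_eq => z; congr (cos (_ + c)); rewrite big_ord_recr/= eqxx; congr (_ + _).
  by apply: eq_bigr => k _; rewrite (ltn_eqF (ltn_ord k)).
rewrite product_prob_fst//=.
transitivity (\int[P]_w (expR (- (a d ^+ 2 / 2)) * cos (S w + c))).
  apply: ex_eq => w; transitivity (\int[Q]_y cos (a d * y + (S w + c))).
    by apply: ex_eq => y; congr cos; ring.
  by rewrite normal_cosine_transform// expr1n mulr1.
rewrite exZ; last first.
  split; last by exists 1 => z; exact: cos_max.
  apply: (measurableT_comp (continuous_measurable_fun (@continuous_cos R))).
  exact: measurable_funD.
by rewrite xiE mulrA -expRD big_ord_recr/= addrC; congr (expR _ * _); ring.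
Qed.

(** The image of independent standard normal variables under a square root of M. *)
Lemma gaussian_exists (R : realType) (d : nat) (M : 'M[R]_d) :
  M^T = M -> (forall a : 'rV[R]_d, 0 <= dotv (a *m M) a) ->
  exists nu : probability (borel 'rV[R]_d) R, centered_gaussian M nu /\
    forall (a : 'rV[R]_d) c, \int[nu]_x cos (dotv a (x : 'rV[R]_d) + c) =
      expR (- (dotv (a *m M) a / 2)) * cos c.
Proof.
move=> MT pos; have [B BE] := psd_factor MT pos.
have [dT [T [P [xi [mxi xiE]]]]] := standard_normal_sequence R d.
pose f w : 'rV[R]_d := (\row_(k < d) xi k w) *m B.
have mf : measurable_fun setT (f : T -> borel 'rV[R]_d).
  apply: measurable_rV => k.
  rewrite (_ : (fun w => _) = (fun w => \sum_(l < d) xi l w * B l k)).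
    by apply: measurable_sum => l; apply: measurable_funM.
  by apply/funext => w; rewrite mxE; apply: eq_bigr => l _; rewrite mxE.
pose f' : {mfun T >-> borel 'rV[R]_d} := HB.pack f (isMeasurableFun.Build _ _ _ _ _ mf).
pose nu : probability (borel 'rV[R]_d) R := distribution P f'.
have mid k : measurable_fun setT (fun x : borel 'rV[R]_d => (x : 'rV[R]_d) 0 k).
  exact: measurable_coord.
have nuE (a : 'rV[R]_d) c : \int[nu]_x cos (dotv a (x : 'rV[R]_d) + c) =
    expR (- (dotv (a *m M) a / 2)) * cos c.
  rewrite -(@law_eq_ex _ _ _ _ _ P nu _ (borel 'rV[R]_d) f id
    (fun x : borel 'rV[R]_d => cos (dotv a (x : 'rV[R]_d) + c)) mf (@measurable_id _ _ _)) => //; last first.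
    exact: (bmfun_cos_dotv mid).
  pose b k : R := if insub k is Some i then (a *m B^T) 0 i else 0.
  transitivity (\int[P]_w cos (\sum_(k < d) b k * xi k w + c)).
    apply: ex_eq => w; congr (cos (_ + c)).
    rewrite /f /dotv trmx_mul mulmxA mxE; apply: eq_bigr => k _.
    by rewrite /b valK !mxE.
  rewrite xiE; congr (expR (- (_ / 2)) * _).
  rewrite BE mulmxA /dotv -mulmxA (_ : B *m a^T = (a *m B^T)^T); last by rewrite trmx_mul trmxK.
  by rewrite [RHS]mxE; apply: eq_bigr => k _; rewrite /b valK [X in _ = _ * X]mxE expr2.
exists nu; split => // a A mA v; split; first exact: pos.
have mda : measurable_fun setT (fun x : borel 'rV[R]_d => dotv a (x : 'rV[R]_d)).
  exact: (measurable_dotv_rv mid).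
have tE t c : \int[nu]_x cos (t * dotv a (x : 'rV[R]_d) + c) = expR (- (t ^+ 2 * v / 2)) * cos c.
  have := nuE (t *: a) c; rewrite -scalemxAl dotvZl dotvZr mulrA -expr2 => <-.
  by apply: ex_eq => x; rewrite dotvZl.
have [v0|vn0] := eqVneq v 0.
  apply: (@cosine_unique _ _ _ _ _ nu (\d_(0 : R)) _ id mda (@measurable_id _ _ _)) => // t c.
  rewrite tE v0 mulr0 mul0r oppr0 expR0 mul1r /Rintegral integral_dirac//=.
    by rewrite indicE in_setT mul1r mulr0 add0r.
  apply/measurable_EFinP.
  apply: (measurableT_comp (continuous_measurable_fun (@continuous_cos R))).
  by apply: measurable_funD => //; apply: measurable_funM.
have sv : 0 < Num.sqrt v by rewrite sqrtr_gt0 lt_neqAle eq_sym vn0 pos.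
apply: (@cosine_unique _ _ _ _ _ nu (normal_prob 0 (Num.sqrt v)) _ id mda (@measurable_id _ _ _)) => // t c.
by rewrite tE normal_cosine_transform// sqr_sqrtr// pos.
Qed.

Section central_limit.
Context {dT : measure_display} {T : measurableType dT} {R : realType} {dS : measure_display}
  {S : measurableType dS}.
Variables (P : probability T R) (X : nat -> T -> S) (d : nat) (v : S -> 'rV[R]_d).
Hypotheses (iidX : iid P X) (bv : forall k, bmfun (fun s => v s 0 k))
  (v0 : forall k, \int[P]_w v (X 0%N w) 0 k = 0).
Let mX := iid_measurable iidX.
Let bvX i k : bmfun (fun w => v (X i w) 0 k) := bmfun_comp (mX i) (bv k).

Definition scaled_sum n w : 'rV[R]_d := (Num.sqrt n%:R)^-1 *: \sum_(i < n) v (X i w).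

Definition second_moment : 'M[R]_d :=
  \matrix_(k, l) \int[P]_w (v (X 0%N w) 0 k * v (X 0%N w) 0 l).

Lemma second_moment_form a :
  dotv (a *m second_moment) a = \int[P]_w (dotv a (v (X 0%N w)) ^+ 2).
Proof.
transitivity (\int[P]_w \sum_k \sum_l (a 0 k * a 0 l) * (v (X 0%N w) 0 l * v (X 0%N w) 0 k)).
  rewrite dotvE ex_sum; last first.
    by move=> k; apply: bmfun_sum => l; apply: bmfunZ; exact: bmfunM.
  apply: eq_bigr => k _; rewrite ex_sum; last by move=> l; apply: bmfunZ; exact: bmfunM.
  rewrite mxE mulr_suml; apply: eq_bigr => l _; rewrite exZ; last exact: bmfunM.
  by rewrite [second_moment _ _]mxE; ring.
apply: ex_eq => w; rewrite expr2 dotvE mulr_suml; apply: eq_bigr => k _.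
by rewrite mulr_sumr; apply: eq_bigr => l _; ring.
Qed.

Lemma scaled_sum_coord n w k :
  scaled_sum n w 0 k = (Num.sqrt n%:R)^-1 * \sum_(i < n) v (X i w) 0 k.
Proof. by rewrite mxE summxE. Qed.

Lemma bmfun_scaled_sum n k : bmfun (fun w => scaled_sum n w 0 k).
Proof.
apply: (bmfun_eq (f := fun w => (Num.sqrt n%:R)^-1 * \sum_(i < n) v (X i w) 0 k)).
  by move=> w; rewrite scaled_sum_coord.
by apply: bmfunZ; apply: bmfun_sum => i; exact: bvX.
Qed.

Lemma ex_sqr_scaled_sum n k : \int[P]_w (scaled_sum n w 0 k ^+ 2) <= second_moment k k.
Proof.
pose m := second_moment k k.
have mE : m = \int[P]_w (v (X 0%N w) 0 k * v (X 0%N w) 0 k) by rewrite /m mxE.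
have m0 : 0 <= m by rewrite mE; apply: ex_ge0 => w; rewrite -expr2 sqr_ge0.
have pair (i j : 'I_n) : \int[P]_w (v (X i w) 0 k * v (X j w) 0 k) = if i == j then m else 0.
  case: eqVneq => [->|ij].
    by rewrite mE; exact: (iid_ex iidX j (bmfunM (bv k) (bv k))).
  rewrite (indep_exM (mX i) (mX j) (iid_indep_pair iidX ij) (bv k) (bv k)).
  by rewrite (iid_ex iidX i (bv k)) v0 mul0r.
have -> : \int[P]_w (scaled_sum n w 0 k ^+ 2) = (Num.sqrt n%:R)^-1 ^+ 2 * (n%:R * m).
  transitivity (\int[P]_w ((Num.sqrt n%:R)^-1 ^+ 2 *
      \sum_(i < n) \sum_(j < n) (v (X i w) 0 k * v (X j w) 0 k))).
    apply: ex_eq => w; rewrite scaled_sum_coord exprMn; congr (_ * _).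
    by rewrite expr2 mulr_suml; apply: eq_bigr => i _; rewrite mulr_sumr.
  rewrite exZ; last by apply: bmfun_sum => i; apply: bmfun_sum => j; exact: bmfunM.
  congr (_ * _); rewrite ex_sum; last by move=> i; apply: bmfun_sum => j; exact: bmfunM.
  transitivity (\sum_(i < n) m); last by rewrite sumr_const card_ord mulr_natl.
  apply: eq_bigr => i _; rewrite ex_sum; last by move=> j; exact: bmfunM.
  rewrite (bigD1 i)//= pair eqxx big1 ?addr0// => j ji.
  by rewrite pair eq_sym (negbTE ji).
rewrite exprVn sqr_sqrtr// mulrA; have [->|n0] := eqVneq n 0%N; first by rewrite mulr0 mul0r.
by rewrite mulVf ?mul1r// pnatr_eq0.
Qed.

Lemma scaled_sum_tight (eps : R) : 0 < eps -> exists2 r, 0 < r &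
  \forall n \near \oo, pr P [set w | r < `|scaled_sum n w|] <= eps.
Proof.
move=> e0; pose t := \sum_k second_moment k k.
have t0 : 0 <= t.
  by apply: sumr_ge0 => k _; rewrite mxE; apply: ex_ge0 => w; rewrite -expr2 sqr_ge0.
pose r := Num.sqrt ((t + 1) / eps).
have q0 : 0 < (t + 1) / eps by rewrite divr_gt0// ltr_wpDl.
have r0 : 0 < r by rewrite sqrtr_gt0.
exists r => //; apply: nearW => n.
have mS k : measurable_fun setT (fun w => scaled_sum n w 0 k) := bmfun_measurable (bmfun_scaled_sum n k).
pose q w := \sum_k scaled_sum n w 0 k ^+ 2.
have bq : bmfun q by apply: bmfun_sum => k; apply: bmfunX; exact: bmfun_scaled_sum.
have r2 : r ^+ 2 = (t + 1) / eps by rewrite sqr_sqrtr// ltW.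
have -> : eps = (t + 1) / r ^+ 2 by rewrite r2; field; rewrite !gt_eqF// ltr_wpDl.
apply: (@le_trans _ _ (pr P [set w | r ^+ 2 <= q w])).
  have mq : measurable [set w | r ^+ 2 <= q w].
    by rewrite -[X in measurable X]setTI; apply: (@measurable_fun_le _ _ _ _ (cst _) q) => //; exact: bmfun_measurable.
  apply: le_pr => //; first exact: (measurable_tail_rv mS).
  move=> w /= rS; rewrite leNgt; apply/negP => qr; move: rS; apply/negP; rewrite -leNgt.
  apply: norm_row_le => [|k]; first exact: ltW.
  rewrite -(ler_sqr (normr_ge0 _) (ltW r0))// real_normK ?num_real//; apply: le_trans (ltW qr).
  by rewrite /q (bigD1 k)//= lerDl sumr_ge0// => l _; exact: sqr_ge0.
apply: (le_trans (markov_bmfun P bq _ _)).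
- by move=> w; apply: sumr_ge0 => k _; exact: sqr_ge0.
- by rewrite exprn_gt0.
rewrite ler_pM2r ?invr_gt0 ?exprn_gt0// ex_sum; last by move=> k; apply: bmfunX; exact: bmfun_scaled_sum.
by rewrite (@le_trans _ _ t)// ?lerDl// ler_sum// => k _; exact: ex_sqr_scaled_sum.
Qed.

Lemma scaled_sum_cosine (a : 'rV[R]_d) c :
  \int[P]_w cos (dotv a (scaled_sum n w) + c) @[n --> \oo] -->
  expR (- (dotv (a *m second_moment) a / 2)) * cos c.
Proof.
have dv s : dotv a (v s) = \sum_k a 0 k * v s 0 k by rewrite dotvE.
have bxi : bmfun (fun s => dotv a (v s)).
  apply: (bmfun_eq (f := fun s => \sum_k a 0 k * v s 0 k)) => [s|]; first by rewrite dv.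
  by apply: bmfun_sum => k; exact: bmfunZ.
have xi0 : \int[P]_w dotv a (v (X 0%N w)) = 0.
  under ex_eq do rewrite dv.
  rewrite ex_sum; last by move=> k; exact: bmfunZ.
  by rewrite big1// => k _; rewrite exZ// v0 mulr0.
have [B B0 xiB] := bmfun_bound bxi.
have rate := cosine_mean_rate iidX bxi xiB xi0.
apply/cvgrPdist_le => eps e0; near=> n.
have n0 : (0 < n)%N by near: n; exact: nbhs_infty_gt.
rewrite distrC second_moment_form; have h := rate n c n0.
have -> : \int[P]_w cos (dotv a (scaled_sum n w) + c) =
    \int[P]_w cos ((Num.sqrt n%:R)^-1 * (\sum_(i < n) dotv a (v (X i w))) + c).
  apply: ex_eq => w; congr (cos (_ + c)); rewrite dotvZr; congr (_ * _).
  rewrite dotvE; under [RHS]eq_bigr do rewrite dotvE.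
  by rewrite exchange_big; apply: eq_bigr => k _; rewrite summxE mulr_sumr.
apply: (le_trans h).
near: n.
have sq : (Num.sqrt n%:R)^-1 @[n --> \oo] --> (0 : R).
  apply: (cvg_invr_pinfty (c := 1) (L := fun n => Num.sqrt n%:R)); last first.
    by apply: nearW => n'; rewrite invr_ge0 sqrtr_ge0 mul1r lexx.
  apply/cvgryPge => A; near=> n'; apply: (le_trans (ler_norm A)).
  rewrite -sqrtr_sqr ler_wsqrtr//.
  by near: n'; exact: nbhs_infty_ger.
have lim0 : (B ^+ 3 + 2 * B ^+ 4) * (Num.sqrt n%:R)^-1 @[n --> \oo] --> (0 : R).
  by rewrite -[X in _ --> X](mulr0 (B ^+ 3 + 2 * B ^+ 4)); apply: cvgM => //; exact: cvg_cst.
move/cvgr0Pnorm_le : lim0 => /(_ _ e0).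
apply: filterS => n' /=; apply: le_trans; exact: ler_norm.
Unshelve. all: by end_near. Qed.

Lemma weak_cvg_scaled_sum (nu : probability (borel 'rV[R]_d) R) (h : 'rV[R]_d -> R) (K : R) :
  (forall a c, \int[nu]_x cos (dotv a (x : 'rV[R]_d) + c) =
     expR (- (dotv (a *m second_moment) a / 2)) * cos c) ->
  continuous h -> (forall x, `|h x| <= K) ->
  \int[P]_w h (scaled_sum n w) @[n --> \oo] --> \int[nu]_x h x.
Proof.
move=> nuE ch hK.
apply: (@cosine_cvg_ex _ _ _ _ _ P nu _ scaled_sum (fun x : borel 'rV[R]_d => (x : 'rV[R]_d)) h K) => //.
- by move=> n k; exact: bmfun_measurable (bmfun_scaled_sum n k).
- by move=> k; exact: measurable_coord.
- exact: scaled_sum_tight.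
- by move=> a c; rewrite nuE; exact: scaled_sum_cosine.
Qed.

End central_limit.

(** Outer expectation is sandwiched between h (Sn) - g and h (Sn) + g, with g small
    off a small measurable event; uniform continuity on a ball that Sn rarely
    leaves is enough. *)
Lemma weak_cvg_star_slutsky (dT : measure_display) (T : measurableType dT) (R : realType)
    (P : probability T R) (d : nat) (X Sn : nat -> T -> 'rV[R]_d)
    (nu : probability (borel 'rV[R]_d) R) :
  (forall n k, measurable_fun setT (fun w => Sn n w 0 k)) ->
  (forall eps : R, 0 < eps -> exists2 r, 0 < r &
    \forall n \near \oo, pr P [set w | r < `|Sn n w|] <= eps) ->
  (forall (h : 'rV[R]_d -> R) K, continuous h -> (forall x, `|h x| <= K) ->
    \int[P]_w h (Sn n w) @[n --> \oo] --> \int[nu]_x h x) ->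
  op_star P (fun n w => X n w - Sn n w) (fun=> 1) -> weak_cvg_star P X nu.
Proof.
move=> mS tS lim /op_starP XS h ch [K0 hK0].
pose K := Num.max K0 1.
have K1 : 1 <= K by rewrite le_max lexx orbT.
have Kp : 0 < K by apply: lt_le_trans K1.
have hK x : `|h x| <= K by rewrite le_max hK0.
have hK' x : - K <= h x <= K by rewrite -ler_norml.
have bS n : bmfun (fun w => h (Sn n w)).
  by split; [exact: (measurable_continuous_rv (mS n) ch)|exists K => w].
have bh : bmfun (h : borel 'rV[R]_d -> R).
  by split; [apply: (@measurable_continuous_rv _ _ _ _ (fun x : borel 'rV[R]_d => (x : 'rV[R]_d))) => // k; exact: measurable_coord|exists K].
rewrite integral_bmfun//.
have close eps : 0 < eps -> \forall n \near \oo,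
    ((\int[P]_w h (Sn n w) - eps)%:E <= outer_expectation P (h \o X n) <= (\int[P]_w h (Sn n w) + eps)%:E)%E.
  move=> e0; pose q := eps / (1 + 4 * K).
  have D0 : 0 < 1 + 4 * K by rewrite ltr_wpDr// mulr_ge0// ltW.
  have q0 : 0 < q by rewrite divr_gt0.
  have qE : q + 2 * K * (q + q) = eps by rewrite /q; field; rewrite gt_eqF.
  have [r r0 tr] := tS _ q0.
  have cA : compact [set x : 'rV[R]_d | `|x| <= r].
    apply: bounded_closed_compact.
      by exists r; split; [exact: num_real|] => x x1 u /= ur; apply: le_trans (ltW x1).
    rewrite (_ : [set x | _] = (fun u : 'rV[R]_d => `|u|) @^-1` [set t | t <= r])//.
    by apply: closed_comp => [u _|]; [exact: norm_continuous|exact: closed_le].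
  have [dl dl0 uc] := uniformly_continuous_on_compact ch cA q0.
  have neg := XS _ dl0 _ q0.
  near=> n.
  have [E [mE sE pE]] : exists E, [/\ measurable E, [set w | dl * 1 < `|X n w - Sn n w|] `<=` E & pr P E <= q].
    by near: n; exact: neg.
  have pS : pr P [set w | r < `|Sn n w|] <= q by near: n; exact: tr.
  pose A := E `|` [set w | r < `|Sn n w|].
  have mA : measurable A by apply: measurableU => //; exact: (measurable_tail_rv (mS n)).
  have pA : pr P A <= q + q.
    apply: (le_trans (pr_setU _ _ _)) => //; first exact: (measurable_tail_rv (mS n)).
    exact: lerD.
  have near_h w : `|h (X n w) - h (Sn n w)| <= q + 2 * K * \1_A w.
    have [wA|wA] := pselect (A w).
      rewrite indicE mem_set// mulr1 (le_trans (ler_normB _ _))//.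
      apply: (le_trans (lerD (hK _) (hK _))); have -> : 2 * K = K + K by ring.
      by rewrite lerDr ltW.
    rewrite indicE memNset// mulr0 addr0 distrC; apply: uc => /=.
      by rewrite leNgt; apply/negP => c; apply: wA; right.
    by rewrite distrC leNgt; apply/negP => c; apply: wA; left; apply: sE; rewrite /= mulr1.
  have bA : bmfun (fun w => q + 2 * K * \1_A w).
    by apply: bmfunD; [exact: bmfun_cst|apply: bmfunZ; exact: bmfun_indic].
  have eA : \int[P]_w (q + 2 * K * \1_A w) <= eps.
    rewrite exD; [|exact: bmfun_cst|by apply: bmfunZ; exact: bmfun_indic].
    rewrite ex_cst exZ; last exact: bmfun_indic.
    by rewrite ex_indic// -qE lerD2l ler_wpM2l// mulr_ge0// ltW.
  apply/andP; split.
    apply: le_ereal_inf_tmp => _ [U [iU hU] <-].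
    have bg : bmfun (fun w => h (Sn n w) - (q + 2 * K * \1_A w)) by exact: bmfunB.
    apply: (@le_trans _ _ (\int[P]_w (h (Sn n w) - (q + 2 * K * \1_A w))%:E)%E).
      by rewrite integral_bmfun// lee_fin exB// lerD2l lerN2.
    apply: le_integral => //; first exact: bmfun_integrable.
    move=> w _; apply: le_trans (hU w); rewrite lee_fin /=.
    by rewrite lerBlDr -lerBlDl (le_trans _ (near_h w))// -normrN opprB ler_norm.
  apply: ge_ereal_inf; exists (\int[P]_w (h (Sn n w) + (q + 2 * K * \1_A w))%:E)%E; last first.
    rewrite integral_bmfun; last exact: (bmfunD (bS n) bA).
    by rewrite lee_fin exD// lerD2l.
  exists (fun w => (h (Sn n w) + (q + 2 * K * \1_A w))%:E) => //; split.
    by apply: bmfun_integrable; exact: (bmfunD (bS n) bA).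
  by move=> w; rewrite lee_fin /= -lerBlDl (le_trans _ (near_h w))// ler_norm.
have fin : \forall n \near \oo, outer_expectation P (h \o X n) \is a fin_num.
  have := close 1 ltr01; apply: filterS => n /andP[lo up].
  by rewrite fin_numE; apply/andP; split; apply/eqP => oe; move: lo up; rewrite oe ?leye_eq ?leeNy_eq.
apply/fine_cvgP; split=> //; apply/cvgrPdist_le => eps e0.
have e2 : 0 < eps / 2 by rewrite divr_gt0.
have l : \int[P]_w h (Sn n w) @[n --> \oo] --> \int[nu]_x h x by apply: lim hK.
near=> n; have fn : outer_expectation P (h \o X n) \is a fin_num by near: n; exact: fin.
have ln : `|\int[nu]_x h x - \int[P]_w h (Sn n w)| <= eps / 2.
  by near: n; move/cvgrPdist_le : l; exact.
have : ((\int[P]_w h (Sn n w) - eps / 2)%:E <= outer_expectation P (h \o X n) <=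
    (\int[P]_w h (Sn n w) + eps / 2)%:E)%E by near: n; exact: close.
rewrite -(fineK fn) !lee_fin /= => /andP[lo up].
move: ln lo up; move: (fine _) (\int[nu]_x h x) (\int[P]_w _) => x0 y0 z0.
rewrite !ler_norml => /andP[A1 A2] A3 A4; apply/andP; split; lra.
Unshelve. all: by end_near. Qed.

Lemma gaussian_limit (dT : measure_display) (T : measurableType dT) (R : realType)
    (dS : measure_display) (S : measurableType dS) (P : probability T R) (X : nat -> T -> S)
    (d : nat) (g : S -> 'rV[R]_d) (infl root : nat -> T -> 'rV[R]_d) (A : 'M[R]_d) :
  iid P X -> (forall k, bmfun (fun s => g s 0 k)) -> (forall i w, infl i w = g (X i w)) ->
  mean P (infl 0%N) = 0 -> op_star P (fun n w => root n w - Gn P infl n w *m A) (fun=> 1) ->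
  exists nu : probability (borel 'rV[R]_d) R,
    centered_gaussian (A^T *m covariance_mx P (infl 0%N) *m A) nu /\ weak_cvg_star P root nu.
Proof.
move=> iidX bg inflE mean0 rep; have mX := iid_measurable iidX.
have gX0 k : \int[P]_w g (X 0%N w) 0 k = 0.
  have /rowP /(_ k) := mean0; rewrite !mxE => <-.
  by apply: ex_eq => w; rewrite inflE.
pose v s := g s *m A.
have bv k : bmfun (fun s => v s 0 k).
  apply: (bmfun_eq (f := fun s => \sum_l A l k * g s 0 l)) => [s|].
    by rewrite mxE; apply: eq_bigr => l _; rewrite mulrC.
  by apply: bmfun_sum => l; exact: bmfunZ.
have bgX k : bmfun (fun w => g (X 0%N w) 0 k) := bmfun_comp (mX 0%N) (bg k).
have v0 k : \int[P]_w v (X 0%N w) 0 k = 0.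
  transitivity (\int[P]_w \sum_l A l k * g (X 0%N w) 0 l).
    by apply: ex_eq => w; rewrite mxE; apply: eq_bigr => l _; rewrite mulrC.
  rewrite ex_sum => [|l]; last exact: bmfunZ.
  by rewrite big1// => l _; rewrite exZ// gX0 mulr0.
have covE : A^T *m covariance_mx P (infl 0%N) *m A = second_moment P X v.
  apply/matrixP => k l; rewrite [RHS]mxE.
  transitivity (\int[P]_w \sum_j \sum_i (A i k * A j l) * (g (X 0%N w) 0 i * g (X 0%N w) 0 j)).
    rewrite ex_sum; last by move=> j; apply: bmfun_sum => i; apply: bmfunZ; exact: bmfunM.
    rewrite mxE; apply: eq_bigr => j _.
    rewrite ex_sum; last by move=> i; apply: bmfunZ; exact: bmfunM.
    rewrite [in LHS]mxE mulr_suml; apply: eq_bigr => i _; rewrite exZ; last exact: bmfunM.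
    rewrite [A^T _ _]mxE [covariance_mx _ _ _ _]mxE mean0.
    rewrite (_ : \int[P]_w ((infl 0%N w 0 i - _) * _) = \int[P]_w (g (X 0%N w) 0 i * g (X 0%N w) 0 j)).
      by rewrite mulrAC.
    by apply: ex_eq => w; rewrite inflE !mxE !subr0.
  apply: ex_eq => w; rewrite [v _ 0 k]mxE [v _ 0 l]mxE mulr_sumr; apply: eq_bigr => j _.
  by rewrite mulr_suml; apply: eq_bigr => i _; ring.
have sym : (second_moment P X v)^T = second_moment P X v.
  by apply/matrixP => k l; rewrite !mxE; apply: ex_eq => w; rewrite mulrC.
have psd a : 0 <= dotv (a *m second_moment P X v) a.
  by rewrite (second_moment_form iidX bv); apply: ex_ge0 => w; exact: sqr_ge0.
have [nu [nuG nuC]] := gaussian_exists sym psd.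
exists nu; rewrite covE; split => //.
apply: (@weak_cvg_star_slutsky _ _ _ P _ root (scaled_sum X v)).
- by move=> n k; exact: bmfun_measurable (bmfun_scaled_sum iidX bv n k).
- exact: scaled_sum_tight.
- by move=> h K ch hK; exact: (weak_cvg_scaled_sum iidX bv v0 nuC ch hK).
have GnE n w : Gn P infl n w *m A = scaled_sum X v n w.
  rewrite /Gn mean0 subr0 /scaled_sum.
  rewrite -!scalemxAl mulmx_suml scalerA; congr (_ *: _); last first.
    by apply: eq_bigr => i _; rewrite inflE.
  have [->|n0] := eqVneq n 0%N; first by rewrite invr0 mulr0 sqrtr0 invr0.
  have s0 : Num.sqrt (n%:R : R) != 0 by rewrite gt_eqF// sqrtr_gt0 ltr0n lt0n.
  by rewrite -[in X in _ * X](@sqr_sqrtr R n%:R)// expr2 invfM mulrA divff// mul1r.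
by move=> eps e0; under eq_fun do under eq_set do rewrite -GnE; exact: rep.
Qed.

(** * The estimator *)

Lemma cond_prob_lower_bound (dT : measure_display) (T : measurableType dT) (R : realType)
    (P : probability T R) (dS : measure_display) (S : measurableType dS) (V : T -> S)
    (b : T -> bool) (p : S -> R) (xi : R) :
  measurable_fun setT V -> measurable_fun setT b ->
  is_cond_exp P (fun w => (b w)%:R) V p -> (forall s, xi <= p s) -> 0 <= xi ->
  forall B, measurable B -> xi * pr P (V @^-1` B) <= pr P (V @^-1` B `&` [set w | b w]).
Proof.
move=> mV mb [mp _ _ pE] xip xi0 B mB.
have mVB : measurable (V @^-1` B) by rewrite -[X in measurable X]setTI; exact: mV.
have mB' := measurable_set_bool mb.
have mVb : measurable (V @^-1` B `&` [set w | b w]) by exact: measurableI.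
rewrite -lee_fin EFinM -!prE//.
have -> : P (V @^-1` B `&` [set w | b w]) = (\int[P]_(w in V @^-1` B) (p (V w))%:E)%E.
  rewrite -pE// setIC -integral_indic//; apply: eq_integral => w _.
  by rewrite indicE; case: (boolP (b w)) => bw; [rewrite mem_set|rewrite memNset//; exact/negP].
rewrite -integral_cst//; apply: ge0_le_integral => //.
- by apply/measurable_EFinP; apply: measurable_funTS; exact: (measurableT_comp mp mV).
- by move=> w _; rewrite lee_fin.
Qed.

Section representation.
Context {dT : measure_display} {T : measurableType dT} {R : realType}.
Variable P : probability T R.
Context {d : nat}.
Variables (Y : nat -> T -> R) (Delta : nat -> T -> bool) (Z : nat -> T -> 'rV[R]_d).
Variables (obs : nat -> T -> bool) (Om W : nat -> T -> R) (K Kz : R).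
Variables (e C : T -> R) (th0 : 'rV[R]_d) (F : probability R R).
Local Notation rV := (borel 'rV[R]_d).
Local Notation core := (R * bool * rV)%type.
Local Notation unit_data := (R * bool * rV * bool * R * R)%type.
Let X i w : unit_data := (Y i w, Delta i w, Z i w, obs i w, Om i w, W i w).
Hypotheses (iidX : iid P X).
Hypotheses (ZK : forall i w, `|Z i w| <= Kz) (OmK : forall i w, `|Om i w| <= K)
  (WK : forall i w, `|W i w| <= K).
Let core0 w : core := (Y 0%N w, Delta 0%N w, Z 0%N w).
Hypotheses (Om1 : is_cond_exp P (Om 0%N) core0 (cst 1))
  (W1 : is_cond_exp P (W 0%N) core0 (cst 1)).
Hypotheses (YE : forall w, Y 0%N w = Num.min (dotv th0 (Z 0%N w) + e w) (C w))
  (DE : forall w, Delta 0%N w = (dotv th0 (Z 0%N w) + e w <= C w)).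
Hypotheses (me : measurable_fun setT e) (mC : measurable_fun setT C).
Hypothesis eF : forall B : set R, measurable B -> P (e @^-1` B) = F B.
Let ZC w : (rV * R)%type := (Z 0%N w, C w).
Hypothesis e_ZC : independent_pair P e ZC.

Let mX := iid_measurable iidX.
Let mcX i : measurable_fun setT (fun w => core_of (X i w)).
Proof. exact: (measurableT_comp measurable_core (mX i)). Qed.

Lemma measurable_cov_data i : measurable_fun setT (Z i : T -> rV).
Proof. exact: (measurableT_comp measurable_snd (mcX i)). Qed.
Lemma measurable_time_data i : measurable_fun setT (Y i).
Proof. exact: (measurableT_comp measurable_core_time (mcX i)). Qed.
Lemma measurable_event_data i : measurable_fun setT (Delta i).
Proof. exact: (measurableT_comp (measurableT_comp measurable_snd measurable_fst) (mcX i)). Qed.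
Let mZk k : measurable_fun setT (fun w => Z 0%N w 0 k).
Proof. exact: (measurableT_comp (measurable_coord k) (measurable_cov_data 0)). Qed.

Let y (s : unit_data) := core_time (core_of s).
Let z (s : unit_data) := core_cov Kz (core_of s).
Let rsX th i w : rs y z th (X i w) = resid th (Y i w) (Z i w).
Proof. exact: rs_data. Qed.
Let zX i w : z (X i w) = Z i w.
Proof. exact: core_cov_data. Qed.
Let my : measurable_fun setT y.
Proof. exact: measurableT_comp measurable_core_time measurable_core. Qed.
Let mz k : measurable_fun setT (fun s => z s 0 k).
Proof. exact: (measurableT_comp (measurable_core_cov Kz k) measurable_core). Qed.
Let zK s : `|z s| <= Kz.
Proof. exact: (norm_core_cov_le ZK). Qed.

Lemma plain_rank_mean_Psi0 th :
  plain_rank_mean P Y Delta Z obs Om W Kz th = Psi0 P Y Delta Z th.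
Proof.
apply/rowP => k; rewrite (Psi0_coord P Delta (measurable_time_data 0) mZk (ZK 0%N)) [LHS]mxE.
apply: ex_eq => w; rewrite -exZ; last first.
  apply: bmfunM; first exact: (bmfun_at_risk (measurable_time_data 0) mZk).
  by apply: bmfunB; [exact: bmfun_cst|exact: (bmfun_cov mZk (ZK 0%N))].
apply: ex_eq => w'; rewrite -[LHS]/(rank_kernel y z event (cst 1) th k (X 0%N w, X 0%N w')).
rewrite /rank_kernel /rank_le/= !rsX !zX /event /core_event/=.
by rewrite mulr1 /at_risk mulrA.
Qed.

Let kern l := rank_kernel y z (weighted_event K) (weight K) th0 l.
Let bwe : bmfun (weighted_event K : unit_data -> R) := bmfun_weighted_event OmK.
Let bw : bmfun (weight K : unit_data -> R) := bmfun_weight OmK.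
Let bkern l : bmfun (kern l). Proof. exact: (bmfun_rank_kernel my mz zK). Qed.

Let ex2_kern l : ex2 P X (kern l) = 0.
Proof.
have /rowP /(_ l) := weighted_rank_mean iidX ZK OmK WK Om1 W1 th0.
rewrite plain_rank_mean_Psi0 (Psi0_true YE DE me mC (measurable_cov_data 0) eF e_ZC (ZK 0%N)).
by rewrite [LHS]mxE [RHS]mxE.
Qed.

Let ex_reweight (a a2 : unit_data -> R) (g : core -> R) : bmfun a -> bmfun a2 -> bmfun g ->
  uncorrelated P X core_of (fun s => a s - a2 s) ->
  \int[P]_w (a (X 0%N w) * g (core_of (X 0%N w))) =
  \int[P]_w (a2 (X 0%N w) * g (core_of (X 0%N w))).
Proof.
move=> ba ba2 bg [bu u]; apply/eqP; rewrite -subr_eq0.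
have bX (h : unit_data -> R) : bmfun h -> bmfun (fun w => h (X 0%N w)).
  by move=> bh; apply: bmfun_comp bh; exact: mX.
have bgX : bmfun (fun w => g (core_of (X 0%N w))) by apply: bmfun_comp bg; exact: mcX.
rewrite -exB; [|by apply: bmfunM => //; exact: bX|by apply: bmfunM => //; exact: bX].
under ex_eq => w do rewrite -mulrBl mulrC.
by apply/eqP; exact: (ex_conditional_zero (mcX 0%N) (bX _ bu) u bg).
Qed.

Lemma influence_hajek i w l :
  influence P Y Delta Z Om W F th0 i w 0 l = hajek P X (kern l) (X i w).
Proof.
have mY := measurable_time_data 0; have mZ0 := measurable_cov_data 0.
have mcs := @measurable_core_time R d; have mcc k := @measurable_core_cov R d Kz k.
rewrite /influence /hajek [LHS]mxE; congr (_ + _).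
  rewrite [LHS]mxE [X in _ * X]mxE.
  transitivity (Om i w * (Delta i w)%:R * \int[P]_w' (at_risk Y Z (resid th0 (Y i w) (Z i w)) th0 0%N w' *
      (Z i w 0 l - Z 0%N w' 0 l))).
    have bat := bmfun_at_risk mY mZk (resid th0 (Y i w) (Z i w)) th0.
    have bcov := bmfun_cov mZk (ZK 0%N) l.
    under ex_eq => w' do rewrite mulrBr.
    rewrite exB; [|by apply: bmfunM => //; exact: bmfun_cst|exact: bmfunM].
    rewrite exZr// -(rho0E P mY mZk) -(rho0_eta0 P mY mZk (ZK 0%N)).
    by rewrite [X in _ * (_ + X)]mxE; ring.
  pose g (x : core) : R := (resid th0 (Y i w) (Z i w) <=
     core_time x - dotv th0 (core_cov Kz x))%R%:R * (Z i w 0 l - core_cov Kz x 0 l).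
  have bg : bmfun g.
    apply: bmfunM.
      apply: bmfun_bool; apply: measurable_fun_ler; first exact: measurable_cst.
      by apply: (measurable_rs (y := core_time) (z := core_cov Kz)).
    apply: bmfunB; first exact: bmfun_cst.
    exact: (bmfun_z mcc (norm_core_cov_le ZK) l).
  have := ex_reweight bw (bmfun_cst 1) bg (uncorrelated_weight iidX OmK WK W1).
  have bgX (h : unit_data -> R) : bmfun h -> bmfun (fun w' => h (X 0%N w') * g (core_of (X 0%N w'))).
    move=> bh; apply: bmfunM; first by apply: bmfun_comp bh; exact: mX.
    by apply: bmfun_comp bg; exact: mcX.
  move=> h; transitivity (Om i w * (Delta i w)%:R * \int[P]_w' (weight K (X 0%N w') * g (core_of (X 0%N w')))).
    rewrite h; congr (_ * _); apply: ex_eq => w'.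
    by rewrite /= mul1r /g -[core_time _ - _]/(rs y z th0 (X 0%N w')) rsX -/(z (X 0%N w')) zX.
  rewrite -exZ; last exact: bgX.
  apply: ex_eq => w'; rewrite /kern /rank_kernel /rank_le/= rsX zX /g.
  rewrite -[core_time _ - _]/(rs y z th0 (X 0%N w')) -/(z (X 0%N w')).
  by rewrite /weighted_event /= clip_id// /event /core_event/=; ring.
rewrite [LHS]mxE [X in - X]mxE.
pose u (t : R) : R := - W i w * (t <= resid th0 (Y i w) (Z i w))%R%:R.
have ble : bmfun (fun t : R => (t <= resid th0 (Y i w) (Z i w))%R%:R : R).
  by apply: bmfun_bool; apply: measurable_fun_ler => //; exact: measurable_cst.
have bu : bmfun u by exact: bmfunZ.
have := compensator YE DE me mC mZ0 eF e_ZC (ZK 0%N) (Z i w 0 l) l bu.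
rewrite (_ : \int[cum_hazard F]_t (u t * _) = \int[cum_hazard F]_t (W i w * rho0 P Y Z t th0 *
   (Z i w 0 l - eta0 P Y Z t th0 0 l) * (t <= resid th0 (Y i w) (Z i w))%R%:R)); last first.
  by apply: eq_Rintegral => t _; rewrite /u; ring.
move=> <-.
pose g (x : core) : R := (core_time x - dotv th0 (core_cov Kz x) <=
   resid th0 (Y i w) (Z i w))%R%:R * (core_cov Kz x 0 l - Z i w 0 l).
have bg : bmfun g.
  apply: bmfunM.
    apply: bmfun_bool; apply: measurable_fun_ler; last exact: measurable_cst.
    by apply: (measurable_rs (y := core_time) (z := core_cov Kz)).
  apply: bmfunB; last exact: bmfun_cst.
  exact: (bmfun_z mcc (norm_core_cov_le ZK) l).
have h := ex_reweight bwe bmfun_event bg (uncorrelated_weighted_event iidX OmK Om1).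
have bgX (a : unit_data -> R) : bmfun a -> bmfun (fun w' => a (X 0%N w') * g (core_of (X 0%N w'))).
  move=> bh; apply: bmfunM; first by apply: bmfun_comp bh; exact: mX.
  by apply: bmfun_comp bg; exact: mcX.
transitivity (W i w * \int[P]_w' (weighted_event K (X 0%N w') * g (core_of (X 0%N w')))).
  rewrite h -exZ; last exact: (bgX _ bmfun_event).
  rewrite -exN; last first.
    rewrite (_ : (fun _ => _) = fun w' => - W i w * (event (X 0%N w') * g (core_of (X 0%N w')))).
      by apply: bmfunZ; exact: (bgX _ bmfun_event).
    apply/funext => w'; rewrite /g -[core_time _ - _]/(rs y z th0 (X 0%N w')) rsX.
    by rewrite -/(z (X 0%N w')) zX /u /event /core_event/=; ring.
  apply: ex_eq => w'; rewrite /g -[core_time _ - _]/(rs y z th0 (X 0%N w')) rsX.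
  by rewrite -/(z (X 0%N w')) zX /u /event /core_event/=; ring.
rewrite -exZ; last exact: bgX.
apply: ex_eq => w'; rewrite /kern /rank_kernel /rank_le/= rsX zX /g.
rewrite -[core_time _ - _]/(rs y z th0 (X 0%N w')) -/(z (X 0%N w')).
rewrite !rsX !zX (_ : weight K (X i w) = W i w); first by ring.
by rewrite /weight /= clip_id.
Qed.

Lemma mean_influence : mean P (influence P Y Delta Z Om W F th0 0%N) = 0.
Proof.
apply/rowP => l; rewrite [LHS]mxE [RHS]mxE -[RHS](ex_hajek iidX (bkern l) (ex2_kern l)).
by apply: ex_eq => w; rewrite influence_hajek.
Qed.

Lemma rank_stat_representation : op_star P (fun n w =>
  Num.sqrt n%:R *: weighted_rank_stat Y Delta Z obs Om W K Kz n th0 w -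
  Gn P (influence P Y Delta Z Om W F th0) n w) (fun=> 1).
Proof.
apply/op_starP => eps e0.
have e2 : 0 < eps / 2 by rewrite divr_gt0.
have main (r : seq 'I_d) : negl P (fun n => [set w | exists2 l, l \in r & eps / 2 <
  `|Num.sqrt n%:R * (n%:R ^- 2 * offdiag_sum X (kern l) n w) -
    Num.sqrt n%:R * (n%:R^-1 * \sum_(i < n) hajek P X (kern l) (X i w))|]).
  elim: r => [|l r IH]; first by apply: negl_near0; near=> n; apply/seteqP; split => // w [].
  apply: negl_sub (negl_setU (hajek_projection iidX (bkern l) (ex2_kern l) e2) IH).
  near=> n; move=> w [l']; rewrite inE => /orP[/eqP ->|lr] h; first by left.
  by right; exists l'.
apply: negl_sub (main (enum 'I_d)); near=> n; move=> w /=; rewrite mulr1 => h.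
apply: contrapT => nex; move: h; rewrite ltNge => /negP; apply.
apply: (@le_trans _ _ (eps / 2)); last by rewrite ler_pdivrMr// mulr_natr mulr2n lerDl ltW.
apply: norm_row_le; first exact: ltW.
move=> l; rewrite leNgt; apply/negP => h; apply: nex; exists l; first by rewrite mem_enum.
apply: (lt_le_trans h); apply: le_of_eq; congr `|_|.
rewrite [LHS]mxE; congr (_ + _); first by rewrite [LHS]mxE [X in _ * X = _]mxE.
rewrite [LHS]mxE; congr (- _); rewrite /Gn mean_influence subr0 [LHS]mxE [X in _ * X = _]mxE summxE.
congr (_ * (_ * _)); apply: eq_bigr => i _.
by rewrite influence_hajek.
Unshelve. all: by end_near. Qed.

Variables (Ka : R) (J : 'M[R]_d).
Hypothesis Ka0 : 0 <= Ka.
Hypothesis anticoncentration : forall theta t h, 0 <= h ->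
  pr P [set w | t <= resid theta (Y 0%N w) (Z 0%N w) <= t + h] <= Ka * h.
Let u := Psi0 P Y Delta Z.
Hypothesis uJ : forall eps : R, 0 < eps -> exists2 dl : R, 0 < dl & forall th,
  `|th - th0| <= dl -> `|u th - (th - th0) *m J| <= eps * `|th - th0|.

Let K0 : 0 <= K. Proof. exact: le_trans (OmK 0%N point). Qed.
Let Kz0 : 0 <= Kz. Proof. exact: le_trans (ZK 0%N point). Qed.
Let mZ := measurable_cov_data 0.
Let mD := measurable_event_data 0.

Let U n th w := weighted_rank_stat Y Delta Z obs Om W K Kz n th w.
Let H n th w := plain_rank_stat Y Delta Z obs Om W Kz n th w.
Let An n w : R := \sum_(j < n) W j w / n%:R.
Let sc n th w := score Y Delta Z Om W n th w.

Let anti_rs theta t h : 0 <= h -> pr P [set w | t <= rs y z theta (X 0%N w) <= t + h] <= Ka * h.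
Proof.
move=> h0; rewrite (_ : [set w | _] = [set w | t <= resid theta (Y 0%N w) (Z 0%N w) <= t + h]).
  exact: anticoncentration.
by apply/seteqP; split => w /=; rewrite rsX.
Qed.

Let mean_u th : rank_mean P X y z event (cst 1) th = u th.
Proof. exact: plain_rank_mean_Psi0. Qed.

Let mean_uw th : rank_mean P X y z (weighted_event K) (weight K) th = u th.
Proof. by rewrite -mean_u; exact: (weighted_rank_mean iidX ZK OmK WK Om1 W1). Qed.

Lemma Psi0_true0 : u th0 = 0.
Proof. exact: (Psi0_true YE DE me mC mZ eF e_ZC (ZK 0%N)). Qed.

Variable L : nat -> R.
Hypotheses (L1 : forall n, (0 < n)%N -> 1 <= L n) (Ly : L @ \oo --> +oo)
  (Lsn : (fun n => (1 + L n ^+ 2) ^+ d.+1 / Num.sqrt n%:R) @ \oo --> 0)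
  (Lexp : (fun n => (n.+1%:R) ^+ (d + 2) * expR (- L n)) @ \oo --> 0).
Let r n : R := L n ^+ 2 / Num.sqrt n%:R.

Let KK0 : 0 <= K * K * Kz. Proof. by rewrite !mulr_ge0. Qed.
Let KK1 : 0 <= (K + 1) * (Kz + 1). Proof. by rewrite mulr_ge0// addr_ge0. Qed.

Let Ueq eps : 0 < eps -> negl P (fun n => [set w | exists th,
  `|th - th0| <= r n /\ eps / Num.sqrt n%:R < `|U n th w - U n th0 w - (u th - u th0)|]).
Proof.
move=> e0; have h0 := rank_stat_local_linear iidX my mz zK (bmfun_weighted_event OmK) (bmfun_weight OmK)
  (norm_weighted_event_le OmK) (norm_weight_le OmK) Ka0 anti_rs Lsn th0 e0.
apply: (negl_sub _ h0); apply: nearW => n w [th [h1 h2]]; exists th; split; first exact: h1.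
by move: h2; rewrite -!mean_uw.
Qed.

Let Heq eps : 0 < eps -> negl P (fun n => [set w | exists th,
  `|th - th0| <= r n /\ eps / Num.sqrt n%:R < `|H n th w - H n th0 w - (u th - u th0)|]).
Proof.
move=> e0; have h0 := rank_stat_local_linear iidX my mz zK bmfun_event (bmfun_cst 1)
  norm_event_le (fun=> lexx `|1|) Ka0 anti_rs Lsn th0 e0.
apply: (negl_sub _ h0); apply: nearW => n w [th [h1 h2]]; exists th; split; first exact: h1.
by move: h2; rewrite -!mean_u.
Qed.

Let tU : tight P (fun n w => Num.sqrt n%:R * `|U n th0 w|).
Proof.
apply: (rank_stat_tight iidX my mz zK (bmfun_weighted_event OmK) (bmfun_weight OmK)
  (norm_weighted_event_le OmK) (norm_weight_le OmK)).
by rewrite mean_uw Psi0_true0.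
Qed.

Let tH : tight P (fun n w => Num.sqrt n%:R * `|H n th0 w|).
Proof.
apply: (rank_stat_tight iidX my mz zK bmfun_event (bmfun_cst 1) norm_event_le (fun=> lexx `|1|)).
by rewrite mean_u Psi0_true0.
Qed.

Let An1 : negl P (fun n => [set w | L n / Num.sqrt n%:R < `|An n w - 1|]).
Proof. exact: (mean_weight_rate iidX ZK OmK WK W1 Lexp). Qed.

Let scU : negl P (fun n => [set w | exists th,
  K * K * Kz * (L n ^+ 2 / n%:R) < `|An n w *: sc n th w - U n th w|]).
Proof. exact: (score_rank_stat iidX ZK OmK WK W1 L1 Lsn Lexp). Qed.

Let UH : negl P (fun n => [set w | exists th,
  (K + 1) * (Kz + 1) * (L n / Num.sqrt n%:R) < `|U n th w - H n th w|]).
Proof. exact: (rank_stat_weights iidX ZK OmK WK Om1 W1 L1 Lexp). Qed.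

Let Hmono n v s s' w : s <= s' ->
  dotv v (H n (th0 + s *: v) w) <= dotv v (H n (th0 + s' *: v) w).
Proof. exact: plain_rank_stat_monotone. Qed.

Section linearity.
Variable tht : nat -> T -> 'rV[R]_d.
Hypothesis root : op_star P (fun n w => sc n (tht n w) w) (fun n => (Num.sqrt n%:R)^-1).

Lemma score_linearity : negl P (fun n => [set w | r n < `|tht n w - th0|]) ->
  tight P (fun n w => Num.sqrt n%:R * `|tht n w - th0|) ->
  op_star P (fun n w => Num.sqrt n%:R *: sc n (tht n w) w -
    (Num.sqrt n%:R *: sc n th0 w + (Num.sqrt n%:R *: (tht n w - th0)) *m J)) (fun=> 1).
Proof.
exact: (estimator_linearity KK0 L1 Ly Lsn Psi0_true0 uJ scU Ueq tU An1 root).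
Qed.

Variable c : R.
Hypotheses (c0 : 0 < c)
  (q : forall n w, let v := tht n w - th0 in c * `|v| ^+ 2 <= dotv v (v *m J)).

Lemma score_root_rate : tight P (fun n w => Num.sqrt n%:R * `|tht n w - th0|).
Proof.
exact: (estimator_rate KK0 KK1 L1 Ly Lsn Psi0_true0 uJ scU UH Ueq Heq tU tH An1 Hmono c0 q root).
Qed.

Lemma score_root_localized : negl P (fun n => [set w | r n < `|tht n w - th0|]).
Proof.
exact: (estimator_localized KK0 KK1 L1 Ly Lsn Psi0_true0 uJ scU UH Heq tH An1 Hmono c0 q root).
Qed.

End linearity.

Let u00 : rank_mean P X y z event (cst 1) th0 = 0.
Proof. by rewrite mean_u Psi0_true0. Qed.

Let uJ' : forall eps : R, 0 < eps -> exists2 dl : R, 0 < dl & forall th,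
  `|th - th0| <= dl -> `|rank_mean P X y z event (cst 1) th - (th - th0) *m J| <= eps * `|th - th0|.
Proof. by move=> e1 /uJ[dl dl0 h]; exists dl => // th; rewrite mean_u; exact: h. Qed.

Let a01 (s : unit_data) : 0 <= (event s : R) <= 1.
Proof. by rewrite /event /core_event; case: (_.2); rewrite ?lexx ?ler01. Qed.

Lemma Psi0_curvature_ge0 v : 0 <= dotv v (v *m J).
Proof. exact: (curvature_ge0 iidX my mz zK bmfun_event a01 u00 uJ'). Qed.

Lemma Psi0_curvature_eq0 v : dotv v (v *m J) = 0 -> v *m J = 0.
Proof. exact: (curvature_eq0 iidX my mz zK bmfun_event a01 Ka0 anti_rs u00 uJ'). Qed.

Section projection.
Variables (tht : nat -> T -> 'rV[R]_d) (Pi : 'M[R]_d).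
Hypothesis root : op_star P (fun n w => sc n (tht n w) w) (fun n => (Num.sqrt n%:R)^-1).
Hypotheses (PiPi : Pi *m Pi = Pi) (PiJ : Pi *m J = J)
  (Pi_nd : forall v : 'rV[R]_d, v *m Pi = v -> v *m J = 0 -> v = 0).
Hypothesis invisible : forall k, exists c, P.-negligible [set w | dotv (row k (1%:M - Pi)) (Z 0%N w) != c].

Let tt n w := th0 + (tht n w - th0) *m Pi.

Let invisible_all : exists2 N : set T, measurable N /\ pr P N = 0 &
  forall n w, ~ N w -> sc n (tt n w) w = sc n (tht n w) w.
Proof.
have /choice[c hc] := invisible.
pose B k := [set z : 'rV[R]_d | dotv (row k (1%:M - Pi)) z != c k].
have mB k : measurable (B k : set rV).
  apply: measurable_set_bool.
  rewrite (_ : (fun z : rV => _) = (fun z : rV => ~~ (dotv (row k (1%:M - Pi)) (z : 'rV[R]_d) == c k)))//.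
  apply: measurable_neg; apply: measurable_fun_eqr; last exact: measurable_cst.
  rewrite (_ : dotv _ = (fun v : 'rV[R]_d => \sum_l (row k (1%:M - Pi)) 0 l * v 0 l)); last first.
    by apply/funext => v; rewrite dotvE.
  apply: measurable_sum => l; apply: measurable_funM; first exact: measurable_cst.
  exact: measurable_coord.
have mZi i : measurable_fun setT (Z i : T -> rV) by exact: (measurable_cov_data i).
have B0 i k : P (Z i @^-1` B k) = 0%E.
  have [_ _ idX] := iidX.
  have /= -> := idX i ((fun s : unit_data => s.1.1.1.2) @^-1` B k); last first.
    rewrite -[X in measurable X]setTI.
    by apply: (measurableT_comp measurable_snd measurable_core) => //; exact: mB.
  have mB0 : measurable (Z 0%N @^-1` B k) by rewrite -[X in measurable X]setTI; exact: mZi.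
  exact: (measure_negligible mB0 (hc k)).
pose E (m : nat) := if insub m is Some k then B k else set0.
have mE m : measurable (E m : set rV) by rewrite /E; case: insub.
have mZE i m : measurable (Z i @^-1` E m).
  by rewrite -[X in measurable X]setTI; apply: mZi.
exists (\bigcup_i \bigcup_m (Z i @^-1` E m)).
  have mN : measurable (\bigcup_i \bigcup_m (Z i @^-1` E m)).
    by apply: bigcup_measurable => i _; exact: bigcup_measurable.
  split => //; rewrite /pr; suff -> : P (\bigcup_i \bigcup_m (Z i @^-1` E m)) = 0%E by [].
  apply: (measure_negligible mN); apply: negligible_bigcup => i; apply: negligible_bigcup => m.
  exists (Z i @^-1` E m); split => //.
  by rewrite /E; case: insub => [k|]; [exact: B0|rewrite preimage_set0 measure0].
move=> n w Nw.
have Zc k i : dotv (row k (1%:M - Pi)) (Z i w) = c k.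
  apply/eqP; apply: contrapT => /negP h; apply: Nw; exists i => //; exists k => //.
  by rewrite /E valK.
apply: (@score_shift _ _ _ _ _ _ _ _ _ _ _ _ (\sum_k (tht n w - th0) 0 k * c k)) => i.
rewrite -[\sum_k _](_ : dotv ((tht n w - th0) *m (1%:M - Pi)) (Z i w) = _); last first.
  rewrite /dotv -mulmxA mxE; apply: eq_bigr => k _; congr (_ * _).
  by rewrite -(Zc k i) /dotv -row_mul [RHS]mxE.
rewrite mulmxBr mulmx1 /resid /tt dotvBl dotvBl dotvDl; ring.
Qed.

Let negl_invisible : negl P (fun n => [set w | sc n (tt n w) w <> sc n (tht n w) w]).
Proof.
have [N [mN N0] h] := invisible_all; apply: negl_null => n; exists N; split => // w /= wn.
by apply: contrapT => Nw; apply: wn; exact: h.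
Qed.

Lemma projected_root : op_star P (fun n w => sc n (tt n w) w) (fun n => (Num.sqrt n%:R)^-1).
Proof.
apply/op_starP => eps e0; have /op_starP/(_ _ e0) r0 := root.
apply: (negl_sub _ (negl_setU r0 negl_invisible)); apply: nearW => n w /= h.
have [<-|] := eqVneq (sc n (tt n w) w) (sc n (tht n w) w); first by left.
by move/eqP; right.
Qed.

Let tt_Pi n w : (tt n w - th0) *m Pi = tt n w - th0.
Proof. by rewrite /tt addrAC subrr add0r -mulmxA PiPi. Qed.

Lemma projected_curvature : exists2 c, 0 < c & forall n w, let v := tt n w - th0 in
  c * `|v| ^+ 2 <= dotv v (v *m J).
Proof.
have [c c0 h] := quadratic_lower_bound Psi0_curvature_ge0
  (fun v vPi q0 => Pi_nd vPi (Psi0_curvature_eq0 q0)).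
by exists c => // n w; exact: h.
Qed.

(** The projected estimator is also an approximate root, and it satisfies the
    quadratic lower bound; v J depends on the projection of v only. *)
Lemma projected_linearity :
  op_star P (fun n w => Num.sqrt n%:R *: sc n (tht n w) w -
    (Num.sqrt n%:R *: sc n th0 w + (Num.sqrt n%:R *: (tht n w - th0)) *m J)) (fun=> 1).
Proof.
have [c c0 hc] := projected_curvature.
have lin := score_linearity projected_root (score_root_localized projected_root c0 hc)
  (score_root_rate projected_root c0 hc).
apply/op_starP => eps e0; have /op_starP/(_ _ e0) lin0 := lin.
apply: (negl_sub _ (negl_setU lin0 negl_invisible)); apply: nearW => n w /= h.
have [e1|] := eqVneq (sc n (tt n w) w) (sc n (tht n w) w); last by move/eqP; right.
left; rewrite e1 /tt addrAC subrr add0r scalemxAl -(mulmxA _ Pi J) PiJ.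
exact: h.
Qed.

End projection.

Lemma nonsingular_rate (tht : nat -> T -> 'rV[R]_d) :
  op_star P (fun n w => sc n (tht n w) w) (fun n => (Num.sqrt n%:R)^-1) ->
  J \in unitmx -> negl P (fun n => [set w | r n < `|tht n w - th0|]) /\
    tight P (fun n w => Num.sqrt n%:R * `|tht n w - th0|).
Proof.
move=> root Ju.
have nd (v : 'rV[R]_d) : v *m 1%:M = v -> dotv v (v *m J) = 0 -> v = 0.
  by move=> _ /Psi0_curvature_eq0 vJ; rewrite -[v](mulmxK Ju) vJ mul0mx.
have [c c0 h] := quadratic_lower_bound Psi0_curvature_ge0 nd.
have hq n w : let v := tht n w - th0 in c * `|v| ^+ 2 <= dotv v (v *m J).
  by apply: h; rewrite mulmx1.
by split; [exact: (score_root_localized root c0 hq)|exact: (score_root_rate root c0 hq)].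
Qed.

Let sn n : R := Num.sqrt n%:R.

Let r_small (e1 : R) : 0 < e1 -> \forall n \near \oo, r n <= e1.
Proof.
move=> e10; have /cvgr0Pnorm_le /(_ _ e10) h := Lsn.
near=> n.
have n0 : (0 < n)%N by near: n; exact: nbhs_infty_gt.
have s0 : 0 < sn n by rewrite /sn sqrtr_gt0 ltr0n.
have h1 : `|(1 + L n ^+ 2) ^+ d.+1 / Num.sqrt n%:R| <= e1 by near: n; exact: h.
have L2 : 0 <= L n ^+ 2 by exact: sqr_ge0.
apply: le_trans h1; rewrite ger0_norm; last first.
  by rewrite divr_ge0 ?exprn_ge0 ?addr_ge0// ltW.
rewrite /r ler_pM2r ?invr_gt0//.
apply: (@le_trans _ _ (1 + L n ^+ 2)); first by rewrite lerDr.
by rewrite -[leLHS]expr1 ler_weXn2l// lerDl.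
Unshelve. all: by end_near. Qed.

Lemma score_rank_stat_equivalence : op_star P (fun n w => sn n *: (sc n th0 w - U n th0 w)) (fun=> 1).
Proof.
apply/op_starP => eps e0.
have tUL := tight_negl_slow Ly tU.
apply: (negl_sub _ (negl_setU scU (negl_setU An1 tUL))).
pose KK := K * K * Kz.
have k3 : 0 < 3 * (KK + 1) by rewrite mulr_gt0// ltr_wpDl.
near=> n => w /= hw; apply: contrapT => good.
have n0 : (0 < n)%N by near: n; exact: nbhs_infty_gt.
have s0 : 0 < sn n by rewrite /sn sqrtr_gt0 ltr0n.
have sn2 : sn n ^+ 2 = n%:R by rewrite sqr_sqrtr.
have Ln := L1 n0.
have r0 : 0 <= r n by rewrite /r divr_ge0 ?sqr_ge0 ?ltW.
have r2 : r n <= 1 / 2 by near: n; apply: r_small.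
have re : r n <= eps / (3 * (KK + 1)) by near: n; apply: r_small; rewrite divr_gt0.
have b1 : sn n * `|An n w *: sc n th0 w - U n th0 w| <= KK * r n.
  have : `|An n w *: sc n th0 w - U n th0 w| <= KK * (L n ^+ 2 / n%:R).
    by rewrite leNgt; apply/negP => h; apply: good; left; exists th0.
  move=> /(ler_wpM2l (ltW s0)) /le_trans; apply; rewrite -sn2 /r.
  by apply: le_of_eq; rewrite -/(sn n); field; rewrite gt_eqF.
have b2 : `|An n w - 1| <= L n / sn n.
  by rewrite leNgt; apply/negP => h; apply: good; right; left.
have b3 : sn n * `|U n th0 w| <= L n.
  by rewrite leNgt; apply/negP => h; apply: good; right; right.
have Lr : L n / sn n <= r n by rewrite /r ler_pM2r ?invr_gt0// expr2 ler_peMr// (le_trans _ Ln).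
have a12 : 1 / 2 <= An n w.
  by move: (le_trans b2 (le_trans Lr r2)); rewrite ler_norml => /andP[+ _]; lra.
have scn : sn n * `|sc n th0 w| <= 2 * (L n + KK * r n).
  have : sn n * `|An n w *: sc n th0 w| <= L n + KK * r n.
    rewrite -[X in `|X|](subrK (U n th0 w)) (le_trans (ler_wpM2l (ltW s0) (ler_normD _ _)))//.
    by rewrite mulrDr addrC lerD.
  rewrite normrZ ger0_norm; last by lra.
  have x0 : 0 <= sn n * `|sc n th0 w| by rewrite mulr_ge0// ltW.
  have := ler_wpM2r x0 a12; rewrite mulrCA; lra.
move: hw; rewrite mulr1 ltNge => /negP; apply.
have -> : sn n *: (sc n th0 w - U n th0 w) =
    sn n *: (An n w *: sc n th0 w - U n th0 w) - (An n w - 1) *: (sn n *: sc n th0 w).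
  rewrite !scalerBr scalerBl scale1r [in RHS]scalerA (mulrC (sn n)) -scalerA.
  by rewrite [RHS]addrC opprB addrA subrK.
apply: (le_trans (ler_normB _ _)).
rewrite (normrZ (sn n) (_ - _)) (normrZ (An n w - 1)) (normrZ (sn n) (sc n th0 w)) (gtr0_norm s0).
apply: (@le_trans _ _ (KK * r n + L n / sn n * (2 * (L n + KK * r n)))).
  by apply: lerD => //; apply: ler_pM => //; rewrite mulr_ge0// ltW.
have -> : L n / sn n * (2 * (L n + KK * r n)) = 2 * r n + 2 * (KK * (r n * (L n / sn n))).
  by rewrite /r -/(sn n); field; rewrite gt_eqF.
have -> : eps = 3 * (KK + 1) * (eps / (3 * (KK + 1))) by rewrite mulrCA divff ?mulr1// gt_eqF.
apply: (@le_trans _ _ (3 * (KK + 1) * r n)); last by rewrite ler_wpM2l// ltW.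
have KKr : 0 <= KK * r n by rewrite mulr_ge0.
have : KK * (r n * (L n / sn n)) <= KK * r n * (1 / 2).
  by rewrite mulrA ler_wpM2l// (le_trans Lr).
have -> : 3 * (KK + 1) * r n = 3 * (KK * r n) + 3 * r n by ring.
by move: KKr r0; move: (r n) (KK * (_ * _)) (KK * r n) => p1 p2 p3; lra.
Unshelve. all: by end_near. Qed.

Let infl := influence P Y Delta Z Om W F th0.

Lemma score_representation : op_star P (fun n w => sn n *: sc n th0 w - Gn P infl n w) (fun=> 1).
Proof.
have h := op_starD score_rank_stat_equivalence
  rank_stat_representation.
apply/op_starP => eps e0; have /op_starP/(_ _ e0) h0 := h.
by apply: (negl_sub _ h0); apply: nearW => n w /=; rewrite scalerBr addrA subrK.
Qed.

Lemma root_representation (tht : nat -> T -> 'rV[R]_d) :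
  op_star P (fun n w => sc n (tht n w) w) (fun n => (Num.sqrt n%:R)^-1) ->
  J \in unitmx ->
  op_star P (fun n w => sn n *: (tht n w - th0) - Gn P infl n w *m invmx (- J)) (fun=> 1).
Proof.
move=> root Ju; have [loc rate] := nonsingular_rate root Ju.
have lin := score_linearity root loc rate.
have sroot : op_star P (fun n w => sn n *: sc n (tht n w) w) (fun=> 1).
  by apply: op_star_rescale => // n n0; rewrite /sn sqrtr_gt0 ltr0n.
have h := op_star_mulmxr (invmx J) (op_starD (op_starD sroot (op_starN lin)) (op_starN score_representation)).
apply/op_starP => eps e0; have /op_starP/(_ _ e0) h0 := h.
have solve (s b g v : 'rV[R]_d) :
    (s - (s - (b + v *m J)) - (b - g)) *m invmx J = v - g *m invmx (- J).
  have -> : invmx (- J) = - invmx J.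
    have Ju' : - J \in unitmx by rewrite -scaleN1r unitmxZ// unitrN1.
    by apply: (can_inj (mulmxK Ju')); rewrite mulVmx// mulNmx mulmxN opprK mulVmx.
  rewrite (_ : _ - (b - g) = v *m J + g); first by rewrite mulmxDl mulmxK// mulmxN opprK.
  by rewrite subKr opprB [LHS]addrC addrA subrK addrC.
by apply: (negl_sub _ h0); apply: nearW => n w /=; rewrite solve.
Qed.

Variables (tau xi : R) (p : 'rV[R]_d -> R).
Hypotheses (xi0 : 0 < xi) (pxi : forall z, xi <= p z)
  (pE : is_cond_exp P (S := rV) (fun w => (tau <= resid th0 (Y 0%N w) (Z 0%N w))%R%:R) (Z 0%N) p).

Let mY := measurable_time_data 0.
Let mdot (v : 'rV[R]_d) : measurable_fun setT (fun w => dotv v (Z 0%N w)).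
Proof. exact: measurable_dotv_rv. Qed.
Let mdotr (v : 'rV[R]_d) : measurable_fun setT (fun z : rV => dotv v (z : 'rV[R]_d)).
Proof. exact: (measurable_dotv_rv (fun k => measurable_coord k)). Qed.
Let c w := C w - dotv th0 (Z 0%N w).
Let mc : measurable_fun setT c. Proof. exact: measurable_funB. Qed.

Let rsE w : rs y z th0 (X 0%N w) = Num.min (e w) (c w).
Proof. by rewrite rsX /resid YE /c addr_minl addrAC subrr add0r. Qed.

Let aE w : event (X 0%N w) = (e w <= c w)%R%:R.
Proof. by rewrite /event /core_event/= DE /c lerBrDl. Qed.

Let indep_ZC (B : set R) (D : set (rV * R)) : measurable B -> measurable D ->
  pr P (e @^-1` B `&` ZC @^-1` D) = pr F B * pr P (ZC @^-1` D).
Proof.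
move=> mB mSD; rewrite /pr e_ZC// eF//.
have mZD : measurable (ZC @^-1` D).
  have mZC : measurable_fun setT ZC by exact: measurable_fun_pair.
  by rewrite -[X in measurable X]setTI; exact: mZC.
by rewrite fineM// fin_num_measure.
Qed.

Let side (s : bool) (v : 'rV[R]_d) (t : R) : set (rV * R) :=
  [set q | (if s then dotv v q.1 <= t else t <= dotv v q.1) && (tau <= q.2 - dotv th0 q.1)].

Let mside s v t : measurable (side s v t).
Proof.
have m1 w : measurable_fun setT (fun q : rV * R => dotv w (q.1 : 'rV[R]_d)).
  by apply: (measurableT_comp (mdotr w)); exact: measurable_fst.
apply: measurable_set_bool; apply: measurable_and.
  by case: s; apply: measurable_fun_ler.
by apply: measurable_fun_ler => //; apply: measurable_funB => //; exact: measurable_snd.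
Qed.

Let pr_side s v t :
  xi * pr P [set w | if s then dotv v (Z 0%N w) <= t else t <= dotv v (Z 0%N w)] <=
  pr P (ZC @^-1` side s v t).
Proof.
pose B : set rV := [set q | if s then dotv v (q : 'rV[R]_d) <= t else t <= dotv v (q : 'rV[R]_d)].
have mB : measurable B.
  by apply: measurable_set_bool; clear B; case: s; apply: measurable_fun_ler.
have mb : measurable_fun setT (fun w => tau <= resid th0 (Y 0%N w) (Z 0%N w)).
  by apply: measurable_fun_ler => //; apply: measurable_funB.
apply: (le_trans (cond_prob_lower_bound mZ mb pE pxi (ltW xi0) mB)).
have mZC : measurable_fun setT ZC by exact: measurable_fun_pair.
apply: le_pr.
- apply: measurableI; last exact: measurable_set_bool.
  by rewrite -[X in measurable X]setTI; exact: mZ.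
- by rewrite -[X in measurable X]setTI; exact: mZC.
move=> w [/= Bw tw]; apply/andP; split=> //.
by apply: (le_trans tw); rewrite -rsX rsE ge_min lexx orbT.
Qed.

(** Condition on Z and use that Y - theta0'Z >= tau has conditional probability at
    least xi: on each side of a spread of v'Z the censoring time exceeds tau with
    positive probability, so the curvature would be positive. *)
Lemma invisible_direction (v : 'rV[R]_d) (a0 b0 c0 : R) :
  a0 < b0 -> b0 <= tau -> 0 < c0 ->
  (forall s1 s2, a0 <= s1 -> s1 <= s2 -> s2 <= b0 -> c0 * (s2 - s1) <= pr F `[s1, s2[) ->
  v *m J = 0 -> exists q, P.-negligible [set w | dotv v (Z 0%N w) != q].
Proof.
move=> ab bt c00 dens vJ.
apply: (@constant_of_no_spread _ _ _ _ _ (d%:R * `|v| * Kz)) => //.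
  by move=> w; apply: (le_trans (norm_dotv_le _ _)); rewrite ler_wpM2l// mulr_ge0.
move=> t k k0; have [lo|lo] := eqVneq (pr P [set w | dotv v (Z 0%N w) <= t]) 0; first by left.
right; apply/eqP; apply: contraT => hi; exfalso.
have pos (s : bool) (t' : R) : pr P [set w | if s then dotv v (Z 0%N w) <= t' else t' <= dotv v (Z 0%N w)] != 0 ->
    0 < pr P (ZC @^-1` side s v t').
  move=> h; apply: lt_le_trans (pr_side s v t').
  by rewrite mulr_gt0// lt_neqAle eq_sym h pr_ge0.
have lo' := pos true t lo; have hi' := pos false (t + k) hi.
have e_low v' t' (B : set R) : measurable B ->
    pr P (e @^-1` B `&` [set w | (dotv v' (z (X 0%N w)) <= t') && (tau <= c w)]) =
    pr F B * pr P [set w | (dotv v' (z (X 0%N w)) <= t') && (tau <= c w)].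
  by move=> mB; under eq_set do rewrite zX; exact: (indep_ZC mB (mside true v' t')).
have e_high v' t' (B : set R) : measurable B ->
    pr P (e @^-1` B `&` [set w | (t' <= dotv v' (z (X 0%N w))) && (tau <= c w)]) =
    pr F B * pr P [set w | (t' <= dotv v' (z (X 0%N w))) && (tau <= c w)].
  by move=> mB; under eq_set do rewrite zX; exact: (indep_ZC mB (mside false v' t')).
have := curvature_gt0 iidX my mz zK bmfun_event a01 u00 uJ' me mc rsE aE e_low e_high (v := v) (t := t)
  k0 ab bt c00 dens.
under eq_set do rewrite zX; move=> /(_ lo'); under eq_set do rewrite zX; move=> /(_ hi').
by rewrite vJ dotvC dotv0l ltxx.
Qed.

End representation.

(** * Asymptotic linearity and normality *)

Theorem theorem3p3
    (disp : measure_display) (T : measurableType disp) (R : realType)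
    (P : probability T R)
    (* Z_i = (Z_1i, Z_2i) with Z_1i in R^d1 and Z_2i in R^d2 *)
    (d1 d2 : nat)
    (Theta Theta0 : set 'rV[R]_(d1 + d2)) (theta0 : 'rV[R]_(d1 + d2))
    (e C Y : nat -> T -> R) (Delta : nat -> T -> bool)
    (Z : nat -> T -> 'rV[R]_(d1 + d2))
    (obs : nat -> T -> bool) (* the indicators R_i *)
    (Om W : nat -> T -> R)
    (F : probability R R) (f : R -> R)
    (tau xi zeta : R)
    (calY : set R) (calZ : set 'rV[R]_(d1 + d2))
    (thetahat : nat -> T -> 'rV[R]_(d1 + d2)) :
  let XT := (R * bool * borel 'rV[R]_(d1 + d2))%type in
  let X i w : XT := (Y i w, Delta i w, Z i w) in
  (* the model *)
  (forall i w, Y i w = Num.min (dotv theta0 (Z i w) + e i w) (C i w)) ->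
  (forall i w, Delta i w = (dotv theta0 (Z i w) + e i w <= C i w)) ->
  iid P e ->
  (forall i (B : set R), measurable B -> P (e i @^-1` B) = F B) ->
  (forall i, measurable_fun setT (C i)) ->
  (forall i, independent_pair P (S2 := (borel 'rV[R]_(d1 + d2) * R)%type)
     (e i) (fun w => (Z i w, C i w))) ->
  iid P (S := (R * bool * borel 'rV[R]_(d1 + d2) * bool * R * R)%type)
    (fun i w => (Y i w, Delta i w, Z i w, obs i w, Om i w, W i w)) ->
  (forall i w, calY (Y i w) /\ calZ (Z i w)) ->
  (* missingness at random, and condition (B) *)
  0 < zeta ->
  (exists pr : R * bool * 'rV[R]_d2 -> R,
     (forall i, is_cond_exp P (fun w => (obs i w)%:R) (X i)
        (fun x => pr (x.1.1, x.1.2, rsubmx x.2))) /\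
     forall v, zeta <= pr v) ->
  (* the weights *)
  (exists K : R, forall i w, `|Om i w| <= K /\ `|W i w| <= K) ->
  (forall i, is_cond_exp P (Om i) (X i) (cst 1)) ->
  (forall i, is_cond_exp P (W i) (X i) (cst 1)) ->
  (* condition (1) *)
  (exists K : R, forall z, calZ z -> `|z| <= K) ->
  (* condition (2) *)
  (forall t, 0 <= f t) ->
  (forall B : set R, measurable B ->
     F B = \int[lebesgue_measure]_(t in B) (f t)%:E)%E ->
  (forall t, derivable f t 1) ->
  (exists K : R, forall t, `|f t| <= K /\ `|f^`()%classic t| <= K) ->
  (\int[lebesgue_measure]_t ((f^`()%classic t / f t) ^+ 2 * f t)%:E < +oo)%E ->
  (* condition (3) *)
  (exists (g : 'rV[R]_(d1 + d2) -> R -> R) (K : R),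
     (forall i, is_cond_density P (S := borel 'rV[R]_(d1 + d2)) (C i) (Z i) g) /\
     forall z c, g z c <= K) ->
  (* condition (A) *)
  0 < xi ->
  (forall i theta, Theta theta -> exists p : 'rV[R]_(d1 + d2) -> R,
     is_cond_exp P (S := borel 'rV[R]_(d1 + d2))
       (fun w => (tau <= resid theta (Y i w) (Z i w))%R%:R) (Z i) p /\
     forall z, xi <= p z) ->
  (* hypotheses of the theorem *)
  open_nbhs theta0 Theta0 -> Theta0 `<=` Theta ->
  (forall n w, Theta (thetahat n w)) ->
  op_star P (fun n w => score Y Delta Z Om W n (thetahat n w) w)
    (fun n => (Num.sqrt n%:R)^-1) ->
  bounded_cont_diff
    (fun theta y z => rho0 P Y Z (resid theta y z) theta : R^o) Theta0 calY calZ ->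
  bounded_cont_diff
    (fun theta y z => eta0 P Y Z (resid theta y z) theta) Theta0 calY calZ ->
  let Psidot theta := 'J (Psi0 P Y Delta Z) theta in
  let rootn n w := Num.sqrt n%:R *: (thetahat n w - theta0) in
  [/\ (* the parenthetical implication *)
      (forall theta, Theta0 theta -> differentiable (Psi0 P Y Delta Z) theta) /\
      (exists K : R, forall theta, Theta0 theta -> `|Psidot theta| <= K) /\
      {within Theta0, continuous Psidot},
      (* (i); the disjunction excludes only a degenerate case in which the
         linearity fails, see NOTES *)
      [\/ (0 < F `]-oo, tau]%classic)%E,
          Op_star P rootn (fun=> 1) |
          Psidot theta0 \in unitmx] ->
      op_star P (fun n w =>
        Num.sqrt n%:R *: score Y Delta Z Om W n (thetahat n w) w -
        (Num.sqrt n%:R *: score Y Delta Z Om W n theta0 w +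
         rootn n w *m Psidot theta0)) (fun=> 1) &
      (* (ii) *)
      Psidot theta0 \in unitmx ->
      let infl := influence P Y Delta Z Om W F theta0 in
      let A := invmx (- Psidot theta0) in
      (exists nu : probability (borel 'rV[R]_(d1 + d2)) R,
         centered_gaussian (A^T *m covariance_mx P (infl 0%N) *m A) nu /\
         weak_cvg_star P rootn nu) /\
      op_star P (fun n w => rootn n w - Gn P infl n w *m A) (fun=> 1)].
Proof.
move=> XT X YE DE iide eF mC eZC iidX cYZ _ _ [K hK] Om1 W1 [Kz hKz] f0 Ff df [Kf hKf] _
  [g [Kg [gd gK]]] xi0 condA oT T0T Th root drho deta Psidot rootn.
have ZK i w : `|Z i w| <= Kz by apply: hKz; have [] := cYZ i w.
have OmK i w : `|Om i w| <= K by have [] := hK i w.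
have WK i w : `|W i w| <= K by have [] := hK i w.
have cY w : calY (Y 0%N w) by have [] := cYZ 0%N w.
have cZ w : calZ (Z 0%N w) by have [] := cYZ 0%N w.
have me : measurable_fun setT (e 0%N) by exact: iid_measurable iide 0%N.
have mZ := measurable_cov_data iidX 0.
have mY := measurable_time_data iidX 0.
have mD := measurable_event_data iidX 0.
have mZk k : measurable_fun setT (fun w => Z 0%N w 0 k).
  exact: (measurableT_comp (measurable_coord k) mZ).
have [oT0 T0th] : open Theta0 /\ Theta0 theta0 by [].
have YE0 := YE 0%N; have DE0 := DE 0%N; have mC0 := mC 0%N; have eZC0 := eZC 0%N.
have cf t : {for t, continuous f}.
  by apply: differentiable_continuous; apply/derivable1_diffP; exact: df.
have mf : measurable_fun setT f by apply: continuous_measurable_fun => t; exact: cf.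
have fK t : f t <= Kf by apply: (le_trans (ler_norm _)); have [] := hKf t.
have Kf0 : 0 <= Kf by exact: le_trans (f0 0) (fK 0).
have Kg0 : 0 <= Kg by have [_ g0 _ _] := gd 0%N; exact: le_trans (g0 0 0) (gK 0 0).
have anti := residual_anticoncentration YE0 me mC0 mZ (eF 0%N) eZC0 (ZK 0%N) f0 fK mf Ff (gd 0%N) gK.
have Ka0 : 0 <= Kf + 2 * Kg by rewrite addr_ge0// mulr_ge0.
have dPsi th (Tth : Theta0 th) := Psi0_differentiable mY mZk mD (ZK 0%N) oT0 cY cZ drho deta Tth.
have Psi00 := Psi0_true0 iidX ZK YE0 DE0 me mC0 (eF 0%N) eZC0.
have uJ eps : 0 < eps -> exists2 dl : R, 0 < dl & forall th, `|th - theta0| <= dl ->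
    `|Psi0 P Y Delta Z th - (th - theta0) *m Psidot theta0| <= eps * `|th - theta0|.
  move=> e0; have [dl dl0 h] := jacobian_estimate (dPsi _ T0th) e0.
  by exists dl => // th /h; rewrite Psi00 subr0.
have [L [L1 Ly Lsn Lexp]] := exists_slow_sequence R (d1 + d2) (d1 + d2 + 2).
have linear := score_linearity iidX ZK OmK WK (Om1 0%N) (W1 0%N) YE0 DE0 me mC0 (eF 0%N) eZC0
  Ka0 anti uJ L1 Ly Lsn Lexp root.
split.
- split; first exact: dPsi.
  split; first exact: (Psi0_jacobian_bounded mY mZk mD (ZK 0%N) oT0 cY cZ drho deta).
  exact: (Psi0_jacobian_continuous mY mZk mD (ZK 0%N) oT0 cY cZ drho deta).
- case=> [Ftau|tightroot|Ju].
  + have [a0 [b0 [c0 [ab bt c00 dens]]]] := positive_density_interval f0 cf Ff Ftau.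
    have [p [pE pxi]] := condA 0%N theta0 (T0T _ T0th).
    have inv v := invisible_direction iidX ZK YE0 DE0 me mC0 (eF 0%N) eZC0 uJ xi0 pxi pE ab bt c00 dens (v := v).
    pose J := Psidot theta0; pose Pi := J *m pinvmx J.
    have PiJ : Pi *m J = J by rewrite /Pi mulmxKpV.
    apply: (projected_linearity iidX ZK OmK WK (Om1 0%N) (W1 0%N) YE0 DE0 me mC0 (eF 0%N) eZC0
      Ka0 anti uJ L1 Ly Lsn Lexp root (Pi := Pi)) => //.
    * by rewrite {2}/Pi mulmxA PiJ.
    * by move=> v vPi; rewrite -/J => vJ; rewrite -vPi /Pi mulmxA vJ mul0mx.
    * move=> k; apply: inv; rewrite -row_mul mulmxBl mul1mx.
      by rewrite -/J PiJ subrr row0.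
  + have tight1 : tight P (fun n w => Num.sqrt n%:R * `|thetahat n w - theta0|).
      move=> eps /(tight_OpP tightroot)[M hM]; exists M; apply: filterS hM => n [E [mE sE pE]].
      exists E; split => // w /= Mw; apply: sE; rewrite /= /rootn normrZ ger0_norm//.
    apply: linear => //.
    have Ly2 : (fun n => L n ^+ 2) @ \oo --> +oo.
      apply/cvgryPge => A; near=> n.
      have n0 : (0 < n)%N by near: n; exact: nbhs_infty_gt.
      have An : A <= L n by near: n; move/cvgryPge : Ly; exact.
      by apply: (le_trans An); rewrite expr2 ler_peMl ?L1// (le_trans ler01)// L1.
    have := Op_star_negl (fun=> ler01) Ly2 tightroot.
    apply: negl_sub; near=> n => w /=.
    have n0 : (0 < n)%N by near: n; exact: nbhs_infty_gt.
    have s0 : 0 < Num.sqrt (n%:R : R) by rewrite sqrtr_gt0 ltr0n.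
    by rewrite mulr1 /rootn normrZ ger0_norm ?sqrtr_ge0// ltr_pdivrMr// mulrC.
  + have [loc rate] := nonsingular_rate iidX ZK OmK WK (Om1 0%N) (W1 0%N) YE0 DE0 me mC0 (eF 0%N) eZC0
      Ka0 anti uJ L1 Ly Lsn Lexp root Ju.
    exact: linear.
- move=> Ju infl A.
  have rep := root_representation iidX ZK OmK WK (Om1 0%N) (W1 0%N) YE0 DE0 me mC0 (eF 0%N) eZC0
      Ka0 anti uJ L1 Ly Lsn Lexp root Ju.
  split; last exact: rep.
  pose kern := rank_kernel (fun s : R * bool * borel 'rV[R]_(d1 + d2) * bool * R * R => core_time (core_of s))
    (fun s : R * bool * borel 'rV[R]_(d1 + d2) * bool * R * R => core_cov Kz (core_of s))
    (weighted_event K) (weight K) theta0.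
  have bkern l : bmfun (kern l).
    apply: bmfun_rank_kernel; last 2 first.
    - exact: (bmfun_weighted_event OmK).
    - exact: (bmfun_weight OmK).
    - exact: measurableT_comp measurable_core_time measurable_core.
    - move=> k; exact: (measurableT_comp (measurable_core_cov Kz k) measurable_core).
    - by move=> s; exact: (norm_core_cov_le ZK).
  pose full i w : (R * bool * borel 'rV[R]_(d1 + d2) * bool * R * R)%type :=
    (Y i w, Delta i w, Z i w, obs i w, Om i w, W i w).
  pose G s : 'rV[R]_(d1 + d2) := \row_l hajek P full (kern l) s.
  apply: (@gaussian_limit _ _ _ _ _ P full _ G infl rootn A iidX) => //.
  + move=> k; apply: (bmfun_eq (f := hajek P _ (kern k))) => [s|]; first by rewrite mxE.
    exact: (bmfun_hajek iidX).
  + move=> i w; apply/rowP => l; rewrite [RHS]mxE.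
    exact: (influence_hajek iidX ZK OmK WK (Om1 0%N) (W1 0%N) YE0 DE0 me mC0 (eF 0%N) eZC0).
  + exact: (mean_influence iidX ZK OmK WK (Om1 0%N) (W1 0%N) YE0 DE0 me mC0 (eF 0%N) eZC0).
Unshelve. all: by end_near. Qed.
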